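(* Let $p$ be an even positive integer and let $q=p/(p-1)$ be its conjugate exponent. Let $\{k_n\}$ be a sequence of functions in $H^q$, none of which is identically $0$, and suppose $k_n\to k$ in $H^q$, where $k \in H^q$ is not identically $0$. Let $F_n$ be the $A^p$ extremal function for $k_n$ and let $F$ be the $A^p$ extremal function for $k$. Then $F_n\to F$ in $H^p$.
   Context: $\mathbb{D}$ is the open unit disc and $\sigma$ is area measure on $\mathbb{D}$ normalized so that $\sigma(\mathbb{D})=1$. For $1<p<\infty$, the Bergman space $A^p$ consists of the analytic functions $f$ on $\mathbb{D}$ with $\|f\|_{A^p}=\left(\int_{\mathbb{D}}|f|^p\,d\sigma\right)^{1/p}<\infty$. For $0<s<\infty$, the Hardy space $H^s$ consists of the analytic functions $f$ on $\mathbb{D}$ with $\|f\|_{H^s}=\sup_{0<r<1}\left(\frac{1}{2\pi}\int_0^{2\pi}|f(re^{i\theta})|^s\,d\theta\right)^{1/s}<\infty$. One has $H^s\subset A^s$. With $q=p/(p-1)$, each bounded linear functional $\phi$ on $A^p$ has a unique representation $\phi(f)=\int_{\mathbb{D}} f\,\overline{k}\,d\sigma$ with $k\in A^q$; $k$ is called the kernel of $\phi$. For $k\in A^q$ not identically $0$, the $A^p$ extremal function for $k$ is the (existing and unique) function $F\in A^p$ with $\|F\|_{A^p}=1$ and $\operatorname{Re}\phi(F)=\sup_{\|g\|_{A^p}=1}\operatorname{Re}\phi(g)=\|\phi\|$, where $\phi$ is the functional with kernel $k$. (By Ryabykh's theorem, if $k\in H^q$ then $F\in H^p$.) *)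

(* Defs.v *)
From mathcomp Require Import all_boot all_order all_algebra.
From mathcomp Require Import complex.
From mathcomp Require Import all_classical all_reals all_analysis.
From mathcomp Require Import measurable_realfun lra.

Set Implicit Arguments.
Unset Strict Implicit.
Unset Printing Implicit Defensive.

Import Order.TTheory GRing.Theory Num.Theory.
Import numFieldNormedType.Exports.
Import ComplexField.Normc.

Local Open Scope classical_set_scope.
Local Open Scope complex_scope.
Local Open Scope ring_scope.

(* Functions on the disc are total functions R[i] -> R[i]; no definition below
   looks at their values outside unit_disc. *)
Section BergmanHardy.
Variable R : realType.
Implicit Types (f g k F : R[i] -> R[i]) (p s : R).

Definition unit_disc : set R[i] := [set z | normc z < 1].

(* R[i]^o carries the topology and the structure of a complex normed module,
   so that this is complex differentiability at each point of the disc. *)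
Definition analytic_on_disc f :=
  forall z, unit_disc z -> derivable (f : R[i]^o -> R[i]^o) z 1.

(* R[i] has no measurable structure in the library: area integrals are taken
   over the plane of pairs (x, y), with z = x +i* y. *)
Definition plane := (measurableTypeR R * measurableTypeR R)%type.

Definition to_C (w : plane) : R[i] := w.1 +i* w.2.

Definition planar_disc : set plane := to_C @^-1` unit_disc.

Definition planar_measure : {measure set plane -> \bar R} :=
  (@lebesgue_measure R \x @lebesgue_measure R)%E.

Lemma planar_disc_measure_inv_ge0 : 0 <= (fine (planar_measure planar_disc))^-1.
Proof. by rewrite invr_ge0 fine_ge0. Qed.

Definition sigma : {measure set plane -> \bar R} :=
  mscale (NngNum planar_disc_measure_inv_ge0) planar_measure.

Lemma planar_discE :
  planar_disc = [set w | w.1 ^+ 2 + w.2 ^+ 2 < 1].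
Proof.
apply/seteqP; split=> -[x y]; rewrite /planar_disc /unit_disc /to_C /=.
  by rewrite -{1}sqrtr1 ltr_sqrt ?ltr01.
by move=> h; rewrite -sqrtr1 ltr_sqrt ?ltr01.
Qed.

Lemma measurable_planar_disc : measurable planar_disc.
Proof.
rewrite planar_discE.
have mf : measurable_fun setT (fun w : plane => w.1 ^+ 2 + w.2 ^+ 2 : R).
  by apply: measurable_funD; apply: measurable_funX;
    [exact: measurable_fst | exact: measurable_snd].
have := mf measurableT _ (measurable_itv `]-oo, 1[).
rewrite setTI; congr measurable.
Qed.

Lemma sigma_planar_disc : sigma planar_disc = 1%E.
Proof.
have box (a b : R) : a <= b -> measurable (`[a, b] `*` `[a, b] : set plane) /\
    planar_measure (`[a, b] `*` `[a, b]) = ((b - a) * (b - a))%:E.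
  move=> ab; split; first by apply: measurableX; exact: measurable_itv.
  rewrite /planar_measure /= product_measure1E; try exact: measurable_itv.
  rewrite /= lebesgue_measure_itv /= lte_fin.
  move: ab; rewrite le_eqVlt => /orP[/eqP->|->]; last by rewrite -EFinD -EFinM.
  by rewrite ltxx subrr mul0r mule0.
have [m0 e0] := box 0 2^-1 ltac:(by rewrite invr_ge0).
have [m1 e1] := box (-1) 1 ltac:(lra).
have lo : (((2^-1 - 0) * (2^-1 - 0))%R%:E <= planar_measure planar_disc)%E.
  rewrite -e0; apply: le_measure; rewrite ?inE//; first exact: measurable_planar_disc.
  rewrite planar_discE => -[x y] /=; rewrite !in_itv /= => -[/andP[? ?] /andP[? ?]]; nra.
have hi : (planar_measure planar_disc <= ((1 - -1) * (1 - -1))%R%:E)%E.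
  rewrite -e1; apply: le_measure; rewrite ?inE//; first exact: measurable_planar_disc.
  rewrite planar_discE => -[x y] /= h; rewrite !in_itv /=.
  by split; apply/andP; split; nra.
change (((fine (planar_measure planar_disc))^-1%:E * planar_measure planar_disc)%E = 1%E).
case: (planar_measure _) lo hi => [r| |] //=.
rewrite !lee_fin => lo hi; rewrite -EFinM mulVf //.
by apply: lt0r_neq0; nra.
Qed.

Definition bergman_norm p f : \bar R :=
  ((\int[sigma]_(w in planar_disc) (normc (f (to_C w)) `^ p)%:E) `^ p^-1)%E.

Definition bergman p f := analytic_on_disc f /\ (bergman_norm p f < +oo)%E.

Definition hardy_norm s f : \bar R :=
  ereal_sup [set
    (((2 * pi)^-1%:E * \int[lebesgue_measure]_(t in `[0%R, (2 * pi)%R])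
        (normc (f (r%:C * (cos t +i* sin t))) `^ s)%:E) `^ s^-1)%E
    | r in `]0%R, 1%R[ ].

Definition hardy s f := analytic_on_disc f /\ (hardy_norm s f < +oo)%E.

Definition hardy_cvg s (u : nat -> R[i] -> R[i]) f :=
  [/\ forall n, hardy s (u n), hardy s f
    & hardy_norm s (fun z => u n z - f z) @[n --> \oo] --> 0%E].

Definition disc_integral (h : R[i] -> R[i]) : R[i] :=
  (\int[sigma]_(w in planar_disc) complex.Re (h (to_C w)))
  +i* (\int[sigma]_(w in planar_disc) complex.Im (h (to_C w))).

Definition functional k g : R[i] := disc_integral (fun z => g z * (k z)^*%C).

Definition bergman_opnorm p (phi : (R[i] -> R[i]) -> R[i]) : \bar R :=
  ereal_sup [set (normc (phi g))%:E
            | g in [set g | bergman p g /\ (bergman_norm p g <= 1)%E]].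

Definition extremal p k F :=
  [/\ bergman p F,
      bergman_norm p F = 1%E,
      (complex.Re (functional k F))%:E =
        ereal_sup [set (complex.Re (functional k g))%:E
                  | g in [set g | bergman p g /\ bergman_norm p g = 1%E]]
    & (complex.Re (functional k F))%:E = bergman_opnorm p (functional k)].

Definition not_identically_zero f := exists2 z, unit_disc z & f z <> 0.

End BergmanHardy.

(* Main.v *)
Require Import Defs.
From HB Require Import structures.
From mathcomp Require Import all_boot all_order all_algebra.
From mathcomp Require Import complex.
From mathcomp Require Import all_classical all_reals all_analysis.
From mathcomp Require Import measurable_realfun ring lra zify.

(** Write p = 2m. Let phi_n and phi be the functionals with kernels k_n and k,
    and lam_n and lam their norms, that is Re phi_n(F_n) and Re phi(F). Since p
    is even, |F|^p = |F^m|^2, and Parseval's identity turns norms of F into sums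
    over the Taylor coefficients c_j of F^m: the p-th power of the H^p norm is
    the sum of |c_j|^2, that of the A^p norm is the sum of |c_j|^2 / (j + 1).

    Varying F in the extremal problem gives the identity
    Re phi(g) = lam Re int g F^(m-1) conj(F^m) for all g in A^p
    (optimal_identity). Comparing F with its dilations gives a bound of F in H^p
    that is uniform over the sequence (ryabykh, Hp_uniform). The norms satisfy
    lam_n --> lam, and since the midpoint of F_n and F nearly attains the norm
    of phi, Clarkson's inequality gives F_n --> F in A^p, hence convergence of
    each Taylor coefficient (lam_cvg, bergman_cvg, coef_cvg). Applying Clarkson's
    inequality once more, on circles, reduces the theorem to the statement that
    the H^p norms of F_n do not exceed that of F in the limit
    (extremal_Hp_cvg).

    For this take g = (z F_n)' in the variational identities for k_n and for k.
    The first right-hand side is lam_n times the combination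
    ||F_n||_(H^p)^p / m + (1 - 1/m) ||F_n||_(A^p)^p, because
    m (z F_n)' F_n^(m-1) = m F_n^m + z (F_n^m)'. The left-hand sides differ by
    the pairing of (z F_n)' with k_n - k over the disc, which is the pairing of
    F_n with k_n - k over the unit circle and is small because k_n --> k in H^q
    (pair_Dz_le). The second right-hand side pairs (z F_n)' F^(m-1) with F^m. A
    trilinear estimate (test_fun_bound), which rests on the Littlewood-Paley
    inequality, makes this pairing depend on finitely many Taylor coefficients
    only, up to the tail of F^m in H^2 (pair_tail). It therefore converges to
    its value at F_n = F, which is lam (||F||_(H^p)^p / m + 1 - 1/m), and
    limsup ||F_n||_(H^p) <= ||F||_(H^p) follows (compare_norms, limsup_norm). As
    (z F_n)' need not lie in A^p, the argument is run on its dilations.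

    The complex analysis behind this consists of Taylor series, obtained from
    Goursat's theorem in the logarithmic coordinate and from the uniqueness of
    Fourier coefficients, and of polar coordinates, obtained from the invariance
    of area under shears. *)

Set Implicit Arguments.
Unset Strict Implicit.
Unset Printing Implicit Defensive.

Import Order.TTheory GRing.Theory Num.Theory.
Import numFieldNormedType.Exports.
Import ComplexField.Normc.

Local Open Scope classical_set_scope.
Local Open Scope complex_scope.
Local Open Scope ring_scope.

Local Notation Re := (@complex.Re _).
Local Notation Im := (@complex.Im _).

(** * The modulus, the complex derivative and the exponential *)

Section ComplexModulus.
Variable R : realType.
Implicit Types z w : R[i].

Lemma normc_sqr z : normc z ^+ 2 = Re z ^+ 2 + Im z ^+ 2.
Proof. by case: z => a b /=; rewrite sqr_sqrtr // addr_ge0 // sqr_ge0. Qed.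

Lemma normc_ge0 z : 0 <= normc z.
Proof. by case: z => a b /=; rewrite sqrtr_ge0. Qed.
Hint Resolve normc_ge0 : core.

Lemma normcX z n : normc (z ^+ n) = normc z ^+ n.
Proof.
elim: n => [|n IHn]; first by rewrite !expr0 -(@normc1 R).
by rewrite !exprS normcM IHn.
Qed.

Lemma normcR (x : R) : normc x%:C = `|x|.
Proof. by rewrite /normc /= expr0n addr0 sqrtr_sqr. Qed.

Lemma normc_conj z : normc z^* = normc z.
Proof. by case: z => a b /=; rewrite sqrrN. Qed.

Lemma normr_Re_le z : `|Re z| <= normc z.
Proof.
case: z => a b /=; rewrite -[leLHS]sqrtr_sqr ler_wsqrtr //.
by rewrite lerDl sqr_ge0.
Qed.

Lemma normr_Im_le z : `|Im z| <= normc z.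
Proof.
case: z => a b /=; rewrite -[leLHS]sqrtr_sqr ler_wsqrtr //.
by rewrite lerDr sqr_ge0.
Qed.

Lemma normc_le_ReIm z : normc z <= `|Re z| + `|Im z|.
Proof.
have h : 0 <= `|Re z| + `|Im z| by rewrite addr_ge0.
rewrite -[leRHS]ger0_norm // -sqrtr_sqr.
case: z h => a b /= h; rewrite ler_wsqrtr //.
by rewrite sqrrD !real_normK ?num_real // lerD2r lerDl mulrn_wge0.
Qed.

Lemma normc_eq0 z : normc z = 0 <-> z = 0.
Proof. by split=> [/eq0_normc//|->]; exact: normc0. Qed.

Lemma lecr_normcB z w : normc z - normc w <= normc (z - w).
Proof. by rewrite lerBlDr -{1}(subrK w z) le_normcD. Qed.

Lemma normcBC z w : normc (z - w) = normc (w - z).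
Proof. by rewrite -normcN opprB. Qed.

Lemma normc_sum n (u : 'I_n -> R[i]) :
  normc (\sum_(i < n) u i) <= \sum_(i < n) normc (u i).
Proof.
elim/big_ind2: _ => [|x1 x2 y1 y2 h1 h2|i _] //; first by rewrite normc0.
by rewrite (le_trans (le_normcD _ _)) // lerD.
Qed.

Lemma mul_conjc z : z * z^* = (normc z ^+ 2)%:C.
Proof.
by rewrite normc_sqr; case: z => a b /=; apply/eqP; rewrite eq_complex /=;
  apply/andP; split; apply/eqP; ring.
Qed.

Lemma Re_le_normc z : Re z <= normc z.
Proof. exact: le_trans (ler_norm _) (normr_Re_le z). Qed.

Lemma Re_scale (x : R) z : Re (x%:C * z) = x * Re z.
Proof. by case: z => a b /=; rewrite mul0r subr0. Qed.

Lemma Im_scale (x : R) z : Im (x%:C * z) = x * Im z.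
Proof. by case: z => a b /=; rewrite mul0r addr0. Qed.

Lemma normC_normc (z : R[i]) : `|z| = (normc z)%:C.
Proof. by []. Qed.

End ComplexModulus.
#[global] Hint Resolve normc_ge0 : core.

Section ComplexDerivative.
Variable R : realType.
Implicit Types (f g : R[i] -> R[i]) (z w l : R[i]).

(** The error is measured by the real-valued modulus, so that estimates stay
    in R; derivable_cderP is the bridge to derivable. *)
Definition cder f z l := forall e : R, 0 < e -> exists2 d : R, 0 < d &
  forall w, normc (w - z) < d -> normc (f w - f z - l * (w - z)) <= e * normc (w - z).

Lemma derivable_cderP f z :
  derivable (f : R[i]^o -> R[i]^o) z 1 <-> exists l, cder f z l.
Proof.
split=> [df|[l dl]].
  exists ('D_1 (f : R[i]^o -> R[i]^o) z) => e e0.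
  have : (fun h : R[i]^o => h^-1 *: ((f (h *: 1 + z) : R[i]^o) - f z)) @ 0^' -->
     'D_1 (f : R[i]^o -> R[i]^o) z by exact: df.
  have e0' : 0 < (e%:C : R[i]) by rewrite ltcR.
  move/cvgrPdist_le => /(_ _ e0') [d' d0' hd].
  have hd0 : d' = (Re d')%:C by rewrite RRe_real // gtr0_real.
  have d0 : 0 < Re d' by move: d0'; rewrite /= hd0 ltcR.
  exists (Re d') => // w wz.
  have [->|wzn] := eqVneq w z; first by rewrite !subrr mulr0 subrr normc0 mulr0.
  have := hd (w - z); rewrite /ball_ /= sub0r normrN subr_eq0.
  rewrite [in X in _ -> X -> _](_ : _ != _); last by [].
  rewrite hd0 normC_normc ltcR => /(_ wz isT).
  rewrite normC_normc lecR [(w - z)%:A]mulr1 subrK => H.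
  have wz0 : w - z != 0 by rewrite subr_eq0.
  rewrite (_ : f w - f z - _ = - (w - z) *
    ('D_1 (f : R[i]^o -> R[i]^o) z - (w - z)^-1 * (f w - f z))).
    by rewrite normcM normcN mulrC ler_wpM2r.
  by field.
apply/cvg_ex; exists l; apply/cvgrPdist_le => e' e0'.
have he : e' = (Re e')%:C by rewrite RRe_real // gtr0_real.
have e0 : 0 < Re e' by move: e0'; rewrite he ltcR.
have [d d0 hd] := dl _ e0.
exists d%:C => /=; first by rewrite ltcR.
move=> h; rewrite /= sub0r normrN normC_normc ltcR => hh h0.
have := hd (h + z); rewrite addrK => /(_ hh) H.
rewrite he normC_normc lecR [(h%:A)]mulr1.
have nh : 0 < normc h.
  by rewrite lt_neqAle normc_ge0 andbT eq_sym; apply/eqP => /normc_eq0 /eqP; rewrite (negbTE h0).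
rewrite -(ler_pM2r nh) (le_trans _ H) // -normcM -normcN.
have E : - ((l - h^-1 * (f (h + z) - f z)) * h) = f (h + z) - f z - l * h.
  by field.
by move: (lexx (normc (f (h + z) - f z - l * h))); rewrite -{1}E.
Qed.

Lemma cder_cst (a : R[i]) z : cder (fun=> a) z 0.
Proof. by move=> e e0; exists 1 => // w _; rewrite subrr mul0r subrr normc0 mulr_ge0 // ltW. Qed.

Lemma cder_id z : cder id z 1.
Proof. by move=> e e0; exists 1 => // w _; rewrite mul1r subrr normc0 mulr_ge0 // ltW. Qed.

Lemma cder_near f g z l (r : R) : 0 < r ->
  (forall w, normc (w - z) < r -> f w = g w) -> cder f z l -> cder g z l.
Proof.
move=> r0 fg df e e0; have [d d0 hd] := df e e0.
exists (Num.min d r) => [|w]; first by rewrite lt_min d0.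
rewrite lt_min => /andP[wd wr]; rewrite -!fg ?hd //.
by rewrite subrr normc0.
Qed.

Lemma cder_lip f z l : cder f z l -> exists2 d : R, 0 < d &
  forall w, normc (w - z) < d -> normc (f w - f z) <= (normc l + 1) * normc (w - z).
Proof.
move=> /(_ 1 ltr01)[d d0 hd]; exists d => // w /hd h.
rewrite -(subrK (l * (w - z)) (f w - f z)) (le_trans (le_normcD _ _)) //.
by rewrite mulrDl addrC lerD // normcM.
Qed.

Lemma cder_cont f z l : cder f z l -> forall e : R, 0 < e ->
  exists2 d : R, 0 < d & forall w, normc (w - z) < d -> normc (f w - f z) <= e.
Proof.
move=> /cder_lip[d d0 hd] e e0.
have l0 : 0 < normc l + 1 by rewrite ltr_wpDl.
exists (Num.min d (e / (normc l + 1))) => [|w]; first by rewrite lt_min d0 divr_gt0.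
rewrite lt_min => /andP[/hd h]; rewrite ltr_pdivlMr // => h2.
by rewrite (le_trans h) // mulrC ltW.
Qed.

Lemma cderD f g z l m : cder f z l -> cder g z m ->
  cder (fun w => f w + g w) z (l + m).
Proof.
move=> df dg e e0; have e2 : 0 < e / 2 by rewrite divr_gt0.
have [d d0 hd] := df _ e2; have [d' d'0 hd'] := dg _ e2.
exists (Num.min d d') => [|w]; first by rewrite lt_min d0.
rewrite lt_min => /andP[/hd h /hd' h'].
rewrite (_ : _ - _ - _ = (f w - f z - l * (w - z)) + (g w - g z - m * (w - z))).
  rewrite (le_trans (le_normcD _ _)) // (le_trans (lerD h h')) //.
  by rewrite -mulrDl -splitr.
by ring.
Qed.

Lemma cderM f g z l m : cder f z l -> cder g z m ->
  cder (fun w => f w * g w) z (l * g z + f z * m).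
Proof.
move=> df dg e e0.
have lg := normc_ge0 (g z); have lf := normc_ge0 (f z).
have ll := normc_ge0 l; have lm := normc_ge0 m.
pose K := normc (f z) + normc (g z) + (normc l + 1) * (normc m + 1) + 1.
have K0 : 0 < K by rewrite /K; nra.
have ek : 0 < e / K by rewrite divr_gt0.
have [d d0 hd] := df _ ek; have [d' d'0 hd'] := dg _ ek.
have [c c0 hc] := cder_lip df; have [c' c'0 hc'] := cder_lip dg.
exists (Num.min (Num.min d d') (Num.min (Num.min c c') (e / K))) => [|w].
  by rewrite !lt_min d0 d'0 c0 c'0.
rewrite !lt_min => /andP[/andP[/hd h1 /hd' h2] /andP[/andP[/hc h3 /hc' h4] h5]].
rewrite (_ : _ - _ - _ = (f w - f z - l * (w - z)) * g z
   + f z * (g w - g z - m * (w - z)) + (f w - f z) * (g w - g z)); last by ring.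
rewrite (le_trans (le_normcD _ _)) // (le_trans (lerD (le_normcD _ _) (lexx _))) //.
rewrite !normcM.
have w0 := normc_ge0 (w - z).
have h34 : normc (f w - f z) * normc (g w - g z) <=
   (normc l + 1) * (normc m + 1) * (e / K) * normc (w - z).
  apply: (le_trans (ler_pM _ _ h3 h4)) => //.
  rewrite mulrACA -[leRHS]mulrA; apply: ler_wpM2l.
    by rewrite mulr_ge0 // addr_ge0.
  exact: ler_wpM2r (ltW h5).
have eK : e = (normc (f z) + normc (g z) + (normc l + 1) * (normc m + 1) + 1) * (e / K).
  by rewrite -/K mulrC divfK // gt_eqF.
have h1' := ler_wpM2r lg h1; have h2' := ler_wpM2l lf h2.
move: h34 h1' h2' eK; set t := e / K in ek *; move=> h34 h1' h2' eK.
rewrite [X in X * normc (w - z)]eK.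
have : 0 <= t * normc (w - z) by rewrite mulr_ge0 // ltW.
move: h34 h1' h2'.
set A := normc _ * normc (_ - _); set B := normc _ * _; set D := normc _ * _ => *.
nra.
Qed.

Lemma cder_comp f g z l m : cder g z m -> cder f (g z) l ->
  cder (fun w => f (g w)) z (l * m).
Proof.
move=> dg df e e0.
have ll := normc_ge0 l; have lm := normc_ge0 m.
pose K := normc l + normc m + 2.
have K0 : 0 < K by rewrite /K; lra.
have ek : 0 < e / K by rewrite divr_gt0.
have [d d0 hd] := df _ ek; have [d' d'0 hd'] := dg _ ek.
have [c c0 hc] := cder_lip dg.
have m0 : 0 < normc m + 1 by lra.
exists (Num.min (Num.min d' c) (d / (normc m + 1))) => [|w].
  by rewrite !lt_min d'0 c0 divr_gt0.
rewrite !lt_min ltr_pdivlMr // => /andP[/andP[/hd' h2 /hc h3] h5].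
have h1 := hd (g w) (le_lt_trans h3 _); rewrite mulrC in h5.
have {}h1 := h1 h5.
rewrite (_ : _ - _ - _ = (f (g w) - f (g z) - l * (g w - g z))
   + l * (g w - g z - m * (w - z))); last by ring.
rewrite (le_trans (le_normcD _ _)) // normcM.
have w0 := normc_ge0 (w - z).
have eK : e = K * (e / K) by rewrite mulrC divfK // gt_eqF.
move: h1 h2 eK; set t := e / K in ek *; move=> h1 h2 eK.
have h1' : t * normc (g w - g z) <= t * ((normc m + 1) * normc (w - z)).
  by rewrite ler_wpM2l // ltW.
have h2' := ler_wpM2l ll h2.
rewrite [X in X * normc (w - z)]eK /K.
have : 0 <= t * normc (w - z) by rewrite mulr_ge0 // ltW.
by move: h1 h1' h2'; set A := normc (_ - _ - _); set B := normc l * _ => *; nra.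
Qed.

Lemma cderX f z l n : cder f z l -> cder (fun w => f w ^+ n) z (n%:R * f z ^+ n.-1 * l).
Proof.
move=> df; elim: n => [|n IHn].
  by rewrite mul0r mul0r; have := @cder_cst 1 z.
have := cderM df IHn; rewrite (_ : l * _ + _ = n.+1%:R * f z ^+ n.+1.-1 * l); last first.
  case: n {IHn} => [|n] /=; first by rewrite !expr0; ring.
  by rewrite exprS -[in RHS]natr1; ring.
by apply: (@cder_near _ _ _ _ 1) => // w _; rewrite exprS.
Qed.

Lemma cderZ f (a : R[i]) z l : cder f z l -> cder (fun w => a * f w) z (a * l).
Proof. by move=> df; have := cderM (cder_cst a z) df; rewrite mul0r add0r. Qed.

Lemma cderB f g z l m : cder f z l -> cder g z m ->
  cder (fun w => f w - g w) z (l - m).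
Proof.
move=> df dg; have := cderD df (cderZ (-1) dg); rewrite mulN1r.
by apply: (@cder_near _ _ _ _ 1) => // w _; rewrite mulN1r.
Qed.

End ComplexDerivative.

Section ComplexExponential.
Variable R : realType.
Implicit Types z w : R[i].

Definition cexp z : R[i] := (expR (Re z))%:C * (cos (Im z) +i* sin (Im z)).

Definition cis (t : R) : R[i] := cos t +i* sin t.

Lemma cisD s t : cis (s + t) = cis s * cis t.
Proof.
rewrite /cis cosD sinD; apply/eqP; rewrite eq_complex /=; apply/andP; split=> //.
by rewrite addrC; apply/eqP; congr (_ + _); rewrite mulrC.
Qed.

Lemma cis0 : cis 0 = 1.
Proof. by rewrite /cis cos0 sin0. Qed.

Lemma cisN t : cis (- t) = (cis t)^*.
Proof. by rewrite /cis cosN sinN. Qed.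

Lemma normc_cis t : normc (cis t) = 1.
Proof. by rewrite /cis /normc cos2Dsin2 sqrtr1. Qed.

Lemma cisX t n : cis t ^+ n = cis (n%:R * t).
Proof.
elim: n => [|n IHn]; first by rewrite expr0 mul0r cis0.
by rewrite exprS IHn -cisD -natr1 mulrDl mul1r addrC.
Qed.

Lemma cis_2pi t : cis (t + 2 * pi) = cis t.
Proof. by rewrite /cis (mulrC 2) mulr_natr cosD2pi sinD2pi. Qed.

Lemma cexpE (x y : R) : cexp (x +i* y) = (expR x)%:C * cis y.
Proof. by []. Qed.

Lemma cexpD z w : cexp (z + w) = cexp z * cexp w.
Proof.
case: z w => a b [c d]; rewrite -[_ +i* _ + _]/((a + c) +i* (b + d)).
by rewrite !cexpE expRD cisD rmorphM /=; ring.
Qed.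

Lemma normc_cexp z : normc (cexp z) = expR (Re z).
Proof. by rewrite normcM normcR normc_cis mulr1 ger0_norm // expR_ge0. Qed.

Lemma is_derive_littleo (f : R -> R) (a l : R) : is_derive a 1 f l ->
  forall e : R, 0 < e -> exists2 d : R, 0 < d &
  forall x, `|x - a| < d -> `|f x - f a - l * (x - a)| <= e * `|x - a|.
Proof.
move=> [df <-] e e0.
have : (fun h : R => h^-1 *: (f (h *: 1 + a) - f a)) @ 0^' --> 'D_1 f a by exact: df.
move/cvgrPdist_le => /(_ _ e0) [d d0 hd].
exists d => // x xa.
have [->|xn] := eqVneq x a; first by rewrite !subrr mulr0 subrr normr0 mulr0.
have := hd (x - a); rewrite /ball_ /= sub0r normrN subr_eq0 => /(_ xa xn).
rewrite [_%:A]mulr1 subrK => H.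
have xa0 : x - a != 0 by rewrite subr_eq0.
rewrite -ler_pdivrMr ?normr_gt0 // -normrV ?unitfE // -normrM -normrN.
rewrite (_ : - _ = 'D_1 f a - (x - a)^-1 *: (f x - f a)) //.
by rewrite [_ *: _]/GRing.scale /=; field.
Qed.

(** The first-order expansions of exp, cos and sin at 0, combined through e^x
    cos y - 1 - x = (e^x - 1 - x) + e^x (cos y - 1) and e^x sin y - y = e^x
    (sin y - y) + y (e^x - 1). *)
Lemma cder_cexp0 : cder cexp 0 1.
Proof.
move=> e e0.
pose c := Num.min 1 (e / 8).
have c0 : 0 < c by rewrite lt_min ltr01 divr_gt0.
have c1 : c <= 1 by rewrite ge_min lexx.
have ce : c * 8 <= e by rewrite -ler_pdivlMr // ge_min lexx orbT.
have [d1 d10 h1] := is_derive_littleo (is_derive_expR (0 : R)) c0.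
have [d2 d20 h2] := is_derive_littleo (is_derive_cos (0 : R)) c0.
have [d3 d30 h3] := is_derive_littleo (is_derive_sin (0 : R)) c0.
exists (Num.min (Num.min (Num.min d1 d2) d3) (c / 2)) => [|[x y]].
  by rewrite !lt_min d10 d20 d30 divr_gt0.
rewrite subr0 mul1r !lt_min => /andP[/andP[/andP[w1 w2] w3] w4].
have nx := normr_Re_le (x +i* y); have ny := normr_Im_le (x +i* y).
rewrite /= -/(normc (x +i* y)) in nx ny.
move: w1 w2 w3 w4 nx ny; set n := normc _ => w1 w2 w3 w4 nx ny.
have {h1} := h1 x; have {h2} := h2 y; have {h3} := h3 y.
rewrite !subr0 expR0 cos0 sin0 oppr0 mul0r !subr0 !mul1r.
rewrite addr0 => /(_ (le_lt_trans ny w3)) h3 /(_ (le_lt_trans ny w2)) h2 /(_ (le_lt_trans nx w1)) h1.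
have [x0 y0] : 0 <= `|x| /\ 0 <= `|y| by [].
have e3 : expR x <= 3.
  move: h1; rewrite ler_norml => /andP[_ h1].
  have := ler_norm x; nra.
have ep := expR_ge0 x.
have e1 : `|expR x - 1| <= 2 * `|x|.
  rewrite -(subrK x (expR x - 1)) (le_trans (ler_normD _ _)) //; nra.
apply: (le_trans (normc_le_ReIm _)).
have -> : Re (cexp (x +i* y) - cexp 0 - (x +i* y)) = (expR x - 1 - x) + expR x * (cos y - 1).
  by rewrite /cexp /= expR0 cos0 sin0; ring.
have -> : Im (cexp (x +i* y) - cexp 0 - (x +i* y)) = expR x * (sin y - y) + y * (expR x - 1).
  by rewrite /cexp /= expR0 cos0 sin0; ring.
rewrite (le_trans (lerD (ler_normD _ _) (ler_normD _ _))) // !normrM (ger0_norm ep).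
have a2 : expR x * `|cos y - 1| <= 3 * (c * `|y|) by apply: ler_pM.
have a3 : expR x * `|sin y - y| <= 3 * (c * `|y|) by apply: ler_pM.
have a4 : `|y| * `|expR x - 1| <= `|y| * (2 * `|x|) by rewrite ler_wpM2l.
have n0 : 0 <= n by rewrite /n.
nra.
Qed.

Lemma cder_cexp z : cder cexp z (cexp z).
Proof.
move=> e e0.
have k0 : 0 < normc (cexp z) by rewrite normc_cexp expR_gt0.
have [d d0 hd] := cder_cexp0 (divr_gt0 e0 k0).
exists d => // w wz; have := hd (w - z); rewrite subr0 mul1r => /(_ wz).
rewrite mulrAC ler_pdivlMr // mulrC -normcM.
have e1 : cexp 0 = 1 :> R[i].
  by rewrite [0](_ : _ = 0 +i* 0) // cexpE expR0 cis0 mulr1.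
rewrite (_ : _ * (cexp (w - z) - _ - _) = cexp w - cexp z - cexp z * (w - z)) //.
by rewrite e1 !mulrBr -cexpD mulr1; congr (cexp _ - _ - _); ring.
Qed.

End ComplexExponential.

(** * Integrals of complex-valued functions *)

Section ComplexIntegral.
Context d (T : measurableType d) (R : realType) (mu : {measure set T -> \bar R}).
Implicit Types (D : set T) (f g : T -> R[i]).

Definition Cintegrable D f :=
  mu.-integrable D (fun x => (Re (f x))%:E) /\ mu.-integrable D (fun x => (Im (f x))%:E).

Definition Cint D f : R[i] :=
  (\int[mu]_(x in D) Re (f x)) +i* (\int[mu]_(x in D) Im (f x)).

Lemma eq_Cint D f g : {in D, f =1 g} -> Cint D f = Cint D g.
Proof. by move=> fg; congr (_ +i* _); apply: eq_Rintegral => x /fg ->. Qed.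

Lemma CintD D f g : measurable D -> Cintegrable D f -> Cintegrable D g ->
  Cint D (fun x => f x + g x) = Cint D f + Cint D g.
Proof.
move=> mD [f1 f2] [g1 g2]; rewrite /Cint.
by congr (_ +i* _); rewrite -RintegralD //; apply: eq_Rintegral => x _; rewrite raddfD.
Qed.

Lemma CintegrableZ D f a : measurable D -> Cintegrable D f ->
  Cintegrable D (fun x => a * f x).
Proof.
case: a => a b mD [f1 f2]; split.
  have := integrableB mD (integrableZl mD a f1) (integrableZl mD b f2).
  by apply: eq_integrable => // x _ /=; case: (f x).
have := integrableD mD (integrableZl mD a f2) (integrableZl mD b f1).
by apply: eq_integrable => // x _ /=; case: (f x).
Qed.

Lemma CintZ D f a : measurable D -> Cintegrable D f ->
  Cint D (fun x => a * f x) = a * Cint D f.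
Proof.
case: a => a b mD [f1 f2]; rewrite /Cint.
have f1a : mu.-integrable D (EFin \o (fun x => a * Re (f x))).
  by have := integrableZl mD a f1; apply: eq_integrable.
have f1b : mu.-integrable D (EFin \o (fun x => b * Re (f x))).
  by have := integrableZl mD b f1; apply: eq_integrable.
have f2a : mu.-integrable D (EFin \o (fun x => a * Im (f x))).
  by have := integrableZl mD a f2; apply: eq_integrable.
have f2b : mu.-integrable D (EFin \o (fun x => b * Im (f x))).
  by have := integrableZl mD b f2; apply: eq_integrable.
apply/eqP; rewrite eq_complex /=; apply/andP; split; apply/eqP.
  rewrite -!RintegralZl // -RintegralB //.
  by apply: eq_Rintegral => x _; case: (f x).
rewrite -!RintegralZl // -RintegralD //.
by apply: eq_Rintegral => x _; case: (f x).
Qed.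

Lemma CintB D f g : measurable D -> Cintegrable D f -> Cintegrable D g ->
  Cint D (fun x => f x - g x) = Cint D f - Cint D g.
Proof.
move=> mD fi gi; rewrite -mulN1r -CintZ // -CintD //; last exact: CintegrableZ.
by apply: eq_Cint => x _; rewrite mulN1r.
Qed.

(** The two components are estimated separately, whence the factor 2. *)
Lemma normc_Cint_le D f (G : T -> R) : measurable D -> Cintegrable D f ->
  mu.-integrable D (EFin \o G) -> (forall x, D x -> normc (f x) <= G x) ->
  normc (Cint D f) <= 2 * \int[mu]_(x in D) G x.
Proof.
move=> mD [f1 f2] Gi fG; apply: (le_trans (normc_le_ReIm _)).
rewrite mulr_natl mulr2n; apply: lerD.
  apply: (le_trans (le_normr_Rintegral mD f1)); apply: le_Rintegral => // [|x Dx].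
    by have := integrable_norm f1; exact.
  exact: le_trans (normr_Re_le _) (fG _ Dx).
apply: (le_trans (le_normr_Rintegral mD f2)); apply: le_Rintegral => // [|x Dx].
  by have := integrable_norm f2; exact.
exact: le_trans (normr_Im_le _) (fG _ Dx).
Qed.

Lemma normc_Cint_bound D f (M : R) : measurable D -> Cintegrable D f ->
  (mu D < +oo)%E -> (forall x, D x -> normc (f x) <= M) ->
  normc (Cint D f) <= 2 * (M * fine (mu D)).
Proof.
move=> mD fi muD fM; have := @normc_Cint_le D f (fun=> M) mD fi.
rewrite Rintegral_cst //; apply => //.
apply/integrableP; split; first by apply/measurable_EFinP; exact: measurable_cst.
rewrite (@integral_cst _ _ _ mu D mD `|M%:E|%E).
by rewrite lte_mul_pinfty // abse_ge0.
Qed.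

Lemma Re_Cint D f : Re (Cint D f) = \int[mu]_(x in D) Re (f x).
Proof. by []. Qed.

End ComplexIntegral.

Section IntervalIntegral.
Variable R : realType.
Implicit Types (h : R -> R[i]) (a b c x : R).

Definition ccont_at h x := forall e : R, 0 < e -> exists2 d : R, 0 < d &
  forall y, `|y - x| < d -> normc (h y - h x) <= e.

Definition cint a b h : R[i] := Cint (@lebesgue_measure R) `[a, b]%classic h.

Lemma Re_ccont h x : ccont_at h x -> {for x, continuous (fun y => Re (h y))}.
Proof.
move=> hc; apply/cvgrPdist_le => e /hc[d d0 hd].
exists d => // y; rewrite /= distrC => /hd; apply: le_trans.
by rewrite normcBC -raddfB; exact: normr_Re_le.
Qed.

Lemma Im_ccont h x : ccont_at h x -> {for x, continuous (fun y => Im (h y))}.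
Proof.
move=> hc; apply/cvgrPdist_le => e /hc[d d0 hd].
exists d => // y; rewrite /= distrC => /hd; apply: le_trans.
by rewrite normcBC -raddfB; exact: normr_Im_le.
Qed.

Lemma continuous_integrable_itv a b (h : R -> R) :
  (forall x, a <= x <= b -> {for x, continuous h}) ->
  (@lebesgue_measure R).-integrable `[a, b]%classic (fun x => (h x)%:E).
Proof.
move=> hc; apply: (@continuous_compact_integrable _ h); first exact: segment_compact.
by apply: continuous_in_subspaceT => x; rewrite inE /= in_itv /=; exact: hc.
Qed.

Lemma ccont_integrable a b h : (forall x, a <= x <= b -> ccont_at h x) ->
  Cintegrable (@lebesgue_measure R) `[a, b]%classic h.
Proof.
by move=> hc; split; apply: continuous_integrable_itv => x /hc;
  [exact: Re_ccont | exact: Im_ccont].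
Qed.

Lemma cint_cst a b (k : R[i]) : a <= b -> cint a b (fun=> k) = (b - a)%:C * k.
Proof.
move=> ab; rewrite /cint /Cint !Rintegral_cst //= lebesgue_measure_itv /=.
have -> : fine (if (a%:E < b%:E)%E then (b%:E - a%:E)%E else 0%E) = b - a.
  rewrite lte_fin; case: ltP => // ba; rewrite (le_anti (_ : b <= a <= b)) ?subrr //.
  by rewrite ab ba.
case: k => k1 k2; apply/eqP; rewrite eq_complex /= !mul0r subr0 addr0.
by rewrite ![_ * (b - a)]mulrC !eqxx.
Qed.

Lemma normc_cint_le a b h (M : R) : a <= b -> (forall x, a <= x <= b -> ccont_at h x) ->
  (forall x, a <= x <= b -> normc (h x) <= M) ->
  normc (cint a b h) <= 2 * (M * (b - a)).
Proof.
move=> ab hc hM.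
have E : (@lebesgue_measure R `[a, b]%classic = (b - a)%:E)%E.
  rewrite lebesgue_measure_itv /= lte_fin; case: ltP => // ba.
  by rewrite (le_anti (_ : b <= a <= b)) ?subrr // ab ba.
have muD : (@lebesgue_measure R `[a, b]%classic < +oo)%E by rewrite E ltry.
have hM' x : `[a, b]%classic x -> normc (h x) <= M by rewrite /= in_itv /=; exact: hM.
have H := normc_Cint_bound _ (ccont_integrable hc) muD hM'.
have := H (measurable_itv _).
by rewrite [X in fine X](_ : _ = (b - a)%:E).
Qed.

Lemma Rintegral_split a c b (h : R -> R) : a <= c <= b ->
  (@lebesgue_measure R).-integrable `[a, b]%classic (fun x => (h x)%:E) ->
  \int[lebesgue_measure]_(x in `[a, b]) h x =
  \int[lebesgue_measure]_(x in `[a, c]) h x + \int[lebesgue_measure]_(x in `[c, b]) h x.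
Proof.
move=> /andP[ac cb] hi.
have := @Rintegral_itvB _ h (BLeft a) (BRight b) c hi.
rewrite !bnd_simp => /(_ ac cb) E.
rewrite -(@Rintegral_itv_obnd_cbnd _ c); last first.
  apply: integrableS hi => // x /=; rewrite !in_itv /= => /andP[cx ->].
  by rewrite (le_trans ac) // ltW.
by rewrite -E addrC subrK.
Qed.

Lemma cint_split a c b h : a <= c <= b -> (forall x, a <= x <= b -> ccont_at h x) ->
  cint a b h = cint a c h + cint c b h.
Proof.
move=> acb hc; have [h1 h2] := ccont_integrable hc.
by rewrite /cint /Cint (Rintegral_split acb h1) (Rintegral_split acb h2).
Qed.

Lemma ccont_cst (k : R[i]) x : ccont_at (fun=> k) x.
Proof. by move=> e e0; exists 1 => // y _; rewrite subrr normc0 ltW. Qed.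

Lemma ccontD h g x : ccont_at h x -> ccont_at g x -> ccont_at (fun y => h y + g y) x.
Proof.
move=> hc gc e e0; have e2 : 0 < e / 2 by rewrite divr_gt0.
have [d d0 hd] := hc _ e2; have [d' d'0 hd'] := gc _ e2.
exists (Num.min d d') => [|y]; first by rewrite lt_min d0.
rewrite lt_min => /andP[/hd A /hd' B].
by rewrite opprD addrACA (le_trans (le_normcD _ _)) // (splitr e) lerD.
Qed.

Lemma ccontZ h (k : R[i]) x : ccont_at h x -> ccont_at (fun y => k * h y) x.
Proof.
move=> hc e e0; have k0 : 0 < normc k + 1 by rewrite ltr_wpDl.
have [d d0 hd] := hc _ (divr_gt0 e0 k0); exists d => // y /hd.
rewrite ler_pdivlMr // => h1; rewrite -mulrBr normcM (le_trans _ h1) //.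
by have := normc_ge0 (h y - h x); nra.
Qed.

Lemma ccontB h g x : ccont_at h x -> ccont_at g x -> ccont_at (fun y => h y - g y) x.
Proof.
move=> hc gc e e0; have [d d0 hd] := ccontD hc (ccontZ (-1) gc) e0.
by exists d => // y /hd; rewrite !mulN1r.
Qed.

Lemma ccontM h g x : ccont_at h x -> ccont_at g x -> ccont_at (fun y => h y * g y) x.
Proof.
move=> hc gc e e0.
have hx := normc_ge0 (h x); have gx := normc_ge0 (g x).
pose K := normc (h x) + normc (g x) + 1.
have K0 : 0 < K by rewrite /K; lra.
pose t := Num.min 1 (e / K).
have t0 : 0 < t by rewrite lt_min ltr01 divr_gt0.
have t1 : t <= 1 by rewrite ge_min lexx.
have tK : t * K <= e by rewrite -ler_pdivlMr // ge_min lexx orbT.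
have [d d0 hd] := hc _ t0; have [d' d'0 hd'] := gc _ t0.
exists (Num.min d d') => [|y]; first by rewrite lt_min d0.
rewrite lt_min => /andP[/hd A /hd' B].
rewrite (_ : _ - _ = (h y - h x) * (g y - g x) + h x * (g y - g x) + (h y - h x) * g x).
  rewrite (le_trans (le_normcD _ _)) // (le_trans (lerD (le_normcD _ _) (lexx _))) //.
  rewrite !normcM (le_trans _ tK) // /K.
  have := normc_ge0 (h y - h x); have := normc_ge0 (g y - g x).
  move: A B; set A := normc (_ - _); set B := normc (_ - _) => *; nra.
by ring.
Qed.

Lemma ccontJ h x : ccont_at h x -> ccont_at (fun y => (h y)^*) x.
Proof.
by move=> hc e e0; have [d d0 hd] := hc _ e0; exists d => // y /hd; rewrite -rmorphB normc_conj.
Qed.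

Lemma ccontX h n x : ccont_at h x -> ccont_at (fun y => h y ^+ n) x.
Proof.
move=> hc; elim: n => [|n IHn] e e0.
  by exists 1 => // y _; rewrite !expr0 subrr normc0 ltW.
 have [d d0 hd] := ccontM hc IHn e0.
by exists d => // y /hd; rewrite !exprS.
Qed.

Lemma ccont_sum n (u : nat -> R -> R[i]) x :
  (forall j, (j < n)%N -> ccont_at (u j) x) -> ccont_at (fun y => \sum_(j < n) u j y) x.
Proof.
elim: n => [|n IHn] h e e0; first by exists 1 => // y _; rewrite !big_ord0 subrr normc0 ltW.
have hn : ccont_at (fun y => \sum_(j < n) u j y) x.
  by apply: IHn => j jn; apply: h; rewrite ltnS ltnW.
by have [d d0 hd] := ccontD hn (h n (ltnSn _)) e0; exists d => // y /hd; rewrite !big_ord_recr.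
Qed.

Lemma ccont_cis x : ccont_at (@cis R) x.
Proof.
move=> e e0; have e2 : 0 < e / 2 by rewrite divr_gt0.
have /cvgrPdist_le/(_ _ e2)[d d0 hd] := @continuous_cos R x.
have /cvgrPdist_le/(_ _ e2)[d' d'0 hd'] := @continuous_sin R x.
exists (Num.min d d') => [|y]; first by rewrite lt_min d0.
rewrite lt_min distrC => /andP[/hd A /hd' B].
apply: (le_trans (normc_le_ReIm _)); rewrite (splitr e) lerD //= distrC //.
Qed.

Lemma ccont_comp (f : R[i] -> R[i]) h x l : ccont_at h x -> cder f (h x) l ->
  ccont_at (fun y => f (h y)) x.
Proof.
move=> hc fd e e0; have [d d0 hd] := cder_cont fd e0.
have d2 : 0 < d / 2 by rewrite divr_gt0.
have [c c0 hcc] := hc _ d2; exists c => // y /hcc h1; apply: hd.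
by rewrite (le_lt_trans h1) // ltr_pdivrMr // mulr_natr mulr2n ltrDl.
Qed.

End IntervalIntegral.

(** * Goursat's theorem for rectangles *)

Section Goursat.
Variable R : realType.
Implicit Types (g : R[i] -> R[i]) (a b c d s t x y : R).

(** The boundary integral over the rectangle [a,b] x [c,d], with opposite
    sides grouped so that cutting the rectangle only splits the integrands. *)
Definition rect_int g a b c d : R[i] :=
  cint a b (fun x => g (x +i* c) - g (x +i* d)) +
  'i%C * cint c d (fun y => g (b +i* y) - g (a +i* y)).

Definition cder_on_rect g a b c d :=
  forall x y, a <= x <= b -> c <= y <= d -> exists l, cder g (x +i* y) l.

Lemma cder_on_rectS g a b c d a' b' c' d' :
  a <= a' -> b' <= b -> c <= c' -> d' <= d ->
  cder_on_rect g a b c d -> cder_on_rect g a' b' c' d'.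
Proof.
move=> aa bb cc dd h x y /andP[x1 x2] /andP[y1 y2]; apply: h.
  by rewrite (le_trans aa) // (le_trans x2).
by rewrite (le_trans cc) // (le_trans y2).
Qed.

Lemma ccont_hline (g : R[i] -> R[i]) x y l : cder g (x +i* y) l ->
  ccont_at (fun x => g (x +i* y)) x.
Proof.
move=> gd; apply: (@ccont_comp _ g (fun x => x +i* y) _ l) => // e e0.
exists e => // z h.
rewrite (_ : _ - _ = (z - x)%:C); first by rewrite normcR ltW.
by apply/eqP; rewrite eq_complex /= subrr !eqxx.
Qed.

Lemma ccont_vline (g : R[i] -> R[i]) x y l : cder g (x +i* y) l ->
  ccont_at (fun y => g (x +i* y)) y.
Proof.
move=> gd; apply: (@ccont_comp _ g (fun y => x +i* y) _ l) => // e e0.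
exists e => // z h.
rewrite (_ : _ - _ = (z - y)%:C * 'i%C).
  rewrite normcM normcR (_ : normc 'i%C = 1) ?mulr1 1?ltW //.
  by rewrite /normc expr0n expr1n add0r sqrtr1.
by apply/eqP; rewrite eq_complex /= !mul0r subrr mulr0 subr0 mulr1 addr0 !eqxx.
Qed.

Lemma ccont_hdiff g a b c d : c <= d -> cder_on_rect g a b c d ->
  forall x, a <= x <= b -> ccont_at (fun x => g (x +i* c) - g (x +i* d)) x.
Proof.
move=> cd h x xab.
have [l hl] : exists l, cder g (x +i* c) l by apply: h; rewrite ?lexx ?cd.
have [l' hl'] : exists l, cder g (x +i* d) l by apply: h; rewrite ?lexx ?cd.
by apply: ccontB; [exact: ccont_hline hl | exact: ccont_hline hl'].
Qed.

Lemma ccont_vdiff g a b c d : a <= b -> cder_on_rect g a b c d ->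
  forall y, c <= y <= d -> ccont_at (fun y => g (b +i* y) - g (a +i* y)) y.
Proof.
move=> ab h y ycd.
have [l hl] : exists l, cder g (a +i* y) l by apply: h; rewrite ?lexx ?ab.
have [l' hl'] : exists l, cder g (b +i* y) l by apply: h; rewrite ?lexx ?ab.
by apply: ccontB; [exact: ccont_vline hl' | exact: ccont_vline hl].
Qed.

Lemma cintD a b (h k : R -> R[i]) : (forall x, a <= x <= b -> ccont_at h x) ->
  (forall x, a <= x <= b -> ccont_at k x) ->
  cint a b (fun x => h x + k x) = cint a b h + cint a b k.
Proof. by move=> hc kc; apply: CintD => //; exact: ccont_integrable. Qed.

Lemma cintZ a b (h : R -> R[i]) (k : R[i]) : (forall x, a <= x <= b -> ccont_at h x) ->
  cint a b (fun x => k * h x) = k * cint a b h.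
Proof. by move=> hc; apply: CintZ => //; exact: ccont_integrable. Qed.

Lemma eq_cint a b (h k : R -> R[i]) : (forall x, a <= x <= b -> h x = k x) ->
  cint a b h = cint a b k.
Proof. by move=> hk; apply: eq_Cint => x; rewrite inE /= in_itv /=; exact: hk. Qed.

Lemma cintB_cst a b (h : R -> R[i]) (k : R[i]) : a <= b ->
  (forall x, a <= x <= b -> ccont_at h x) ->
  cint a b (fun x => h x - k) = cint a b h - (b - a)%:C * k.
Proof.
move=> ab hc; rewrite -cint_cst // /cint CintB //; apply: ccont_integrable => // x _.
exact: ccont_cst.
Qed.

Lemma rect_int_splitx g a e b c d : a <= e <= b -> c <= d ->
  cder_on_rect g a b c d ->
  rect_int g a b c d = rect_int g a e c d + rect_int g e b c d.
Proof.
move=> aeb cd h; have /andP[ae eb] := aeb.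
rewrite /rect_int (cint_split aeb); last exact: ccont_hdiff.
have hl : cder_on_rect g a e c d by apply: cder_on_rectS h.
have hr : cder_on_rect g e b c d by apply: cder_on_rectS h.
rewrite (@eq_cint c d (fun y => g (b +i* y) - g (a +i* y))
  (fun y => (g (e +i* y) - g (a +i* y)) + (g (b +i* y) - g (e +i* y)))).
  rewrite [cint c d (fun y => _ + _)]cintD; [by ring|exact: ccont_vdiff|exact: ccont_vdiff].
by move=> y _; ring.
Qed.

Lemma rect_int_splity g a b c e d : c <= e <= d -> a <= b ->
  cder_on_rect g a b c d ->
  rect_int g a b c d = rect_int g a b c e + rect_int g a b e d.
Proof.
move=> ced ab h; have /andP[ce ed] := ced.
rewrite /rect_int (cint_split ced); last exact: ccont_vdiff.
have hl : cder_on_rect g a b c e by apply: cder_on_rectS h.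
have hr : cder_on_rect g a b e d by apply: cder_on_rectS h.
rewrite (@eq_cint a b (fun x => g (x +i* c) - g (x +i* d))
  (fun x => (g (x +i* c) - g (x +i* e)) + (g (x +i* e) - g (x +i* d)))).
  rewrite [cint a b (fun x => _ + _)]cintD; [by ring|exact: ccont_hdiff|exact: ccont_hdiff].
by move=> y _; ring.
Qed.

(** Affine functions have boundary integral 0, so that only the first-order
    error of g at the point (x0, y0) contributes. *)
Lemma rect_int_small g a b c d x0 y0 l (e : R) :
  a <= x0 <= b -> c <= y0 <= d -> 0 <= e -> cder_on_rect g a b c d ->
  (forall x y, a <= x <= b -> c <= y <= d ->
     normc (g (x +i* y) - g (x0 +i* y0) - l * ((x +i* y) - (x0 +i* y0))) <=
     e * normc ((x +i* y) - (x0 +i* y0))) ->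
  normc (rect_int g a b c d) <= 4 * e * ((b - a) + (d - c)) ^+ 2.
Proof.
move=> x0ab y0cd e0 h he.
have ab : a <= b by case/andP: x0ab => [? /(le_trans _)]; apply.
have cd : c <= d by case/andP: y0cd => [? /(le_trans _)]; apply.
pose E z := g z - g (x0 +i* y0) - l * (z - (x0 +i* y0)).
have hE x y : a <= x <= b -> c <= y <= d -> normc (E (x +i* y)) <= e * ((b - a) + (d - c)).
  move=> xab ycd; apply: le_trans (he _ _ xab ycd) _; rewrite ler_wpM2l //.
  apply: (le_trans (normc_le_ReIm _)); move: xab ycd x0ab y0cd => /=.
  move=> /andP[? ?] /andP[? ?] /andP[? ?] /andP[? ?].
  by apply: lerD; rewrite ler_norml; apply/andP; split; lra.
have EC : rect_int g a b c d =
    cint a b (fun x => (g (x +i* c) - g (x +i* d)) - l * ('i%C * (c - d)%:C)) +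
    'i%C * cint c d (fun y => (g (b +i* y) - g (a +i* y)) - l * (b - a)%:C).
  have k1 := ccont_hdiff cd h; have k2 := ccont_vdiff ab h.
  rewrite !cintB_cst // /rect_int !rmorphB /=.
  have ii : 'i%C * 'i%C = -1 :> R[i] by rewrite -expr2 sqr_i.
  by ring.
rewrite EC (le_trans (le_normcD _ _)) // normcM.
rewrite (_ : normc 'i%C = 1 :> R); last by rewrite /normc expr0n expr1n add0r sqrtr1.
set S := (b - a) + (d - c) in hE *.
have S0 : 0 <= S by rewrite addr_ge0 ?subr_ge0.
have b1 : normc (cint a b (fun x => (g (x +i* c) - g (x +i* d)) - l * ('i%C * (c - d)%:C)))
    <= 2 * ((2 * (e * S)) * (b - a)).
  apply: normc_cint_le => // x xab.
    by apply: ccontB; [exact: (ccont_hdiff cd h) | exact: ccont_cst].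
  rewrite (_ : _ - _ = E (x +i* c) - E (x +i* d)).
    rewrite (le_trans (le_normcD _ _)) // normcN mulr_natl mulr2n.
    by rewrite lerD // hE // ?lexx ?cd.
  rewrite /E (_ : 'i%C * (c - d)%:C = (x +i* c) - (x +i* d)); first by ring.
  by apply/eqP; rewrite eq_complex /=; apply/andP; split; apply/eqP; ring.
have b2 : normc (cint c d (fun y => (g (b +i* y) - g (a +i* y)) - l * (b - a)%:C))
    <= 2 * ((2 * (e * S)) * (d - c)).
  apply: normc_cint_le => // y ycd.
    by apply: ccontB; [exact: (ccont_vdiff ab h) | exact: ccont_cst].
  rewrite (_ : _ - _ = E (b +i* y) - E (a +i* y)).
    rewrite (le_trans (le_normcD _ _)) // normcN mulr_natl mulr2n.
    by rewrite lerD // hE // ?lexx ?ab.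
  rewrite /E (_ : (b - a)%:C = (b +i* y) - (a +i* y)); first by ring.
  by apply/eqP; rewrite eq_complex /= subrr !eqxx.
rewrite mul1r (le_trans (lerD b1 b2)) // /S; lra.
Qed.

Lemma nested_point (x : nat -> R) (s : R) : 0 <= s ->
  (forall n, x n <= x n.+1 <= x n + s / 2 ^+ n.+1) ->
  exists x0, forall n, x n <= x0 <= x n + s / 2 ^+ n.
Proof.
move=> s0 hx.
have sn n : s / 2 ^+ n = s / 2 ^+ n.+1 + s / 2 ^+ n.+1.
  by rewrite exprS; field; rewrite expf_neq0.
have inc n m : (n <= m)%N -> x n <= x m.
  by move=> /subnKC <-; elim: (m - n)%N => [|k IH]; rewrite ?addn0 // addnS (le_trans IH) //; case/andP: (hx (n + k)%N).
have dec n m : (n <= m)%N -> x m + s / 2 ^+ m <= x n + s / 2 ^+ n.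
  move=> /subnKC <-; elim: (m - n)%N => [|k IH]; rewrite ?addn0 // addnS (le_trans _ IH) //.
  by have /andP[_] := hx (n + k)%N; rewrite (sn (n + k)%N); lra.
have s2 n : 0 <= s / 2 ^+ n by rewrite divr_ge0 // exprn_ge0.
have ub n m : x m <= x n + s / 2 ^+ n.
  have [mn|nm] := leqP m n; first by rewrite (le_trans (inc _ _ mn)) // lerDl.
  by rewrite (le_trans _ (dec _ _ (ltnW nm))) // lerDl.
exists (sup (range x)) => n; apply/andP; split.
  apply: ub_le_sup; last by exists n.
  by exists (x 0%N + s / 2 ^+ 0) => _ [m _ <-].
by apply: ge_sup; [exists (x 0%N); exists 0%N | move=> _ [m _ <-]].
Qed.

Lemma goursat_step g x y s t : 0 <= s -> 0 <= t ->
  cder_on_rect g x (x + (s + s)) y (y + (t + t)) ->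
  exists w : R * R, [/\ cder_on_rect g w.1 (w.1 + s) w.2 (w.2 + t),
    normc (rect_int g x (x + (s + s)) y (y + (t + t))) / 4 <=
      normc (rect_int g w.1 (w.1 + s) w.2 (w.2 + t)),
    x <= w.1 <= x + s & y <= w.2 <= y + t].
Proof.
move=> s0 t0 h.
have sub u v : 0 <= u <= s -> 0 <= v <= t ->
    cder_on_rect g (x + u) (x + u + s) (y + v) (y + v + t).
  by move=> /andP[u0 us] /andP[v0 vt]; apply: cder_on_rectS h; clear -u0 us v0 vt; lra.
have hl : cder_on_rect g x (x + s) y (y + (t + t)).
  by apply: cder_on_rectS h; clear -s0 t0; lra.
have hr : cder_on_rect g (x + s) (x + (s + s)) y (y + (t + t)).
  by apply: cder_on_rectS h; clear -s0 t0; lra.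
pose mu u v := normc (rect_int g u (u + s) v (v + t)).
have E : normc (rect_int g x (x + (s + s)) y (y + (t + t))) <=
    (mu x y + mu x (y + t)) + (mu (x + s) y + mu (x + s) (y + t)).
  rewrite (@rect_int_splitx _ _ (x + s)) //; last 2 first.
  - by clear -s0; lra.
  - by clear -t0; lra.
  rewrite (le_trans (le_normcD _ _)) // lerD //.
    rewrite (@rect_int_splity _ _ _ _ (y + t)) //; last 2 first.
    - by clear -t0; lra.
    - by clear -s0; lra.
    by rewrite (addrA y t t) le_normcD.
  rewrite (@rect_int_splity _ _ _ _ (y + t)) //; last 2 first.
  - by clear -t0; lra.
  - by clear -s0; lra.
  by rewrite (addrA x s s) (addrA y t t) le_normcD.
have AR (M m1 m2 m3 m4 : R) : M <= m1 + m2 + (m3 + m4) -> m1 < M / 4 -> m2 < M / 4 ->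
    m3 < M / 4 -> M / 4 <= m4 by clear; lra.
move: E; set M := normc _ => E.
have [h1|h1] := leP (M / 4) (mu x y).
  exists (x, y); split; [|exact: h1|by clear -s0 => /=; lra | by clear -t0 => /=; lra].
  by have := sub 0 0; rewrite !addr0; apply; clear -s0 t0; lra.
have [h2|h2] := leP (M / 4) (mu x (y + t)).
  exists (x, y + t); split; [|exact: h2|by clear -s0 => /=; lra | by clear -t0 => /=; lra].
  by have := sub 0 t; rewrite !addr0; apply; clear -s0 t0; lra.
have [h3|h3] := leP (M / 4) (mu (x + s) y).
  exists (x + s, y); split; [|exact: h3|by clear -s0 => /=; lra | by clear -t0 => /=; lra].
  by have := sub s 0; rewrite !addr0; apply; clear -s0 t0; lra.
exists (x + s, y + t); split => /=.
- by apply: sub; clear -s0 t0; lra.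
- exact: AR E h1 h2 h3.
- by clear -s0; lra.
- by clear -t0; lra.
Qed.

(** Bisect, keeping a quarter whose integral is at least a quarter of the
    former one; at the limit point differentiability makes it too small. *)
Lemma goursat g a c s t : 0 <= s -> 0 <= t ->
  cder_on_rect g a (a + s) c (c + t) -> rect_int g a (a + s) c (c + t) = 0.
Proof.
move=> s0 t0 h.
pose sz (n : nat) := s / 2 ^+ n; pose tz (n : nat) := t / 2 ^+ n.
have sS n : sz n = sz n.+1 + sz n.+1.
  by rewrite /sz exprS; field; rewrite expf_neq0.
have tS n : tz n = tz n.+1 + tz n.+1.
  by rewrite /tz exprS; field; rewrite expf_neq0.
have sz0 n : 0 <= sz n by rewrite divr_ge0 // exprn_ge0.
have tz0 n : 0 <= tz n by rewrite divr_ge0 // exprn_ge0.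
pose mu n (w : R * R) := normc (rect_int g w.1 (w.1 + sz n) w.2 (w.2 + tz n)).
pose ok n (w : R * R) := cder_on_rect g w.1 (w.1 + sz n) w.2 (w.2 + tz n).
have step n w : exists w' : R * R, ok n w ->
    [/\ ok n.+1 w', mu n w / 4 <= mu n.+1 w',
      w.1 <= w'.1 <= w.1 + sz n.+1 & w.2 <= w'.2 <= w.2 + tz n.+1].
  have [okw|nok] := pselect (ok n w); last by exists w.
  move: okw; rewrite /ok /mu (sS n) (tS n) => okw.
  by have [w' H] := goursat_step (sz0 n.+1) (tz0 n.+1) okw; exists w'.
pose nx n w := projT1 (cid (step n w)).
pose fix W n := if n is k.+1 then nx k (W k) else (a, c).
have W0 : ok 0%N (W 0%N) by rewrite /ok /sz /tz /= !divr1.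
have okW n : ok n (W n).
  by elim: n => // n IHn /=; rewrite /nx; case: cid => w' /= /(_ IHn)[].
have WS n : [/\ mu n (W n) / 4 <= mu n.+1 (W n.+1),
    (W n).1 <= (W n.+1).1 <= (W n).1 + sz n.+1 & (W n).2 <= (W n.+1).2 <= (W n).2 + tz n.+1].
  by rewrite [W n.+1]/= /nx; case: cid => w' /= /(_ (okW n))[].
have WSx n : (W n).1 <= (W n.+1).1 <= (W n).1 + sz n.+1 by have [] := WS n.
have WSy n : (W n).2 <= (W n.+1).2 <= (W n).2 + tz n.+1 by have [] := WS n.
have [x0 hx0] := @nested_point (fun n => (W n).1) s s0 WSx.
have [y0 hy0] := @nested_point (fun n => (W n).2) t t0 WSy.
have muW n : mu 0%N (W 0%N) / 4 ^+ n <= mu n (W n).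
  elim: n => [|n IHn]; first by rewrite expr0 divr1.
  have [h1 _ _] := WS n; apply: le_trans h1.
  by rewrite exprSr invfM mulrA ler_wpM2r.
have M0 : mu 0%N (W 0%N) = normc (rect_int g a (a + s) c (c + t)).
  by rewrite /mu /sz /tz /= !divr1.
have [l hl] : exists l, cder g (x0 +i* y0) l.
  by apply: (okW 0%N); [exact: hx0 | exact: hy0].
apply/normc_eq0/eqP; rewrite eq_le normc_ge0 andbT -M0.
apply/ler_addgt0Pl => e e0; rewrite addr0.
pose K := 4 * (s + t) ^+ 2 + 1.
have K0 : 0 < K by rewrite ltr_wpDl // mulr_ge0 // sqr_ge0.
have [d d0 hd] := hl _ (divr_gt0 e0 K0).
have [n hn] : exists n : nat, (s + t) / 2 ^+ n < d.
  have st1 : 0 < s + t + 1 by lra.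
  have := @near_infty_natSinv_expn_lt R (PosNum (divr_gt0 d0 st1)).
  case=> N _ /(_ N (leqnn N)) /=.
  rewrite ltr_pdivlMr // => h1; exists N; rewrite (le_lt_trans _ h1) //.
  have p0 : 0 <= 1 / 2 ^+ N :> R by rewrite divr_ge0 // exprn_ge0.
  rewrite (_ : (s + t) / 2 ^+ N = 1 / 2 ^+ N * (s + t)); last by rewrite div1r mulrC.
  by apply: ler_wpM2l => //; clear; lra.
have hsm := @rect_int_small g (W n).1 ((W n).1 + sz n) (W n).2 ((W n).2 + tz n) x0 y0 l (e / K)
  (hx0 n) (hy0 n) (ltW (divr_gt0 e0 K0)) (okW n).
have {hsm} : mu n (W n) <= 4 * (e / K) * (sz n + tz n) ^+ 2.
  rewrite (le_trans (hsm _)) //.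
    move=> x y xab ycd; apply: hd.
    apply: le_lt_trans (normc_le_ReIm _) (le_lt_trans _ hn); rewrite /= mulrDl.
    have AR (U S u v : R) : U <= u <= U + S -> U <= v <= U + S -> `|v - u| <= S.
      by clear; move=> *; rewrite ler_norml; apply/andP; split; lra.
    by apply: lerD; [exact: AR (hx0 n) xab | exact: AR (hy0 n) ycd].
  rewrite (_ : (W n).1 + sz n - (W n).1 = sz n); last by ring.
  by rewrite (_ : (W n).2 + tz n - (W n).2 = tz n); last by ring.
move=> /(le_trans (muW n)).
rewrite ler_pdivrMr ?exprn_gt0 // => /le_trans; apply.
have -> : 4 * (e / K) * (sz n + tz n) ^+ 2 * 4 ^+ n = (e / K) * (4 * (s + t) ^+ 2).
  rewrite /sz /tz (_ : 4 = 2 ^+ 2 :> R) ?expr2; last by lra.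
  by rewrite exprMn; field; rewrite expf_neq0 //= gt_eqF.
by rewrite mulrAC ler_pdivrMr // ler_wpM2l 1?ltW // /K; lra.
Qed.

End Goursat.

(** * Power series *)

Section PowerSeries.
Variable R : realType.
Implicit Types (a : nat -> R[i]) (f : R[i] -> R[i]) (z w : R[i]) (r : R).

Definition psum a N z : R[i] := \sum_(j < N) a j * z ^+ j.

(** The radius of convergence is at least 1. *)
Definition radius_ge1 a := forall r, 0 <= r < 1 ->
  exists M : R, forall j, normc (a j) * r ^+ j <= M.

(** Convergence of the partial sums is uniform on smaller closed discs. *)
Definition power_rep a f := forall r, 0 <= r < 1 -> forall e : R, 0 < e ->
  exists N0, forall N, (N0 <= N)%N -> forall z, normc z <= r ->
    normc (f z - psum a N z) <= e.

Lemma geom_le (q : R) N : 0 <= q < 1 -> \sum_(j < N) q ^+ j <= (1 - q)^-1.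
Proof.
move=> /andP[q0 q1]; have q1' : 0 < 1 - q by lra.
rewrite -[leRHS]div1r ler_pdivlMr // mulrC.
have -> : (1 - q) * (\sum_(j < N) q ^+ j) = 1 - q ^+ N.
  by rewrite -opprB mulNr -subrX1 opprB.
by rewrite lerBlDr lerDl exprn_ge0.
Qed.

(** Compare r with the larger radius (1 + r) / 2. *)
Lemma radius_ge1_geom a r : radius_ge1 a -> 0 <= r < 1 ->
  exists M q : R, [/\ 0 <= M, 0 <= q < 1 & forall j, normc (a j) * r ^+ j <= M * q ^+ j].
Proof.
move=> ha /andP[r0 r1].
have s0 : 0 < (1 + r) / 2 by clear -r0 r1; lra.
have [M hM] := ha ((1 + r) / 2) ltac:(clear -r0 r1; lra).
exists M, (r / ((1 + r) / 2)); split.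
- by apply: le_trans (hM 0%N); rewrite mulr_ge0 // exprn_ge0 // ltW.
- by rewrite divr_ge0 // ?ltW //= ltr_pdivrMr // mul1r; clear -r1; lra.
move=> j; rewrite expr_div_n mulrA ler_pdivlMr ?exprn_gt0 //.
by rewrite mulrAC ler_wpM2r // exprn_ge0.
Qed.

Lemma radius_ge1_sum a r : radius_ge1 a -> 0 <= r < 1 ->
  exists C : R, forall N, \sum_(j < N) normc (a j) * r ^+ j <= C.
Proof.
move=> ha hr; have [M [q [M0 q01 h]]] := radius_ge1_geom ha hr.
exists (M * (1 - q)^-1) => N; apply: (@le_trans _ _ (\sum_(j < N) M * q ^+ j)).
  by apply: ler_sum => j _.
by rewrite -mulr_sumr ler_wpM2l // geom_le.
Qed.

Lemma normc_term_le a z r j : normc z <= r ->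
  normc (a j * z ^+ j) <= normc (a j) * r ^+ j.
Proof. by move=> zr; rewrite normcM normcX ler_wpM2l // lerXn2r // nnegrE // (le_trans _ zr). Qed.

Lemma psum_tail a r M q N k z : 0 <= q < 1 -> 0 <= M ->
  (forall j, normc (a j) * r ^+ j <= M * q ^+ j) -> normc z <= r ->
  normc (psum a (N + k) z - psum a N z) <= M * q ^+ N / (1 - q).
Proof.
move=> q01 M0 h zr; have /andP[q0 q1] := q01.
rewrite /psum big_split_ord /= addrAC subrr add0r.
apply: (le_trans (normc_sum _)).
apply: (@le_trans _ _ (\sum_(j < k) M * q ^+ N * q ^+ j)).
  apply: ler_sum => j _; apply: le_trans (normc_term_le _ _ zr) _.
  by rewrite (le_trans (h _)) // exprD mulrA.
by rewrite -mulr_sumr ler_wpM2l ?geom_le // mulr_ge0 // exprn_ge0.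
Qed.

Lemma geom_small (M q e : R) : 0 <= q < 1 -> 0 <= M -> 0 < e ->
  exists N0, forall N, (N0 <= N)%N -> M * q ^+ N / (1 - q) <= e.
Proof.
move=> /andP[q0 q1] M0 e0.
have q1' : 0 < 1 - q by lra.
have M1 : 0 < M + 1 by lra.
have e1 : 0 < e * (1 - q) / (M + 1) by rewrite divr_gt0 // mulr_gt0.
have : (fun n => q ^+ n) @ \oo --> (0 : R) by apply: cvg_expr; rewrite ger0_norm.
move=> /cvgrPdist_le/(_ _ e1)[N0 _ hN]; exists N0 => N /hN.
rewrite sub0r normrN ger0_norm ?exprn_ge0 // ler_pdivlMr // => h.
rewrite ler_pdivrMr // (le_trans _ h) // mulrC ler_wpM2l ?exprn_ge0 //.
by rewrite lerDl.
Qed.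

Lemma power_sum_exists a : radius_ge1 a -> exists f, power_rep a f.
Proof.
move=> ha.
have ptw z : normc z < 1 -> exists l : R[i], forall e : R, 0 < e -> exists N0, forall N, (N0 <= N)%N ->
    normc (l - psum a N z) <= e.
  move=> z1; have hz : 0 <= normc z < 1 by rewrite normc_ge0.
  have [M [q [M0 q01 h]]] := radius_ge1_geom ha hz.
  have /andP[q0 q1] := q01.
  have hc (u : nat -> R) : (forall j, `|u j| <= normc (a j) * normc z ^+ j) ->
      cvgn (series u).
    move=> hu; apply: normed_cvg.
    apply: (@series_le_cvg _ _ (geometric M q)) => [n|n|n|].
    - exact: normr_ge0.
    - by rewrite /geometric /= mulr_ge0 // exprn_ge0.
    - by rewrite (le_trans (hu n)) // h.
    - by apply: is_cvg_geometric_series; rewrite ger0_norm.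
  have c1 := hc (fun j => Re (a j * z ^+ j)) (fun j => le_trans (normr_Re_le _) (normc_term_le a j (lexx _))).
  have c2 := hc (fun j => Im (a j * z ^+ j)) (fun j => le_trans (normr_Im_le _) (normc_term_le a j (lexx _))).
  exists (limn (series (fun j => Re (a j * z ^+ j))) +i* limn (series (fun j => Im (a j * z ^+ j)))).
  move=> e e0; have e2 : 0 < e / 2 by rewrite divr_gt0.
  move/cvgrPdist_le: c1 => /(_ _ e2)[N1 _ h1]; move/cvgrPdist_le: c2 => /(_ _ e2)[N2 _ h2].
  exists (maxn N1 N2) => N; rewrite geq_max => /andP[/h1 H1 /h2 H2].
  apply: le_trans (normc_le_ReIm _) _; rewrite (splitr e) lerD //.
    apply: le_trans H1; rewrite le_eqVlt; apply/orP; left; apply/eqP; congr `|_|.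
    rewrite raddfB /= /psum raddf_sum; congr (_ - _).
    by rewrite /series /= big_mkord.
  apply: le_trans H2; rewrite le_eqVlt; apply/orP; left; apply/eqP; congr `|_|.
  rewrite raddfB /= /psum raddf_sum; congr (_ - _).
  by rewrite /series /= big_mkord.
have ptw' z : exists l : R[i], normc z < 1 -> forall e : R, 0 < e -> exists N0, forall N, (N0 <= N)%N ->
    normc (l - psum a N z) <= e.
  have [z1|z1] := pselect (normc z < 1); last by exists 0 => /z1.
  by have [l hl] := ptw z z1; exists l.
pose f z := projT1 (cid (ptw' z)).
have fP z : normc z < 1 -> forall e : R, 0 < e -> exists N0, forall N, (N0 <= N)%N ->
    normc (f z - psum a N z) <= e by rewrite /f; case: cid.
exists f => r hr e e0.
have e2 : 0 < e / 2 by rewrite divr_gt0.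
have [M [q [M0 q01 h]]] := radius_ge1_geom ha hr.
have [N0 hN0] := geom_small q01 M0 e2.
exists N0 => N N0N z zr; have /andP[r0 r1] := hr.
have [N1 hN1] := fP z (le_lt_trans zr r1) _ e2.
have {}hN1 := hN1 (N + N1)%N (leq_addl _ _).
rewrite -(subrK (psum a (N + N1) z) (f z)) -addrA (le_trans (le_normcD _ _)) //.
rewrite (splitr e) lerD // (le_trans (psum_tail _ _ q01 M0 h zr)) //.
exact: hN0.
Qed.

Definition pderiv a j : R[i] := j.+1%:R * a j.+1.

Lemma normc_nat n : normc (n%:R : R[i]) = n%:R :> R.
Proof. by rewrite -(rmorph_nat (real_complex R)) normcR ger0_norm. Qed.

Lemma natexp_bound (q : R) j : 0 <= q < 1 -> j%:R * q ^+ j <= (1 - q)^-1.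
Proof.
move=> /andP[q0 q1]; have q01 : 0 <= q < 1 by rewrite q0.
apply: le_trans (geom_le j q01).
have -> : j%:R * q ^+ j = \sum_(i < j) q ^+ j by rewrite sumr_const card_ord mulr_natl.
by apply: ler_sum => i _; rewrite ler_wiXn2l ?(ltW q1) // ltnW.
Qed.

Lemma radius_ge1_nat a : radius_ge1 a -> radius_ge1 (fun j => j%:R * a j).
Proof.
move=> ha r hr; have [M [q [M0 q01 h]]] := radius_ge1_geom ha hr.
exists (M * (1 - q)^-1) => j; rewrite normcM normc_nat -mulrA.
apply: le_trans (ler_wpM2l _ (h j)) _ => //.
by rewrite mulrCA ler_wpM2l // natexp_bound.
Qed.

Lemma coef_pow_le a r s : 0 <= r <= s -> forall j, normc (a j) * r ^+ j <= normc (a j) * s ^+ j.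
Proof. by move=> /andP[r0 rs] j; rewrite ler_wpM2l // lerXn2r // nnegrE (le_trans r0). Qed.

Lemma radius_ge1_pderiv a : radius_ge1 a -> radius_ge1 (pderiv a).
Proof.
move=> /radius_ge1_nat ha r /andP[r0 r1].
have s0 : 0 < (1 + r) / 2 by clear -r0 r1; lra.
have [M hM] := ha ((1 + r) / 2) ltac:(clear -r0 r1; lra).
exists (M / ((1 + r) / 2)) => j; rewrite ler_pdivlMr //.
apply: le_trans (hM j.+1); rewrite exprSr [leRHS]mulrA; apply: ler_wpM2r; first exact: ltW.
by apply: (@coef_pow_le (pderiv a)); clear -r0 r1; lra.
Qed.

Lemma psum_recl a N z : psum a N.+1 z = a 0%N + z * psum (fun j => a j.+1) N z.
Proof.
rewrite /psum big_ord_recl expr0 mulr1; congr (_ + _); rewrite mulr_sumr.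
by apply: eq_bigr => i _; rewrite lift0 exprS mulrCA.
Qed.

(** The bound is the second derivative of the monomial at r, so that the
    bounds can be summed over a power series. *)
Lemma expr_taylor2 z w r j : normc z <= r -> normc w <= r ->
  normc (w ^+ j.+2 - z ^+ j.+2 - j.+2%:R * z ^+ j.+1 * (w - z)) <=
  (j.+2%:R * j.+1%:R) * r ^+ j * normc (w - z) ^+ 2.
Proof.
move=> zr wr; have r0 : 0 <= r by rewrite (le_trans _ zr).
have d1 n : normc (w ^+ n.+1 - z ^+ n.+1) <= n.+1%:R * r ^+ n * normc (w - z).
  rewrite subrXX normcM mulrC ler_wpM2r // (le_trans (normc_sum _)) //.
  have -> : n.+1%:R * r ^+ n = \sum_(i < n.+1) r ^+ n by rewrite sumr_const card_ord mulr_natl.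
  apply: ler_sum => i _; rewrite normcM !normcX.
  rewrite [leRHS](_ : _ = r ^+ (n - i) * r ^+ i); last by rewrite -exprD subnK // -ltnS.
  by rewrite ler_pM ?exprn_ge0 // lerXn2r ?nnegrE.
elim: j => [|j IHj].
  have -> : w ^+ 2 - z ^+ 2 - 2%:R * z ^+ 1 * (w - z) = (w - z) ^+ 2 by ring.
  rewrite normcX expr0 mulr1 mulr1 ler_peMl ?exprn_ge0 //.
  by rewrite ler1n.
have -> : w ^+ j.+3 - z ^+ j.+3 - j.+3%:R * z ^+ j.+2 * (w - z) =
   z * (w ^+ j.+2 - z ^+ j.+2 - j.+2%:R * z ^+ j.+1 * (w - z)) +
   (w - z) * (w ^+ j.+2 - z ^+ j.+2).
  by rewrite (exprS w j.+2) (exprS z j.+2) (exprS z j.+1) -[j.+3%:R]natr1; ring.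
rewrite (le_trans (le_normcD _ _)) // !normcM.
have n0 := normc_ge0 (w - z).
have h1 : normc z * normc (w ^+ j.+2 - z ^+ j.+2 - j.+2%:R * z ^+ j.+1 * (w - z)) <=
    r * (j.+2%:R * j.+1%:R * r ^+ j * normc (w - z) ^+ 2) by apply: ler_pM.
have h2 : normc (w - z) * normc (w ^+ j.+2 - z ^+ j.+2) <=
    normc (w - z) * (j.+2%:R * r ^+ j.+1 * normc (w - z)) by apply: ler_wpM2l.
apply: le_trans (lerD h1 h2) _.
rewrite (_ : _ + _ = j.+2%:R * j.+2%:R * r ^+ j.+1 * normc (w - z) ^+ 2).
  by rewrite !ler_wpM2r ?exprn_ge0 // ler_nat.
by rewrite (exprS r j) -![j.+2%:R]natr1; ring.
Qed.

Lemma psum_taylor2 a r z w N : normc z <= r -> normc w <= r ->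
  normc (psum a N.+2 w - psum a N.+2 z - psum (pderiv a) N.+1 z * (w - z)) <=
  (\sum_(j < N) normc (pderiv (pderiv a) j) * r ^+ j) * normc (w - z) ^+ 2.
Proof.
move=> zr wr.
have -> : psum a N.+2 w - psum a N.+2 z - psum (pderiv a) N.+1 z * (w - z) =
   \sum_(j < N) a j.+2 * (w ^+ j.+2 - z ^+ j.+2 - j.+2%:R * z ^+ j.+1 * (w - z)).
  rewrite !psum_recl.
  rewrite (_ : _ - _ - _ = w * (w * psum (fun j => a j.+2) N w) -
      z * (z * psum (fun j => a j.+2) N z) -
      z * psum (fun j => pderiv a j.+1) N z * (w - z)); last first.
    by rewrite [pderiv a 0]/pderiv; ring.
  rewrite /psum !mulr_sumr mulr_suml -!sumrB; apply: eq_bigr => j _.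
  by rewrite /pderiv !exprS; ring.
rewrite (le_trans (normc_sum _)) // mulr_suml; apply: ler_sum => j _.
rewrite normcM /pderiv !normcM !normc_nat.
apply: le_trans (ler_wpM2l _ (expr_taylor2 j zr wr)) _ => //.
rewrite le_eqVlt; apply/orP; left; apply/eqP; ring.
Qed.

(** The second-order remainder of the partial sums is O(|w - z|^2) with a
    constant independent of the partial sum, hence so is that of the limit. *)
Lemma power_rep_cder a f f1 z : radius_ge1 a -> power_rep a f -> power_rep (pderiv a) f1 ->
  normc z < 1 -> cder f z (f1 z).
Proof.
move=> ha fr f1r z1.
have z0 := normc_ge0 z.
pose r := (1 + normc z) / 2.
have hr : 0 <= r < 1 by rewrite /r; clear -z1 z0; lra.
have zr : normc z <= r by rewrite /r; clear -z1 z0; lra.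
have [C hC] := radius_ge1_sum (radius_ge1_pderiv (radius_ge1_pderiv ha)) hr.
have C0 : 0 <= C by apply: le_trans (hC 0%N); rewrite big_ord0.
have key w : normc w <= r -> normc (f w - f z - f1 z * (w - z)) <= C * normc (w - z) ^+ 2.
  move=> wr; apply/ler_addgt0Pr => e e0.
  have wz0 := normc_ge0 (w - z).
  pose e' := e / (3 + normc (w - z)).
  have e'0 : 0 < e' by rewrite divr_gt0 //; clear -wz0; lra.
  have eE : e' * (3 + normc (w - z)) = e by rewrite divfK // gt_eqF //; clear -wz0; lra.
  have [N1 h1] := fr _ hr _ e'0; have [N2 h2] := f1r _ hr _ e'0.
  have l1 : (N1 <= (N1 + N2).+2)%N by rewrite -addn2 -addnA leq_addr.
  have l2 : (N2 <= (N1 + N2).+1)%N by rewrite -addn1 -addnA addnCA leq_addr.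
  have a1 := h1 _ l1 w wr; have a2 := h1 _ l1 z zr; have a3 := h2 _ l2 z zr.
  have a4 := le_trans (psum_taylor2 a (N1 + N2) zr wr) (ler_wpM2r (exprn_ge0 2 wz0) (hC _)).
  rewrite (_ : _ - _ - _ = (psum a (N1 + N2).+2 w - psum a (N1 + N2).+2 z - psum (pderiv a) (N1 + N2).+1 z * (w - z))
     + (f w - psum a (N1 + N2).+2 w) - (f z - psum a (N1 + N2).+2 z)
     - (f1 z - psum (pderiv a) (N1 + N2).+1 z) * (w - z)); last by ring.
  have t1 (x y : R[i]) : normc (x - y) <= normc x + normc y.
    by rewrite (le_trans (le_normcD _ _)) // normcN.
  apply: le_trans (t1 _ _) _; apply: le_trans (lerD (t1 _ _) (lexx _)) _.
  apply: le_trans (lerD (lerD (le_normcD _ _) (lexx _)) (lexx _)) _.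
  rewrite normcM; have a5 := ler_wpM2r wz0 a3.
  have AR (n Y1 Y2 Y3 Y4 Y5 e1 : R) : 0 < e1 -> Y3 <= e1 -> Y4 <= e1 -> Y5 <= Y1 ->
    Y2 <= e1 * n -> Y5 + Y3 + Y4 + Y2 <= Y1 + e1 * (3 + n) by clear; nra.
  by rewrite -eE; exact: AR e'0 a1 a2 a4 a5.
move=> e e0; exists (Num.min (r - normc z) (e / (C + 1))) => [|w].
  rewrite lt_min; apply/andP; split; first by rewrite /r; clear -z1; lra.
  by rewrite divr_gt0 // ltr_wpDl.
rewrite lt_min => /andP[w1 w2].
have wr : normc w <= r.
  by have := le_normcD (w - z) z; rewrite subrK; move: w1; clear; lra.
apply: le_trans (key _ wr) _; rewrite expr2 mulrA ler_wpM2r //.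
move: w2; rewrite ltr_pdivlMr ?ltr_wpDl // => w2.
by have := normc_ge0 (w - z); move: w2 C0; clear; nra.
Qed.

End PowerSeries.

(** * Uniqueness of Fourier coefficients *)

Section FourierUniqueness.
Variable R : realType.
Implicit Types (h : R -> R[i]) (phi : R -> R).

Lemma Rint_ge phi a b c : a <= b -> (forall x, a <= x <= b -> {for x, continuous phi}) ->
  (forall x, a <= x <= b -> c <= phi x) ->
  c * (b - a) <= \int[lebesgue_measure]_(x in `[a, b]) phi x.
Proof.
move=> ab hc hle.
have E : \int[lebesgue_measure]_(x in `[a, b]) (cst c : R -> R) x = c * (b - a).
  rewrite Rintegral_cst //= lebesgue_measure_itv /= lte_fin; case: ltP => // ba.
  by rewrite (le_anti (_ : b <= a <= b)) ?subrr // ab ba.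
rewrite -E; apply: le_Rintegral => //.
- by apply: continuous_integrable_itv => x _; exact: cvg_cst.
- exact: continuous_integrable_itv.
Qed.

Lemma cos_noninc (x y : R) : 0 <= x -> x <= y -> y <= pi -> cos y <= cos x.
Proof.
move=> x0; rewrite le_eqVlt => /predU1P[->//|xy] yp; apply: ltW.
rewrite ltr_cos // in_itv /=; apply/andP; split; rewrite ?x0 //.
  exact: ltW (lt_le_trans xy yp).
exact: ltW (le_lt_trans x0 xy).
Qed.

Lemma cos_abs (x : R) : cos `|x| = cos x.
Proof. by case: (ger0P x) => _; rewrite ?cosN. Qed.

Lemma cos_le_away (eta u : R) : 0 <= eta <= pi -> eta <= u <= 2 * pi - eta -> cos u <= cos eta.
Proof.
move=> /andP[e0 ep] /andP[eu ue].
have [up|pu] := leP u pi; first exact: cos_noninc.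
rewrite (_ : cos u = cos (2 * pi - u)); first by apply: cos_noninc => //; clear -eu ue pu; lra.
by rewrite -[RHS]cosN opprB (mulrC 2) mulr_natr -[in LHS](subrK (pi *+ 2) u) cosD2pi.
Qed.

Lemma continuous_shift_cos (t0 : R) N : continuous (fun t : R => (2 + 2 * cos (t - t0)) ^+ N).
Proof.
move=> x; apply: (@continuous_comp _ _ _ (fun t : R => 2 + 2 * cos (t - t0)) (fun y => y ^+ N)); last exact: exprn_continuous.
apply: cvgD; first exact: cvg_cst.
apply: cvgM; first exact: cvg_cst.
apply: (@continuous_comp _ _ _ (fun t : R => t - t0) cos); last exact: continuous_cos.
by apply: cvgB; [exact: cvg_id | exact: cvg_cst].
Qed.

(** The kernels (2 + 2 cos (t - t0))^N concentrate at t0 as N grows, so that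
    integrals against them see the sign of phi at t0. *)
Lemma cos_kernel phi (t0 : R) : continuous phi -> 0 < t0 < 2 * pi -> 0 < phi t0 ->
  exists N, 0 < \int[lebesgue_measure]_(t in `[0, 2 * pi]) (phi t * (2 + 2 * cos (t - t0)) ^+ N).
Proof.
move=> pc /andP[t00 t0p] pt0.
have pi3 : 1 <= pi :> R by apply: le_trans (pi_ge2 R); rewrite ler1n.
have d0 : 0 < phi t0 / 2 by rewrite divr_gt0.
have /cvgrPdist_le/(_ _ d0)[d dp hd] := pc t0.
pose eta := Num.min (Num.min (d / 2) (t0 / 2)) (Num.min ((2 * pi - t0) / 2) 1).
have eta0 : 0 < eta by rewrite !lt_min !divr_gt0 ?subr_gt0 ?ltr01.
have [e1 e2 e3 e4] : [/\ eta <= d / 2, eta <= t0 / 2, eta <= (2 * pi - t0) / 2 & eta <= 1].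
  by split; rewrite /eta !ge_min ?lexx ?orbT.
have near t : `|t - t0| <= eta -> phi t0 / 2 <= phi t.
  move=> tt; have {hd} := hd t; rewrite /ball_ /= distrC.
  move=> /(_ (le_lt_trans tt _)); rewrite ler_distlC.
  have -> : eta < d by move: e1 dp => /=; clear; lra.
  by move=> /(_ isT)/andP[+ _]; clear; lra.
have [M M0 hM] : exists2 M : R, 0 <= M & forall t, 0 <= t <= 2 * pi -> - M <= phi t.
  have pp : 0 <= 2 * pi :> R by clear -pi3; lra.
  have [c _ hc] := @EVT_min R phi 0 (2 * pi) pp (continuous_subspaceT pc).
  exists `|phi c| => // t tt; rewrite (le_trans _ (hc t _)) //.
  by rewrite lerNl -normrN ler_norm.
pose q : R := 2 + 2 * cos eta; pose q' : R := 2 + 2 * cos (eta / 2).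
have q0 : 0 <= q by have := cos_geN1 eta; rewrite /q; clear; lra.
have qq : q < q'.
  have : cos eta < cos (eta / 2).
    by rewrite ltr_cos ?in_itv /=; [|apply/andP; split|apply/andP; split]; clear -eta0 e4 pi3; lra.
  by rewrite /q /q'; clear; lra.
have q'0 : 0 < q' by exact: le_lt_trans qq.
pose K := 2 * pi * M; have K0 : 0 <= K by rewrite /K !mulr_ge0 //; clear -pi3; lra.
have [N hN] : exists N : nat, K * q ^+ N < phi t0 / 2 * eta * q' ^+ N.
  have de : 0 < phi t0 / 2 * eta by rewrite mulr_gt0.
  have K1 : 0 < K + 1 by clear -K0; lra.
  have : (fun n => (q / q') ^+ n) @ \oo --> (0 : R).
    by apply: cvg_expr; rewrite ger0_norm ?divr_ge0 // ?(ltW q'0) // ltr_pdivrMr // mul1r.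
  move=> /cvgrPdist_lt/(_ _ (divr_gt0 de K1))[N _ h]; exists N.
  have := h N (leqnn N); rewrite sub0r normrN ger0_norm ?exprn_ge0 ?divr_ge0 // ?(ltW q'0) //.
  rewrite expr_div_n ltr_pdivrMr ?exprn_gt0 // mulrAC ltr_pdivlMr // => h1.
  apply: le_lt_trans h1; rewrite mulrC ler_wpM2l ?exprn_ge0 //; clear -K0; lra.
exists N; set g := fun t => _.
have gc : continuous (fun t : R => phi t * (2 + 2 * cos (t - t0)) ^+ N).
  by move=> x; apply: cvgM; [exact: pc | exact: continuous_shift_cos].
have gi a b : (@lebesgue_measure R).-integrable `[a, b]%classic
    (fun t => (phi t * (2 + 2 * cos (t - t0)) ^+ N)%:E).
  by apply: continuous_integrable_itv => x _; exact: gc.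
rewrite (@Rintegral_split _ 0 (t0 - eta / 2)) //; last by clear -eta0 e2 e3 t0p t00; lra.
rewrite (@Rintegral_split _ (t0 - eta / 2) (t0 + eta / 2)) //; last by clear -eta0 e2 e3 t0p t00; lra.
have kge t : 0 <= 2 + 2 * cos (t - t0) by have := cos_geN1 (t - t0); clear; lra.
have out t : 0 <= t <= 2 * pi -> - (M * q ^+ N) <= phi t * (2 + 2 * cos (t - t0)) ^+ N.
  move=> tt; have [tn|tf] := leP `|t - t0| eta.
    apply: (@le_trans _ _ 0); first by rewrite oppr_le0 mulr_ge0 // exprn_ge0.
    by rewrite mulr_ge0 ?exprn_ge0 // (le_trans _ (near _ tn)) // ltW.
  apply: (@le_trans _ _ (- M * (2 + 2 * cos (t - t0)) ^+ N)).
    rewrite mulNr lerN2 ler_wpM2l // lerXn2r ?nnegrE // /q lerD2l ler_pM2l //.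
    rewrite -(cos_abs (t - t0)); apply: cos_le_away.
      by apply/andP; split; clear -eta0 e4 pi3; lra.
    rewrite (ltW tf) /=; move: tt e2 e3 t00 t0p; clear.
    by move=> /andP[? ?] *; rewrite ler_norml; apply/andP; split; lra.
  by rewrite ler_wpM2r ?exprn_ge0 // hM.
have inn t : t0 - eta / 2 <= t <= t0 + eta / 2 ->
    phi t0 / 2 * q' ^+ N <= phi t * (2 + 2 * cos (t - t0)) ^+ N.
  move=> tt; have tn : `|t - t0| <= eta / 2.
    by move: tt; clear; move=> /andP[? ?]; rewrite ler_norml; apply/andP; split; lra.
  apply: ler_pM; rewrite ?exprn_ge0 ?(ltW d0) ?(ltW q'0) //.
    by apply: near; apply: le_trans tn _; clear -eta0; lra.
  rewrite lerXn2r ?nnegrE ?(ltW q'0) // /q' lerD2l ler_pM2l //.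
  by rewrite -(cos_abs (t - t0)); apply: cos_noninc => //; clear -e4 pi3 eta0; lra.
have b1 := @Rint_ge _ 0 (t0 - eta / 2) (- (M * q ^+ N)) ltac:(clear -eta0 e2; lra)
  (fun x _ => gc x) (fun x hx => out x ltac:(move: hx t0p eta0; clear; move=> /andP[? ?] *; apply/andP; split; lra)).
have b2 := @Rint_ge _ (t0 - eta / 2) (t0 + eta / 2) _ ltac:(clear -eta0; lra)
  (fun x _ => gc x) inn.
have b3 := @Rint_ge _ (t0 + eta / 2) (2 * pi) (- (M * q ^+ N)) ltac:(clear -eta0 e3; lra)
  (fun x _ => gc x) (fun x hx => out x ltac:(move: hx t00 eta0; clear; move=> /andP[? ?] *; apply/andP; split; lra)).
apply: lt_le_trans (lerD b1 (lerD b2 b3)).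
have MQ : 0 <= M * q ^+ N by rewrite mulr_ge0 // exprn_ge0.
move: hN MQ eta0; rewrite /K; set Q := q ^+ N; set Q' := q' ^+ N; clear => *; nra.
Qed.

Definition cmean h : R[i] := ((2 * pi)^-1)%:C * cint 0 (2 * pi) h.

Definition ccont h := forall x, ccont_at h x.

(** The kernels of cos_kernel are trigonometric polynomials, so that h
    integrates to 0 against all of them; the component of h that does not
    vanish at t0 would contradict cos_kernel. *)
Lemma fourier_unique h : ccont h ->
  (forall j : int, cint 0 (2 * pi) (fun t => h t * cis (j%:~R * t)) = 0) ->
  forall t0, 0 < t0 < 2 * pi -> h t0 = 0.
Proof.
move=> hc hj t0 ht0.
have cc j : ccont (fun t => cis (j%:~R * t) : R[i]).
  move=> x e e0; have [d d0 hd] := ccont_cis (j%:~R * x) e0.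
  have j0 : 0 < `|j%:~R : R| + 1 by rewrite ltr_wpDl.
  exists (d / (`|j%:~R| + 1)) => [|y]; first by rewrite divr_gt0.
  rewrite ltr_pdivlMr // => yx; apply: hd; apply: le_lt_trans yx.
  by rewrite -mulrBr normrM mulrC ler_wpM2l // lerDl.
pose k (t : R) : R[i] := (2 + 2 * cos (t - t0))%:C.
have kE t : k t = 2 + (cis t0)^* * cis t + cis t0 * cis (- t).
  rewrite /k /cis cosN sinN cosB; apply/eqP; rewrite eq_complex /=.
  by apply/andP; split; apply/eqP; ring.
have kc : ccont k.
  move=> x e e0; have [d d0 hd] : exists2 d : R, 0 < d & forall y, `|y - x| < d ->
      normc ((2 + (cis t0)^* * cis (1%:~R * y) + cis t0 * cis ((-1)%:~R * y)) -
     (2 + (cis t0)^* * cis (1%:~R * x) + cis t0 * cis ((-1)%:~R * x))) <= e.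
    have := @ccontD R _ _ x (ccontD (ccont_cst 2 x) (ccontZ (cis t0)^* (@cc 1 x)))
      (ccontZ (cis t0) (@cc (-1) x)); exact.
  by exists d => // y /hd; rewrite !kE !mulN1r !mul1r.
have kN N : ccont (fun t => k t ^+ N) by move=> x; apply: ccontX.
have z N : forall j : int, cint 0 (2 * pi) (fun t => h t * k t ^+ N * cis (j%:~R * t)) = 0.
  elim: N => [|N IHN] j.
    by rewrite -[RHS](hj j); apply: eq_cint => t _; rewrite expr0 mulr1.
  have c1 i : ccont (fun t => h t * k t ^+ N * cis (i%:~R * t)).
    by move=> x; apply: ccontM; [apply: ccontM|exact: cc]; [exact: hc|exact: kN].
  rewrite (@eq_cint _ _ _ _ (fun t => 2 * (h t * k t ^+ N * cis (j%:~R * t)) +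
     ((cis t0)^* * (h t * k t ^+ N * cis ((j + 1)%:~R * t)) +
      cis t0 * (h t * k t ^+ N * cis ((j - 1)%:~R * t))))); last first.
    move=> t _; rewrite exprS kE.
    have -> : cis ((j + 1)%:~R * t) = cis (j%:~R * t) * cis t :> R[i].
      by rewrite -cisD rmorphD /= mulrDl mul1r.
    have -> : cis ((j - 1)%:~R * t) = cis (j%:~R * t) * cis (- t) :> R[i].
      by rewrite -cisD rmorphB /= mulrBl mul1r.
    by ring.
  have c2 i (a : R[i]) x : ccont_at (fun t => a * (h t * k t ^+ N * cis (i%:~R * t))) x.
    by apply: ccontZ; exact: c1.
  rewrite cintD; [|by move=> *; exact: c2|by move=> *; apply: ccontD; exact: c2].
  rewrite cintD; [|by move=> *; exact: c2|by move=> *; exact: c2].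
  by rewrite !cintZ ?IHN ?mulr0 ?addr0 // => *; exact: c1.
have Z N : cint 0 (2 * pi) (fun t => h t * k t ^+ N) = 0.
  by rewrite -[RHS](z N 0); apply: eq_cint => t _; rewrite mul0r cis0 mulr1.
have pos phi : continuous phi -> (forall N, \int[lebesgue_measure]_(t in `[0, 2 * pi])
    (phi t * (2 + 2 * cos (t - t0)) ^+ N) = 0) -> phi t0 <= 0.
  move=> pc hz; rewrite leNgt; apply/negP => /(cos_kernel pc ht0)[N].
  by rewrite hz ltxx.
have opp phi : continuous phi -> (forall N, \int[lebesgue_measure]_(t in `[0, 2 * pi])
    (phi t * (2 + 2 * cos (t - t0)) ^+ N) = 0) -> phi t0 = 0.
  move=> pc hz; apply/eqP; rewrite eq_le pos //= -oppr_le0.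
  apply: (pos (fun t => - phi t)) => [x|N]; first by apply: cvgN; exact: pc.
  transitivity (-1 * \int[lebesgue_measure]_(t in `[0, 2 * pi])
    (phi t * (2 + 2 * cos (t - t0)) ^+ N)); last by rewrite hz mulr0.
  rewrite -RintegralZl //.
    by apply: eq_Rintegral => x _; rewrite mulN1r mulNr.
  apply: continuous_integrable_itv => x _; apply: cvgM; first exact: pc.
  exact: continuous_shift_cos.
have hR := opp _ (fun x => Re_ccont (hc x)); have hI := opp _ (fun x => Im_ccont (hc x)).
apply/eqP; rewrite eq_complex; apply/andP; split; apply/eqP.
  apply: hR => N; have := Z N; rewrite /cint /Cint => -[E _]; rewrite -[RHS]E.
  apply: eq_Rintegral => x _; by rewrite /k -rmorphXn /= [in RHS]mulrC Re_scale mulrC.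
apply: hI => N; have := Z N; rewrite /cint /Cint => -[_ E]; rewrite -[RHS]E.
apply: eq_Rintegral => x _; by rewrite /k -rmorphXn /= [in RHS]mulrC Im_scale mulrC.
Qed.

End FourierUniqueness.

(** * Taylor coefficients as circle means *)

Section Taylor.
Variable R : realType.
Implicit Types (f g G : R[i] -> R[i]) (h : R -> R[i]) (z w : R[i]) (r s : R).

Lemma pi_pos2 : 0 < 2 * pi :> R.
Proof. by rewrite mulr_gt0 // pi_gt0. Qed.

Lemma polar_form z : exists2 t : R, 0 <= t <= 2 * pi & z = (normc z)%:C * cis t.
Proof.
have [->|z0] := eqVneq z 0.
  by exists 0; rewrite ?lexx ?(ltW pi_pos2) // normc0 mul0r.
have n0 : 0 < normc z by rewrite lt_neqAle normc_ge0 andbT eq_sym; apply/eqP => /normc_eq0/eqP; rewrite (negbTE z0).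
have e1 := normc_sqr z.
have xb : -1 <= Re z / normc z <= 1.
  rewrite -ler_norml normrM normfV (ger0_norm (normc_ge0 z)) ler_pdivrMr // mul1r.
  exact: normr_Re_le.
have [a0 ap] := (acos_ge0 xb, acos_lepi xb).
have sE : sin (acos (Re z / normc z)) = `|Im z| / normc z.
  rewrite sin_acos // (_ : 1 - _ = (Im z / normc z) ^+ 2).
    by rewrite sqrtr_sqr normrM normfV (ger0_norm (normc_ge0 z)).
  by rewrite !expr_div_n e1; field; rewrite -e1 expf_neq0 // gt_eqF.
have cE : cos (acos (Re z / normc z)) = Re z / normc z by rewrite acosK // in_itv.
have [i0|i0] := leP 0 (Im z).
  exists (acos (Re z / normc z)); first by rewrite a0 (le_trans ap) // ler_peMl ?pi_ge0 // ler1n.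
  rewrite /cis cE sE ger0_norm //; apply/eqP; rewrite eq_complex /= !mul0r subr0 addr0.
  by rewrite !(mulrC (normc z)) !divfK ?eqxx // gt_eqF.
exists (2 * pi - acos (Re z / normc z)).
  by move: a0 ap (pi_ge0 R); clear; lra.
rewrite -(cis_2pi (2 * pi - _)).
have -> : 2 * pi - acos (Re z / normc z) + 2 * pi = - acos (Re z / normc z) + 2 * pi + 2 * pi by ring.
rewrite !cis_2pi cisN /cis cE sE ltr0_norm // /=; apply/eqP; rewrite eq_complex /= !mul0r subr0 addr0.
by rewrite mulNr opprK !(mulrC (normc z)) !divfK ?eqxx // gt_eqF.
Qed.

Lemma cint_conj a b h : (forall x, a <= x <= b -> ccont_at h x) ->
  cint a b (fun t => (h t)^*) = (cint a b h)^*.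
Proof.
move=> hc; have [h1 h2] := ccont_integrable hc.
apply/eqP; rewrite eq_complex /=; apply/andP; split; apply/eqP.
  by apply: eq_Rintegral => x _; case: (h x).
rewrite -mulN1r -RintegralZl //; apply: eq_Rintegral => x _.
by rewrite mulN1r; case: (h x).
Qed.

Lemma cmeanD h1 h2 : ccont h1 -> ccont h2 -> cmean (fun t => h1 t + h2 t) = cmean h1 + cmean h2.
Proof. by move=> c1 c2; rewrite /cmean cintD ?mulrDr. Qed.

Lemma cmeanZ h k : ccont h -> cmean (fun t => k * h t) = k * cmean h.
Proof. by move=> c1; rewrite /cmean cintZ // mulrCA. Qed.

Lemma cmeanB h1 h2 : ccont h1 -> ccont h2 -> cmean (fun t => h1 t - h2 t) = cmean h1 - cmean h2.
Proof.
move=> c1 c2; rewrite -mulN1r -cmeanZ // -cmeanD //; last by move=> x; exact: ccontZ.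
by rewrite /cmean; congr (_ * _); apply: eq_cint => t _; rewrite mulN1r.
Qed.

Lemma cmean_conj h : ccont h -> cmean (fun t => (h t)^*) = (cmean h)^*.
Proof. by move=> c1; rewrite /cmean cint_conj // rmorphM [X in _ = X * _]conjc_real. Qed.

Lemma eq_cmean h1 h2 : (forall t, h1 t = h2 t) -> cmean h1 = cmean h2.
Proof. by move=> hh; rewrite /cmean; congr (_ * _); apply: eq_cint => t _. Qed.

Lemma cmean_cst (k : R[i]) : cmean (fun=> k) = k.
Proof.
rewrite /cmean cint_cst ?(ltW pi_pos2) // subr0 mulrA -rmorphM /= mulVf ?mul1r //.
by rewrite gt_eqF // pi_pos2.
Qed.

Lemma cmean_sum n (u : nat -> R -> R[i]) : (forall j, ccont (u j)) ->
  cmean (fun t => \sum_(j < n) u j t) = \sum_(j < n) cmean (u j).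
Proof.
move=> uc; elim: n => [|n IHn].
  by rewrite big_ord0 -[RHS](cmean_cst 0); apply: eq_cmean => t; rewrite big_ord0.
rewrite big_ord_recr /= -IHn -cmeanD //; last by move=> x; apply: ccont_sum => j _; exact: uc.
by apply: eq_cmean => t; rewrite big_ord_recr.
Qed.

Lemma normc_cmean_le h (M : R) : ccont h -> (forall t, normc (h t) <= M) ->
  normc (cmean h) <= 2 * M.
Proof.
move=> hc hM; rewrite normcM normcR ger0_norm ?invr_ge0 ?(ltW pi_pos2) //.
have := @normc_cint_le R 0 (2 * pi) h M (ltW pi_pos2) (fun x _ => hc x) (fun x _ => hM x).
rewrite subr0 => H; rewrite mulrC ler_pdivrMr ?pi_pos2 //.
by rewrite -mulrA.
Qed.

Lemma analytic_cder f z : analytic_on_disc f -> normc z < 1 -> exists l, cder f z l.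
Proof. by move=> fa /fa /derivable_cderP. Qed.

Lemma cder_analytic f : (forall z, normc z < 1 -> exists l, cder f z l) -> analytic_on_disc f.
Proof. by move=> h z /h /derivable_cderP. Qed.

(** Goursat on a rectangle of height 2 pi: the horizontal sides cancel by
    periodicity. *)
Lemma vline_const G a b : a <= b -> (forall z, Re z <= b -> exists l, cder G z l) ->
  (forall x y, G (x +i* (y + 2 * pi)) = G (x +i* y)) ->
  cint 0 (2 * pi) (fun y => G (b +i* y)) = cint 0 (2 * pi) (fun y => G (a +i* y)).
Proof.
move=> ab Gd Gp.
have hr : cder_on_rect G a (a + (b - a)) 0 (0 + 2 * pi).
  by move=> x y /andP[_ xb] _; apply: Gd; rewrite /= (le_trans xb) // addrC subrK.
have := goursat (_ : 0 <= b - a) (ltW pi_pos2) hr.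
rewrite subr_ge0 => /(_ ab); rewrite /rect_int add0r addrC [a + _]addrC subrK.
rewrite (@eq_cint _ a b _ (fun=> 0)); last first.
  by move=> x _; rewrite -[2 * pi]add0r Gp subrr.
rewrite cint_cst // mulr0 addr0 => /eqP; rewrite mulf_eq0 => /orP[/eqP[]/eqP|/eqP].
  by rewrite oner_eq0.
have hr' : cder_on_rect G a b 0 (2 * pi).
  by move: hr; rewrite add0r [a + _]addrC subrK.
have pp := ltW pi_pos2.
have cb : forall y, 0 <= y <= 2 * pi -> ccont_at (fun y => G (b +i* y)) y.
  by move=> y hy; have [l hl] := hr' b y (introT andP (conj ab (lexx b))) hy; exact: ccont_vline hl.
have ca : forall y, 0 <= y <= 2 * pi -> ccont_at (fun y => G (a +i* y)) y.
  by move=> y hy; have [l hl] := hr' a y (introT andP (conj (lexx a) ab)) hy; exact: ccont_vline hl.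
rewrite /cint CintB //; [|exact: ccont_integrable..].
by move/eqP; rewrite subr_eq0 => /eqP.
Qed.

Lemma ccont_circle f r : analytic_on_disc f -> 0 <= r < 1 -> ccont (fun t => f (r%:C * cis t)).
Proof.
move=> fa /andP[r0 r1] x.
have [l hl] := @analytic_cder f (r%:C * cis x) fa ltac:(by rewrite normcM normcR normc_cis mulr1 ger0_norm).
by apply: (@ccont_comp _ f (fun t => r%:C * cis t) _ l) => //; apply: ccontZ; exact: ccont_cis.
Qed.

Lemma ccont_cisX n : ccont (fun t : R => cis t ^+ n).
Proof. by move=> x; apply: ccontX; exact: ccont_cis. Qed.

Lemma ccont_cisNX n : ccont (fun t : R => cis (- t) ^+ n).
Proof.
move=> x; have := ccontJ (@ccont_cisX n x); rewrite /ccont_at => H e e0.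
by have [d d0 hd] := H e e0; exists d => // y /hd; rewrite !cisN -!rmorphXn.
Qed.

(** The coordinate z = e^w turns the annulus between the radii r and s into
    the rectangle [ln r, ln s] x [0, 2 pi], where Goursat applies; the sign sg
    covers the moments against z^n and z^-n together. *)
Lemma circle_moment_const f n (sg r s : R) : analytic_on_disc f -> sg = 1 \/ sg = -1 ->
  0 < r -> r <= s -> s < 1 ->
  (expR (sg * ln s) ^+ n)%:C * cint 0 (2 * pi) (fun t => f (s%:C * cis t) * cis (sg * t) ^+ n) =
  (expR (sg * ln r) ^+ n)%:C * cint 0 (2 * pi) (fun t => f (r%:C * cis t) * cis (sg * t) ^+ n).
Proof.
move=> fa hsg r0 rs s1; have s0 : 0 < s := lt_le_trans r0 rs.
pose G z := f (cexp z) * cexp (sg%:C * z) ^+ n.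
have GE (u : R) t : 0 < u -> G (ln u +i* t) =
    (expR (sg * ln u) ^+ n)%:C * (f (u%:C * cis t) * cis (sg * t) ^+ n).
  move=> u0; rewrite /G cexpE lnK ?posrE //.
  have -> : sg%:C * (ln u +i* t) = (sg * ln u) +i* (sg * t).
    by apply/eqP; rewrite eq_complex /= !mul0r subr0 addr0 !eqxx.
  by rewrite cexpE exprMn rmorphXn /= mulrCA.
have hcc u : 0 < u -> u < 1 -> forall x, 0 <= x <= 2 * pi ->
    ccont_at (fun t => f (u%:C * cis t) * cis (sg * t) ^+ n) x.
  move=> u0 u1 x _; apply: ccontM; first by apply: ccont_circle => //; rewrite (ltW u0).
  case: hsg => ->.
    by under eq_fun do rewrite mul1r; exact: ccont_cisX.
  by under eq_fun do rewrite mulN1r; exact: ccont_cisNX.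
have cE (u : R) : 0 < u -> u < 1 -> cint 0 (2 * pi) (fun t => G (ln u +i* t)) =
    (expR (sg * ln u) ^+ n)%:C * cint 0 (2 * pi) (fun t => f (u%:C * cis t) * cis (sg * t) ^+ n).
  by move=> u0 u1; rewrite -cintZ; [apply: eq_cint => t _; exact: GE|exact: hcc].
rewrite -(cE s s0 s1) -(cE r r0 (le_lt_trans rs s1)).
apply: vline_const; first by rewrite ler_ln ?posrE.
  move=> z zs.
  have [l hl] : exists l, cder f (cexp z) l.
    apply: analytic_cder => //; rewrite normc_cexp; apply: le_lt_trans s1.
    by rewrite -[leRHS]lnK ?posrE // ler_expR.
  have d1 := cder_comp (cder_cexp z) hl.
  have d2 := cderX n (cder_comp (cderZ sg%:C (@cder_id R z)) (cder_cexp (sg%:C * z))).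
  by exists (l * cexp z * cexp (sg%:C * z) ^+ n + f (cexp z) *
    (n%:R * cexp (sg%:C * z) ^+ n.-1 * (cexp (sg%:C * z) * (sg%:C * 1)))); exact: cderM d1 d2.
move=> x y.
have E v : sg%:C * (x +i* v) = (sg * x) +i* (sg * v).
  by apply/eqP; rewrite eq_complex /= !mul0r subr0 addr0 !eqxx.
rewrite /G !E !cexpE cis_2pi; congr (_ * (_ * _) ^+ _).
case: hsg => ->; first by rewrite !mul1r cis_2pi.
by rewrite !mulN1r -(cis_2pi (- (y + _))); congr cis; ring.
Qed.

(** The n-th negative moment on the circle of radius r equals (s / r)^(n+1)
    times the one on the circle of radius s, which stays bounded as s tends to
    0. *)
Lemma circle_neg_coef f n r : analytic_on_disc f -> 0 < r < 1 ->
  cmean (fun t => f (r%:C * cis t) * cis t ^+ n.+1) = 0.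
Proof.
move=> fa /andP[r0 r1].
have [l0 hl0] := @analytic_cder f 0 fa ltac:(by rewrite normc0).
have [d d0 hd] := cder_cont hl0 ltr01.
pose M := normc (f 0) + 1.
have M0 : 0 < M by rewrite ltr_wpDl.
pose I s := cint 0 (2 * pi) (fun t => f (s%:C * cis t) * cis t ^+ n.+1).
have IE s : 0 < s -> I s = cint 0 (2 * pi) (fun t => f (s%:C * cis t) * cis (1 * t) ^+ n.+1).
  by move=> _; apply: eq_cint => t _; rewrite mul1r.
have key s : 0 < s -> s <= r -> s < d -> r ^+ n.+1 * normc (I r) <= s ^+ n.+1 * (2 * (M * (2 * pi))).
  move=> s0 sr sd.
  have /(congr1 (@normc R)) := circle_moment_const n.+1 fa (or_introl (erefl 1)) s0 sr r1.
  rewrite -!IE // !mul1r !lnK ?posrE // !normcM !normcR !ger0_norm ?exprn_ge0 ?(ltW s0) ?(ltW r0) //.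
  move=> ->; rewrite ler_wpM2l ?exprn_ge0 ?(ltW s0) //.
  have := @normc_cint_le R 0 (2 * pi) (fun t => f (s%:C * cis t) * cis t ^+ n.+1) M (ltW pi_pos2).
  rewrite subr0; apply => t _.
    apply: ccontM; last exact: ccont_cisX.
    by apply: ccont_circle => //; rewrite (ltW s0) (le_lt_trans sr).
  rewrite normcM normcX normc_cis expr1n mulr1 -(subrK (f 0) (f _)).
  rewrite (le_trans (le_normcD _ _)) // /M addrC lerD2l; apply: hd.
  by rewrite subr0 normcM normcR normc_cis mulr1 gtr0_norm.
suff I0 : I r = 0 by rewrite /cmean -/(I r) I0 mulr0.
apply/normc_eq0/eqP; rewrite eq_le normc_ge0 andbT.
rewrite -(pmulr_rle0 _ (_ : 0 < r ^+ n.+1)) ?exprn_gt0 //.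
apply/ler_addgt0Pl => e e0; rewrite addr0.
pose C := 2 * (M * (2 * pi)); have C0 : 0 < C by rewrite /C !mulr_gt0 // ?pi_gt0.
pose s := Num.min (Num.min r (d / 2)) (e / C).
have s0 : 0 < s by rewrite !lt_min r0 !divr_gt0.
have sr : s <= r by rewrite /s !ge_min lexx.
have sd : s < d by rewrite /s; apply: (@le_lt_trans _ _ (d / 2)); [rewrite !ge_min lexx orbT|clear -d0; lra].
apply: le_trans (key s s0 sr sd) _.
have sC : s * C <= e by rewrite -ler_pdivlMr // /s ge_min lexx orbT.
apply: le_trans sC; rewrite ler_wpM2r ?(ltW C0) // exprS ler_piMr ?(ltW s0) //.
by rewrite exprn_ile1 ?(ltW s0) // (le_trans sr) // ltW.
Qed.

Lemma analytic_cst k : analytic_on_disc (fun=> k : R[i]).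
Proof. by apply: cder_analytic => z _; exists 0; exact: cder_cst. Qed.

Lemma cmean_cisX n : cmean (fun t => cis t ^+ n.+1 : R[i]) = 0.
Proof.
rewrite -(@circle_neg_coef _ n 2^-1 (@analytic_cst 1)); last by clear; lra.
by apply: eq_cmean => t; rewrite mul1r.
Qed.

Lemma cis_mulN (t : R) : cis t * cis (- t) = 1.
Proof. by rewrite -cisD subrr cis0. Qed.

Lemma cmean_orth i j : cmean (fun t => cis t ^+ i * cis (- t) ^+ j : R[i]) = (i == j)%:R.
Proof.
have [ij|ji|->] := ltngtP i j; last first.
- rewrite -[RHS](cmean_cst 1); apply: eq_cmean => t.
  by rewrite -exprMn cis_mulN expr1n.
- rewrite -(subnK (ltnW ji)).
  have [k ->] : exists k, (i - j)%N = k.+1 by exists (i - j).-1; rewrite prednK // subn_gt0.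
  transitivity (cmean (fun t => cis t ^+ k.+1 : R[i])); last exact: cmean_cisX.
  apply: eq_cmean => t.
  by rewrite exprD -mulrA -exprMn cis_mulN expr1n mulr1.
- rewrite -(subnK (ltnW ij)).
  have [k ->] : exists k, (j - i)%N = k.+1 by exists (j - i).-1; rewrite prednK // subn_gt0.
  transitivity ((cmean (fun t => cis t ^+ k.+1 : R[i]))^*); last by rewrite cmean_cisX; exact: conjc0.
  rewrite -cmean_conj; last exact: ccont_cisX.
  apply: eq_cmean => t; rewrite exprD mulrCA -exprMn cis_mulN expr1n mulr1.
  by rewrite cisN -rmorphXn.
Qed.

(** The n-th Taylor coefficient, read off on the circle of radius 1/2; by
    circle_coef every radius in (0, 1) gives the same value. *)
Definition acoef f n : R[i] := (2 ^+ n) * cmean (fun t => f ((2^-1)%:C * cis t) * cis (- t) ^+ n).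

Lemma circle_coef f n r : analytic_on_disc f -> 0 < r < 1 ->
  cmean (fun t => f (r%:C * cis t) * cis (- t) ^+ n) = acoef f n * (r ^+ n)%:C.
Proof.
move=> fa /andP[r0 r1].
have key u v : 0 < u -> u <= v -> v < 1 ->
   (v ^- n)%:C * cmean (fun t => f (v%:C * cis t) * cis (- t) ^+ n) =
   (u ^- n)%:C * cmean (fun t => f (u%:C * cis t) * cis (- t) ^+ n).
  move=> u0 uv v1; have v0 := lt_le_trans u0 uv.
  have Eu (w : R) : cint 0 (2 * pi) (fun t => f (w%:C * cis t) * cis (- t) ^+ n) =
      cint 0 (2 * pi) (fun t => f (w%:C * cis t) * cis (-1 * t) ^+ n).
    by apply: eq_cint => t _; rewrite (mulN1r t).
  have := circle_moment_const n fa (or_intror (erefl (-1))) u0 uv v1.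
  rewrite (mulN1r (ln u)) (mulN1r (ln v)) !expRN !lnK ?posrE // !exprVn -!Eu => H.
  by rewrite /cmean mulrCA H mulrCA.
have h2 : 0 < 2^-1 :> R by rewrite invr_gt0.
have h21 : 2^-1 < 1 :> R by clear; lra.
have E : (r ^- n)%:C * cmean (fun t => f (r%:C * cis t) * cis (- t) ^+ n) = acoef f n.
  have -> : acoef f n = ((2^-1) ^- n)%:C * cmean (fun t => f ((2^-1)%:C * cis t) * cis (- t) ^+ n).
    by rewrite exprVn invrK rmorphXn /= (rmorph_nat (real_complex R) 2).
  have [rh|hr] := leP r 2^-1; first exact: esym (key _ _ r0 rh h21).
  exact: key h2 (ltW hr) r1.
rewrite -E mulrAC -rmorphM /= mulVf ?mul1r // expf_neq0 // gt_eqF //.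
Qed.

Lemma circle_bound f r : analytic_on_disc f -> 0 <= r < 1 ->
  exists M : R, forall t, normc (f (r%:C * cis t)) <= M.
Proof.
move=> fa hr; have cc := ccont_circle fa hr; have /andP[r0 _] := hr.
have c : continuous (fun t => normc (f (r%:C * cis t))).
  move=> x; apply/cvgrPdist_le => e e0; have [d d0 hd] := cc x e e0.
  exists d => // y; rewrite /= distrC => /hd; apply: le_trans.
  rewrite ler_norml; apply/andP; split; last by rewrite normcBC lecr_normcB.
  by rewrite lerNl opprB lecr_normcB.
have [m _ hm] := @EVT_max R _ 0 (2 * pi) (ltW pi_pos2) (continuous_subspaceT c).
exists (normc (f (r%:C * cis m))) => t.
have [b hb ->] := polar_form (r%:C * cis t).
by rewrite normcM normcR normc_cis mulr1 ger0_norm //; apply: hm; rewrite in_itv.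
Qed.

Lemma acoef_radius_ge1 f : analytic_on_disc f -> radius_ge1 (acoef f).
Proof.
move=> fa r /andP[r0 r1].
pose s := (1 + r) / 2; have s01 : 0 < s < 1 by rewrite /s; clear -r0 r1; lra.
have rs : 0 <= r <= s by rewrite /s; clear -r0 r1; lra.
have s01' : 0 <= s < 1 by case/andP: s01 => /ltW -> ->.
have [M hM] := circle_bound fa s01'.
exists (2 * M) => j; apply: le_trans (coef_pow_le _ rs j) _.
have /(congr1 (@normc R)) := circle_coef j fa s01.
rewrite [in RHS]normcM normcR ger0_norm ?exprn_ge0 //; last by case/andP: s01'.
move=> <-; apply: normc_cmean_le => [x|t].
  by apply: ccontM; [exact: ccont_circle | exact: ccont_cisNX].
by rewrite normcM normcX normc_cis expr1n mulr1; exact: hM.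
Qed.

Lemma ccont_psum a N r : ccont (fun t => psum a N (r%:C * cis t)).
Proof.
move=> x; apply: (@ccont_sum R N (fun j t => a j * (r%:C * cis t) ^+ j)) => j _.
apply: ccontZ; apply: ccontX; apply: ccontZ.
exact: ccont_cis.
Qed.

Lemma cmean_psum a N r (u : R -> R[i]) : ccont u ->
  cmean (fun t => psum a N (r%:C * cis t) * u t) =
  \sum_(j < N) (a j * (r ^+ j)%:C) * cmean (fun t => cis t ^+ j * u t).
Proof.
move=> uc.
have cu j : ccont (fun t => cis t ^+ j * u t) by move=> x; apply: ccontM; [exact: ccont_cisX|exact: uc].
rewrite (@eq_cmean _ (fun t => \sum_(j < N) (a j * (r ^+ j)%:C) * (cis t ^+ j * u t))); last first.
  move=> t; rewrite /psum mulr_suml; apply: eq_bigr => j _.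
  by rewrite exprMn -rmorphXn /= !mulrA.
rewrite (@cmean_sum N (fun j t => (a j * (r ^+ j)%:C) * (cis t ^+ j * u t))); last first.
  by move=> j x; apply: ccontZ; exact: cu.
by apply: eq_bigr => j _; rewrite (cmeanZ _ (cu j)).
Qed.

Lemma psum_circle_coef a N n r : (n < N)%N ->
  cmean (fun t => psum a N (r%:C * cis t) * cis (- t) ^+ n) = a n * (r ^+ n)%:C.
Proof.
move=> nN; rewrite (cmean_psum _ _ _ (@ccont_cisNX n)) (bigD1 (Ordinal nN)) //= big1 ?addr0 => [|j jn].
  by rewrite cmean_orth eqxx mulr1.
by rewrite cmean_orth; move: jn; rewrite -val_eqE /= => /negbTE ->; rewrite mulr0.
Qed.

Lemma psum_circle_neg a N n r :
  cmean (fun t => psum a N (r%:C * cis t) * cis t ^+ n.+1) = 0.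
Proof.
rewrite (cmean_psum _ _ _ (@ccont_cisX n.+1)); apply: big1 => j _.
rewrite (@eq_cmean _ (fun t => cis t ^+ (j + n).+1)) ?cmean_cisX ?mulr0 // => t.
by rewrite -exprD addnS.
Qed.

End Taylor.

(** * Taylor's theorem and operations on coefficients *)

Section TaylorExpansion.
Variable R : realType.
Implicit Types (f g : R[i] -> R[i]) (a : nat -> R[i]) (h : R -> R[i]) (z w : R[i]) (r s : R).

(** Uniform convergence on the circle permits termwise integration. *)
Lemma unif_circle_mean a g r (u : R -> R[i]) : analytic_on_disc g -> power_rep a g -> 0 <= r < 1 ->
  ccont u -> (exists B : R, forall t, normc (u t) <= B) -> forall e : R, 0 < e ->
  exists N0, forall N, (N0 <= N)%N ->
  normc (cmean (fun t => g (r%:C * cis t) * u t) - cmean (fun t => psum a N (r%:C * cis t) * u t)) <= e.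
Proof.
move=> ga gr hr uc [B hB] e e0; have /andP[r0 r1] := hr.
have B0 : 0 <= B by apply: le_trans (hB 0).
have k0 : 0 < e / (2 * (B + 1)) by rewrite divr_gt0 // mulr_gt0 // ltr_wpDl.
have [N0 hN] := gr r hr _ k0; exists N0 => N NN.
have c1 := ccont_circle ga hr; have c2 := @ccont_psum R a N r.
rewrite -cmeanB; [|by move=> x; apply: ccontM..].
have cc : ccont (fun t => g (r%:C * cis t) * u t - psum a N (r%:C * cis t) * u t).
  by move=> x; apply: ccontB; apply: ccontM.
apply: le_trans (normc_cmean_le (M := e / (2 * (B + 1)) * (B + 1)) cc _) _.
  move=> t; rewrite -mulrBl normcM; apply: ler_pM => //.
    by apply: hN => //; rewrite normcM normcR normc_cis mulr1 ger0_norm.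
  by apply: le_trans (hB t) _; rewrite lerDl.
rewrite le_eqVlt; apply/orP; left; apply/eqP; field.
by rewrite gt_eqF // ltr_wpDl.
Qed.

Lemma normc_small_eq (x y : R[i]) : (forall e : R, 0 < e -> normc (x - y) <= e) -> x = y.
Proof.
move=> h; apply/eqP; rewrite -subr_eq0; apply/eqP/normc_eq0/eqP.
rewrite eq_le normc_ge0 andbT; apply/ler_addgt0Pl => e e0; rewrite addr0; exact: h.
Qed.

Lemma power_rep_coef a g r n : analytic_on_disc g -> power_rep a g -> 0 <= r < 1 ->
  cmean (fun t => g (r%:C * cis t) * cis (- t) ^+ n) = a n * (r ^+ n)%:C.
Proof.
move=> ga gr hr; apply: normc_small_eq => e e0.
have hB : exists B : R, forall t, normc (cis (- t) ^+ n : R[i]) <= B.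
  by exists 1 => t; rewrite normcX normc_cis expr1n.
have [N0 hN] := unif_circle_mean ga gr hr (@ccont_cisNX R n) hB e0.
have := hN (N0 + n.+1)%N (leq_addr _ _).
by rewrite psum_circle_coef // addnS ltnS leq_addl.
Qed.

Lemma power_rep_neg a g r n : analytic_on_disc g -> power_rep a g -> 0 <= r < 1 ->
  cmean (fun t => g (r%:C * cis t) * cis t ^+ n.+1) = 0.
Proof.
move=> ga gr hr; apply: normc_small_eq => e e0.
have hB : exists B : R, forall t, normc (cis t ^+ n.+1 : R[i]) <= B.
  by exists 1 => t; rewrite normcX normc_cis expr1n.
have [N0 hN] := unif_circle_mean ga gr hr (@ccont_cisX R n.+1) hB e0.
by have := hN N0 (leqnn _); rewrite psum_circle_neg.
Qed.

Lemma power_rep_analytic a g : radius_ge1 a -> power_rep a g -> analytic_on_disc g.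
Proof.
move=> ha gr; have [g1 g1r] := power_sum_exists (radius_ge1_pderiv ha).
by apply: cder_analytic => z z1; exists (g1 z); exact: power_rep_cder ha gr g1r z1.
Qed.

(** The power series S with these coefficients has the same Fourier
    coefficients as f on every circle. Fourier uniqueness holds at interior
    points of [0, 2 pi], that is off the positive real axis; real points
    follow by continuity. *)
Theorem taylor f : analytic_on_disc f -> power_rep (acoef f) f.
Proof.
move=> fa; have ha := acoef_radius_ge1 fa.
have [S Sr] := power_sum_exists ha.
have Sa := power_rep_analytic ha Sr.
suff fS z : normc z < 1 -> f z = S z.
  move=> r /andP[r0 r1] e e0; have [N0 hN] := Sr r ltac:(by rewrite r0) e e0.
  by exists N0 => N NN z zr; rewrite fS ?hN // (le_lt_trans zr).
(* off the real axis the argument lies strictly between 0 and 2 pi *)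
have good w : Im w != 0 -> normc w < 1 -> f w = S w.
  move=> iw w1; have [t /andP[t0 tp] wE] := polar_form w.
  have w0 : 0 < normc w.
    rewrite lt_neqAle normc_ge0 andbT eq_sym; apply/eqP => /normc_eq0 w0.
    by move: iw; rewrite w0 eqxx.
  have hr : 0 <= normc w < 1 by rewrite normc_ge0.
  have hr' : 0 < normc w < 1 by rewrite w0.
  have c1 := ccont_circle fa hr; have c2 := ccont_circle Sa hr.
  have imE : Im w = normc w * sin t by have := congr1 (@complex.Im R) wE; rewrite Im_scale.
  have tt : 0 < t < 2 * pi.
    rewrite !lt_neqAle t0 tp !andbT; apply/andP; split; apply/eqP => tE.
      by move: iw; rewrite imE -tE sin0 mulr0 eqxx.
    move: iw; rewrite imE tE; have := @cis_2pi R 0; rewrite add0r => -[_ ->].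
    by rewrite sin0 mulr0 eqxx.
  rewrite wE; apply/eqP; rewrite -subr_eq0; apply/eqP.
  apply: (@fourier_unique R (fun t => f ((normc w)%:C * cis t) - S ((normc w)%:C * cis t))) => //.
    by move=> x; exact: ccontB.
  move=> j; have pos x : (2 * pi)^-1%:C * x = 0 :> R[i] -> x = 0.
    move=> /eqP; rewrite mulf_eq0 => /orP[/eqP[]/eqP|/eqP//].
    by rewrite invr_eq0 gt_eqF // pi_pos2.
  apply: pos; rewrite -/(cmean _).
  case: j => n.
    have [->|n0] := posnP n.
      transitivity (cmean (fun t => f ((normc w)%:C * cis t) * cis (- t) ^+ 0 - S ((normc w)%:C * cis t) * cis (- t) ^+ 0)).
        by apply: eq_cmean => x; rewrite mul0r cis0 !expr0 !mulr1.
      rewrite cmeanB; [|by move=> x; apply: ccontM => //; exact: ccont_cisNX..].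
      by rewrite (circle_coef _ fa hr') (power_rep_coef _ Sa Sr hr) subrr.
    case: n n0 => // n _.
    transitivity (cmean (fun t => f ((normc w)%:C * cis t) * cis t ^+ n.+1 - S ((normc w)%:C * cis t) * cis t ^+ n.+1)).
      by apply: eq_cmean => x; rewrite cisX mulrBl.
    rewrite cmeanB; [|by move=> x; apply: ccontM => //; exact: ccont_cisX..].
    by rewrite (circle_neg_coef _ fa hr') (power_rep_neg _ Sa Sr hr) subrr.
  transitivity (cmean (fun t => f ((normc w)%:C * cis t) * cis (- t) ^+ n.+1 - S ((normc w)%:C * cis t) * cis (- t) ^+ n.+1)).
    apply: eq_cmean => x; rewrite cisX mulrBl; congr (_ * cis _ - _ * cis _).
      by rewrite NegzE rmorphN /= mulNr mulrN.
    by rewrite NegzE rmorphN /= mulNr mulrN.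
  rewrite cmeanB; [|by move=> x; apply: ccontM => //; exact: ccont_cisNX..].
  by rewrite (circle_coef _ fa hr') (power_rep_coef _ Sa Sr hr) subrr.
move=> z1; have [iz|iz] := eqVneq (Im z) 0; last exact: good.
apply: normc_small_eq => e e0; have e2 : 0 < e / 2 by rewrite divr_gt0.
have [l hl] := analytic_cder fa z1; have [l' hl'] := analytic_cder Sa z1.
have [d d0 hd] := cder_cont hl e2; have [d' d'0 hd'] := cder_cont hl' e2.
pose eta := Num.min (Num.min (d / 2) (d' / 2)) ((1 - normc z) / 2).
have eta0 : 0 < eta by rewrite !lt_min !divr_gt0 // subr_gt0.
have [e1 e3 e4] : [/\ eta <= d / 2, eta <= d' / 2 & eta <= (1 - normc z) / 2].
  by split; rewrite /eta !ge_min ?lexx ?orbT.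
pose w := z + 0 +i* eta.
have wz : normc (w - z) = eta.
  by rewrite /w addrC addKr /normc expr0n add0r sqrtr_sqr gtr0_norm.
have fw : f w = S w.
  apply: good; first by rewrite /w raddfD /= iz add0r gt_eqF.
  have := le_normcD (w - z) z; rewrite subrK wz => /le_lt_trans; apply.
  by move: e4 z1; clear; lra.
have h1 := hd w ltac:(rewrite wz; move: e1 d0; clear; lra).
have h2 := hd' w ltac:(rewrite wz; move: e3 d'0; clear; lra).
rewrite (_ : f z - S z = (S w - S z) - (f w - f z)); last by rewrite fw; ring.
rewrite (le_trans (le_normcD _ _)) // normcN (splitr e) lerD //.
Qed.

Lemma acoef_unique a f : analytic_on_disc f -> power_rep a f -> acoef f = a.
Proof.
move=> fa fr; apply/funext => n.
have h2 : 0 <= (2^-1 : R) < 1 by apply/andP; split; clear; lra.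
rewrite /acoef (power_rep_coef n fa fr h2) mulrCA.
by rewrite rmorphXn fmorphV (rmorph_nat (real_complex R) 2) -exprMn mulfV ?expr1n ?mulr1 // pnatr_eq0.
Qed.

Lemma psumD a b N z : psum (fun j => a j + b j) N z = psum a N z + psum b N z.
Proof. by rewrite /psum -big_split; apply: eq_bigr => j _; rewrite mulrDl. Qed.

Lemma psumZ a k N z : psum (fun j => k * a j) N z = k * psum a N z.
Proof. by rewrite /psum mulr_sumr; apply: eq_bigr => j _; rewrite mulrA. Qed.

Lemma power_repD a b f g : power_rep a f -> power_rep b g ->
  power_rep (fun j => a j + b j) (fun z => f z + g z).
Proof.
move=> fr gr r hr e e0; have e2 : 0 < e / 2 by rewrite divr_gt0.
have [N1 h1] := fr r hr _ e2; have [N2 h2] := gr r hr _ e2.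
exists (maxn N1 N2) => N; rewrite geq_max => /andP[n1 n2] z zr.
rewrite psumD opprD addrACA (le_trans (le_normcD _ _)) // (splitr e) lerD //.
  exact: h1.
exact: h2.
Qed.

Lemma power_repZ a k f : power_rep a f -> power_rep (fun j => k * a j) (fun z => k * f z).
Proof.
move=> fr r hr e e0; have k0 : 0 < normc k + 1 by rewrite ltr_wpDl.
have [N1 h1] := fr r hr _ (divr_gt0 e0 k0).
exists N1 => N n1 z zr; rewrite psumZ -mulrBr normcM.
have := h1 N n1 z zr; rewrite ler_pdivlMr // => h; apply: le_trans h.
by have := normc_ge0 (f z - psum a N z); nra.
Qed.

Lemma analyticD f g : analytic_on_disc f -> analytic_on_disc g -> analytic_on_disc (fun z => f z + g z).
Proof.
move=> fa ga; apply: cder_analytic => z z1.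
by have [l hl] := analytic_cder fa z1; have [m hm] := analytic_cder ga z1; exists (l + m); exact: cderD.
Qed.

Lemma analyticM f g : analytic_on_disc f -> analytic_on_disc g -> analytic_on_disc (fun z => f z * g z).
Proof.
move=> fa ga; apply: cder_analytic => z z1.
by have [l hl] := analytic_cder fa z1; have [m hm] := analytic_cder ga z1; exists (l * g z + f z * m); exact: cderM.
Qed.

Lemma analyticZ k f : analytic_on_disc f -> analytic_on_disc (fun z => k * f z).
Proof.
move=> fa; apply: cder_analytic => z z1.
by have [l hl] := analytic_cder fa z1; exists (k * l); exact: cderZ.
Qed.

Lemma analyticB f g : analytic_on_disc f -> analytic_on_disc g -> analytic_on_disc (fun z => f z - g z).
Proof.
move=> fa ga; apply: cder_analytic => z z1.
by have [l hl] := analytic_cder fa z1; have [m hm] := analytic_cder ga z1; exists (l - m); exact: cderB.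
Qed.

Lemma analyticX f n : analytic_on_disc f -> analytic_on_disc (fun z => f z ^+ n).
Proof.
move=> fa; apply: cder_analytic => z z1.
by have [l hl] := analytic_cder fa z1; exists (n%:R * f z ^+ n.-1 * l); exact: cderX.
Qed.

Lemma analytic_id : analytic_on_disc (@id R[i]).
Proof. by apply: cder_analytic => z _; exists 1; exact: cder_id. Qed.

Definition dilate s f z := f (s%:C * z).

Lemma normc_dilate_le s z r : 0 <= s <= 1 -> normc z <= r -> normc (s%:C * z) <= r.
Proof.
move=> /andP[s0 s1] zr; rewrite normcM normcR ger0_norm //; apply: le_trans zr.
by rewrite ler_piMl.
Qed.

Lemma analytic_dilate s f : 0 <= s <= 1 -> analytic_on_disc f -> analytic_on_disc (dilate s f).
Proof.
move=> s01 fa; apply: cder_analytic => z z1.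
have [l hl] : exists l, cder f (s%:C * z) l.
  by apply: analytic_cder => //; apply: le_lt_trans (normc_dilate_le s01 (lexx _)) z1.
by exists (l * (s%:C * 1)); apply: cder_comp hl; apply: cderZ; exact: cder_id.
Qed.

Lemma acoefD f g j : analytic_on_disc f -> analytic_on_disc g ->
  acoef (fun z => f z + g z) j = acoef f j + acoef g j.
Proof.
by move=> fa ga; rewrite (acoef_unique (analyticD fa ga) (power_repD (taylor fa) (taylor ga))).
Qed.

Lemma acoefZ k f j : analytic_on_disc f -> acoef (fun z => k * f z) j = k * acoef f j.
Proof. by move=> fa; rewrite (acoef_unique (@analyticZ k f fa) (@power_repZ _ k f (taylor fa))). Qed.

Lemma eq_acoef f g j : (forall z, normc z < 1 -> f z = g z) -> acoef f j = acoef g j.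
Proof.
move=> fg; rewrite /acoef; congr (_ * _); apply: eq_cmean => t; rewrite fg //.
by rewrite normcM normcR normc_cis mulr1 ger0_norm ?invr_ge0 //; clear; lra.
Qed.

Lemma acoefB f g j : analytic_on_disc f -> analytic_on_disc g ->
  acoef (fun z => f z - g z) j = acoef f j - acoef g j.
Proof.
move=> fa ga; rewrite (@eq_acoef _ (fun z => f z + (-1) * g z)); last by move=> z _; rewrite mulN1r.
by rewrite (acoefD j fa (@analyticZ (-1) g ga)) (acoefZ (-1) j ga) mulN1r.
Qed.

Lemma acoef_dilate s f j : 0 <= s <= 1 -> analytic_on_disc f ->
  acoef (dilate s f) j = (s ^+ j)%:C * acoef f j.
Proof.
move=> s01 fa.
suff H : power_rep (fun j => (s ^+ j)%:C * acoef f j) (dilate s f).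
  by rewrite (acoef_unique (analytic_dilate s01 fa) H).
move=> r hr e e0; have [N0 hN] := taylor fa hr e0.
exists N0 => N NN z zr; have := hN N NN (s%:C * z) (normc_dilate_le s01 zr).
rewrite /dilate /psum; congr (normc (_ - _) <= _); apply: eq_bigr => i _.
by rewrite exprMn rmorphXn mulrA [acoef f i * _]mulrC.
Qed.

Lemma cder_unique f z l m : cder f z l -> cder f z m -> l = m.
Proof.
move=> hl hm; apply: normc_small_eq => e e0; have e2 : 0 < e / 2 by rewrite divr_gt0.
have [d d0 hd] := hl _ e2; have [d' d'0 hd'] := hm _ e2.
pose eta := Num.min (d / 2) (d' / 2).
have eta0 : 0 < eta by rewrite lt_min !divr_gt0.
have [e1 e3] : eta <= d / 2 /\ eta <= d' / 2 by split; rewrite /eta ge_min lexx ?orbT.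
pose w := z + eta%:C.
have wz : w - z = eta%:C by rewrite /w addrC addKr.
have nw : normc (w - z) = eta by rewrite wz normcR gtr0_norm.
have h1 := hd w ltac:(rewrite nw; move: e1 d0; clear; lra).
have h2 := hd' w ltac:(rewrite nw; move: e3 d'0; clear; lra).
rewrite -(ler_pM2r eta0) -nw -normcM.
rewrite (_ : (l - m) * (w - z) = (f w - f z - m * (w - z)) - (f w - f z - l * (w - z))); last by ring.
by rewrite (le_trans (le_normcD _ _)) // normcN (splitr e) mulrDl lerD.
Qed.

Definition cderiv f z : R[i] := xget 0 [set l | cder f z l].

Lemma cderivE f z l : cder f z l -> cderiv f z = l.
Proof. by move=> hl; rewrite /cderiv; case: xgetP => [m _ hm|/(_ l)] //; exact: cder_unique hm hl. Qed.

Lemma cderivP f z : analytic_on_disc f -> normc z < 1 -> cder f z (cderiv f z).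
Proof. by move=> fa z1; have [l hl] := analytic_cder fa z1; rewrite (cderivE hl). Qed.

Lemma power_rep_cderiv f : analytic_on_disc f -> power_rep (pderiv (acoef f)) (cderiv f).
Proof.
move=> fa; have ha := acoef_radius_ge1 fa.
have [g gr] := power_sum_exists (radius_ge1_pderiv ha).
move=> r hr e e0; have [N0 hN] := gr r hr e e0; exists N0 => N NN z zr.
have z1 : normc z < 1 by case/andP: hr => _; exact: le_lt_trans.
by rewrite (cderivE (power_rep_cder ha (taylor fa) gr z1)) hN.
Qed.

Lemma analytic_cderiv f : analytic_on_disc f -> analytic_on_disc (cderiv f).
Proof.
by move=> fa; exact: power_rep_analytic (radius_ge1_pderiv (acoef_radius_ge1 fa)) (power_rep_cderiv fa).
Qed.

Definition euler f z := z * cderiv f z.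

Lemma analytic_euler f : analytic_on_disc f -> analytic_on_disc (euler f).
Proof. by move=> fa; apply: analyticM; [exact: analytic_id | exact: analytic_cderiv]. Qed.

Lemma acoef_euler f j : analytic_on_disc f -> acoef (euler f) j = j%:R * acoef f j.
Proof.
move=> fa.
suff H : power_rep (fun j => j%:R * acoef f j) (euler f).
  by rewrite (acoef_unique (analytic_euler fa) H).
move=> r hr e e0; have [N0 hN] := power_rep_cderiv fa hr e0.
exists N0.+1 => -[//|N] NN z zr; have := hN N NN z zr.
rewrite psum_recl mul0r add0r /euler -mulrBr normcM => h; apply: le_trans h.
by rewrite ler_piMl // (le_trans zr) // ltW //; case/andP: hr.
Qed.

Lemma eulerX f n z : analytic_on_disc f -> normc z < 1 ->
  euler (fun z => f z ^+ n.+1) z = n.+1%:R * f z ^+ n * euler f z.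
Proof.
move=> fa z1; rewrite /euler (cderivE (cderX n.+1 (cderivP fa z1))) /=; ring.
Qed.

Lemma eulerD f g z : analytic_on_disc f -> analytic_on_disc g -> normc z < 1 ->
  euler (fun z => f z + g z) z = euler f z + euler g z.
Proof.
by move=> fa ga z1; rewrite /euler (cderivE (cderD (cderivP fa z1) (cderivP ga z1))) mulrDr.
Qed.

Lemma eulerZ k f z : analytic_on_disc f -> normc z < 1 ->
  euler (fun z => k * f z) z = k * euler f z.
Proof.
by move=> fa z1; rewrite /euler (cderivE (cderZ k (cderivP fa z1))); ring.
Qed.

Lemma euler_dilate s f z : 0 <= s <= 1 -> analytic_on_disc f -> normc z < 1 ->
  euler (dilate s f) z = dilate s (euler f) z.
Proof.
move=> s01 fa z1.
have sz : normc (s%:C * z) < 1 by apply: le_lt_trans (normc_dilate_le s01 (lexx _)) z1.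
have h := cder_comp (cderZ s%:C (@cder_id R z)) (cderivP fa sz).
by rewrite /euler /dilate (cderivE h); ring.
Qed.

End TaylorExpansion.

(** * Linear changes of variables in the plane *)

Section LineTransformations.
Variable R : realType.
Local Open Scope ereal_scope.
Notation mu := (@lebesgue_measure R).
Implicit Types (g : measurableTypeR R -> \bar R) (c r : R).

Lemma measurable_shift c : measurable_fun setT (fun x : measurableTypeR R => (x + c)%R : measurableTypeR R).
Proof. by apply: measurable_funD => //; exact: measurable_id. Qed.

Lemma measurable_scale r : measurable_fun setT (fun x : measurableTypeR R => (r * x)%R : measurableTypeR R).
Proof. by apply: measurable_funM => //; exact: measurable_id. Qed.

Lemma lebesgue_shift c (A : set (measurableTypeR R)) : measurable A ->
  mu A = pushforward mu (fun x : measurableTypeR R => (x + c)%R : measurableTypeR R) A.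
Proof.
have mc := measurable_shift c.
apply: (@lebesgue_measure_unique R (measure_function_pushforward__canonical__measure_function_Measure mu mc)).
move=> _ [[a b] _ <-] /=; rewrite /pushforward.
rewrite (_ : (fun x : R => (x + c)%R) @^-1` `]a, b]%classic = `](a - c)%R, (b - c)%R]%classic); last first.
  by apply/seteqP; split=> x /=; rewrite !in_itv /= ltrBlDr lerBrDr.
rewrite !lebesgue_measure_itv /= !lte_fin ltrD2r; case: ifP => // _.
by rewrite -!EFinB; congr (_%:E); ring.
Qed.

Lemma lebesgue_scale r (A : set (measurableTypeR R)) : (0 < r)%R -> measurable A ->
  mu A = r%:E * pushforward mu (fun x : measurableTypeR R => (r * x)%R : measurableTypeR R) A.
Proof.
move=> r0; have mc := measurable_scale r.
pose m' := (measure_function_pushforward__canonical__measure_function_Measure mu mc).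
apply: (@lebesgue_measure_unique R (mscale (NngNum (ltW r0)) m')).
move=> _ [[a b] _ <-] /=; rewrite /mscale /= /pushforward.
rewrite (_ : (fun x : R => (r * x)%R) @^-1` `]a, b]%classic = `](a / r)%R, (b / r)%R]%classic); last first.
  by apply/seteqP; split=> x /=; rewrite !in_itv /= ltr_pdivrMr // ler_pdivlMr // ![(x * r)%R]mulrC.
rewrite !lebesgue_measure_itv /= !lte_fin ltr_pM2r ?invr_gt0 //; case: ifP => _; last by rewrite mule0.
by rewrite -!EFinB -EFinM; congr (_%:E); field; rewrite gt_eqF.
Qed.

Lemma ge0_integral_shift c g : measurable_fun setT g -> (forall x, 0 <= g x) ->
  \int[mu]_x g (x + c)%R = \int[mu]_x g x.
Proof.
move=> mg g0; have mc := measurable_shift c.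
pose m' := (measure_function_pushforward__canonical__measure_function_Measure mu mc).
transitivity (\int[m']_x g x).
  by rewrite (ge0_integral_pushforward mc) // preimage_setT.
by apply: eq_measure_integral => A mA _; rewrite /m' /= -lebesgue_shift.
Qed.

Lemma ge0_integral_scale r g : (0 < r)%R -> measurable_fun setT g -> (forall x, 0 <= g x) ->
  r%:E * \int[mu]_x g (r * x)%R = \int[mu]_x g x.
Proof.
move=> r0 mg g0; have mc := measurable_scale r.
pose m' := (measure_function_pushforward__canonical__measure_function_Measure mu mc).
transitivity (\int[mscale (NngNum (ltW r0)) m']_x g x).
  rewrite ge0_integral_mscale //; congr (_ * _).
  by rewrite (ge0_integral_pushforward mc) // preimage_setT.
by apply: eq_measure_integral => A mA _; rewrite [LHS]/= /mscale /= -lebesgue_scale.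
Qed.

Lemma ge0_integral_periodic g (b T : R) : measurable_fun setT g -> (forall x, 0 <= g x) ->
  (forall x, g (x + T)%R = g x) -> (0 <= b <= T)%R ->
  \int[mu]_(x in `[0%R, T]) g (x + b)%R = \int[mu]_(x in `[0%R, T]) g x.
Proof.
move=> mg g0 gT /andP[b0 bT].
have mr (X : set (measurableTypeR R)) : measurable X -> measurable_fun setT (g \_ X).
  by move=> mX; apply/(measurable_restrictT g mX); exact: measurable_funS mg.
have mgb : measurable_fun setT (fun x : measurableTypeR R => g (x + b)%R).
  exact: measurableT_comp mg (measurable_shift b).
have cc (u : measurableTypeR R -> \bar R) (x y : R) : measurable_fun setT u ->
    \int[mu]_(t in `[x, y]) u t = \int[mu]_(t in `[x, y[) u t.
  by move=> mu'; rewrite -integral_itv_bndo_bndc //; exact: measurable_funS mu'.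
have shift (u : measurableTypeR R -> \bar R) (x y c : R) : measurable_fun setT u -> (forall t, 0 <= u t) ->
    \int[mu]_(t in `[x, y[) u (t + c)%R = \int[mu]_(t in `[(x + c)%R, (y + c)%R[) u t.
  move=> mu' u0; rewrite [LHS]integral_mkcond [RHS]integral_mkcond.
  rewrite -[RHS](ge0_integral_shift c) //.
  - apply: eq_integral => t _; rewrite !patchE; congr (if _ then _ else _).
    by apply/idP/idP; rewrite !inE /= !in_itv /= lerD2r ltrD2r.
  - by apply/(measurable_restrictT u (measurable_itv _)); exact: measurable_funS mu'.
  - by move=> t; rewrite patchE; case: ifP.
have split (u : measurableTypeR R -> \bar R) (x y z : R) : (x <= y)%R -> (y <= z)%R -> measurable_fun setT u -> (forall t, 0 <= u t) ->
    \int[mu]_(t in `[x, z[) u t = \int[mu]_(t in `[x, y[) u t + \int[mu]_(t in `[y, z[) u t.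
  move=> xy yz mu' u0.
  rewrite (@itv_bndbnd_setU _ _ (BLeft x) (BLeft y) (BLeft z)) ?bnd_simp //.
  rewrite ge0_integral_setU //.
  - exact: measurable_funS mu'.
  - apply/disj_setPS => t [/=]; rewrite !in_itv /= => /andP[_ ty] /andP[].
    by rewrite leNgt ty.
rewrite !cc // shift // add0r (split _ b T) //; last by rewrite lerDl.
rewrite [RHS](split _ 0%R b) // addeC; congr (_ + _).
have := shift g 0%R b T mg g0; rewrite add0r (addrC b T) => <-.
by apply: eq_integral => t _; rewrite gT.
Qed.

End LineTransformations.

Section PlaneTransformations.
Variable R : realType.
Local Open Scope ereal_scope.
Notation leb := (@lebesgue_measure R).
Notation mu2 := (leb \x leb).
Implicit Types (h : plane R -> \bar R) (c s r : R).

Lemma measurable_pair_R d (T : measurableType d) (f1 f2 : T -> measurableTypeR R) :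
  measurable_fun setT f1 -> measurable_fun setT f2 ->
  measurable_fun setT (fun t => (f1 t, f2 t) : plane R).
Proof. by move=> m1 m2; exact/measurable_fun_pair. Qed.

Lemma measurable_lin a b : measurable_fun setT (fun w : plane R => (a * w.1 + b * w.2)%R : measurableTypeR R).
Proof.
by apply: measurable_funD; apply: measurable_funM; try exact: measurable_cst;
  [exact: measurable_fst|exact: measurable_snd].
Qed.

Lemma measurable_linmap a b c d :
  measurable_fun setT (fun w : plane R => ((a * w.1 + b * w.2)%R, (c * w.1 + d * w.2)%R) : plane R).
Proof. by apply: measurable_pair_R; exact: measurable_lin. Qed.

Lemma tonelli_xy h : measurable_fun setT h -> (forall w, 0 <= h w) ->
  \int[mu2]_w h w = \int[leb]_x \int[leb]_y h (x, y).
Proof. by move=> mh h0; exact: (@fubini_tonelli1 _ _ _ _ R leb leb h mh h0). Qed.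

Lemma tonelli_yx h : measurable_fun setT h -> (forall w, 0 <= h w) ->
  \int[mu2]_w h w = \int[leb]_y \int[leb]_x h (x, y).
Proof. by move=> mh h0; exact: (@fubini_tonelli2 _ _ _ _ R leb leb h mh h0). Qed.

Lemma integral_shear_y h c : measurable_fun setT h -> (forall w, 0 <= h w) ->
  \int[mu2]_w h (w.1, (w.2 + c * w.1)%R) = \int[mu2]_w h w.
Proof.
move=> mh h0.
have ms : measurable_fun setT (fun w : plane R => (w.1, (w.2 + c * w.1)%R) : plane R).
  have := measurable_linmap 1 0 c 1; congr measurable_fun.
  by apply/funext => w; rewrite !mul1r mul0r addr0 addrC.
transitivity (\int[leb]_x \int[leb]_y h (x, (y + c * x)%R)).
  exact: (tonelli_xy (measurableT_comp mh ms) (fun w => h0 _)).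
rewrite [RHS](tonelli_xy mh h0); apply: eq_integral => x _ /=.
apply: (ge0_integral_shift (c * x) (g := fun y => h (x, y))) => //.
exact: measurableT_comp mh (measurable_pair1 _).
Qed.

Lemma integral_shear_x h c : measurable_fun setT h -> (forall w, 0 <= h w) ->
  \int[mu2]_w h ((w.1 + c * w.2)%R, w.2) = \int[mu2]_w h w.
Proof.
move=> mh h0.
have ms : measurable_fun setT (fun w : plane R => ((w.1 + c * w.2)%R, w.2) : plane R).
  have := measurable_linmap 1 c 0 1; congr measurable_fun.
  by apply/funext => w; rewrite !mul1r mul0r add0r.
transitivity (\int[leb]_y \int[leb]_x h ((x + c * y)%R, y)).
  exact: (tonelli_yx (measurableT_comp mh ms) (fun w => h0 _)).
rewrite [RHS](tonelli_yx mh h0); apply: eq_integral => y _ /=.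
apply: (ge0_integral_shift (c * y) (g := fun x => h (x, y))) => //.
exact: measurableT_comp mh (measurable_pair2 _).
Qed.

Definition plane_rot (t : R) (w : plane R) : plane R :=
  ((cos t * w.1 - sin t * w.2)%R, (sin t * w.1 + cos t * w.2)%R).

Lemma measurable_rot t : measurable_fun setT (plane_rot t).
Proof.
have := measurable_linmap (cos t) (- sin t) (sin t) (cos t); congr measurable_fun.
by apply/funext => w; rewrite mulNr.
Qed.

(** Rotation by t is the product of three shears with factors - tan (t / 2),
    sin t and - tan (t / 2). *)
Lemma integral_rot_ne h t : cos t != (-1)%R -> measurable_fun setT h -> (forall w, 0 <= h w) ->
  \int[mu2]_w h (plane_rot t w) = \int[mu2]_w h w.
Proof.
move=> ct mh h0; pose k := (- (sin t / (1 + cos t)))%R.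
have m1 (c : R) : measurable_fun setT (fun w : plane R => ((w.1 + c * w.2)%R, w.2) : plane R).
  have := measurable_linmap 1 c 0 1; congr measurable_fun.
  by apply/funext => w; rewrite !mul1r mul0r add0r.
have m2 (c : R) : measurable_fun setT (fun w : plane R => (w.1, (w.2 + c * w.1)%R) : plane R).
  have := measurable_linmap 1 0 c 1; congr measurable_fun.
  by apply/funext => w; rewrite !mul1r mul0r addr0 addrC.
rewrite -[RHS](integral_shear_x k mh h0).
have mh1 := measurableT_comp mh (m1 k).
rewrite -[RHS](integral_shear_y (sin t) mh1 (fun w => h0 _)).
have mh2 := measurableT_comp mh1 (m2 (sin t)).
rewrite -[RHS](integral_shear_x k mh2 (fun w => h0 _)).
apply: eq_integral => -[x y] _ /=; congr h; rewrite /plane_rot /= /k.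
have c1 : (1 + cos t != 0)%R by rewrite addrC addr_eq0.
have e := cos2Dsin2 t; have e' : (sin t ^+ 2 = 1 - cos t ^+ 2)%R by rewrite -e; ring.
have E : (sin t * (sin t / (1 + cos t)) = 1 - cos t)%R.
  by rewrite mulrA -expr2 e'; field.
have E2 : (sin t / (1 + cos t) * cos t = sin t - sin t / (1 + cos t))%R by field.
congr (_, _); last first.
  transitivity (sin t * x + (1 - sin t * (sin t / (1 + cos t))) * y)%R; last by ring.
  by rewrite E; ring.
transitivity ((1 - sin t * (sin t / (1 + cos t))) * x - (sin t / (1 + cos t) + (sin t / (1 + cos t)) * (1 - sin t * (sin t / (1 + cos t)))) * y)%R; last by ring.
by rewrite E [(1 - (1 - _))%R](_ : _ = cos t) ?E2; ring.
Qed.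

Lemma rotD s t w : plane_rot (s + t) w = plane_rot s (plane_rot t w).
Proof. by rewrite /plane_rot /= cosD sinD; congr (_, _); ring. Qed.

(** At t = pi, where tan (t / 2) is infinite, rotate twice by t / 2. *)
Lemma integral_rot h t : measurable_fun setT h -> (forall w, 0 <= h w) ->
  \int[mu2]_w h (plane_rot t w) = \int[mu2]_w h w.
Proof.
move=> mh h0; have [ct|] := eqVneq (cos t) (-1)%R; last by move=> ?; exact: integral_rot_ne.
have c2 : cos (t / 2) != (-1)%R :> R.
  apply/eqP => c2; have := ct; rewrite {1}(splitr t) cosD -!expr2.
  have := cos2Dsin2 (t / 2); rewrite c2; set S := (sin _ ^+ 2)%R; rewrite sqrrN expr1n.
  by clear => ? ?; exfalso; lra.
have E : forall w, plane_rot t w = plane_rot (t / 2) (plane_rot (t / 2) w) by move=> w; rewrite -rotD -splitr.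
under eq_integral do rewrite E.
rewrite (integral_rot_ne (h := fun w => h (plane_rot (t / 2) w)) c2) //.
  exact: integral_rot_ne.
exact: measurableT_comp mh (measurable_rot _).
Qed.

Lemma integral_dilate h r : (0 < r)%R -> measurable_fun setT h -> (forall w, 0 <= h w) ->
  (r ^+ 2)%:E * \int[mu2]_w h ((r * w.1)%R, (r * w.2)%R) = \int[mu2]_w h w.
Proof.
move=> r0 mh h0.
have ms : measurable_fun setT (fun w : plane R => ((r * w.1)%R, (r * w.2)%R) : plane R).
  have := measurable_linmap r 0 0 r; congr measurable_fun.
  by apply/funext => w; rewrite !mul0r addr0 add0r.
rewrite [X in _ * X](_ : _ = \int[leb]_x \int[leb]_y h ((r * x)%R, (r * y)%R)); last first.
  exact: (tonelli_xy (measurableT_comp mh ms) (fun w => h0 _)).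
rewrite [RHS](tonelli_xy mh h0).
rewrite expr2 EFinM -muleA.
have mF := @measurable_fun_fubini_tonelli_F _ _ _ _ R leb _ mh h0.
rewrite -(ge0_integral_scale r0 mF) //; last by move=> x; exact: integral_ge0.
congr (_ * _); rewrite -ge0_integralZl //; last 3 first.
- exact: (@measurable_fun_fubini_tonelli_F _ _ _ _ R leb _ (measurableT_comp mh ms) (fun w => h0 _)).
- by move=> x _; exact: integral_ge0.
- by rewrite lee_fin ltW.
apply: eq_integral => x _ /=.
apply: (ge0_integral_scale r0 (g := fun y => h ((r * x)%R, y))) => //.
exact: measurableT_comp mh (measurable_pair1 _).
Qed.

End PlaneTransformations.

(** * Polar coordinates *)

Section Area.
Variable R : realType.
Local Open Scope ereal_scope.

(** Lebesgue measure on the plane under a name of its own, which carries the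
    sigma-finiteness that Tonelli's theorem asks for. *)
Definition area : set (plane R) -> \bar R := planar_measure R.

HB.instance Definition _ := Measure.copy area (planar_measure R).

Lemma sigma_finite_area : sigma_finite [set: plane R] area.
Proof.
by case: (lebesgue_integral_fubini.measure_function_Measure_isSigmaFinite__to__measure_function_isSigmaFinite
  (@lebesgue_measure R) (@lebesgue_measure R)).
Qed.

HB.instance Definition _ :=
  Measure_isSigmaFinite.Build _ (plane R) R area sigma_finite_area.

End Area.
Arguments area : clear implicits.

Section PolarCoordinates.
Variable R : realType.
Local Open Scope ereal_scope.
Notation leb := (@lebesgue_measure R).
Notation mu2 := (leb \x leb).
Notation disc := (@planar_disc R).
Implicit Types (h : plane R -> \bar R) (t : R).

Definition sqmod (w : plane R) : R := (w.1 ^+ 2 + w.2 ^+ 2)%R.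

Lemma measurable_sqmod : measurable_fun setT (sqmod : plane R -> measurableTypeR R).
Proof.
by apply: measurable_funD; apply: measurable_funX; [exact: measurable_fst | exact: measurable_snd].
Qed.

Lemma sqmod_ge0 w : (0 <= sqmod w)%R.
Proof. by rewrite addr_ge0 // sqr_ge0. Qed.

Lemma sqmodE (w : plane R) : sqmod w = (normc (to_C w) ^+ 2)%R.
Proof. by rewrite normc_sqr. Qed.

Lemma in_disc (w : plane R) : disc w <-> (sqmod w < 1)%R.
Proof. by rewrite planar_discE. Qed.

Definition sigma_factor : R := (fine (planar_measure R disc))^-1.

Lemma sigma_factor_ge0 : (0 <= sigma_factor)%R.
Proof. exact: planar_disc_measure_inv_ge0. Qed.

Lemma sigmaE (A : set (plane R)) : sigma R A = sigma_factor%:E * mu2 A.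
Proof. by []. Qed.

Lemma integral_sigma h : measurable_fun setT h -> (forall w, 0 <= h w) ->
  \int[sigma R]_w h w = sigma_factor%:E * \int[mu2]_w h w.
Proof. by move=> mh h0; rewrite /sigma ge0_integral_mscale. Qed.

Lemma sigma_rot h t : measurable_fun setT h -> (forall w, 0 <= h w) ->
  \int[sigma R]_w h (plane_rot t w) = \int[sigma R]_w h w.
Proof.
move=> mh h0; rewrite !integral_sigma ?integral_rot //.
exact: measurableT_comp mh (measurable_rot _).
Qed.

Lemma measurable_subdisc t : measurable ([set w | (sqmod w < t)%R] : set (plane R)).
Proof.
have := measurable_sqmod measurableT (measurable_itv `]-oo, t[).
rewrite setTI; congr measurable; apply/seteqP; split=> w /=; rewrite in_itv //=.
Qed.

(** Area scales with the square of the radius, which is the parameter t here. *)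
Lemma sigma_subdisc t : (0 <= t <= 1)%R -> sigma R [set w | (sqmod w < t)%R] = t%:E.
Proof.
move=> /andP[]; rewrite le_eqVlt => /predU1P[<- _|t0 t1].
  rewrite (_ : [set w | _] = set0) ?measure0 //; apply/seteqP; split=> w //=.
  by rewrite ltNge sqmod_ge0.
pose r := (Num.sqrt t)^-1%R.
have st : (0 < Num.sqrt t)%R by rewrite sqrtr_gt0.
have r0 : (0 < r)%R by rewrite invr_gt0.
have r2 : (r ^+ 2 = t^-1)%R by rewrite exprVn sqr_sqrtr // ltW.
have mD := @measurable_planar_disc R.
have mi : measurable_fun setT (fun w : plane R => (\1_disc w : R)%:E).
  by apply/measurable_EFinP; exact: measurable_indic.
have := integral_dilate r0 mi (fun w => ltac:(by rewrite lee_fin)).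
have I1 : \int[mu2]_w (\1_disc w : R)%:E = mu2 disc by rewrite integral_indic // setIT.
rewrite I1 (_ : \int[mu2]_w _ = mu2 [set w | (sqmod w < t)%R]); last first.
  rewrite -[in RHS](setIT [set w | _]) -integral_indic //; last exact: measurable_subdisc.
  apply: eq_integral => w _; rewrite !indicE; congr ((nat_of_bool _)%:R%:E).
  apply/idP/idP; rewrite !inE /= planar_discE /= /sqmod !exprMn -mulrDr r2.
    by rewrite mulrC ltr_pdivrMr // mul1r.
  by rewrite mulrC ltr_pdivrMr // mul1r.
rewrite r2 => E.
have := @sigma_planar_disc R; rewrite !sigmaE -E muleCA => E1.
rewrite -[LHS]mul1e -(divff (lt0r_neq0 t0)) EFinM -muleA.
by rewrite E1 mule1.
Qed.

(** |z|^2 is uniformly distributed on [0, 1) under sigma; half-lines suffice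
    to compare the two measures. *)
Lemma sigma_radial (A : set (measurableTypeR R)) : measurable A -> A `<=` `[0%R, 1%R[%classic ->
  sigma R (sqmod @^-1` A) = leb A.
Proof.
move=> mA A01; have mN := measurable_sqmod.
have mD := @measurable_planar_disc R.
pose m1 : {measure set (measurableTypeR R) -> \bar R} := measure_function_pushforward__canonical__measure_function_Measure
  (measure_function_mrestr__canonical__measure_function_Measure (sigma R) mD) mN.
pose m2 : {measure set (measurableTypeR R) -> \bar R} := measure_function_mrestr__canonical__measure_function_Measure leb (measurable_itv `[0%R, 1%R[).
have : m1 A = m2 A; last first.
  rewrite /m1 /m2 /= /pushforward /mrestr (setIidl A01) => <-; congr (sigma R _).
  apply/seteqP; split=> w /=; last by case.
  by move=> Aw; split=> //; apply/in_disc; move: (A01 _ Aw); rewrite /= in_itv /= => /andP[].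
have ci (x : R) : (0 <= x <= 1)%R -> sigma R ([set w | (x <= sqmod w)%R] `&` disc) = (1 - x)%:E.
  move=> x01; rewrite EFinB -(@sigma_planar_disc R) -(sigma_subdisc x01).
  have mx := @measurable_subdisc x.
  have fx : sigma R [set w | (sqmod w < x)%R] \is a fin_num by rewrite sigma_subdisc.
  have sub : [set w | (sqmod w < x)%R] `<=` disc.
    by move=> w /= wx; apply/in_disc; apply: lt_le_trans wx _; case/andP: x01.
  rewrite [in RHS](_ : disc = ([set w | (x <= sqmod w)%R] `&` disc) `|` [set w | (sqmod w < x)%R]); last first.
    apply/seteqP; split=> w /=; last by case=> [[]|/sub].
    by move=> dw; case: (leP x (sqmod w)) => h; [left|right].
  rewrite measureU //; [by rewrite addeK| |].
  - apply: measurableI => //; rewrite (_ : [set w | _] = ~` [set w | (sqmod w < x)%R]).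
      exact: measurableC.
    by apply/seteqP; split=> w /=; [move=> h; apply/negP; rewrite -leNgt|move/negP; rewrite -leNgt].
  - by apply/seteqP; split=> w //= [[h _]]; rewrite ltNge h.
have MU := @measure_unique _ R (measurableTypeR R) (@RGenCInfty.G R) (fun k : nat => `[(- k%:R)%R, +oo[%classic).
apply: (MU _ _ _ _ m1 m2) => //.
- exact: RGenCInfty.measurableE.
- move=> _ _ [x ->] [y ->]; exists (Num.max x y); apply/seteqP; split=> z /=.
    by rewrite !in_itv /= !andbT ge_max => -[-> ->].
  by rewrite !in_itv /= !andbT ge_max => /andP[-> ->].
- by move=> k; exists (- k%:R)%R.
- apply/seteqP; split=> // x _; exists (Num.truncn `|x|).+1 => //=.
  rewrite in_itv /= andbT lerNl; apply: le_trans (ler_norm _) _.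
  by rewrite normrN; apply: ltW; exact: truncnS_gt.
- move=> _ [x ->]; rewrite /m1 /m2 /= /pushforward /mrestr.
  have -> : sqmod @^-1` `[x, +oo[ = [set w | (x <= sqmod w)%R].
    by apply/seteqP; split=> w /=; rewrite in_itv /= andbT.
  have [x0|x0] := leP x 0%R.
    rewrite (_ : _ `&` disc = disc); last first.
      by apply/seteqP; split=> w /= => [[]|dw] //; split => //; exact: le_trans x0 (sqmod_ge0 _).
    rewrite (_ : _ `&` _ = `[0%R, 1%R[%classic); last first.
      apply/seteqP; split=> w /=; rewrite !in_itv /= ?andbT; first by case.
      by move=> /andP[w0 w1]; rewrite w0 w1 (le_trans x0).
    rewrite lebesgue_measure_itv /= lte_fin ltr01 sube0; exact: sigma_planar_disc.
  have [x1|x1] := leP x 1%R.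
    rewrite ci ?(ltW x0) // (_ : _ `&` _ = `[x, 1%R[%classic); last first.
      apply/seteqP; split=> w /=; rewrite !in_itv /= ?andbT; first by case=> -> /andP[_ ->].
      by move=> /andP[w0 w1]; rewrite w0 w1 (le_trans (ltW x0)).
    rewrite lebesgue_measure_itv /= lte_fin; case: ltP => // h.
    by rewrite (le_anti (_ : (x <= 1 <= x)%R)) ?subrr // x1 h.
  rewrite (_ : _ `&` disc = set0); last first.
    by apply/seteqP; split=> w //= [h /in_disc]; rewrite ltNge (le_trans (ltW x1) h).
  rewrite (_ : _ `&` _ = set0) ?measure0 //.
  apply/seteqP; split=> w //=; rewrite !in_itv /= andbT => -[h /andP[_]].
  by rewrite ltNge (le_trans (ltW x1)).
- move=> k; rewrite /m1 /= /pushforward /mrestr; apply: (@le_lt_trans _ _ (sigma R disc)).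
    apply: le_measure; rewrite ?inE //; apply: measurableI => //.
    by have := mN measurableT _ (measurable_itv `[(- k%:R)%R, +oo[); rewrite setTI.
  by rewrite sigma_planar_disc ltry.
Qed.

Lemma radial_integral (G : measurableTypeR R -> \bar R) : measurable_fun setT G -> (forall t, 0 <= G t) ->
  \int[sigma R]_(w in disc) G (sqmod w) = \int[leb]_(t in `[0%R, 1%R[) G t.
Proof.
move=> mG G0; have mN := measurable_sqmod.
pose m1 := measure_function_pushforward__canonical__measure_function_Measure (sigma R) mN.
transitivity (\int[m1]_(t in `[0%R, 1%R[) G t).
  rewrite (ge0_integral_pushforward mN) //; last exact: measurable_funS mG.
  rewrite (_ : sqmod @^-1` _ = disc) //; apply/seteqP; split=> w /=; rewrite in_itv /= sqmod_ge0 /=.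
    by move=> ?; exact/in_disc.
  by move=> /in_disc.
by apply: eq_measure_integral => A mA A01; exact: sigma_radial.
Qed.

Definition polar (s : R) (a : R) : plane R := ((Num.sqrt s * cos a)%R, (Num.sqrt s * sin a)%R).

(** The parameter s is the squared radius: polar coordinates then have no
    Jacobian. *)
Definition circ_avg h (s : R) : \bar R :=
  (2 * pi)^-1%:E * \int[leb]_(a in `[0%R, (2 * pi)%R]) h (polar s a).

Lemma measurable_cosR : measurable_fun setT (cos : measurableTypeR R -> measurableTypeR R).
Proof. by apply: continuous_measurable_fun; exact: continuous_cos. Qed.

Lemma measurable_sinR : measurable_fun setT (sin : measurableTypeR R -> measurableTypeR R).
Proof. by apply: continuous_measurable_fun; exact: continuous_sin. Qed.

Lemma measurable_sqrtR : measurable_fun setT (Num.sqrt : measurableTypeR R -> measurableTypeR R).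
Proof. by apply: continuous_measurable_fun; exact: sqrt_continuous. Qed.

Lemma measurable_polar2 : measurable_fun setT (fun u : plane R => polar u.1 u.2 : plane R).
Proof.
apply: measurable_pair_R; apply: measurable_funM.
- exact: measurableT_comp measurable_sqrtR measurable_fst.
- exact: measurableT_comp measurable_cosR measurable_snd.
- exact: measurableT_comp measurable_sqrtR measurable_fst.
- exact: measurableT_comp measurable_sinR measurable_snd.
Qed.

Lemma polar_sqmod (w : plane R) : exists2 b : R, (0 <= b <= 2 * pi)%R & w = polar (sqmod w) b.
Proof.
have [b hb E] := polar_form (to_C w); exists b => //.
have E1 := congr1 (@complex.Re R) E; have E2 := congr1 (@complex.Im R) E.
rewrite Re_scale in E1; rewrite Im_scale in E2.
rewrite /polar sqmodE sqrtr_sqr ger0_norm //.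
by apply: injective_projections; [exact: E1 | exact: E2].
Qed.

Lemma measurable_patch_snd h : measurable_fun setT h ->
  measurable_fun setT (fun u : plane R => ((fun a => h (polar u.1 a)) \_ `[0%R, (2 * pi)%R]) u.2).
Proof.
move=> mh.
pose S : set (plane R) := setT `*` `[0%R, (2 * pi)%R]%classic.
have mS : measurable S by apply: measurableX => //; exact: measurable_itv.
rewrite (_ : (fun u => _) = (fun u : plane R => h (polar u.1 u.2)) \_ S); last first.
  apply/funext => -[s a] /=; rewrite !patchE; congr (if _ then _ else _).
  by apply/idP/idP; rewrite !inE /S /= => // -[].
apply/(measurable_restrictT _ mS); apply: (@measurable_funS _ _ _ _ setT) => //.
exact: measurableT_comp mh measurable_polar2.
Qed.

Lemma measurable_circ_avg h : measurable_fun setT h -> (forall w, 0 <= h w) ->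
  measurable_fun setT (circ_avg h : measurableTypeR R -> \bar R).
Proof.
move=> mh h0; apply: measurable_funeM.
have mp := measurable_patch_snd mh.
have p0 (u : plane R) : 0 <= ((fun a => h (polar u.1 a)) \_ `[0%R, (2 * pi)%R]) u.2.
  by rewrite patchE; case: ifP.
have := @measurable_fun_fubini_tonelli_F _ _ _ _ R leb _ mp p0.
congr measurable_fun; apply/funext => s; rewrite /fubini_F.
by rewrite [RHS]integral_mkcond.
Qed.

Lemma circ_avg_ge0 h s : (forall w, 0 <= h w) -> 0 <= circ_avg h s.
Proof.
move=> h0; apply: mule_ge0; last by apply: integral_ge0.
by rewrite lee_fin invr_ge0 mulr_ge0 // pi_ge0.
Qed.

(** Averaging over all rotations turns h into a radial function, and the
    squared modulus is uniform on [0, 1) under sigma. *)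
Theorem polar_integral h : measurable_fun setT h -> (forall w, 0 <= h w) ->
  \int[sigma R]_(w in disc) h w = \int[leb]_(s in `[0%R, 1%R[) circ_avg h s.
Proof.
move=> mh h0; have mD := @measurable_planar_disc R.
pose g : plane R -> \bar R := h \_ disc.
have mg : measurable_fun setT g by apply/(measurable_restrictT h mD); exact: measurable_funS mh.
have g0 w : 0 <= g w by rewrite /g patchE; case: ifP.
rewrite -(radial_integral (measurable_circ_avg mh h0)); last by move=> t; exact: circ_avg_ge0.
rewrite integral_mkcond -/g [RHS]integral_mkcond.
have p0 : (0 < 2 * pi :> R)%R by exact: pi_pos2.
have cT : (2 * pi)%R%:E = leb `[0%R, (2 * pi)%R]%classic by rewrite lebesgue_measure_itv /= lte_fin p0 sube0.
pose f (u : measurableTypeR R * plane R) : \bar R := ((fun a => g (plane_rot a u.2)) \_ `[0%R, (2 * pi)%R]) u.1.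
have mf : measurable_fun setT f.
  pose S : set (measurableTypeR R * plane R) := `[0%R, (2 * pi)%R]%classic `*` setT.
  have mS : measurable S by apply: measurableX => //; exact: measurable_itv.
  rewrite (_ : f = (fun u => g (plane_rot u.1 u.2)) \_ S); last first.
    apply/funext => -[s a] /=; rewrite /f !patchE; congr (if _ then _ else _).
    by apply/idP/idP; rewrite !inE /S /= => // -[].
  apply/(measurable_restrictT _ mS); apply: (@measurable_funS _ _ _ _ setT) => //.
  apply: (measurableT_comp mg); apply: measurable_pair_R.
    apply: measurable_funB; apply: measurable_funM;
      by [exact: measurableT_comp measurable_cosR measurable_fst
         |exact: measurableT_comp measurable_sinR measurable_fst
         |exact: measurableT_comp measurable_fst measurable_snd
         |exact: measurableT_comp measurable_snd measurable_snd].
  apply: measurable_funD; apply: measurable_funM;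
    by [exact: measurableT_comp measurable_cosR measurable_fst
       |exact: measurableT_comp measurable_sinR measurable_fst
       |exact: measurableT_comp measurable_fst measurable_snd
       |exact: measurableT_comp measurable_snd measurable_snd].
have f0 u : 0 <= f u by rewrite /f patchE; case: ifP.
have inner w : \int[leb]_a f (a, w) = (2 * pi)%:E * ((circ_avg h \o sqmod) \_ disc) w.
  transitivity (\int[leb]_(a in `[0%R, (2 * pi)%R]) g (plane_rot a w)).
    by rewrite [RHS]integral_mkcond.
  have rs a : sqmod (plane_rot a w) = sqmod w.
    rewrite /sqmod /plane_rot /=; have := cos2Dsin2 a; set C := cos a; set S := sin a => e.
    transitivity ((C ^+ 2 + S ^+ 2) * (w.1 ^+ 2 + w.2 ^+ 2))%R; first by ring.
    by rewrite e mul1r.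
  rewrite patchE; case: ifP; rewrite ?inE => dw; last first.
    rewrite mule0 integral0_eq // => a _; rewrite /g patchE ifF //.
    apply/negP; rewrite inE => /in_disc; rewrite rs => dw'.
    by move/negP: dw; rewrite inE; apply; exact/in_disc.
  have [b hb wE] := polar_sqmod w.
  rewrite /circ_avg /= muleA -EFinM mulfV ?gt_eqF // mul1e.
  rewrite -(@ge0_integral_periodic R (fun a => h (polar (sqmod w) a)) b (2 * pi)) //.
  - apply: eq_integral => a _; rewrite /g patchE ifT; last by rewrite inE; apply/in_disc; rewrite rs; exact/in_disc.
    congr h; rewrite {1}wE /plane_rot /polar /= cosD sinD; congr (_, _); ring.
  - apply: measurableT_comp mh _; exact: measurableT_comp measurable_polar2 (measurable_pair1 _).
  - by move=> a; rewrite /polar (mulrC 2%R) mulr_natr cosD2pi sinD2pi.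
have outer a : \int[sigma R]_w f (a, w) = ((fun=> \int[sigma R]_w g w) \_ `[0%R, (2 * pi)%R]) a.
  rewrite patchE; case: ifPn => aI.
    rewrite -[RHS](sigma_rot a mg g0); apply: eq_integral => w _.
    by rewrite /f /= patchE aI.
  by apply: integral0_eq => w _; rewrite /f /= patchE (negbTE aI).
have fk : (sigma_factor%:E * mu2 disc = 1) by rewrite -sigmaE sigma_planar_disc.
have k0 := sigma_factor_ge0.
have T1 : \int[leb]_a \int[sigma R]_w f (a, w) = \int[sigma R]_w \int[leb]_a f (a, w).
  transitivity (\int[leb]_a (sigma_factor%:E * \int[mu2]_w f (a, w))).
    apply: eq_integral => a _; apply: integral_sigma => //.
    exact: measurableT_comp mf (measurable_pair1 _).
  rewrite ge0_integralZl //; last 2 first.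
  - exact: (@measurable_fun_fubini_tonelli_F _ _ _ _ R (area R) f mf f0).

  - by move=> a _; apply: integral_ge0 => w _; exact: f0.
  rewrite (@fubini_tonelli _ _ _ _ R leb (area R) f mf f0) -integral_sigma //.
  - exact: (@measurable_fun_fubini_tonelli_G _ _ _ _ R leb f mf f0).
  - by move=> w; apply: integral_ge0 => a _; exact: f0.
have T2 : \int[leb]_a \int[sigma R]_w f (a, w) = \int[sigma R]_w g w * (2 * pi)%:E.
  transitivity (\int[leb]_a ((fun=> \int[sigma R]_w g w) \_ `[0%R, (2 * pi)%R]) a).
    by apply: eq_integral => a _; exact: outer.
  by rewrite -integral_mkcond cT integral_cst.
have T3 : \int[sigma R]_w \int[leb]_a f (a, w) =
    \int[sigma R]_w ((2 * pi)%:E * ((circ_avg h \o sqmod) \_ disc) w).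
  by apply: eq_integral => w _; exact: inner.
move: T1; rewrite {}T2 {}T3.
have mca : measurable_fun setT (circ_avg h \o sqmod).
  exact: measurableT_comp (measurable_circ_avg mh h0) measurable_sqmod.
rewrite ge0_integralZl //; last 3 first.
- by apply/(measurable_restrictT _ mD); exact: measurable_funS mca.
- by move=> w _; rewrite patchE; case: ifP => // _; exact: circ_avg_ge0.
- by rewrite lee_fin ltW.
rewrite muleC => /(congr1 (mule (2 * pi)^-1%:E)).
by rewrite !muleA -!EFinM mulVf ?gt_eqF // !mul1e.
Qed.

End PolarCoordinates.

(** * Parseval's identity *)

Section RealSeries.
Variable R : realType.
Implicit Types (a u : nat -> R) (l c r s K : R).

(** A sequence of radii that increases to 1. *)
Definition rho_ (n : nat) : R := 1 - n.+1%:R^-1.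

Lemma rho_01 n : 0 <= rho_ n < 1.
Proof.
rewrite /rho_ subr_ge0 invf_le1 ?ltr0n // ler1n /=.
by rewrite ltrBlDr ltrDl invr_gt0 ltr0n.
Qed.

Lemma cvg_rho : rho_ @ \oo --> (1 : R).
Proof.
rewrite -[X in _ --> X](subr0 1); apply: cvgB; first exact: cvg_cst.
exact: cvg_harmonic.
Qed.

Lemma rho_le1 n : rho_ n <= 1.
Proof. by have /andP[_ /ltW] := rho_01 n. Qed.

Lemma rho_gt0 n : (0 < n)%N -> 0 < rho_ n.
Proof. by move=> n0; rewrite /rho_ subr_gt0 invf_lt1 ?ltr0n // ltr1n. Qed.

Lemma cvg_rhoX n : (fun i : nat => rho_ i ^+ n) @ \oo --> (1 : R).
Proof.
elim: n => [|n IH]; first exact: cvg_cst.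
have H := cvgM (cvg_rho) IH; rewrite mulr1 in H.
have -> : (fun i : nat => rho_ i ^+ n.+1) = rho_ \* (fun i => rho_ i ^+ n).
  by apply/funext => i /=; rewrite exprS.
exact: H.
Qed.

Lemma cvg_ord_sum N (a : nat -> nat -> R) (l : nat -> R) : (forall j, (fun n => a n j) @ \oo --> l j) ->
  (fun n => \sum_(j < N) a n j) @ \oo --> \sum_(j < N) l j.
Proof.
move=> al; elim: N => [|N IH].
  by rewrite big_ord0 (_ : (fun n => _) = (fun=> 0)); [exact: cvg_cst|apply/funext => n; rewrite big_ord0].
rewrite big_ord_recr /= (_ : (fun n => _) = (fun n => \sum_(j < N) a n j + a n N)); first exact: cvgD.
by apply/funext => n; rewrite big_ord_recr.
Qed.

Lemma cvg_real_eq (u v : nat -> R) (a b : R) : u @ \oo --> a -> v @ \oo --> b -> (forall n, u n = v n) -> a = b.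
Proof.
move=> ua vb /funext uv; rewrite -uv in vb.
by rewrite -(cvg_lim (@Rhausdorff R) ua) (cvg_lim (@Rhausdorff R) vb).
Qed.

Lemma limit_le u l c : u @ \oo --> l -> (\forall n \near \oo, u n <= c) -> l <= c.
Proof.
move=> ul uc; rewrite -(cvg_lim (@Rhausdorff R) ul).
by apply: limr_le => //; apply/cvg_ex; exists l.
Qed.

Lemma limit_ge u l c : u @ \oo --> l -> (\forall n \near \oo, c <= u n) -> c <= l.
Proof.
move=> ul uc; rewrite -(cvg_lim (@Rhausdorff R) ul).
by apply: limr_ge => //; apply/cvg_ex; exists l.
Qed.

Lemma poly_at_one a N K : (forall s, 0 <= s < 1 -> \sum_(j < N) a j * s ^+ j <= K) ->
  \sum_(j < N) a j <= K.
Proof.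
move=> hK.
have c : (fun n => \sum_(j < N) a j * rho_ n ^+ j) @ \oo --> \sum_(j < N) a j * 1.
  apply: (@cvg_ord_sum N (fun n j => a j * rho_ n ^+ j) (fun j => a j * 1)) => j.
  by apply: cvgM; [exact: cvg_cst|exact: cvg_rhoX].
have -> : \sum_(j < N) a j = \sum_(j < N) a j * 1 by apply: eq_bigr => j _; rewrite mulr1.
by apply: limit_le c _; apply: nearW => n; apply: hK; exact: rho_01.
Qed.

Lemma series_ge a N : (forall j, 0 <= a j) -> ((\sum_(j < N) a j)%:E <= \sum_(j <oo) (a j)%:E)%E.
Proof.
move=> a0; rewrite -(big_mkord predT a) -sumEFin.
by apply: (@nneseries_lim_ge R (EFin \o a) predT 0 N) => j _ _; rewrite /= lee_fin.
Qed.

Lemma series_le a K : (forall j, 0 <= a j) -> (forall N, \sum_(j < N) a j <= K) ->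
  (\sum_(j <oo) (a j)%:E <= K%:E)%E.
Proof.
move=> a0 aK; apply: lime_le; first by apply: is_cvg_nneseries => j _ _; rewrite lee_fin.
by apply: nearW => N; rewrite sumEFin lee_fin big_mkord.
Qed.

Lemma series_cvg a l : (forall j, 0 <= a j) -> (\sum_(j <oo) (a j)%:E = l%:E)%E ->
  (fun N => \sum_(j < N) a j) @ \oo --> l.
Proof.
move=> a0 al.
have cv : (fun N => (\sum_(0 <= j < N) (a j)%:E)%E) @ \oo --> l%:E.
  by rewrite -al; apply: is_cvg_nneseries => j _ _; rewrite lee_fin.
rewrite (_ : (fun N => _) = fine \o (fun N => (\sum_(0 <= j < N) (a j)%:E)%E)); first exact: fine_cvg cv.
by apply/funext => N /=; rewrite sumEFin big_mkord.
Qed.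

End RealSeries.

Section Parseval.
Variable R : realType.
Notation leb := (@lebesgue_measure R).
Implicit Types (f g h : R[i] -> R[i]) (r s : R).

Lemma ccont_circleJ f r : analytic_on_disc f -> 0 <= r < 1 -> ccont (fun t => (f (r%:C * cis t))^*).
Proof. by move=> fa hr x; apply: ccontJ; exact: ccont_circle. Qed.

Lemma cis_conj (t : R) : (cis t)^* = cis (- t).
Proof. by rewrite cisN. Qed.

Lemma to_C_polar s a : 0 <= s -> to_C (polar s a) = (Num.sqrt s)%:C * cis a.
Proof.
by move=> s0; apply/eqP; rewrite eq_complex Re_scale Im_scale /to_C /polar /= !eqxx.
Qed.

Lemma normc_polar s a : 0 <= s -> normc (to_C (polar s a)) = Num.sqrt s.
Proof. by move=> s0; rewrite to_C_polar // normcM normcR normc_cis mulr1 ger0_norm ?sqrtr_ge0. Qed.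

Lemma sqrt_lt1 s : 0 <= s < 1 -> 0 <= Num.sqrt s < 1.
Proof. by move=> /andP[s0 s1]; rewrite sqrtr_ge0 -sqrtr1 ltr_sqrt. Qed.

(** Only g is expanded; its terms then meet the Fourier coefficients of conj
    k. *)
Lemma parseval_pair g k s : analytic_on_disc g -> analytic_on_disc k -> 0 <= s < 1 ->
  (fun N => \sum_(j < N) Re (acoef g j * (acoef k j)^*) * s ^+ j) @ \oo -->
  Re (cmean (fun t => g ((Num.sqrt s)%:C * cis t) * (k ((Num.sqrt s)%:C * cis t))^*)).
Proof.
move=> ga ka hs; have /andP[s0 s1] := hs; have hr := sqrt_lt1 hs.
pose r := Num.sqrt s; have r2 : r ^+ 2 = s by rewrite sqr_sqrtr.
have uc := ccont_circleJ ka hr.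
have ub : exists B : R, forall t, normc ((k (r%:C * cis t))^*) <= B.
  by have [B hB] := circle_bound ka hr; exists B => t; rewrite normc_conj.
apply/cvgrPdist_le => e e0.
have [N0 hN] := unif_circle_mean ga (taylor ga) hr uc ub e0.
exists N0 => // N NN; have := hN N NN.
rewrite (cmean_psum _ _ _ uc).
have -> : \sum_(j < N) (acoef g j * (r ^+ j)%:C) * cmean (fun t => cis t ^+ j * (k (r%:C * cis t))^*) =
  \sum_(j < N) (s ^+ j)%:C * (acoef g j * (acoef k j)^*).
  apply: eq_bigr => j _.
  have -> : cmean (fun t => cis t ^+ j * (k (r%:C * cis t))^*) = (acoef k j * (r ^+ j)%:C)^*.
    rewrite -(power_rep_coef j ka (taylor ka) hr) -cmean_conj; last first.
      by move=> x; apply: ccontM; [exact: ccont_circle|exact: ccont_cisNX].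
    by apply: eq_cmean => t; rewrite [RHS]rmorphM [RHS]mulrC rmorphXn /= cis_conj opprK.
  rewrite rmorphM /= -r2 -exprM mulnC exprM rmorphXn /= expr2.
  have -> : (r%:C ^+ j)^* = r%:C ^+ j by rewrite -rmorphXn; apply/eqP; rewrite eq_complex /= oppr0 !eqxx.
  have -> : (r ^+ j * r ^+ j)%:C = r%:C ^+ j * r%:C ^+ j by rewrite rmorphM rmorphXn.
  by rewrite mulrACA [RHS]mulrC.
set S := \sum_(j < N) (s ^+ j)%:C * _ => h.
have E : Re S = \sum_(j < N) Re (acoef g j * (acoef k j)^*) * s ^+ j.
  by rewrite /S raddf_sum; apply: eq_bigr => j _; exact: (etrans (Re_scale _ _) (mulrC _ _)).
rewrite -E; move: h; set A := cmean _ => h.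
by have := normr_Re_le (A - S); rewrite raddfB => h2; apply: le_trans h2 h.
Qed.

Lemma circ_avgE (u : R -> R[i]) : ccont u ->
  ((2 * pi)^-1%:E * \int[leb]_(t in `[0%R, (2 * pi)%R]) (Re (u t))%:E)%E = (Re (cmean u))%:E.
Proof.
move=> uc; have [iR _] := @ccont_integrable R 0 (2 * pi) u (fun x _ => uc x).
have fi : (\int[leb]_(t in `[0%R, (2 * pi)%R]) (Re (u t))%:E)%E \is a fin_num.
  by apply: integrable_fin_num => //; exact: measurable_itv.
rewrite /cmean Re_scale EFinM; congr (_ * _)%E.
by rewrite /cint Re_Cint /Rintegral fineK.
Qed.

Theorem parseval h s : analytic_on_disc h -> 0 <= s < 1 ->
  circ_avg (fun w => (normc (h (to_C w)) ^+ 2)%:E) s =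
  (\sum_(j <oo) (normc (acoef h j) ^+ 2 * s ^+ j)%:E)%E.
Proof.
move=> ha hs; have /andP[s0 s1] := hs; have hr := sqrt_lt1 hs.
pose u t := h ((Num.sqrt s)%:C * cis t) * (h ((Num.sqrt s)%:C * cis t))^*.
have uc : ccont u by move=> x; apply: ccontM; [exact: ccont_circle|exact: ccont_circleJ].
transitivity ((Re (cmean u))%:E : \bar R).
  rewrite -(circ_avgE uc) /circ_avg; congr (_ * _)%E; apply: eq_integral => t _.
  by rewrite to_C_polar // /u mul_conjc.
apply/esym/cvg_lim => //; rewrite -/u.
rewrite (_ : (fun n => _) = EFin \o (fun N => \sum_(j < N) Re (acoef h j * (acoef h j)^*) * s ^+ j)); last first.
  by apply/funext => N /=; rewrite sumEFin big_mkord; congr EFin; apply: eq_bigr => j _; rewrite mul_conjc.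
by apply: cvg_EFin; [exact: nearW|exact: parseval_pair].
Qed.

(** On the circle of radius 1/2 expand f alone: the terms with j <= n produce
    the coefficients of g, and the others are negative moments, which vanish. *)
Lemma acoefM f g n : analytic_on_disc f -> analytic_on_disc g ->
  acoef (fun z => f z * g z) n = \sum_(j < n.+1) acoef f j * acoef g (n - j)%N.
Proof.
move=> fa ga; pose r : R := 2^-1.
have hr0 : 0 < r < 1 by rewrite /r; apply/andP; split; clear; lra.
have hr : 0 <= r < 1 by case/andP: hr0 => /ltW -> ->.
have rn0 : (r ^+ n)%:C != 0 :> R[i].
  by rewrite rmorphXn expf_neq0 // fmorph_eq0 gt_eqF //; case/andP: hr0.
apply: (mulIf rn0); rewrite -(circle_coef n (analyticM fa ga) hr0).
pose u t := g (r%:C * cis t) * cis (- t) ^+ n.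
have uc : ccont u by move=> x; apply: ccontM; [exact: ccont_circle|exact: ccont_cisNX].
have ub : exists B : R, forall t, normc (u t) <= B.
  have [B hB] := circle_bound ga hr; exists B => t.
  by rewrite /u normcM normcX normc_cis expr1n mulr1.
rewrite (@eq_cmean _ _ (fun t => f (r%:C * cis t) * u t)); last by move=> t; rewrite mulrA.
apply: normc_small_eq => e e0.
have [N0 hN] := unif_circle_mean fa (taylor fa) hr uc ub e0.
have := hN (N0 + n.+1)%N (leq_addr _ _); rewrite (cmean_psum _ _ _ uc).
suff -> : \sum_(j < N0 + n.+1) (acoef f j * (r ^+ j)%:C) * cmean (fun t => cis t ^+ j * u t) =
   (\sum_(j < n.+1) acoef f j * acoef g (n - j)%N) * (r ^+ n)%:C by [].
rewrite mulr_suml addnC big_split_ord /= [X in _ + X]big1 ?addr0 => [|j _].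
  apply: eq_bigr => j _; have jn : (j <= n)%N by rewrite -ltnS.
  rewrite (@eq_cmean _ _ (fun t => g (r%:C * cis t) * cis (- t) ^+ (n - j))); last first.
    move=> t; rewrite /u mulrCA; congr (_ * _).
    have -> : cis (- t) ^+ n = cis (- t) ^+ (n - j) * cis (- t) ^+ j by rewrite -exprD subnK.
    by rewrite mulrCA -exprMn cis_mulN expr1n mulr1.
  by rewrite (circle_coef (n - j) ga hr0) (_ : (r ^+ n)%:C = (r ^+ j)%:C * (r ^+ (n - j))%:C); [ring|by rewrite -rmorphM -exprD subnKC].
rewrite (@eq_cmean _ _ (fun t => g (r%:C * cis t) * cis t ^+ j.+1)).
  by rewrite (power_rep_neg j ga (taylor ga) hr) mulr0.
move=> t; rewrite /u mulrCA; congr (_ * _).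
by rewrite addSn -addnS exprD mulrAC -exprMn cis_mulN expr1n mul1r.
Qed.

End Parseval.

(** * Area integrals of analytic functions *)

Section Measurability.
Variable R : realType.
Notation leb := (@lebesgue_measure R).
Notation disc := (@planar_disc R).
Implicit Types (f g h : R[i] -> R[i]) (F G : plane R -> R[i]) (D : set (plane R)).

Definition cmeas D F :=
  measurable_fun D (fun w => Re (F w) : measurableTypeR R) /\
  measurable_fun D (fun w => Im (F w) : measurableTypeR R).

Lemma cmeas_cst D c : cmeas D (fun=> c).
Proof. by split; exact: measurable_cst. Qed.

Lemma cmeas_to_C D : cmeas D (@to_C R).
Proof.
by split; apply: (@measurable_funS _ _ _ _ setT) => //; [exact: measurable_fst|exact: measurable_snd].
Qed.

Lemma cmeasD D F G : cmeas D F -> cmeas D G -> cmeas D (fun w => F w + G w).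
Proof.
move=> [F1 F2] [G1 G2]; split.
  rewrite (_ : (fun w => _) = (fun w => Re (F w) + Re (G w))); first exact: measurable_funD.
  by apply/funext => w; rewrite raddfD.
rewrite (_ : (fun w => _) = (fun w => Im (F w) + Im (G w))); first exact: measurable_funD.
by apply/funext => w; rewrite raddfD.
Qed.

Lemma cmeasM D F G : cmeas D F -> cmeas D G -> cmeas D (fun w => F w * G w).
Proof.
move=> [F1 F2] [G1 G2]; split.
  rewrite (_ : (fun w => _) = (fun w => Re (F w) * Re (G w) - Im (F w) * Im (G w))).
    by apply: measurable_funB; exact: measurable_funM.
  by apply/funext => w; case: (F w) => ? ?; case: (G w).
rewrite (_ : (fun w => _) = (fun w => Re (F w) * Im (G w) + Im (F w) * Re (G w))).
  by apply: measurable_funD; exact: measurable_funM.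
by apply/funext => w; case: (F w) => ? ?; case: (G w).
Qed.

Lemma cmeasJ D F : cmeas D F -> cmeas D (fun w => (F w)^*).
Proof.
move=> [F1 F2]; split.
  by rewrite (_ : (fun w => _) = (fun w => Re (F w))) //; apply/funext => w; case: (F w).
rewrite (_ : (fun w => _) = (fun w => - Im (F w))); first exact: measurable_funN.
by apply/funext => w; case: (F w).
Qed.

Lemma cmeasX D F n : cmeas D F -> cmeas D (fun w => F w ^+ n).
Proof.
move=> mF; elim: n => [|n IH].
  by rewrite (_ : (fun w => _) = (fun=> 1)); [exact: cmeas_cst|apply/funext => w; rewrite expr0].
rewrite (_ : (fun w => _) = (fun w => F w * F w ^+ n)); first exact: cmeasM.
by apply/funext => w; rewrite exprS.
Qed.

Lemma cmeas_sum D n (F : nat -> plane R -> R[i]) : (forall j, cmeas D (F j)) ->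
  cmeas D (fun w => \sum_(j < n) F j w).
Proof.
move=> mF; elim: n => [|n IH].
  by rewrite (_ : (fun w => _) = (fun=> 0)); [exact: cmeas_cst|apply/funext => w; rewrite big_ord0].
rewrite (_ : (fun w => _) = (fun w => (\sum_(j < n) F j w) + F n w)); first exact: cmeasD.
by apply/funext => w; rewrite big_ord_recr.
Qed.

Lemma cmeas_normc D F : cmeas D F -> measurable_fun D (fun w => normc (F w) : measurableTypeR R).
Proof.
move=> [F1 F2].
rewrite (_ : (fun w => _) = Num.sqrt \o (fun w => Re (F w) ^+ 2 + Im (F w) ^+ 2)); last first.
  by apply/funext => w /=; case: (F w).
apply: measurableT_comp; first exact: measurable_sqrtR.
by apply: measurable_funD; exact: measurable_funX.
Qed.

Lemma cmeas_lim D F (u : nat -> plane R -> R[i]) : (forall n, cmeas D (u n)) ->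
  (forall w, D w -> forall e : R, 0 < e -> exists N0, forall N, (N0 <= N)%N -> normc (F w - u N w) <= e) ->
  cmeas D F.
Proof.
move=> mu uF; split.
  apply: (@measurable_fun_cvg _ _ R D (fun n w => Re (u n w))); first by move=> m; case: (mu m).
  move=> w Dw; apply/cvgrPdist_le => e e0; have [N0 hN] := uF w Dw e e0.
  exists N0 => // N /= NN; rewrite -raddfB; apply: le_trans (normr_Re_le _) _; exact: hN.
apply: (@measurable_fun_cvg _ _ R D (fun n w => Im (u n w))); first by move=> m; case: (mu m).
move=> w Dw; apply/cvgrPdist_le => e e0; have [N0 hN] := uF w Dw e e0.
exists N0 => // N /= NN; rewrite -raddfB; apply: le_trans (normr_Im_le _) _; exact: hN.
Qed.

(** An analytic function is the pointwise limit of its Taylor polynomials. *)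
Lemma cmeas_analytic f : analytic_on_disc f -> cmeas disc (fun w => f (to_C w)).
Proof.
move=> fa; apply: (@cmeas_lim disc _ (fun N w => psum (acoef f) N (to_C w))).
  move=> N; apply: (@cmeas_sum disc N (fun j w => acoef f j * to_C w ^+ j)) => j.
  apply: cmeasM; first exact: cmeas_cst.
  by apply: cmeasX; exact: cmeas_to_C.
move=> w Dw e e0; have w1 : 0 <= normc (to_C w) < 1 by rewrite normc_ge0; exact: Dw.
have [N0 hN] := taylor fa w1 e0.
by exists N0 => N NN; apply: hN.
Qed.

End Measurability.

Section DiscIntegrals.
Variable R : realType.
Notation leb := (@lebesgue_measure R).
Notation disc := (@planar_disc R).
Notation mD := (@measurable_planar_disc R).
Implicit Types (f g h : R[i] -> R[i]) (r s t : R).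
Local Open Scope ereal_scope.

Lemma sqmod_polar s a : (0 <= s)%R -> sqmod (polar s a) = s.
Proof. by move=> s0; rewrite sqmodE normc_polar // sqr_sqrtr. Qed.

Lemma polar_disc s a : (0 <= s < 1)%R -> disc (polar s a).
Proof. by move=> /andP[s0 s1]; apply/in_disc; rewrite sqmod_polar. Qed.

Lemma polar_integral_disc (H : plane R -> \bar R) : measurable_fun disc H ->
  (forall w, disc w -> 0 <= H w) ->
  \int[sigma R]_(w in disc) H w = \int[leb]_(s in `[0%R, 1%R[) circ_avg H s.
Proof.
move=> mH H0.
transitivity (\int[sigma R]_(w in disc) (H \_ disc) w).
  by apply: eq_integral => w; rewrite patchE => ->.
rewrite polar_integral; last 2 first.
- by apply/(measurable_restrictT H mD).
- by move=> w; rewrite patchE; case: ifP => //; rewrite inE; exact: H0.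
apply: eq_integral => s; rewrite inE /= in_itv /= => /andP[s0 s1].
rewrite /circ_avg; congr (_ * _); apply: eq_integral => a _.
by rewrite patchE ifT // inE; apply: polar_disc; rewrite s0 s1.
Qed.

Lemma circ_avg_radial (c : R -> R) (H : plane R -> \bar R) s : (0 <= s)%R -> (0 <= c s)%R ->
  measurable_fun `[0%R, (2 * pi)%R]%classic (fun a => H (polar s a)) ->
  (forall a, 0 <= H (polar s a)) ->
  circ_avg (fun w => (c (sqmod w))%:E * H w) s = (c s)%:E * circ_avg H s.
Proof.
move=> s0 cs mH H0; rewrite /circ_avg.
transitivity ((2 * pi)^-1%:E * \int[leb]_(a in `[0%R, (2 * pi)%R]) ((c s)%:E * H (polar s a))).
  by congr (_ * _); apply: eq_integral => a _; rewrite sqmod_polar.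
by rewrite ge0_integralZl //; rewrite muleCA.
Qed.

Lemma measurable_abs2 h : analytic_on_disc h ->
  measurable_fun disc (fun w => (normc (h (to_C w)) ^+ 2)%:E).
Proof.
move=> ha; apply/measurable_EFinP; apply: measurable_funX.
exact: cmeas_normc (cmeas_analytic ha).
Qed.

Lemma measurable_polar_s s : measurable_fun setT (polar s : measurableTypeR R -> plane R).
Proof. exact: measurableT_comp (@measurable_polar2 R) (measurable_pair1 _). Qed.

Lemma measurable_circle (H : plane R -> \bar R) s : (0 <= s < 1)%R -> measurable_fun disc H ->
  measurable_fun setT (fun a : measurableTypeR R => H (polar s a)).
Proof.
move=> s01 mH.
apply: (@measurable_comp _ _ _ _ _ _ disc H setT (polar s) mD) => //.
  by move=> w [a _ <-]; exact: polar_disc.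
exact: measurable_polar_s.
Qed.

(** Parseval on every circle, integrated over the radii. *)
Lemma disc_weight (c : R -> R) h : analytic_on_disc h ->
  measurable_fun setT (c : measurableTypeR R -> measurableTypeR R) -> (forall s, 0 <= s < 1 -> 0 <= c s)%R ->
  \int[sigma R]_(w in disc) (c (sqmod w) * normc (h (to_C w)) ^+ 2)%:E =
  \sum_(j <oo) ((normc (acoef h j) ^+ 2)%:E * \int[leb]_(s in `[0%R, 1%R[) (c s * s ^+ j)%:E).
Proof.
move=> ha mc c0.
have mc' : measurable_fun disc (fun w => c (sqmod w)).
  apply: (@measurable_funS _ _ _ _ setT) => //.
  exact: measurableT_comp mc (@measurable_sqmod R).
have ms j : measurable_fun (`[0%R, 1%R[%classic : set (measurableTypeR R)) (fun s : R => (c s * s ^+ j)%:E).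
  apply/measurable_EFinP; apply: (@measurable_funS _ _ _ _ setT) => //.
  by apply: measurable_funM => //; apply: measurable_funX.
have c0' s j : `[0%R, 1%R[%classic s -> 0 <= (c s * s ^+ j)%:E.
  by rewrite /= in_itv /= => s01; rewrite lee_fin mulr_ge0 ?c0 // exprn_ge0 //; case/andP: s01.
rewrite polar_integral_disc; last 2 first.
- apply/measurable_EFinP; apply: measurable_funM => //.
  by apply/measurable_EFinP; exact: measurable_abs2.
- move=> w /in_disc w1; rewrite lee_fin mulr_ge0 ?sqr_ge0 // c0 // sqmod_ge0 //.
transitivity (\int[leb]_(s in `[0%R, 1%R[) \sum_(j <oo) ((normc (acoef h j) ^+ 2)%:E * (c s * s ^+ j)%:E)).
  apply: eq_integral => s; rewrite inE /= in_itv /= => s01.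
  have s0 : (0 <= s)%R by case/andP: s01.
  rewrite (_ : circ_avg _ s = circ_avg (fun w => (c (sqmod w))%:E * (normc (h (to_C w)) ^+ 2)%:E) s); last first.
    by rewrite /circ_avg; congr (_ * _); apply: eq_integral => a _; rewrite EFinM.
  rewrite circ_avg_radial ?c0 //; last 2 first.
  - apply: (@measurable_funS _ _ _ _ setT) => //.
    exact: (@measurable_circle (fun w => (normc (h (to_C w)) ^+ 2)%:E) s s01 (measurable_abs2 ha)).
  - by move=> a; rewrite lee_fin sqr_ge0.
  rewrite parseval // -nneseriesZl; last by move=> j _; rewrite lee_fin mulr_ge0 ?sqr_ge0 ?exprn_ge0.
  by apply: eq_eseriesr => j _; rewrite -!EFinM mulrCA.
rewrite integral_nneseries //.
- apply: eq_eseriesr => j _; rewrite ge0_integralZl // ?lee_fin ?sqr_ge0 //.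
  by move=> s; exact: c0'.
- by move=> j; apply: measurable_funeM.
- by move=> j s Ds; apply: mule_ge0; [rewrite lee_fin sqr_ge0|exact: c0'].
Qed.

Lemma integral_pow (r : R) j : (0 <= r)%R ->
  \int[leb]_(s in `[0%R, r[) (s ^+ j)%:E = (r ^+ j.+1 / j.+1%:R)%:E.
Proof.
rewrite le_eqVlt => /predU1P[<-|r0].
  by rewrite set_itv_ge ?bnd_simp ?ltxx // integral_set0 exprS !mul0r.
have cX (k : nat) : continuous (fun x : R => x ^+ k)%R by move=> x; exact: exprn_continuous.
rewrite integral_itv_bndo_bndc; last first.
  by apply/measurable_EFinP; apply: (@measurable_funS _ _ _ _ setT) => //.
pose F (x : R) := (j.+1%:R^-1 * x ^+ j.+1)%R.
have dF (x : R) : is_derive x (1%R : R) F (x ^+ j)%R.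
  have H := @is_deriveZ _ _ _ _ (j.+1%:R^-1)%R x (1%R : R) _ (@is_deriveX R R (@id R) j.+1 x (1%R : R) 1%R (is_derive_id x (1%R : R))).
  have -> : F = (j.+1%:R^-1 \*: (@id R ^+ j.+1))%R by apply/funext => y; rewrite /F fctE.
  apply: (is_derive_eq H).
  by rewrite /GRing.scale /= mulr1 mulrA mulVf ?mul1r // pnatr_eq0.
rewrite (@continuous_FTC2 R _ F) //.
- by rewrite /F expr0n mulr0 sube0 mulrC.
- by apply: continuous_subspaceT.
- have cF : continuous F by move=> x; apply: cvgM; [exact: cvg_cst|exact: cX].
  split; first by move=> x _; have [] := dF x.
    by apply: cvg_at_right_filter; exact: cF.
  by apply: cvg_at_left_filter; exact: cF.
- by move=> x _; rewrite derive1E; have [_ ->] := dF x.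
Qed.

End DiscIntegrals.

(** * Integrals over concentric discs *)

Section TruncatedIntegrals.
Variable R : realType.
Notation leb := (@lebesgue_measure R).
Notation disc := (@planar_disc R).
Notation mD := (@measurable_planar_disc R).
Implicit Types (f g h k : R[i] -> R[i]) (r s t rho : R).
Local Open Scope ereal_scope.

Lemma patch_mem (T : Type) (u : T -> \bar R) (D : set T) x : D x -> (u \_ D) x = u x.
Proof. by move=> Dx; rewrite patchE mem_set. Qed.

Lemma patch_notin (T : Type) (u : T -> \bar R) (D : set T) x : ~ D x -> (u \_ D) x = 0.
Proof. by move=> Dx; rewrite patchE memNset. Qed.

Definition subdisc rho : set (plane R) := [set w | (sqmod w < rho)%R].

Lemma subdisc_sub rho : (rho <= 1)%R -> subdisc rho `<=` disc.
Proof. by move=> r1 w /= wr; apply/in_disc; exact: lt_le_trans r1. Qed.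

Lemma subdisc1 : subdisc 1 = disc.
Proof. by apply/seteqP; split=> w /in_disc. Qed.

Lemma disc_sq_trunc h rho : analytic_on_disc h -> (0 <= rho <= 1)%R ->
  \int[sigma R]_(w in subdisc rho) (normc (h (to_C w)) ^+ 2)%:E =
  \sum_(j <oo) (normc (acoef h j) ^+ 2 * (rho ^+ j.+1 / j.+1%:R))%:E.
Proof.
move=> ha /andP[r0 r1].
pose c : R -> R := \1_(`]-oo, rho[%classic).
have mc : measurable_fun setT (c : measurableTypeR R -> measurableTypeR R).
  by apply: measurable_indic; exact: measurable_itv.
have c0 s : (0 <= s < 1)%R -> (0 <= c s)%R by move=> _; rewrite /c indicE.
have cE s : c s = ((s < rho)%R : nat)%:R.
  by rewrite /c indicE; congr ((nat_of_bool _)%:R); apply/idP/idP; rewrite inE /= in_itv.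
transitivity (\int[sigma R]_(w in disc) (c (sqmod w) * normc (h (to_C w)) ^+ 2)%:E).
  rewrite [LHS]integral_mkcond [RHS]integral_mkcond; apply: eq_integral => w _.
  have [wr|wr] := ltP (sqmod w) rho.
    by rewrite !patch_mem ?cE ?wr ?mul1r //; exact: subdisc_sub wr.
  have nwr : ~ subdisc rho w by rewrite /subdisc /= ltNge wr.
  rewrite patch_notin // patchE cE ltNge wr mul0r; by case: ifP.
rewrite disc_weight //; apply: eq_eseriesr => j _; rewrite [in RHS]EFinM; congr (_ * _).
rewrite -integral_pow // [LHS]integral_mkcond [RHS]integral_mkcond; apply: eq_integral => s _.
have [/= s01|/= s01] := pselect (`[0%R, 1%R[%classic s); last first.
  rewrite !patch_notin //= in_itv /= => /andP[s0 sr]; apply: s01.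
  by rewrite in_itv /= s0 (lt_le_trans sr).
move: (s01); rewrite /= in_itv /= => /andP[s0 s1].
have [sr|sr] := ltP s rho; first by rewrite !patch_mem ?cE ?sr ?mul1r //= in_itv /= s0 sr.
rewrite patch_mem // patch_notin ?cE /=; first by rewrite ltNge sr mul0r.
by rewrite in_itv /= s0 /= ltNge sr.
Qed.

Lemma disc_sq h : analytic_on_disc h ->
  \int[sigma R]_(w in disc) (normc (h (to_C w)) ^+ 2)%:E =
  \sum_(j <oo) (normc (acoef h j) ^+ 2 / j.+1%:R)%:E.
Proof.
move=> ha; rewrite -subdisc1 disc_sq_trunc ?ler01 ?lexx //.
by apply: eq_eseriesr => j _; rewrite expr1n mul1r.
Qed.

Lemma disc_sq_defect h : analytic_on_disc h ->
  \int[sigma R]_(w in disc) ((1 - sqmod w) * normc (h (to_C w)) ^+ 2)%:E =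
  \sum_(j <oo) (normc (acoef h j) ^+ 2 / (j.+1%:R * j.+2%:R))%:E.
Proof.
move=> ha; rewrite (@disc_weight R (fun s => 1 - s)%R) //.
- apply: eq_eseriesr => j _; rewrite [in RHS]EFinM; congr (_ * _).
  have m1 (i : nat) : measurable_fun (`[0%R, 1%R[%classic : set (measurableTypeR R)) (fun s : R => (s ^+ i)%:E).
    by apply/measurable_EFinP; apply: (@measurable_funS _ _ _ _ setT) => //.
  have m2 : measurable_fun (`[0%R, 1%R[%classic : set (measurableTypeR R)) (fun s : R => ((1 - s) * s ^+ j)%:E).
    apply/measurable_EFinP; apply: (@measurable_funS _ _ _ _ setT) => //.
    by apply: measurable_funM => //; apply: measurable_funB.
  have p1 (s : R) (i : nat) : `[0%R, 1%R[%classic s -> 0 <= (s ^+ i)%:E.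
    by rewrite /= in_itv /= => /andP[s0 _]; rewrite lee_fin exprn_ge0.
  have p2 (s : R) : `[0%R, 1%R[%classic s -> 0 <= ((1 - s) * s ^+ j)%:E.
    by rewrite /= in_itv /= => /andP[s0 s1]; rewrite lee_fin mulr_ge0 ?exprn_ge0 // subr_ge0 ltW.
  have E : \int[leb]_(s in `[0%R, 1%R[) ((1 - s) * s ^+ j)%:E + \int[leb]_(s in `[0%R, 1%R[) (s ^+ j.+1)%:E =
           \int[leb]_(s in `[0%R, 1%R[) (s ^+ j)%:E.
    rewrite -ge0_integralD //; last by move=> s; exact: p1.
    by apply: eq_integral => s _; rewrite -EFinD exprS; congr (_%:E); ring.
  rewrite !integral_pow ?ler01 // !expr1n !mul1r in E.
  move: E; set I := integral _ _ _ => /(congr1 (fun x => x - j.+2%:R^-1%:E)).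
  rewrite addeK // => ->; rewrite -EFinB; congr (_%:E).
  have j1 : (j.+1%:R != 0 :> R)%R by rewrite pnatr_eq0.
  have j2 : (j.+2%:R != 0 :> R)%R by rewrite pnatr_eq0.
  apply: (mulIf (mulf_neq0 j1 j2)); rewrite mulVf ?mulf_neq0 // mulrBl.
  by rewrite mulrA mulVf // mul1r mulrC -mulrA mulfV // mulr1 -natrB // subSnn.
- by apply: measurable_funB.
- by move=> s /andP[_ s1]; rewrite subr_ge0 ltW.
Qed.

Lemma circle_sum_fin h s : analytic_on_disc h -> (0 <= s < 1)%R ->
  \sum_(j <oo) (normc (acoef h j) ^+ 2 * s ^+ j)%:E < +oo.
Proof.
move=> ha hs; rewrite -parseval //; have hr := sqrt_lt1 hs; have /andP[s0 _] := hs.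
pose r := Num.sqrt s.
have uc : ccont (fun t => h (r%:C * cis t) * (h (r%:C * cis t))^*)%R.
  by move=> x; apply: ccontM; [exact: ccont_circle|exact: ccont_circleJ].
rewrite (_ : circ_avg _ _ = (Re (cmean (fun t => h (r%:C * cis t) * (h (r%:C * cis t))^*)%R))%:E) ?ltry //.
rewrite -(circ_avgE uc) /circ_avg; congr (_ * _)%E; apply: eq_integral => t _.
by rewrite to_C_polar // mul_conjc.
Qed.

Lemma trunc_fin h rho : analytic_on_disc h -> (0 <= rho < 1)%R ->
  \int[sigma R]_(w in subdisc rho) (normc (h (to_C w)) ^+ 2)%:E < +oo.
Proof.
move=> ha hr; have /andP[r0 r1] := hr.
rewrite disc_sq_trunc ?r0 ?ltW //; apply: le_lt_trans (circle_sum_fin ha hr).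
apply: lee_nneseries => j.
  by move=> _ _; rewrite lee_fin mulr_ge0 ?sqr_ge0 ?divr_ge0 ?exprn_ge0.
move=> _; rewrite lee_fin ler_wpM2l ?sqr_ge0 // exprS ler_pdivrMr ?ltr0n //.
rewrite [leLHS]mulrC ler_wpM2l ?exprn_ge0 //.
by apply: le_trans (ltW r1) _; rewrite ler1n.
Qed.

Lemma measurable_subdisc_fun d (T : measurableType d) rho (H : plane R -> T) : (rho <= 1)%R -> measurable_fun disc H -> measurable_fun (subdisc rho) H.
Proof. by move=> r1; apply: measurable_funS; [exact: mD|exact: subdisc_sub]. Qed.

Lemma trunc_integrable h rho : analytic_on_disc h -> (0 <= rho < 1)%R ->
  (sigma R).-integrable (subdisc rho) (fun w => (normc (h (to_C w)) ^+ 2)%:E).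
Proof.
move=> ha hr; apply/integrableP; split.
  apply: measurable_subdisc_fun; first by apply: ltW; case/andP: hr.
  exact: measurable_abs2.
rewrite (eq_integral (fun w => (normc (h (to_C w)) ^+ 2)%:E)); first exact: trunc_fin.
by move=> w _; rewrite /= ger0_norm // sqr_ge0.
Qed.

Lemma trunc_series h rho : analytic_on_disc h -> (0 <= rho < 1)%R ->
  (fun N => \sum_(j < N) normc (acoef h j) ^+ 2 * (rho ^+ j.+1 / j.+1%:R))%R @ \oo -->
  (\int[sigma R]_(w in subdisc rho) (normc (h (to_C w)) ^+ 2))%R.
Proof.
move=> ha hr; have /andP[r0 r1] := hr; 
apply: (@series_cvg R (fun j => normc (acoef h j) ^+ 2 * (rho ^+ j.+1 / j.+1%:R))%R).
  by move=> j; rewrite mulr_ge0 ?sqr_ge0 ?divr_ge0 ?exprn_ge0.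
rewrite -disc_sq_trunc ?r0 ?ltW // /Rintegral fineK // ge0_fin_numE ?trunc_fin //.
by apply: integral_ge0 => w _; rewrite lee_fin sqr_ge0.
Qed.

(** The integrand of Re (functional k g). *)
Definition re_pair g k (w : plane R) : R := Re (g (to_C w) * (k (to_C w))^*)%R.

Lemma re_pairE g k w : re_pair g k w = (4^-1 * (normc (g (to_C w) + k (to_C w)) ^+ 2 - normc (g (to_C w) - k (to_C w)) ^+ 2))%R.
Proof. by rewrite /re_pair !normc_sqr; case: (g _) => a b; case: (k _) => c d /=; field. Qed.

Lemma measurable_re_pair g k : analytic_on_disc g -> analytic_on_disc k -> measurable_fun disc (re_pair g k : plane R -> measurableTypeR R).
Proof.
by move=> ga ka; have [] := cmeasM (cmeas_analytic ga) (cmeasJ (cmeas_analytic ka)).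
Qed.

(** Polarization reduces the pairing to squares; on a smaller disc all the
    series converge. *)
Lemma pair_trunc g k rho : analytic_on_disc g -> analytic_on_disc k -> (0 <= rho < 1)%R ->
  (fun N => \sum_(j < N) Re (acoef g j * (acoef k j)^*) * (rho ^+ j.+1 / j.+1%:R))%R @ \oo -->
  (\int[sigma R]_(w in subdisc rho) re_pair g k w)%R.
Proof.
move=> ga ka hr; have aD := analyticD ga ka; have aB := analyticB ga ka.
have mL : measurable (subdisc rho) by exact: measurable_subdisc.
have -> : (\int[sigma R]_(w in subdisc rho) re_pair g k w =
   4^-1 * (\int[sigma R]_(w in subdisc rho) (normc (g (to_C w) + k (to_C w)) ^+ 2)
    - \int[sigma R]_(w in subdisc rho) (normc (g (to_C w) - k (to_C w)) ^+ 2)))%R.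
  have i1 := trunc_integrable aD hr; have i2 := trunc_integrable aB hr.
  rewrite -RintegralB // -RintegralZl //; last by have := integrableB mL i1 i2; apply: eq_integrable.
  by apply: eq_Rintegral => w _; rewrite re_pairE.
rewrite (_ : (fun N => _) = (fun N => 4^-1 *
  (\sum_(j < N) normc (acoef (fun z => g z + k z) j) ^+ 2 * (rho ^+ j.+1 / j.+1%:R)
   - \sum_(j < N) normc (acoef (fun z => g z - k z) j) ^+ 2 * (rho ^+ j.+1 / j.+1%:R)))%R); last first.
  apply/funext => N; rewrite -sumrB mulr_sumr; apply: eq_bigr => j _.
  rewrite (acoefD j ga ka) (acoefB j ga ka) -mulrBl [RHS]mulrA; congr (_ * _)%R.
  by rewrite !normc_sqr; case: (acoef g j) => a b; case: (acoef k j) => c d /=; field.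
by apply: cvgM; [exact: cvg_cst|apply: cvgB; exact: trunc_series].
Qed.

(** Dominated convergence: a point with |z|^2 < r lies in almost all of the
    smaller discs. *)
Lemma trunc_cvg (u : plane R -> R) (r_ : nat -> R) r : (sigma R).-integrable disc (fun w => (u w)%:E) ->
  r_ @ \oo --> r -> (forall n, r_ n <= r)%R -> (r <= 1)%R ->
  (fun n => \int[sigma R]_(w in subdisc (r_ n)) u w)%R @ \oo --> (\int[sigma R]_(w in subdisc r) u w)%R.
Proof.
move=> iu cv le r1.
have mu : measurable_fun disc (fun w => (u w)%:E) by case/integrableP: iu.
pose v s w := ((u \_ (subdisc s)) w)%:E.
have vE s : (s <= 1)%R -> \int[sigma R]_(w in subdisc s) (u w)%:E = \int[sigma R]_(w in disc) v s w.
  move=> s1; rewrite [LHS]integral_mkcond [RHS]integral_mkcond; apply: eq_integral => w _.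
  rewrite !patchE /v patchE; case: ifPn => // ws; last by case: ifP.
  by rewrite ifT // inE; apply: (subdisc_sub s1); move: ws; rewrite inE.
have mv s : (s <= 1)%R -> measurable_fun disc (v s).
  move=> s1; have -> : v s = (fun w => (u w)%:E) \_ (subdisc s).
    by apply/funext => w; rewrite /v !patchE; case: ifP.
  apply: (@measurable_funS _ _ _ _ setT) => //.
  apply/(measurable_restrictT _ (@measurable_subdisc R s)); exact: measurable_subdisc_fun.
have ae1 w : disc w -> (fun n => v (r_ n) w) @ \oo --> v r w.
  move=> Dw; have [wr|wr] := ltP (sqmod w) r.
    have [N _ hN] : \forall n \near \oo, (sqmod w < r_ n)%R by exact: (cv _ (lt_nbhsr wr)).
    apply: cvg_near_cst; exists N => // n /= Nn.
    by rewrite /v !patchE !mem_set //; exact: hN.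
  rewrite (_ : (fun n => _) = (fun=> v r w)); first exact: cvg_cst.
  apply/funext => n; rewrite /v !patchE !memNset //; rewrite /subdisc /= ltNge ?wr //.
  by rewrite (le_trans (le n) wr).
have [_ _ H] := @dominated_convergence _ _ R (sigma R) disc mD (fun n => v (r_ n)) (v r) (fun w => `|(u w)%:E|)
  (fun n => mv _ (le_trans (le n) r1)) (mv _ r1) ltac:(by apply: aeW => w; exact: ae1)
  (integrable_abse iu)
  ltac:(by apply: aeW => w n Dw; rewrite /v patchE; case: ifP => //; rewrite abse0 abse_ge0).
have iv s : (s <= 1)%R -> (sigma R).-integrable disc (v s).
  move=> s1; apply: (le_integrable mD (mv s s1) _ iu) => w Dw.
  by rewrite /v patchE; case: ifP => //; rewrite abse0 abse_ge0.
rewrite /Rintegral (vE _ r1) (_ : (fun n => _) = (fun n => fine (\int[sigma R]_(w in disc) v (r_ n) w))); last first.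
  by apply/funext => n; rewrite vE ?(le_trans (le n)).
apply: fine_cvg; rewrite fineK; first exact: H.
by apply: integrable_fin_num; [exact: mD|exact: iv].
Qed.

End TruncatedIntegrals.

(** * Real integrands on the disc and on annuli *)

Section DiscCalculus.
Variable R : realType.
Notation disc := (@planar_disc R).
Notation mD := (@measurable_planar_disc R).
Implicit Types (u v : plane R -> R) (f g k : R[i] -> R[i]).

Definition dmeas u := measurable_fun disc (u : plane R -> measurableTypeR R).
Definition dintegrable u := (sigma R).-integrable disc (EFin \o u).
Definition dint u : R := \int[sigma R]_(w in disc) u w.

Lemma dintegrable_meas u : dintegrable u -> dmeas u.
Proof. by move=> /integrableP[/measurable_EFinP]. Qed.

Lemma eq_dint u v : (forall w, disc w -> u w = v w) -> dint u = dint v.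
Proof. by move=> uv; apply: eq_Rintegral => w; rewrite inE => /uv. Qed.

Lemma eq_dintegrable u v : (forall w, disc w -> u w = v w) -> dintegrable u -> dintegrable v.
Proof. by move=> uv; apply: (eq_integrable mD) => w; rewrite inE /= => /uv ->. Qed.

Lemma dintegrableD u v : dintegrable u -> dintegrable v -> dintegrable (fun w => u w + v w).
Proof. by move=> iu iv; have := integrableD mD iu iv; apply: (eq_integrable mD). Qed.

Lemma dintegrableZ c u : dintegrable u -> dintegrable (fun w => c * u w).
Proof. by move=> iu; have := integrableZl mD c iu; apply: (eq_integrable mD). Qed.

Lemma dintegrable_le u v : dmeas u -> (forall w, disc w -> `|u w| <= v w) -> dintegrable v -> dintegrable u.
Proof.
move=> mu uv; apply: (le_integrable mD); first exact/measurable_EFinP.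
move=> w Dw; rewrite /= lee_fin; apply: le_trans (uv w Dw) _; exact: ler_norm.
Qed.

Lemma dintegrable_cst c : dintegrable (fun=> c).
Proof.
apply/integrableP; split; first exact: measurable_cst.
by rewrite /= integral_cst ?sigma_planar_disc ?mule1 ?ltry //; exact: mD.
Qed.

Lemma dintD u v : dintegrable u -> dintegrable v -> dint (fun w => u w + v w) = dint u + dint v.
Proof. by move=> iu iv; rewrite /dint RintegralD //; exact: mD. Qed.

Lemma dintB u v : dintegrable u -> dintegrable v -> dint (fun w => u w - v w) = dint u - dint v.
Proof. by move=> iu iv; rewrite /dint RintegralB //; exact: mD. Qed.

Lemma dintZ c u : dintegrable u -> dint (fun w => c * u w) = c * dint u.
Proof. by move=> iu; rewrite /dint RintegralZl //; exact: mD. Qed.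

Lemma dint_cst c : dint (fun=> c) = c.
Proof. by rewrite /dint /Rintegral integral_cst ?sigma_planar_disc ?mule1 //; exact: mD. Qed.

Lemma dint_ge0 u : (forall w, disc w -> 0 <= u w) -> 0 <= dint u.
Proof. exact: Rintegral_ge0. Qed.

Lemma dint_le u v : dintegrable u -> dintegrable v -> (forall w, disc w -> u w <= v w) -> dint u <= dint v.
Proof. by move=> iu iv uv; apply: le_Rintegral => //; exact: mD. Qed.

Lemma dintE u : dintegrable u -> (\int[sigma R]_(w in disc) (u w)%:E = (dint u)%:E)%E.
Proof. by move=> iu; rewrite /dint /Rintegral fineK //; apply: integrable_fin_num iu; exact: mD. Qed.

Lemma dintegrable_ge0 u : dmeas u -> (forall w, disc w -> 0 <= u w) ->
  (\int[sigma R]_(w in disc) (u w)%:E < +oo)%E -> dintegrable u.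
Proof.
move=> mu u0 ui; apply/integrableP; split; first exact/measurable_EFinP.
rewrite (eq_integral (fun w => (u w)%:E)) // => w; rewrite inE => Dw.
by rewrite /= ger0_norm // u0.
Qed.

Definition inside (r : R) (w : plane R) : R := ((sqmod w < r)%R : nat)%:R.
Definition outside (r : R) (w : plane R) : R := ((r <= sqmod w)%R : nat)%:R.

Lemma inside_outside r w : inside r w = 1 - outside r w.
Proof. by rewrite /inside /outside ltNge; case: (_ <= _); rewrite /= ?subrr ?subr0. Qed.

Lemma outside01 r w : 0 <= outside r w <= 1.
Proof. by rewrite /outside; case: (r <= _)%R; rewrite /= ?lexx ?ler01. Qed.

Lemma dmeas_outside r : dmeas (outside r).
Proof.
apply: (@measurable_funS _ _ _ _ setT) => //.
have m1 : measurable_fun setT (\1_(`[r, +oo[%classic) : measurableTypeR R -> measurableTypeR R).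
  by apply: measurable_indic; exact: measurable_itv.
have := measurableT_comp m1 (@measurable_sqmod R).
rewrite (_ : _ \o _ = outside r) //; apply/funext => w; rewrite /= indicE /outside.
by congr ((nat_of_bool _)%:R); apply/idP/idP; rewrite inE /= in_itv /= andbT.
Qed.

Lemma dmeasM u v : dmeas u -> dmeas v -> dmeas (fun w => u w * v w).
Proof. exact: measurable_funM. Qed.

Lemma dintegrable_outside r u : dintegrable u -> dintegrable (fun w => outside r w * u w).
Proof.
move=> iu; apply: (@dintegrable_le _ (fun w => `|u w|)).
- by apply: dmeasM; [exact: dmeas_outside|exact: dintegrable_meas].
- move=> w _; rewrite normrM; have /andP[h0 h1] := outside01 r w.
  by rewrite (ger0_norm h0) ler_piMl.
- by have := integrable_norm iu.
Qed.

Lemma dint_inside r u : (r <= 1)%R ->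
  \int[sigma R]_(w in subdisc r) u w = dint (fun w => inside r w * u w).
Proof.
move=> r1; rewrite /dint Rintegral_mkcond [RHS]Rintegral_mkcond; apply: eq_Rintegral => w _.
rewrite !patchE; have [wr|wr] := ltP (sqmod w) r.
  by rewrite !mem_set ?/inside ?wr ?mul1r //; exact: subdisc_sub wr.
rewrite memNset; last by rewrite /subdisc /= ltNge wr.
by rewrite /inside ltNge wr mul0r; case: ifP.
Qed.

Lemma dint_outside r u : (r <= 1)%R -> dintegrable u ->
  \int[sigma R]_(w in subdisc r) u w = dint u - dint (fun w => outside r w * u w).
Proof.
move=> r1 iu; rewrite dint_inside // -dintB //; last exact: dintegrable_outside.
by apply: eq_dint => w _; rewrite inside_outside mulrBl mul1r.
Qed.

Lemma measurable_circ_avg_disc (H : plane R -> \bar R) : measurable_fun disc H ->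
  (forall w, disc w -> (0 <= H w)%E) ->
  measurable_fun (`[0, 1[%classic : set (measurableTypeR R)) (circ_avg H : measurableTypeR R -> \bar R).
Proof.
move=> mH H0.
have m1 : measurable_fun setT (circ_avg (H \_ disc) : measurableTypeR R -> \bar R).
  apply: measurable_circ_avg; first exact/(measurable_restrictT H mD).
  by move=> w; rewrite patchE; case: ifP => //; rewrite inE; exact: H0.
apply: (@eq_measurable_fun _ _ _ _ _ (circ_avg (H \_ disc))); last by apply: measurable_funS m1.
move=> s; rewrite inE /= in_itv /= => s01; rewrite /circ_avg; congr (_ * _)%E.
by apply: eq_integral => a _; rewrite patchE mem_set //; exact: polar_disc.
Qed.

Lemma circ_avg_ge0_disc u s : 0 <= s < 1 -> (forall w, disc w -> 0 <= u w) ->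
  (0 <= circ_avg (fun w => (u w)%:E) s)%E.
Proof.
move=> s01 u0; apply: mule_ge0; first by rewrite lee_fin invr_ge0 (ltW (@pi_pos2 R)).
by apply: integral_ge0 => a _; rewrite lee_fin u0 //; exact: polar_disc.
Qed.

Lemma measurable_circle_itv u s : 0 <= s < 1 -> dmeas u ->
  measurable_fun (`[0%R, (2 * pi)%R]%classic : set (measurableTypeR R)) (fun a => (u (polar s a))%:E).
Proof.
move=> hs mu; apply: (@measurable_funS _ _ _ _ setT) => //.
by apply: (@measurable_circle R (fun w => (u w)%:E) s hs); exact/measurable_EFinP.
Qed.

Lemma circ_avg_mono u v s : 0 <= s < 1 -> dmeas u -> dmeas v -> (forall w, 0 <= u w) ->
  (forall w, disc w -> u w <= v w) ->
  (circ_avg (fun w => (u w)%:E) s <= circ_avg (fun w => (v w)%:E) s)%E.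
Proof.
move=> hs mu mv u0 uv.
apply: lee_wpmul2l; first by rewrite lee_fin invr_ge0 (ltW (@pi_pos2 R)).
apply: ge0_le_integral => //; [by move=> a _; rewrite lee_fin|exact: measurable_circle_itv..|].
by move=> a _; rewrite lee_fin uv //; exact: polar_disc.
Qed.

Lemma circ_avgD u v s : 0 <= s < 1 -> dmeas u -> dmeas v -> (forall w, 0 <= u w) ->
  (forall w, 0 <= v w) ->
  (circ_avg (fun w => (u w + v w)%:E) s = circ_avg (fun w => (u w)%:E) s + circ_avg (fun w => (v w)%:E) s)%E.
Proof.
move=> hs mu mv u0 v0; have mcu := measurable_circle_itv hs mu; have mcv := measurable_circle_itv hs mv.
rewrite /circ_avg -ge0_muleDr; last 2 first.
- by apply: integral_ge0 => a _; rewrite lee_fin.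
- by apply: integral_ge0 => a _; rewrite lee_fin.
congr mule; under eq_integral do rewrite EFinD.
by rewrite ge0_integralD //; move=> a _; rewrite lee_fin.
Qed.

Lemma circ_avgZ c u s : 0 <= s < 1 -> 0 <= c -> dmeas u -> (forall w, 0 <= u w) ->
  (circ_avg (fun w => (c * u w)%:E) s = c%:E * circ_avg (fun w => (u w)%:E) s)%E.
Proof.
move=> hs c0 mu u0; have mcu := measurable_circle_itv hs mu.
rewrite /circ_avg muleCA; congr mule; under eq_integral do rewrite EFinM.
by rewrite ge0_integralZl // => a _; rewrite lee_fin.
Qed.

Lemma outside_circ r u s : dmeas u -> (forall w, disc w -> 0 <= u w) -> 0 <= s < 1 ->
  circ_avg (fun w => (outside r w * u w)%:E) s = ((nat_of_bool (r <= s)%R)%:R%:E * circ_avg (fun w => (u w)%:E) s)%E.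
Proof.
move=> mu u0 s01; have /andP[s0 s1] := s01.
rewrite -(@circ_avg_radial R (fun s => (nat_of_bool (r <= s)%R)%:R) (fun w => (u w)%:E)) //.
- apply: (@measurable_funS _ _ _ _ setT) => //.
  by apply: (@measurable_circle R (fun w => (u w)%:E) s s01); exact/measurable_EFinP.
- by move=> a; rewrite lee_fin u0 //; exact: polar_disc.
Qed.

(** In polar coordinates an annulus is a union of circles. *)
Lemma outside_le r u v : dmeas u -> dmeas v ->
  (forall w, disc w -> 0 <= u w) -> (forall w, disc w -> 0 <= v w) ->
  (forall s, 0 < s < 1 -> r <= s -> (circ_avg (fun w => (u w)%:E) s <= circ_avg (fun w => (v w)%:E) s)%E) ->
  (\int[sigma R]_(w in disc) (outside r w * u w)%:E <= \int[sigma R]_(w in disc) (outside r w * v w)%:E)%E.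
Proof.
move=> mu mv u0 v0 uv.
have ou w : disc w -> (0 <= (outside r w * u w)%:E)%E.
  by move=> Dw; rewrite lee_fin mulr_ge0 ?u0 //; case/andP: (outside01 r w).
have ov w : disc w -> (0 <= (outside r w * v w)%:E)%E.
  by move=> Dw; rewrite lee_fin mulr_ge0 ?v0 //; case/andP: (outside01 r w).
have mou : measurable_fun disc (fun w => (outside r w * u w)%:E).
  by apply/measurable_EFinP; apply: dmeasM mu; exact: dmeas_outside.
have mov : measurable_fun disc (fun w => (outside r w * v w)%:E).
  by apply/measurable_EFinP; apply: dmeasM mv; exact: dmeas_outside.
have S : `]0%R, 1%R[%classic `<=` (`[0%R, 1%R[%classic : set (measurableTypeR R)).
  by move=> s /=; rewrite !in_itv /= => /andP[/ltW -> ->].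
have mI : measurable (`[0%R, 1%R[%classic : set (measurableTypeR R)) by exact: measurable_itv.
have m1 := measurable_funS mI S (measurable_circ_avg_disc mou ou).
have m2 := measurable_funS mI S (measurable_circ_avg_disc mov ov).
rewrite !polar_integral_disc //.
rewrite -(integral_itv_obnd_cbnd m1) -(integral_itv_obnd_cbnd m2).
apply: ge0_le_integral => //.
- by move=> s /S /=; rewrite in_itv /= => s01; apply: circ_avg_ge0_disc => // w /ou; rewrite lee_fin.
- move=> s Ss; have := S _ Ss; move: Ss; rewrite /= !in_itv /= => s1 s2.
  rewrite !outside_circ //; have [rs|rs] := leP r s; last by rewrite !mul0e.
  by rewrite !mul1e; exact: uv.
Qed.

Lemma circ_avg_cst (c s : R) : circ_avg (fun=> c%:E) s = c%:E.
Proof.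
rewrite /circ_avg integral_cst //= lebesgue_measure_itv /= lte_fin pi_pos2 sube0.
by rewrite -!EFinM mulrCA mulVf ?mulr1 // gt_eqF // pi_pos2.
Qed.

Lemma dint_outside_cst r c : 0 <= r <= 1 -> dint (fun w => outside r w * c) = (1 - r) * c.
Proof.
move=> r01; have := @dint_outside r (fun=> c) _ (dintegrable_cst c).
rewrite dint_cst; case/andP: (r01) => r0 r1 /(_ r1) => E.
have : \int[sigma R]_(w in subdisc r) c = r * c.
  rewrite Rintegral_cst; last exact: measurable_subdisc.
  by have := sigma_subdisc r01; rewrite /subdisc => -> /=; rewrite mulrC.
by rewrite E => /eqP; rewrite subr_eq => /eqP H; rewrite mulrBl mul1r {2}H; ring.
Qed.

Lemma outside_ub r u K : 0 <= r <= 1 -> 0 <= K -> dmeas u -> (forall w, disc w -> 0 <= u w) ->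
  (forall s, 0 < s < 1 -> (circ_avg (fun w => (u w)%:E) s <= K%:E)%E) ->
  (\int[sigma R]_(w in disc) (outside r w * u w)%:E <= ((1 - r) * K)%:E)%E.
Proof.
move=> r01 K0 mu u0 uK; rewrite -dint_outside_cst // -dintE; last first.
  exact: dintegrable_outside (dintegrable_cst K).
apply: (@outside_le r u (fun=> K)) => //; first exact: measurable_cst.
by move=> s s01 _; rewrite circ_avg_cst uK.
Qed.

Lemma outside_lb r u a : 0 <= r <= 1 -> 0 <= a -> dintegrable u -> (forall w, disc w -> 0 <= u w) ->
  (forall s, r <= s < 1 -> (a%:E <= circ_avg (fun w => (u w)%:E) s)%E) ->
  (1 - r) * a <= dint (fun w => outside r w * u w).
Proof.
move=> r01 a0 iu u0 ua; rewrite -dint_outside_cst // -lee_fin -dintE; last first.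
  exact: dintegrable_outside (dintegrable_cst a).
rewrite -dintE; last exact: dintegrable_outside.
apply: (@outside_le r (fun=> a) u) => //; [exact: measurable_cst|exact: dintegrable_meas|].
by move=> s /andP[_ s1] rs; rewrite circ_avg_cst ua // rs s1.
Qed.

(** The case r = 0 of outside_ub, where the annulus is the whole disc. *)
Lemma circ_bounded_integrable u K : 0 <= K -> dmeas u -> (forall w, disc w -> 0 <= u w) ->
  (forall s, 0 < s < 1 -> (circ_avg (fun w => (u w)%:E) s <= K%:E)%E) ->
  dintegrable u /\ dint u <= K.
Proof.
move=> K0 mu u0 uK.
have H := @outside_ub 0 u K ltac:(by rewrite lexx ler01) K0 mu u0 uK.
rewrite subr0 mul1r (eq_integral (fun w => (u w)%:E)) in H; last first.
  by move=> w _; rewrite /outside sqmod_ge0 mul1r.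
have iu : dintegrable u by apply: dintegrable_ge0 => //; apply: le_lt_trans H _; exact: ltry.
by split=> //; move: H; rewrite dintE.
Qed.

End DiscCalculus.

(** * Power means and Hardy norms *)

Section PowerMeans.
Variable R : realType.
Notation disc := (@planar_disc R).
Implicit Types (f g k : R[i] -> R[i]) (m : nat) (q t e K : R).

(** If b <= e a^m the first term dominates; otherwise a <= (b / e)^(1/m). *)
Lemma young m (a b e : R) : (0 < m)%N -> 0 <= a -> 0 <= b -> 0 < e ->
  a * b <= e * a ^+ m.+1 + (e^-1) `^ (m%:R^-1) * b `^ (1 + m%:R^-1).
Proof.
move=> m0 a0 b0 e0; have c0 : 0 <= (e^-1) `^ (m%:R^-1) * b `^ (1 + m%:R^-1) by rewrite mulr_ge0 ?powR_ge0.
have mR : m%:R != 0 :> R by rewrite pnatr_eq0 -lt0n.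
have [h|h] := leP b (e * a ^+ m).
  by rewrite -[leLHS]addr0 lerD // exprS mulrCA ler_wpM2l.
rewrite -[leLHS]add0r lerD ?mulr_ge0 ?exprn_ge0 ?(ltW e0) //.
have b1 : 0 < b by apply: le_lt_trans h; rewrite mulr_ge0 ?exprn_ge0 ?(ltW e0).
have ha : a <= (e^-1 * b) `^ (m%:R^-1).
  have am : a ^+ m <= e^-1 * b by rewrite -(ler_pM2l e0) mulrA mulfV ?gt_eqF // mul1r ltW.
  have := @ge0_ler_powR R (m%:R^-1) _ (a ^+ m) (e^-1 * b).
  rewrite -powR_mulrn // -powRrM mulfV // powRr1 // invr_ge0 ler0n => /(_ isT); apply.
  - by rewrite nnegrE powR_ge0.
  - by rewrite nnegrE mulr_ge0 // invr_ge0 ltW.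
  - by rewrite powR_mulrn.
rewrite powRD; last by rewrite gt_eqF // implybT.
rewrite powRr1 // mulrCA mulrC ler_wpM2l //.
by apply: le_trans ha _; rewrite powRM // invr_ge0 ltW.
Qed.

Definition abspow m f (w : plane R) : R := normc (f (to_C w)) ^+ (2 * m).
Definition abspowR q k (w : plane R) : R := normc (k (to_C w)) `^ q.

Lemma abspow_ge0 m f w : 0 <= abspow m f w.
Proof. by rewrite exprn_ge0 // normc_ge0. Qed.

Lemma abspowR_ge0 q f w : 0 <= abspowR q f w.
Proof. exact: powR_ge0. Qed.

Lemma abspowE m f w : abspow m f w = normc ((fun z => f z ^+ m) (to_C w)) ^+ 2.
Proof. by rewrite /abspow normcX mulnC exprM. Qed.

Lemma dmeas_abspow m f : analytic_on_disc f -> dmeas (abspow m f).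
Proof. by move=> fa; apply: measurable_funX; exact: cmeas_normc (cmeas_analytic fa). Qed.

Lemma dmeas_abspowR q k : analytic_on_disc k -> dmeas (abspowR q k).
Proof.
move=> ka; apply: (measurableT_comp (measurable_powR q)).
exact: cmeas_normc (cmeas_analytic ka).
Qed.

(** K is a bound for the p-th power of the H^p norm, p = 2m. *)
Definition Hp_bound m f K := forall s, 0 <= s < 1 -> (circ_avg (fun w => (abspow m f w)%:E) s <= K%:E)%E.
Definition Hq_bound q k K := forall s, 0 < s < 1 -> (circ_avg (fun w => (abspowR q k w)%:E) s <= K%:E)%E.

Lemma circ_abspow m f s : analytic_on_disc f -> 0 <= s < 1 ->
  circ_avg (fun w => (abspow m f w)%:E) s =
  (\sum_(j <oo) (normc (acoef (fun z => f z ^+ m) j) ^+ 2 * s ^+ j)%:E)%E.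
Proof.
move=> fa hs; rewrite -(parseval (@analyticX _ f m fa) hs).
by congr (_ * _)%E; apply: eq_integral => a _; rewrite abspowE.
Qed.

Lemma circ_abspow_ge m f s N : analytic_on_disc f -> 0 <= s < 1 ->
  ((\sum_(j < N) normc (acoef (fun z => f z ^+ m) j) ^+ 2 * s ^+ j)%:E <= circ_avg (fun w => (abspow m f w)%:E) s)%E.
Proof.
move=> fa hs; rewrite (circ_abspow m fa hs); have /andP[s0 _] := hs.
apply: (@series_ge R (fun j => normc (acoef (fun z => f z ^+ m) j) ^+ 2 * s ^+ j)) => j.
by rewrite mulr_ge0 ?sqr_ge0 ?exprn_ge0.
Qed.

Lemma circ_abspow_homo m f r s : analytic_on_disc f -> 0 <= r -> r <= s -> s < 1 ->
  (circ_avg (fun w => (abspow m f w)%:E) r <= circ_avg (fun w => (abspow m f w)%:E) s)%E.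
Proof.
move=> fa r0 rs s1; rewrite !circ_abspow //; last 2 first.
- by rewrite (le_trans r0 rs) s1.
- by rewrite r0 (le_lt_trans rs s1).
apply: lee_nneseries => j.
  by move=> _ _; rewrite lee_fin mulr_ge0 ?sqr_ge0 ?exprn_ge0.
by move=> _; rewrite lee_fin ler_wpM2l ?sqr_ge0 // lerXn2r // nnegrE // (le_trans r0 rs).
Qed.

(** |f|^(2m) = |f^m|^2, so that Parseval reads the means of |f|^(2m) off the
    Taylor coefficients of f^m. *)
Lemma Hp_coef m f K N : analytic_on_disc f -> Hp_bound m f K ->
  \sum_(j < N) normc (acoef (fun z => f z ^+ m) j) ^+ 2 <= K.
Proof.
move=> fa hK; apply: (@poly_at_one R (fun j => normc (acoef (fun z => f z ^+ m) j) ^+ 2)) => s hs; rewrite -lee_fin.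
exact: le_trans (circ_abspow_ge m N fa hs) (hK s hs).
Qed.

Lemma coef_Hp m f K : analytic_on_disc f ->
  (forall N, \sum_(j < N) normc (acoef (fun z => f z ^+ m) j) ^+ 2 <= K) -> Hp_bound m f K.
Proof.
move=> fa hK s hs; rewrite circ_abspow //; have /andP[s0 s1] := hs.
apply: (@series_le R (fun j => normc (acoef (fun z => f z ^+ m) j) ^+ 2 * s ^+ j)) => [j|N]; first by rewrite mulr_ge0 ?sqr_ge0 ?exprn_ge0.
apply: le_trans (hK N); apply: ler_sum => j _.
by rewrite ler_piMr ?sqr_ge0 // exprn_ile1 // ltW.
Qed.

Lemma hardy_circle t f r : 0 <= r ->
  (((2 * pi)^-1%:E * \int[lebesgue_measure]_(a in `[0%R, (2 * pi)%R])
     (normc (f (r%:C * (cos a +i* sin a))) `^ t)%:E) =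
  circ_avg (fun w => (abspowR t f w)%:E) (r ^+ 2))%E.
Proof.
move=> r0; rewrite /circ_avg; apply: (congr1 (mule _)); apply: eq_integral => a _.
by rewrite /abspowR to_C_polar ?sqr_ge0 // sqrtr_sqr ger0_norm.
Qed.

Lemma hardy_norm_ge0 t f : (0 <= hardy_norm t f)%E.
Proof.
apply: ereal_sup_ge.
exists (circ_avg (fun w => (abspowR t f w)%:E) (2^-1 ^+ 2) `^ t^-1)%E; last exact: poweR_ge0.
exists 2^-1; last by rewrite (@hardy_circle t f 2^-1) // invr_ge0.
by rewrite /= in_itv /=; apply/andP; split; clear; lra.
Qed.

Lemma hardy_norm_circ t f s : 0 < t -> 0 < s < 1 ->
  (circ_avg (fun w => (abspowR t f w)%:E) s <= hardy_norm t f `^ t)%E.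
Proof.
move=> t0 s01; have /andP[s0 s1] := s01.
have c0 : (0 <= circ_avg (fun w => (abspowR t f w)%:E) s)%E.
  apply: circ_avg_ge0_disc => [|w _]; [by rewrite (ltW s0) s1|exact: abspowR_ge0].
rewrite -[leLHS]poweRe1 // -{1}(mulVf (lt0r_neq0 t0)) poweRrM.
apply: gt0_ler_poweR; first exact: ltW.
- by rewrite in_itv /= poweR_ge0 leey.
- by rewrite in_itv /= hardy_norm_ge0 leey.
apply: ereal_sup_ubound; exists (Num.sqrt s) => /=.
  by rewrite in_itv /= sqrtr_gt0 s0 -sqrtr1 ltr_sqrt.
have E := @hardy_circle t f (Num.sqrt s) (sqrtr_ge0 s).
rewrite (sqr_sqrtr (ltW s0)) in E; by rewrite E.
Qed.

Lemma hardy_Hq t f : 0 < t -> hardy t f -> exists2 K, 0 <= K & Hq_bound t f K.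
Proof.
move=> t0 [fa fn]; exists (fine (hardy_norm t f `^ t)%E).
  by rewrite fine_ge0 // poweR_ge0.
move=> s hs; rewrite fineK ?hardy_norm_circ // ge0_fin_numE ?poweR_ge0 //.
exact: poweR_lty.
Qed.

Lemma hardy_norm_le_bound t f d : 0 < t -> 0 <= d -> (hardy_norm t f <= d%:E)%E -> Hq_bound t f (d `^ t).
Proof.
move=> t0 d0 fd s hs; apply: le_trans (hardy_norm_circ f t0 hs) _.
rewrite -poweR_EFin.
have n0 := hardy_norm_ge0 t f.
apply: gt0_ler_poweR => //; first exact: ltW.
- by rewrite in_itv /= n0 leey.
- by rewrite in_itv /= lee_fin d0 leey.
Qed.

Lemma Hq_hardy_norm t f K : 0 < t -> 0 <= K -> Hq_bound t f K -> (hardy_norm t f <= (K `^ t^-1)%:E)%E.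
Proof.
move=> t0 K0 hK; apply: ub_ereal_sup => _ [r /= r01 <-].
move: r01; rewrite in_itv /= => /andP[r0 r1].
have hs : 0 < r ^+ 2 < 1 by rewrite exprn_gt0 //= expr_lt1 // ltW.
rewrite (@hardy_circle t f r (ltW r0)) -poweR_EFin.
apply: gt0_ler_poweR; [by rewrite invr_ge0 ltW| | |exact: hK].
- rewrite in_itv /= leey andbT; apply: circ_avg_ge0_disc => [|w _]; last exact: abspowR_ge0.
  by case/andP: hs => /ltW -> ->.
- by rewrite in_itv /= lee_fin K0 leey.
Qed.

Lemma abspowR_abspow m f w : abspowR (2 * m)%:R f w = abspow m f w.
Proof. by rewrite /abspowR /abspow powR_mulrn // normc_ge0. Qed.

End PowerMeans.

(** * Powers of the modulus to first order *)

Section Elementary.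
Variable R : realType.
Implicit Types (a b : R[i]) (s t x y c : R).

Lemma bernoulli_le n c : 0 <= c -> n%:R * c <= n%:R - 1 + c ^+ n.
Proof.
move=> c0; elim: n => [|n IH]; first by rewrite mul0r expr0 sub0r addNr.
have h : 0 <= (c ^+ n - 1) * (c - 1).
  have [c1|c1] := leP c 1.
    by rewrite mulr_le0 // subr_le0 // exprn_ile1.
  by rewrite mulr_ge0 // subr_ge0 ?(ltW c1) // exprn_ege1 // ltW.
rewrite exprS -natr1; move: IH h; set N := n%:R; set X := c ^+ n => IH h.
by clear -IH h; nra.
Qed.

Lemma power_expand m : exists2 C : R, 0 <= C & forall a b t, `|t| <= 1 -> exists2 e,
  (a + t%:C * b) ^+ m = a ^+ m + t%:C * (m%:R * a ^+ m.-1 * b) + (t ^+ 2)%:C * e &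
  normc e <= C * (normc a + normc b) ^+ m.
Proof.
elim: m => [|m [C C0 IH]].
  exists 0 => // a b t _; exists 0; last by rewrite normc0 mul0r.
  by rewrite !expr0 !mul0r !mulr0 !addr0.
exists (C + m%:R); first by rewrite addr_ge0.
move=> a b t t1; have [e E he] := IH a b t t1.
exists ((a + t%:C * b) * e + m%:R * a ^+ m.-1 * b ^+ 2).
  rewrite exprS {}E rmorphXn /=.
  have -> : a ^+ m.+1 = a * a ^+ m by rewrite exprS.
  have H : m%:R * a ^+ m = m%:R * a ^+ m.-1 * a :> R[i].
    by case: (m) => [|k]; rewrite ?mul0r //= exprSr mulrA.
  rewrite -[m.+1%:R]natr1 (mulrDl m%:R) H mul1r; ring.
set s := normc a + normc b in he *.
have a0 := normc_ge0 a; have b0 := normc_ge0 b.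
have s0 : 0 <= s by rewrite addr_ge0.
have as_ : normc a <= s by rewrite lerDl.
have bs : normc b <= s by rewrite lerDr.
apply: le_trans (le_normcD _ _) _; rewrite [leRHS]mulrDl; apply: lerD.
  rewrite normcM exprS mulrCA; apply: ler_pM; rewrite ?normc_ge0 //.
  apply: le_trans (le_normcD _ _) _; rewrite /s lerD2l normcM normcR.
  by rewrite ler_piMl.
rewrite !normcM !normcX normc_nat -mulrA.
case: m {IH he E} => [|k]; first by rewrite !mul0r.
rewrite ler_wpM2l // [s ^+ _]exprSr exprSr -[s ^+ k * s * s]mulrA -expr2.
by apply: ler_pM; rewrite ?exprn_ge0 ?sqr_ge0 //; apply: lerXn2r; rewrite ?nnegrE.
Qed.

Lemma normc_sq_add (x y : R[i]) : normc (x + y) ^+ 2 = normc x ^+ 2 + 2 * Re (y * x^*) + normc y ^+ 2.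
Proof. by rewrite !normc_sqr; case: x => a b; case: y => c d /=; ring. Qed.

Lemma Re_lin2 (t u : R) (x y e : R[i]) :
  Re ((t%:C * y + u%:C * e) * x^*) = t * Re (y * x^*) + u * Re (e * x^*).
Proof. by case: x => ? ?; case: y => ? ?; case: e => ? ? /=; ring. Qed.

Lemma powRD_le (q : R) (x y : R) : 0 <= q -> 0 <= x -> 0 <= y -> (x + y) `^ q <= 2 `^ q * (x `^ q + y `^ q).
Proof.
move=> q0 x0 y0; have h (a b : R) : 0 <= a -> a <= b -> (a + b) `^ q <= 2 `^ q * (a `^ q + b `^ q).
  move=> a0 ab; have b0 := le_trans a0 ab.
  apply: (@le_trans _ _ ((2 * b) `^ q)).
    by apply: ge0_ler_powR; rewrite ?nnegrE ?addr_ge0 ?mulr_ge0 // mulr2n mulrDl mul1r lerD2r.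
  by rewrite powRM // ler_wpM2l ?powR_ge0 // lerDr powR_ge0.
have [xy|/ltW yx] := leP x y; first exact: h.
by rewrite addrC [x `^ q + _]addrC; exact: h.
Qed.

Lemma sum_pow_le n x y : 0 <= x -> 0 <= y -> (x + y) ^+ n <= 2 ^+ n * (x ^+ n + y ^+ n).
Proof. by move=> x0 y0; have := powRD_le (ler0n R n) x0 y0; rewrite !powR_mulrn ?addr_ge0. Qed.

(** |x + y|^2 = |x|^2 + 2 Re (y conj x) + |y|^2 applied to the expansion of (a
    + t b)^m around x = a^m. *)
Lemma power_norm_expand m : exists2 C : R, 0 <= C & forall a b t, `|t| <= 1 ->
  normc (a + t%:C * b) ^+ (2 * m) <= normc a ^+ (2 * m)
   + t * ((2 * m)%:R * Re (b * a ^+ m.-1 * (a ^+ m)^*)) + t ^+ 2 * (C * (normc a ^+ (2 * m) + normc b ^+ (2 * m))).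
Proof.
have [C C0 H] := power_expand m.
pose Q := (m%:R ^+ 2 + 2 * m%:R * C + C ^+ 2 + 2 * C).
have Q0 : 0 <= Q by rewrite !addr_ge0 ?mulr_ge0 ?exprn_ge0.
exists (Q * 2 ^+ (2 * m)).
  by rewrite mulr_ge0 ?exprn_ge0.
move=> a b t t1; have [e E he] := H a b t t1.
set s := normc a + normc b in he.
have a0 := normc_ge0 a; have b0 := normc_ge0 b.
have s0 : 0 <= s by rewrite addr_ge0.
have as_ : normc a <= s by rewrite lerDl.
have bs : normc b <= s by rewrite lerDr.
set S := s ^+ m in he; have S0 : 0 <= S by rewrite exprn_ge0.
pose x := a ^+ m; pose y := m%:R * a ^+ m.-1 * b.
have hx : normc x <= S by rewrite normcX; apply: lerXn2r; rewrite ?nnegrE.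
have hy : normc y <= m%:R * S.
  rewrite /y !normcM normcX normc_nat -mulrA.
  case: (m) @S {he S0 hx x y E H Q0 Q C0 C} => [|k] S; first by rewrite !mul0r.
  by rewrite ler_wpM2l // /S exprSr; apply: ler_pM; rewrite ?exprn_ge0 //; apply: lerXn2r; rewrite ?nnegrE.
have S2 : S ^+ 2 <= 2 ^+ (2 * m) * (normc a ^+ (2 * m) + normc b ^+ (2 * m)).
  by rewrite /S -exprM mulnC; exact: sum_pow_le.
have nE : normc (a + t%:C * b) ^+ (2 * m) = normc (x + (t%:C * y + (t ^+ 2)%:C * e)) ^+ 2.
  by rewrite mulnC exprM -normcX E addrA.
have nx : normc a ^+ (2 * m) = normc x ^+ 2 by rewrite mulnC exprM -normcX.
rewrite nE normc_sq_add nx -!addrA lerD2l.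
have R1 : Re ((t%:C * y + (t ^+ 2)%:C * e) * x^*) = t * Re (y * x^*) + t ^+ 2 * Re (e * x^*).
  exact: Re_lin2.
have R2 : Re (y * x^*) = m%:R * Re (b * a ^+ m.-1 * (a ^+ m)^*).
  rewrite /y -[m%:R in LHS](rmorph_nat (real_complex R)) -!mulrA Re_scale; congr (_ * Re _).
  by rewrite /x mulrCA.
have R3 : Re (e * x^*) <= C * S * S.
  apply: le_trans (Re_le_normc _) _; rewrite normcM normc_conj.
  by apply: ler_pM; rewrite ?normc_ge0.
have N2 : normc (t%:C * y + (t ^+ 2)%:C * e) ^+ 2 <= t ^+ 2 * (m%:R * S + C * S) ^+ 2.
  rewrite -[t ^+ 2 in leRHS](real_normK (num_real t)) -exprMn; apply: lerXn2r; rewrite ?nnegrE ?normc_ge0 ?mulr_ge0 ?addr_ge0 ?mulr_ge0 //.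
  apply: le_trans (le_normcD _ _) _; rewrite (normcM t%:C y) (normcM (t ^+ 2)%:C e) !normcR normrX mulrDr; apply: lerD.
    by rewrite ler_wpM2l.
  rewrite expr2 -mulrA ler_wpM2l //; apply: le_trans (_ : 1 * normc e <= _); last by rewrite mul1r.
  by rewrite ler_wpM2r ?normc_ge0.
rewrite R1 R2; move: N2 R3 S2; set A := normc (_ + _) ^+ 2; set B := Re (e * _).
set D := Re _; set W := normc x ^+ 2 + normc b ^+ (2 * m); set Z := 2 ^+ (2 * m).
rewrite nx -/W => N2 R3 S2.
have t20 : 0 <= t ^+ 2 by rewrite sqr_ge0.
have h1 : t ^+ 2 * B <= t ^+ 2 * (C * S * S) by rewrite ler_wpM2l.
have h2 : t ^+ 2 * (Q * S ^+ 2) <=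
   t ^+ 2 * (Q * (Z * W)).
  by rewrite ler_wpM2l // ler_wpM2l.
apply: (@le_trans _ _ (2 * (t * (m%:R * D)) + (2 * (t ^+ 2 * (C * S * S)) + t ^+ 2 * (m%:R * S + C * S) ^+ 2))).
  by rewrite mulrDr -addrA lerD2l lerD // ler_wpM2l.
rewrite natrM; apply: le_trans (_ : t * (2 * m%:R * D) + t ^+ 2 * (Q * S ^+ 2) <= _).
  by rewrite le_eqVlt; apply/orP; left; apply/eqP; rewrite /Q; ring.
by rewrite lerD2l; apply: le_trans h2 _; rewrite !mulrA.
Qed.

(** Divide by t and let t tend to 0 from both sides. *)
Lemma linear_le_square x c : (forall t, `|t| <= 1 -> t * x <= t ^+ 2 * c) -> x = 0.
Proof.
move=> H; apply/eqP; rewrite -normr_eq0 eq_le normr_ge0 andbT.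
have c0 : 0 <= c.
  have h1 := H 1 ltac:(by rewrite normr1); have h2 := H (-1) ltac:(by rewrite normrN1).
  by clear -h1 h2; lra.
apply/ler_addgt0Pl => d d0; rewrite addr0.
pose t := Num.min 1 (d / (c + 1)).
have c1 : 0 < c + 1 by rewrite ltr_wpDl.
have t0 : 0 < t by rewrite lt_min ltr01 divr_gt0.
have t1 : t <= 1 by rewrite ge_min lexx.
have tc : t * c <= d.
  apply: (@le_trans _ _ (d / (c + 1) * (c + 1))); last by rewrite divfK // gt_eqF.
  by apply: ler_pM; rewrite ?(ltW t0) // ?ge_min ?lexx ?orbT // lerDl.
have h1 : t * x <= t ^+ 2 * c by apply: H; rewrite ger0_norm // ltW.
have h2 : (- t) * x <= (- t) ^+ 2 * c by apply: H; rewrite normrN ger0_norm // ltW.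
rewrite sqrrN mulNr -mulrN in h2; rewrite expr2 -mulrA ler_pM2l // in h1.
rewrite expr2 -mulrA ler_pM2l // in h2.
by rewrite ler_norml; apply/andP; split; [rewrite lerNl|]; apply: le_trans tc.
Qed.

End Elementary.

(** * The extremal problem *)

Section ExtremalProblem.
Variable R : realType.
Notation disc := (@planar_disc R).
Implicit Types (f g h k F : R[i] -> R[i]) (m : nat) (q t e K lam : R).

(** The exponent conjugate to p = 2m. *)
Definition conj_exp m : R := 1 + ((2 * m).-1%:R)^-1.
(** The constant of Young's inequality for the exponents 2m and conj_exp m. *)
Definition young_const m e : R := (e^-1) `^ (((2 * m).-1%:R)^-1).

Lemma young_const_ge0 m e : 0 <= young_const m e.
Proof. exact: powR_ge0. Qed.

Lemma conj_exp_gt0 m : 0 < conj_exp m.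
Proof. by rewrite /conj_exp ltr_wpDr // invr_ge0. Qed.

Lemma youngp m (a b e : R) : (0 < m)%N -> 0 <= a -> 0 <= b -> 0 < e ->
  a * b <= e * a ^+ (2 * m) + young_const m e * b `^ (conj_exp m).
Proof.
move=> m0 a0 b0 e0.
have M : (0 < (2 * m).-1)%N by lia.
have E : (2 * m = (2 * m).-1.+1)%N by lia.
have := young M a0 b0 e0; by rewrite -E.
Qed.

Lemma re_pair_le m g k e w : (0 < m)%N -> 0 < e ->
  `|re_pair g k w| <= e * abspow m g w + young_const m e * abspowR (conj_exp m) k w.
Proof.
move=> m0 e0; apply: le_trans (normr_Re_le _) _; rewrite normcM normc_conj.
by apply: youngp; rewrite ?normc_ge0.
Qed.

Lemma dintegrable_re_pair m g k : (0 < m)%N -> analytic_on_disc g -> analytic_on_disc k ->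
  dintegrable (abspow m g) -> dintegrable (abspowR (conj_exp m) k) -> dintegrable (re_pair g k).
Proof.
move=> m0 ga ka ig ik.
apply: (@dintegrable_le _ _ (fun w => 1 * abspow m g w + young_const m 1 * abspowR (conj_exp m) k w)).
- exact: measurable_re_pair.
- by move=> w _; apply: re_pair_le.
- by apply: dintegrableD; apply: dintegrableZ.
Qed.

Lemma dint_re_pair_le m g k e : (0 < m)%N -> 0 < e -> analytic_on_disc g -> analytic_on_disc k ->
  dintegrable (abspow m g) -> dintegrable (abspowR (conj_exp m) k) ->
  `|dint (re_pair g k)| <= e * dint (abspow m g) + young_const m e * dint (abspowR (conj_exp m) k).
Proof.
move=> m0 e0 ga ka ig ik; have ir := dintegrable_re_pair m0 ga ka ig ik.
have h1 := dintegrableZ e ig; have h2 := dintegrableZ (young_const m e) ik.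
rewrite -(dintZ _ ig) -(dintZ _ ik) -dintD //.
apply: le_trans (le_normr_Rintegral (@measurable_planar_disc R) ir) _.
apply: dint_le; [|exact: dintegrableD|by move=> w _; exact: re_pair_le].
by have := integrable_norm ir.
Qed.

Lemma abspowZ m c f w : 0 <= c -> abspow m (fun z => c%:C * f z) w = c ^+ (2 * m) * abspow m f w.
Proof. by move=> c0; rewrite /abspow normcM normcR ger0_norm // exprMn. Qed.

Lemma re_pairZl (c : R) g k w : re_pair (fun z => c%:C * g z) k w = c * re_pair g k w.
Proof. by rewrite /re_pair -mulrA Re_scale. Qed.

Lemma re_pairDl f g k w : re_pair (fun z => f z + g z) k w = re_pair f k w + re_pair g k w.
Proof. by rewrite /re_pair mulrDl raddfD. Qed.

Lemma re_pairBr f g k w : re_pair f (fun z => g z - k z) w = re_pair f g w - re_pair f k w.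
Proof. by rewrite /re_pair rmorphB mulrBr raddfB. Qed.

(** F is extremal for k, and lam is the norm of the functional; the last
    clause is Re phi(h) <= lam ||h|| with the root linearized by the
    inequality of arithmetic and geometric means. *)
Definition optimal m k F lam :=
  [/\ analytic_on_disc F, dintegrable (abspow m F), dint (abspow m F) = 1, lam = dint (re_pair F k) &
  forall h, analytic_on_disc h -> dintegrable (abspow m h) ->
    (2 * m)%:R * dint (re_pair h k) <= lam * ((2 * m)%:R - 1 + dint (abspow m h))].

Lemma bergman_normE m f : bergman_norm (2 * m)%:R f = ((\int[sigma R]_(w in disc) (abspow m f w)%:E) `^ ((2 * m)%:R^-1))%E.
Proof. by rewrite /bergman_norm; congr (poweR _ _); apply: eq_integral => w _; rewrite -abspowR_abspow. Qed.

Lemma p_gt0 m : (0 < m)%N -> 0 < (2 * m)%:R :> R.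
Proof. by move=> m0; rewrite ltr0n muln_gt0. Qed.

Lemma bergman_integrable m f : (0 < m)%N -> bergman (2 * m)%:R f -> dintegrable (abspow m f).
Proof.
move=> m0 [fa]; rewrite bergman_normE => h.
apply: dintegrable_ge0; [exact: dmeas_abspow|by move=> w _; exact: abspow_ge0|].
by apply: lty_poweRy h; rewrite invr_neq0 // gt_eqF // p_gt0.
Qed.

Lemma bergman_norm1 m f : (0 < m)%N -> bergman (2 * m)%:R f -> bergman_norm (2 * m)%:R f = 1%E -> dint (abspow m f) = 1.
Proof.
move=> m0 fb; have iF := bergman_integrable m0 fb.
rewrite bergman_normE dintE // => /(congr1 (fun x => x `^ (2 * m)%:R)%E).
rewrite -poweRrM mulVf ?gt_eqF ?p_gt0 // poweRe1 ?lee_fin ?dint_ge0 //; last by move=> w _; exact: abspow_ge0.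
by rewrite poweR1r => -[].
Qed.

Lemma Re_functional g k : Re (functional k g) = dint (re_pair g k).
Proof. by []. Qed.

(** Scale h to the unit ball, where Re phi <= lam, and use p c <= p - 1 + c^p
    with c = ||h||. *)
Lemma extremal_optimal m k F : (0 < m)%N -> analytic_on_disc k -> dintegrable (abspowR (conj_exp m) k) ->
  extremal (2 * m)%:R k F -> optimal m k F (dint (re_pair F k)).
Proof.
move=> m0 ka ik [bF nF _ hop]; have [Fa _] := bF; have iF := bergman_integrable m0 bF.
have F1 := bergman_norm1 m0 bF nF.
have p0 := p_gt0 m0.
rewrite Re_functional in hop; set lam := dint (re_pair F k) in hop *.
have opub g : analytic_on_disc g -> dintegrable (abspow m g) -> dint (abspow m g) <= 1 ->
    normc (functional k g) <= lam.
  move=> ga ig g1; rewrite -lee_fin hop; apply: ereal_sup_ubound; exists g => //.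
  have n1 : (bergman_norm (2 * m)%:R g <= 1)%E.
    rewrite bergman_normE dintE // poweR_EFin lee_fin.
    have := @ge0_ler_powR R ((2 * m)%:R^-1) _ (dint (abspow m g)) 1.
    rewrite powR1 invr_ge0 ltW // => /(_ isT); apply => //; rewrite nnegrE //.
    by apply: dint_ge0 => w _; exact: abspow_ge0.
  by split; [split; [exact: ga|exact: le_lt_trans n1 (ltry 1)]|exact: n1].
have lam0 : 0 <= lam.
  by apply: le_trans (opub F Fa iF _); rewrite ?F1 // normc_ge0.
split=> // h ha ih; set B := dint (abspow m h).
have B0 : 0 <= B by apply: dint_ge0 => w _; exact: abspow_ge0.
have key c : 0 < c -> B <= c ^+ (2 * m) -> dint (re_pair h k) <= lam * c.
  move=> c0 Bc; have ci : 0 <= c^-1 by rewrite invr_ge0 ltW.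
  pose g z := (c^-1)%:C * h z.
  have ga : analytic_on_disc g by exact: (@analyticZ _ (c^-1)%:C h ha).
  have ig : dintegrable (abspow m g).
    by apply: eq_dintegrable (dintegrableZ (c^-1 ^+ (2 * m)) ih) => w _; rewrite abspowZ.
  have Ig : dint (abspow m g) = c^-1 ^+ (2 * m) * B.
    by rewrite -dintZ //; apply: eq_dint => w _; rewrite abspowZ.
  have := opub g ga ig; rewrite Ig exprVn mulrC ler_pdivrMr ?exprn_gt0 // mul1r => /(_ Bc) H.
  have H2 := le_trans (Re_le_normc _) H.
  rewrite Re_functional in H2.
  have E : dint (re_pair g k) = c^-1 * dint (re_pair h k).
    rewrite -dintZ; last exact: dintegrable_re_pair ih ik.
    by apply: eq_dint => w _; rewrite re_pairZl.
  by rewrite E mulrC ler_pdivrMr // in H2.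
have [B00|Bn0] := eqVneq B 0.
  have := key 2^-1 ltac:(by rewrite invr_gt0) ltac:(by rewrite B00 exprn_ge0 // invr_ge0).
  rewrite B00 addr0 => h1; apply: (@le_trans _ _ ((2 * m)%:R * (lam * 2^-1))); first by rewrite ler_pM2l.
  rewrite mulrCA ler_wpM2l // natrM mulrAC mulfV ?mul1r ?pnatr_eq0 //.
  have : 1 <= m%:R :> R by rewrite ler1n.
  by clear; set x := m%:R; lra.
pose c := B `^ ((2 * m)%:R^-1).
have c0 : 0 < c by rewrite powR_gt0 // lt_neqAle eq_sym Bn0.
have cB : c ^+ (2 * m) = B.
  by rewrite -powR_mulrn ?(ltW c0) // /c -powRrM mulVf ?gt_eqF // powRr1.
have := key c c0 ltac:(by rewrite cB) => h1.
apply: (@le_trans _ _ ((2 * m)%:R * (lam * c))); first by rewrite ler_pM2l.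
rewrite mulrCA ler_wpM2l // -cB; apply: bernoulli_le; exact: ltW.
Qed.

Lemma dintegrable_test m F g : (0 < m)%N -> analytic_on_disc F -> analytic_on_disc g ->
  dintegrable (abspow m F) -> dintegrable (abspow m g) ->
  dintegrable (re_pair (fun z => g z * F z ^+ m.-1) (fun z => F z ^+ m)).
Proof.
move=> m0 Fa ga iF ig.
apply: (@dintegrable_le _ _ (fun w => abspow m g w + abspow m F w)).
- apply: measurable_re_pair; last exact: (@analyticX _ F m Fa).
  exact: (@analyticM _ g (fun z => F z ^+ m.-1) ga (@analyticX _ F m.-1 Fa)).
- move=> w _; apply: le_trans (normr_Re_le _) _.
  rewrite !normcM normc_conj !normcX -mulrA -exprD /abspow.
  have -> : (m.-1 + m = (2 * m).-1)%N by lia.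
  have {2 3}-> : (2 * m = (2 * m).-1.+1)%N by lia.
  set x := normc (g _); set y := normc (F _); set n := (2 * m).-1.
  have x0 : 0 <= x := normc_ge0 _; have y0 : 0 <= y := normc_ge0 _.
  have [xy|/ltW yx] := leP x y.
    apply: le_trans (_ : y * y ^+ n <= _); first by rewrite ler_wpM2r ?exprn_ge0.
    by rewrite -exprS lerDr exprn_ge0.
  apply: le_trans (_ : x * x ^+ n <= _); last by rewrite -exprS lerDl exprn_ge0.
  by rewrite ler_wpM2l //; apply: lerXn2r; rewrite ?nnegrE.
- exact: dintegrableD.
Qed.

(** The variational identity of the extremal problem. Perturb F to F + t g:
    the inequality in the definition of optimal is an equality at t = 0, so that
    its two sides agree to first order in t. *)
Theorem optimal_identity m k F lam g : (0 < m)%N -> analytic_on_disc k -> dintegrable (abspowR (conj_exp m) k) ->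
  optimal m k F lam -> analytic_on_disc g -> dintegrable (abspow m g) ->
  dint (re_pair g k) = lam * dint (re_pair (fun z => g z * F z ^+ m.-1) (fun z => F z ^+ m)).
Proof.
move=> m0 ka ik [Fa iF F1 lamE Fh] ga ig; have p0 := p_gt0 m0.
have [C C0 H] := @power_norm_expand R m.
pose J := dint (re_pair (fun z => g z * F z ^+ m.-1) (fun z => F z ^+ m)); rewrite -/J.
have lam0 : 0 <= lam.
  have := Fh (fun=> 0) (@analytic_cst R 0).
  rewrite (_ : abspow m (fun=> 0) = fun=> 0); last first.
    by apply/funext => w; rewrite /abspow normc0 expr0n muln_eq0 /= eqn0Ngt m0.
  move=> /(_ (dintegrable_cst 0)).
  rewrite (_ : re_pair (fun=> 0) k = fun=> 0); last by apply/funext => w; rewrite /re_pair mul0r.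
  rewrite dint_cst mulr0 addr0 pmulr_lge0 //.
  by rewrite subr_gt0 ltr1n; lia.
have iJ := dintegrable_test m0 Fa ga iF ig.
pose L := dint (re_pair g k).
have ir := dintegrable_re_pair m0 ga ka ig ik.
have irF := dintegrable_re_pair m0 Fa ka iF ik.
apply/eqP; rewrite -subr_eq0; apply/eqP.
apply: (@linear_le_square R _ (lam * (C * (1 + dint (abspow m g))) / (2 * m)%:R)) => t t1.
pose h z := F z + t%:C * g z.
have tga : analytic_on_disc (fun z => t%:C * g z) by exact: (@analyticZ _ t%:C g ga).
have ha : analytic_on_disc h by exact: (@analyticD _ F (fun z => t%:C * g z) Fa tga).
pose ub w := abspow m F w + (t * (2 * m)%:R * re_pair (fun z => g z * F z ^+ m.-1) (fun z => F z ^+ m) w + t ^+ 2 * C * (abspow m F w + abspow m g w)).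
have hub w : abspow m h w <= ub w.
  apply: le_trans (H (F (to_C w)) (g (to_C w)) t t1) _.
  by rewrite /ub -addrA !mulrA.
have iQ := dintegrableD iF ig.
have iQ2 := dintegrableZ (t ^+ 2 * C) iQ.
have iJ2 := dintegrableZ (t * (2 * m)%:R) iJ.
have iS := dintegrableD iJ2 iQ2.
have iub : dintegrable ub := dintegrableD iF iS.
have ih : dintegrable (abspow m h).
  apply: (@dintegrable_le _ _ ub) => //; first exact: dmeas_abspow.
  by move=> w _; rewrite ger0_norm ?abspow_ge0.
have Iub : dint ub = 1 + (t * (2 * m)%:R * J + t ^+ 2 * C * (1 + dint (abspow m g))).
  by rewrite /ub (dintD iF iS) (dintD iJ2 iQ2) (dintZ _ iJ) (dintZ _ iQ) (dintD iF ig) F1.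
have Ih : dint (re_pair h k) = lam + t * L.
  rewrite lamE /L -(dintZ _ ir) -(dintD irF (dintegrableZ _ ir)).
  by apply: eq_dint => w _; rewrite /h re_pairDl re_pairZl.
have h1 := Fh h ha ih.
have h2 : dint (abspow m h) <= dint ub by apply: dint_le => // w _.
rewrite Ih in h1; rewrite Iub in h2.
have h3 := ler_wpM2l lam0 h2.
have h4 : (2 * m)%:R * (t * (L - lam * J)) <= t ^+ 2 * (lam * (C * (1 + dint (abspow m g)))).
  move: h1 h3; clear; set p := (2 * m)%:R; set G := dint (abspow m g); set X := dint (abspow m h) => h1 h3.
  by nra.
rewrite -(ler_pM2l p0); apply: le_trans h4 _.
by rewrite [leRHS]mulrCA ler_wpM2l ?sqr_ge0 // [leRHS]mulrC divfK // gt_eqF.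
Qed.

End ExtremalProblem.

(** * Ryabykh's theorem *)

Section Regularity.
Variable R : realType.
Notation disc := (@planar_disc R).
Implicit Types (f g h k F : R[i] -> R[i]) (m : nat) (q t e K lam r : R).

Lemma Hp_integrable m f K : analytic_on_disc f -> 0 <= K -> Hp_bound m f K ->
  dintegrable (abspow m f) /\ dint (abspow m f) <= K.
Proof.
move=> fa K0 hK; apply: circ_bounded_integrable => //; first exact: dmeas_abspow.
  by move=> w _; exact: abspow_ge0.
by move=> s /andP[s0 s1]; apply: hK; rewrite ltW.
Qed.

Lemma Hq_integrable q k K : analytic_on_disc k -> 0 <= K -> Hq_bound q k K ->
  dintegrable (abspowR q k) /\ dint (abspowR q k) <= K.
Proof.
move=> ka K0 hK; apply: circ_bounded_integrable => //; first exact: dmeas_abspowR.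
by move=> w _; exact: abspowR_ge0.
Qed.

Lemma p_gt1 m : (0 < m)%N -> 0 < (2 * m)%:R - 1 :> R.
Proof. by move=> m0; rewrite subr_gt0 ltr1n; lia. Qed.

Lemma disc_abspow m f : analytic_on_disc f -> (\int[sigma R]_(w in disc) (abspow m f w)%:E =
  \sum_(j <oo) (normc (acoef (fun z => f z ^+ m) j) ^+ 2 / j.+1%:R)%:E)%E.
Proof.
move=> fa; rewrite -(disc_sq (@analyticX _ f m fa)); apply: eq_integral => w _; congr EFin; exact: abspowE.
Qed.

Lemma trunc_abspow m f r : analytic_on_disc f -> 0 <= r <= 1 -> (\int[sigma R]_(w in subdisc r) (abspow m f w)%:E =
  \sum_(j <oo) (normc (acoef (fun z => f z ^+ m) j) ^+ 2 * (r ^+ j.+1 / j.+1%:R))%:E)%E.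
Proof.
move=> fa hr; rewrite -(disc_sq_trunc (@analyticX _ f m fa) hr); apply: eq_integral => w _; congr EFin; exact: abspowE.
Qed.

Lemma acoef_dilateX m r f j : 0 <= r <= 1 -> analytic_on_disc f ->
  normc (acoef (fun z => dilate r f z ^+ m) j) ^+ 2 = (r ^+ 2) ^+ j * normc (acoef (fun z => f z ^+ m) j) ^+ 2.
Proof.
move=> hr fa; have -> : (fun z => dilate r f z ^+ m) = dilate r (fun z => f z ^+ m) by [].
rewrite (acoef_dilate j hr (@analyticX _ f m fa)) normcM normcR exprMn; congr (_ * _).
by rewrite (real_normK (num_real _)) -!exprM mulnC.
Qed.

Lemma acoef_dilateX_le m r f j : 0 <= r <= 1 -> analytic_on_disc f ->
  normc (acoef (fun z => dilate r f z ^+ m) j) ^+ 2 <= normc (acoef (fun z => f z ^+ m) j) ^+ 2.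
Proof.
move=> hr fa; have /andP[r0 r1] := hr.
apply: (eq_ind_r (fun x => x <= _) _ (acoef_dilateX m j hr fa)).
apply: ler_piMl; first exact: sqr_ge0.
by apply: exprn_ile1; [exact: sqr_ge0|exact: exprn_ile1].
Qed.

Lemma Hp_dilate m f K r : analytic_on_disc f -> 0 <= r <= 1 -> Hp_bound m f K -> Hp_bound m (dilate r f) K.
Proof.
move=> fa hr hK; apply: coef_Hp; first exact: analytic_dilate.
move=> N; apply: le_trans (Hp_coef N fa hK); apply: ler_sum => j _.
exact: acoef_dilateX_le.
Qed.

Lemma Hp_dilate_ex m f r : analytic_on_disc f -> 0 <= r < 1 -> exists2 K, 0 <= K & Hp_bound m (dilate r f) K.
Proof.
move=> fa /andP[r0 r1]; have hr : 0 <= r <= 1 by rewrite r0 ltW.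
have hs : 0 <= r ^+ 2 < 1 by rewrite sqr_ge0 expr_lt1.
have fin := circle_sum_fin (@analyticX _ f m fa) hs.
have pos j : (0 <= (normc (acoef (fun z => f z ^+ m) j) ^+ 2 * (r ^+ 2) ^+ j)%:E)%E.
  by rewrite lee_fin mulr_ge0 ?sqr_ge0 // exprn_ge0 // sqr_ge0.
have pS : (0 <= \sum_(j <oo) (normc (acoef (fun z => f z ^+ m) j) ^+ 2 * (r ^+ 2) ^+ j)%:E)%E.
  by apply: nneseries_ge0 => j _ _; exact: pos.
exists (fine (\sum_(j <oo) (normc (acoef (fun z => f z ^+ m) j) ^+ 2 * (r ^+ 2) ^+ j)%:E)%E); first exact: fine_ge0.
apply: coef_Hp; first exact: analytic_dilate.
move=> N; rewrite -lee_fin fineK ?ge0_fin_numE //.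
rewrite (eq_bigr (fun j : 'I_N => normc (acoef (fun z => f z ^+ m) j) ^+ 2 * (r ^+ 2) ^+ j)); last first.
  by move=> j _; exact: (etrans (acoef_dilateX m j hr fa) (mulrC _ _)).
by apply: (@series_ge R (fun j => normc (acoef (fun z => f z ^+ m) j) ^+ 2 * (r ^+ 2) ^+ j)) => j; rewrite -lee_fin.
Qed.

Lemma dint_trunc u : dintegrable u ->
  (fun n => \int[sigma R]_(w in subdisc (rho_ R n)) u w) @ \oo --> dint u.
Proof.
by move=> iu; rewrite /dint -subdisc1; apply: trunc_cvg => //; [exact: cvg_rho|exact: rho_le1].
Qed.

Lemma pair_coef_dilate g k r rho : analytic_on_disc g -> analytic_on_disc k -> 0 <= r <= 1 -> 0 <= rho < 1 ->
  \int[sigma R]_(w in subdisc rho) re_pair (fun z => r%:C * dilate r g z) k w =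
  \int[sigma R]_(w in subdisc (r * rho)) re_pair g k w.
Proof.
move=> ga ka hr hrho; have /andP[r0 r1] := hr; have /andP[p0 p1] := hrho.
have hrr : 0 <= r * rho < 1 by rewrite mulr_ge0 //=; apply: le_lt_trans p1; rewrite ler_piMl.
have da := analytic_dilate hr ga.
have H1 := pair_trunc (@analyticZ _ r%:C (dilate r g) da) ka hrho.
have H2 := pair_trunc ga ka hrr.
apply: (cvg_real_eq H1 H2) => N; apply: eq_bigr => j _.
rewrite (acoefZ r%:C j da) (acoef_dilate j hr ga) mulrA -rmorphM -exprS -mulrA Re_scale exprMn.
by rewrite -!mulrA mulrCA.
Qed.

(** Both sides have the same series: replacing g by r g_r multiplies the term
    with index j by r^(j+1), and so does restricting the integral to |z|^2 <
    r. *)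
Lemma pair_dilate g k r : analytic_on_disc g -> analytic_on_disc k -> 0 <= r <= 1 ->
  dintegrable (re_pair g k) -> dintegrable (re_pair (fun z => r%:C * dilate r g z) k) ->
  dint (re_pair (fun z => r%:C * dilate r g z) k) = \int[sigma R]_(w in subdisc r) re_pair g k w.
Proof.
move=> ga ka hr ig id_; have /andP[r0 r1] := hr.
have H1 := dint_trunc id_.
have H2 : (fun n => \int[sigma R]_(w in subdisc (r * rho_ R n)) re_pair g k w) @ \oo -->
    \int[sigma R]_(w in subdisc r) re_pair g k w.
  apply: trunc_cvg => //.
    rewrite -[X in _ --> X](mulr1 r); apply: cvgM; [exact: cvg_cst|exact: (@cvg_rho R)].
  by move=> n; rewrite ler_piMr // rho_le1.
by apply: (cvg_real_eq H1 H2) => n; rewrite pair_coef_dilate // rho_01.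
Qed.

Lemma coef_nonzero k : analytic_on_disc k -> not_identically_zero k -> exists j, acoef k j != 0.
Proof.
move=> ka [z z1 kz]; apply: contrapT => H; apply: kz.
have a0 j : acoef k j = 0.
  by apply/eqP; apply: contrapT => /negP h; apply: H; exists j.
apply: normc_small_eq => e e0; have hz : 0 <= normc z < 1 by rewrite normc_ge0.
have [N hN] := taylor ka hz e0.
have := hN N (leqnn N) z (lexx _); rewrite /psum big1 // => j _; by rewrite a0 mul0r.
Qed.

(** The functional is positive at the dilated kernel k(z/2), whose pairing
    with k has nonnegative terms. *)
Lemma optimal_norm_gt0 m k F lam : (0 < m)%N -> analytic_on_disc k -> dintegrable (abspowR (conj_exp R m) k) ->
  not_identically_zero k -> optimal m k F lam -> 0 < lam.
Proof.
move=> m0 ka ik knz [Fa iF F1 lamE Fh].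
have [j0 kj] := coef_nonzero ka knz.
have hr : 0 <= (2^-1 : R) < 1 by apply/andP; split; clear; lra.
have hr' : 0 <= (2^-1 : R) <= 1 by apply/andP; split; clear; lra.
pose g := dilate 2^-1 k; have ga : analytic_on_disc g := analytic_dilate hr' ka.
have [K K0 gK] := @Hp_dilate_ex m k 2^-1 ka hr.
have [ig _] := Hp_integrable ga K0 gK.
have ir := dintegrable_re_pair m0 ga ka ig ik.
pose c : R := 2^-1 ^+ j0 * normc (acoef k j0) ^+ 2 * (2^-1 ^+ j0.+1 / j0.+1%:R).
have n0 : 0 < normc (acoef k j0).
  by rewrite lt_neqAle normc_ge0 eq_sym andbT; apply/eqP => /normc_eq0/eqP; exact/negP.
have c0 : 0 < c by rewrite /c !mulr_gt0 ?exprn_gt0 ?invr_gt0 ?ltr0n.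
have pos : c <= dint (re_pair g k).
  apply: limit_ge (dint_trunc ir) _.
  near=> n.
  have hn := rho_01 R n; apply: limit_ge (pair_trunc ga ka hn) _.
  near=> N.
  have j0N : (j0 < N)%N by near: N; exists j0.+1.
  have term j : Re (acoef g j * (acoef k j)^*) = 2^-1 ^+ j * normc (acoef k j) ^+ 2.
    rewrite (acoef_dilate j hr' ka) -mulrA Re_scale; congr (_ * _).
    by rewrite mul_conjc.
  rewrite (bigD1 (Ordinal j0N)) //= -[leLHS]addr0; apply: lerD.
    rewrite term /c ler_wpM2l // ?mulr_ge0 ?exprn_ge0 ?normc_ge0 ?invr_ge0 //.
    rewrite ler_pM2r ?invr_gt0 ?ltr0n //; apply: lerXn2r; rewrite ?nnegrE ?invr_ge0 //; first by case/andP: hn.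
    near: n; exists 1%N => // n /= n1; rewrite /rho_ lerBrDr -lerBrDl.
    have : n.+1%:R^-1 <= 2^-1 :> R by rewrite lef_pV2 ?posrE ?ltr0n // ler_nat.
    by clear; set x := _^-1; lra.
  apply: sumr_ge0 => j _; rewrite term !mulr_ge0 ?exprn_ge0 ?invr_ge0 ?normc_ge0 //.
  by case/andP: hn.
have p0 := @p_gt0 R m m0.
have h := Fh g ga ig.
have B0 : 0 <= dint (abspow m g) by apply: dint_ge0 => w _; exact: abspow_ge0.
have lhs : 0 < (2 * m)%:R * dint (re_pair g k) by rewrite mulr_gt0 // (lt_le_trans c0).
have := lt_le_trans lhs h; rewrite pmulr_lgt0 //.
exact: ltr_pwDl (p_gt1 m0) B0.
Unshelve. all: by end_near.
Qed.

(** In terms of the coefficients of F^m: passing to r F_r multiplies the term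
    with index j by r^(2m+2j), at most the factor r^(j+1) of the disc |z|^2 <
    r. *)
Lemma dilate_mass m F r : (0 < m)%N -> analytic_on_disc F -> dintegrable (abspow m F) -> 0 <= r < 1 ->
  dint (abspow m (fun z => r%:C * dilate r F z)) <= dint (abspow m F) - dint (fun w => outside r w * abspow m F w).
Proof.
move=> m0 Fa iF hr; have /andP[r0 r1] := hr; have hr' : 0 <= r <= 1 by rewrite r0 ltW.
have da := analytic_dilate hr' Fa.
rewrite -(dint_outside (ltW r1) iF).
have Ga := @analyticX _ F m Fa.
have itr : (sigma R).-integrable (subdisc r) (fun w => (abspow m F w)%:E).
  have := trunc_integrable Ga hr; apply: eq_integrable => //; first exact: measurable_subdisc.
  by move=> w _; rewrite abspowE.
have [K K0 dK] := @Hp_dilate_ex m F r Fa hr.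
have [id_ _] := Hp_integrable da K0 dK.
have E : dint (abspow m (fun z => r%:C * dilate r F z)) = r ^+ (2 * m) * dint (abspow m (dilate r F)).
  by rewrite -(dintZ _ id_); apply: eq_dint => w _; rewrite abspowZ.
rewrite E -lee_fin EFinM -(dintE id_) /Rintegral fineK; last first.
  by apply: integrable_fin_num itr; exact: measurable_subdisc.
rewrite (disc_abspow m da) (trunc_abspow m Fa hr').
rewrite -nneseriesZl; last by move=> j _; rewrite lee_fin mulr_ge0 ?sqr_ge0.
apply: lee_nneseries => j.
  by move=> _ _; rewrite -EFinM lee_fin !mulr_ge0 ?exprn_ge0 ?normc_ge0.
move=> _; rewrite -EFinM lee_fin.
apply: (eq_ind_r (fun x => r ^+ (2 * m) * (x / j.+1%:R) <= _) _ (acoef_dilateX m j hr' Fa)).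
move: (normc _ ^+ 2) (sqr_ge0 (normc (acoef (fun z => F z ^+ m) j))) => A A0.
rewrite !mulrA ler_pM2r ?invr_gt0 ?ltr0n // [leRHS]mulrC ler_wpM2r //.
by rewrite -exprM -exprD ler_wiXn2l ?(ltW r1) //; lia.
Qed.

(** Compare F with r F_r. The functional loses the integral of F conj k over
    the annulus r <= |z|^2 < 1, the p-th power of the norm loses at least the
    integral of |F|^p there, and extremality bounds the second loss by a
    multiple of the first. Young's inequality absorbs half of it, which leaves
    a bound for the integral of |F|^p over the annulus by that of |k|^q, hence
    by (1 - r) K. Since the means of |F|^p increase with the radius, the mean
    at r is bounded. *)
Theorem ryabykh m k F lam K : (0 < m)%N -> analytic_on_disc k -> 0 <= K -> Hq_bound (conj_exp R m) k K ->
  optimal m k F lam -> 0 < lam ->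
  Hp_bound m F (2 * (2 * m)%:R * young_const m (lam / (2 * (2 * m)%:R)) * K / lam).
Proof.
move=> m0 ka K0 kK eF lam0 r hr; have [Fa iF F1 lamE Fh] := eF.
have /andP[r0 r1] := hr; have hr' : 0 <= r <= 1 by rewrite r0 ltW.
have [ik _] := Hq_integrable ka K0 kK.
have p0 := @p_gt0 R m m0; set p := (2 * m)%:R in p0 *.
(* with p * e = lam / 2, Young's inequality absorbs half of lam * X *)
pose e := lam / (2 * p); have e0 : 0 < e by rewrite divr_gt0 // mulr_gt0.
rewrite -/e; set y := young_const m e.
pose a := fine (circ_avg (fun w => (abspow m F w)%:E) r).
have aE : circ_avg (fun w => (abspow m F w)%:E) r = a%:E.
  rewrite /a fineK // ge0_fin_numE; first by rewrite circ_abspow //; exact: circle_sum_fin (@analyticX _ F m Fa) hr.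
  by apply: circ_avg_ge0_disc => // w _; exact: abspow_ge0.
have a0 : 0 <= a by rewrite -lee_fin -aE; apply: circ_avg_ge0_disc => // w _; exact: abspow_ge0.
rewrite aE lee_fin.
pose X := dint (fun w => outside r w * abspow m F w).
have aX : (1 - r) * a <= X.
  apply: outside_lb => //; first by move=> w _; exact: abspow_ge0.
  by move=> s /andP[rs s1]; rewrite -aE; exact: circ_abspow_homo.
have iqo := dintegrable_outside r ik.
have Y : dint (fun w => outside r w * abspowR (conj_exp R m) k w) <= (1 - r) * K.
  rewrite -lee_fin -dintE //; apply: outside_ub => //; first exact: dmeas_abspowR.
  by move=> w _; exact: abspowR_ge0.
have ir := dintegrable_re_pair m0 Fa ka iF ik.
have da := analytic_dilate hr' Fa.
have rda : analytic_on_disc (fun z => r%:C * dilate r F z) := @analyticZ _ r%:C (dilate r F) da.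
have [K' K'0 dK] := @Hp_dilate_ex m F r Fa hr.
have [id_ _] := Hp_integrable da K'0 dK.
have ird : dintegrable (abspow m (fun z => r%:C * dilate r F z)).
  by apply: eq_dintegrable (dintegrableZ (r ^+ (2 * m)) id_) => w _; rewrite abspowZ.
have irr := dintegrable_re_pair m0 rda ka ird ik.
have T1 := pair_dilate Fa ka hr' ir irr.
rewrite (dint_outside (ltW r1) ir) -lamE in T1.
have Z : dint (fun w => outside r w * re_pair F k w) <= e * X + y * ((1 - r) * K).
  have ipo := dintegrable_outside r iF.
  have h1 := dintegrableZ e ipo; have h2 := dintegrableZ y iqo.
  apply: (@le_trans _ _ (e * X + y * dint (fun w => outside r w * abspowR (conj_exp R m) k w))); last first.
    by rewrite lerD2l ler_wpM2l // young_const_ge0.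
  rewrite /X -(dintZ _ ipo) -(dintZ _ iqo) -(dintD h1 h2).
  apply: dint_le; [exact: dintegrable_outside|exact: dintegrableD|].
  move=> w _; rewrite (mulrCA e) (mulrCA y) -mulrDr; apply: ler_wpM2l; first by case/andP: (outside01 r w).
  by apply: le_trans (ler_norm _) _; exact: re_pair_le.
have H := Fh _ rda ird.
rewrite {}T1 -/p in H.
have M := dilate_mass m0 Fa iF hr; rewrite F1 -/X in M.
have M2 := ler_wpM2l (ltW lam0) M.
have ep : p * e = lam / 2 by rewrite /e invfM mulrCA; congr (_ * _); rewrite mulrCA mulfV ?mulr1 // gt_eqF.
have Z2 := ler_wpM2l (ltW p0) Z.
have fin : (1 - r) * (lam * a) <= (1 - r) * (2 * p * y * K).
  have t1 : lam * X <= lam / 2 * X + p * y * ((1 - r) * K).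
    have epX : p * (e * X) = lam / 2 * X by rewrite mulrA ep.
    rewrite mulrDr epX in Z2.
    move: H M2 Z2; set O := dint (fun w => outside r w * re_pair F k w); set B := dint (abspow m _); clear.
    by nra.
  have := ler_wpM2l (ltW lam0) aX.
  move: t1; clear; nra.
rewrite ler_pdivlMr // mulrC; move: fin; by rewrite ler_pM2l // subr_gt0.
Qed.

End Regularity.

(** * Pairing a derivative with a kernel *)

Section CirclePairing.
Variable R : realType.
Notation disc := (@planar_disc R).
Implicit Types (f g h k u v : R[i] -> R[i]) (m : nat) (e K s r : R).

Lemma circle_pair_le m f k Kf Kk e s : (0 < m)%N -> analytic_on_disc f -> analytic_on_disc k ->
  Hp_bound m f Kf -> Hq_bound (conj_exp R m) k Kk -> 0 < e -> 0 < s < 1 ->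
  Re (cmean (fun t => f ((Num.sqrt s)%:C * cis t) * (k ((Num.sqrt s)%:C * cis t))^*)) <= e * Kf + young_const m e * Kk.
Proof.
move=> m0 fa ka hf hk e0 hs; have hs' : 0 <= s < 1 by case/andP: hs => /ltW -> ->.
have s0 : 0 <= s by case/andP: hs'.
have hr := sqrt_lt1 hs'.
set u := (fun t => _).
have uc : ccont u by move=> x; apply: ccontM; [exact: ccont_circle|exact: ccont_circleJ].
rewrite -lee_fin -(circ_avgE uc).
pose b w := e * abspow m f w + young_const m e * abspowR (conj_exp R m) k w.
have b0 w : 0 <= b w by rewrite addr_ge0 // mulr_ge0 ?abspow_ge0 ?abspowR_ge0 ?young_const_ge0 // ltW.
have mf := dmeas_abspow m fa; have mk := dmeas_abspowR (conj_exp R m) ka.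
have m1 : dmeas (fun w => e * abspow m f w) by apply: dmeasM mf; exact: measurable_cst.
have m2 : dmeas (fun w => young_const m e * abspowR (conj_exp R m) k w) by apply: dmeasM mk; exact: measurable_cst.
have mb : dmeas b by exact: measurable_funD.
have p1 : (0 <= (2 * pi : R)^-1%:E)%E by rewrite lee_fin invr_ge0 (ltW (@pi_pos2 R)).
have bE : (circ_avg (fun w => (b w)%:E) s <= (e * Kf + young_const m e * Kk)%:E)%E.
  rewrite (circ_avgD hs' m1 m2); last 2 first.
  - by move=> w; rewrite mulr_ge0 ?abspow_ge0 // ltW.
  - by move=> w; rewrite mulr_ge0 ?abspowR_ge0 ?young_const_ge0.
  rewrite (circ_avgZ hs' (ltW e0) mf (@abspow_ge0 R m f)) (circ_avgZ hs' (young_const_ge0 _ _) mk (@abspowR_ge0 R _ k)).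
  rewrite EFinD !EFinM; apply: leeD; apply: lee_wpmul2l; rewrite ?lee_fin ?(ltW e0) ?young_const_ge0 //.
    exact: hf.
  exact: hk.
apply: le_trans bE; apply: lee_wpmul2l => //.
have [iu _] := @ccont_integrable R 0 (2 * pi) u (fun x _ => uc x).
have [fin|] := ltP (\int[@lebesgue_measure R]_(a in `[0%R, (2 * pi)%R]) (b (polar s a))%:E)%E +oo%E; last first.
  by move=> h; apply: le_trans h; exact: leey.
apply: le_integral => //.
  apply/integrableP; split; first exact: measurable_circle_itv.
  by under eq_integral do rewrite /= ger0_norm //.
move=> a _; rewrite lee_fin; apply: le_trans (ler_norm _) _.
by have := @re_pair_le R m f k e (polar s a) m0 e0; rewrite /re_pair to_C_polar.
Qed.

(** The derivative of z u(z). *)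
Definition Dz u z : R[i] := u z + euler u z.

Lemma analytic_Dz u : analytic_on_disc u -> analytic_on_disc (Dz u).
Proof. by move=> ua; exact: (@analyticD _ u (euler u) ua (analytic_euler ua)). Qed.

Lemma acoef_Dz u j : analytic_on_disc u -> acoef (Dz u) j = j.+1%:R * acoef u j.
Proof.
move=> ua; apply: etrans (acoefD j ua (analytic_euler ua)) _.
by rewrite (acoef_euler j ua) -natr1 [RHS]mulrDl mul1r addrC.
Qed.

Lemma Re_natM (n : nat) (z : R[i]) : Re (n%:R * z) = n%:R * Re z.
Proof. by rewrite -[n%:R in LHS](rmorph_nat (real_complex R)) Re_scale. Qed.

(** The factor j + 1 of the derivative cancels the weight 1 / (j + 1) of the
    area integral. What remains is a pairing over one circle, which the H^p
    and H^q norms control. *)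
Lemma pair_Dz_le m f k Kf Kk e s : (0 < m)%N -> analytic_on_disc f -> analytic_on_disc k ->
  0 <= Kf -> 0 <= Kk -> Hp_bound m f Kf -> Hq_bound (conj_exp R m) k Kk -> 0 < e -> 0 < s < 1 ->
  dint (re_pair (dilate s (Dz f)) k) <= e * Kf + young_const m e * Kk.
Proof.
move=> m0 fa ka Kf0 Kk0 hf hk e0 hs; have hs' : 0 <= s < 1 by case/andP: hs => /ltW -> ->.
have hs1 : 0 <= s <= 1 by case/andP: hs' => -> /ltW ->.
have /andP[s0 s1] := hs.
have Da := analytic_Dz fa; have da := analytic_dilate hs1 Da.
have [ik _] := Hq_integrable ka Kk0 hk.
have [K' K'0 dK] := @Hp_dilate_ex R m (Dz f) s Da hs'.
have [id_ _] := Hp_integrable da K'0 dK.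
have ir := dintegrable_re_pair m0 da ka id_ ik.
set B := e * Kf + _.
have B0 : 0 <= B by rewrite addr_ge0 // mulr_ge0 ?young_const_ge0 // ltW.
apply: limit_le (dint_trunc ir) _.
have hsn0 n : (0 < n)%N -> 0 < s * rho_ R n < 1.
  move=> n0; rewrite mulr_gt0 ?rho_gt0 //=.
  by apply: le_lt_trans s1; rewrite ler_piMr ?rho_le1 // ltW.
near=> n.
have hn := rho_01 R n; have /andP[n0 n1] := hn.
have hsn : 0 < s * rho_ R n < 1.
  by apply: hsn0; near: n; exists 1%N.
have hsn' : 0 <= s * rho_ R n < 1 by case/andP: hsn => /ltW -> ->.
have P := pair_trunc da ka hn.
have Q : (fun N => rho_ R n * \sum_(j < N) Re (acoef f j * (acoef k j)^*) * (s * rho_ R n) ^+ j) @ \oo -->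
  rho_ R n * Re (cmean (fun t => f ((Num.sqrt (s * rho_ R n))%:C * cis t) * (k ((Num.sqrt (s * rho_ R n))%:C * cis t))^*)).
  by apply: cvgM; [exact: cvg_cst|exact: parseval_pair].
rewrite (cvg_real_eq P Q); last first.
  move=> N; rewrite /= mulr_sumr; apply: eq_bigr => j _.
  have E : acoef (dilate s (Dz f)) j * (acoef k j)^* = (s ^+ j)%:C * (j.+1%:R * (acoef f j * (acoef k j)^*)).
    by apply: (etrans (congr1 (fun x => x * _) (etrans (acoef_dilate j hs1 Da) (congr1 (fun x => _ * x) (acoef_Dz j fa))))); rewrite !mulrA.
  apply: (etrans (congr1 (fun x => Re x * _) E)).
  rewrite Re_scale Re_natM exprMn exprS.
  move: (Re _) => x.
  have j1 : j.+1%:R != 0 :> R by rewrite pnatr_eq0.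
  by field.
apply: (@le_trans _ _ (rho_ R n * B)); last by rewrite ler_piMl // ltW.
by rewrite ler_wpM2l //; exact: (circle_pair_le m0 fa ka hf hk e0 hsn).
Unshelve. all: by end_near.
Qed.

End CirclePairing.

(** * The trilinear estimate *)

Section Trilinear.
Variable R : realType.
Notation disc := (@planar_disc R).
Implicit Types (f g h k u v X : R[i] -> R[i]) (m : nat) (e K s r : R).

(** Its integral over the disc is the sum of |x_j|^2 / ((j + 1) (j + 2)),
    where the x_j are the Taylor coefficients of X. *)
Definition defect X (w : plane R) : R := (1 - sqmod w) * normc (X (to_C w)) ^+ 2.

Lemma defect_ge0 X w : disc w -> 0 <= defect X w.
Proof. by move=> /in_disc w1; rewrite mulr_ge0 ?sqr_ge0 // subr_ge0 ltW. Qed.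

Lemma dmeas_defect X : analytic_on_disc X -> dmeas (defect X).
Proof.
move=> Xa; apply: dmeasM; last by apply: measurable_funX; exact: cmeas_normc (cmeas_analytic Xa).
apply: measurable_funB; first exact: measurable_cst.
by apply: (@measurable_funS _ _ _ _ setT) => //; exact: measurable_sqmod.
Qed.

Lemma defect_le K X : analytic_on_disc X ->
  (forall N, \sum_(j < N) normc (acoef X j) ^+ 2 / (j.+1%:R * j.+2%:R) <= K) ->
  dintegrable (defect X) /\ dint (defect X) <= K.
Proof.
move=> Xa hK.
have H : (\int[sigma R]_(w in disc) (defect X w)%:E <= K%:E)%E.
  by rewrite disc_sq_defect //; apply: (@series_le R (fun j => normc (acoef X j) ^+ 2 / (j.+1%:R * j.+2%:R))) => // j; rewrite divr_ge0 ?sqr_ge0 ?mulr_ge0.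
have iX : dintegrable (defect X).
  apply: dintegrable_ge0; [exact: dmeas_defect|exact: defect_ge0|].
  by apply: le_lt_trans H _; exact: ltry.
by split=> //; move: H; rewrite dintE.
Qed.

Lemma defect_ge N X : analytic_on_disc X -> dintegrable (defect X) ->
  \sum_(j < N) normc (acoef X j) ^+ 2 / (j.+1%:R * j.+2%:R) <= dint (defect X).
Proof.
move=> Xa iX; rewrite -lee_fin -dintE // disc_sq_defect //.
apply: (@series_ge R (fun j => normc (acoef X j) ^+ 2 / (j.+1%:R * j.+2%:R))) => j.
by rewrite divr_ge0 ?sqr_ge0 ?mulr_ge0.
Qed.

Lemma defect_hardy K X : analytic_on_disc X -> (forall N, \sum_(j < N) normc (acoef X j) ^+ 2 <= K) ->
  dintegrable (defect X) /\ dint (defect X) <= K.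
Proof.
move=> Xa hK; apply: defect_le => // N; apply: le_trans (hK N); apply: ler_sum => j _.
rewrite ler_pdivrMr ?mulr_gt0 ?ltr0n // ler_peMr ?sqr_ge0 // -natrM ler1n muln_gt0 //.
Qed.

(** The Littlewood-Paley inequality, from j^2 <= (j + 1) (j + 2). *)
Lemma defect_euler K X : analytic_on_disc X -> (forall N, \sum_(j < N) normc (acoef X j) ^+ 2 <= K) ->
  dintegrable (defect (euler X)) /\ dint (defect (euler X)) <= K.
Proof.
move=> Xa hK; apply: defect_le; first exact: analytic_euler.
move=> N; apply: le_trans (hK N); apply: ler_sum => j _.
rewrite (acoef_euler j Xa) normcM normc_nat exprMn.
rewrite ler_pdivrMr ?mulr_gt0 ?ltr0n // mulrC ler_wpM2l ?sqr_ge0 //.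
by rewrite -natrX -natrM ler_nat; nia.
Qed.

Lemma sqr_sum_le (x y : R) : (x + y) ^+ 2 <= 2 * (x ^+ 2 + y ^+ 2).
Proof. by have := sqr_ge0 (x - y); rewrite !expr2; lra. Qed.

(** Either |b| <= 2 |a|, or both |a + b| and |a - b| are at least |b| / 2; in
    the latter case 2 c = (c + d) + (c - d) shares c out between the last two
    terms. *)
Lemma polar_max n (a b c d : R[i]) :
  normc b ^+ n * normc c <= 2 ^+ n * (normc a ^+ n * normc c + normc (a + b) ^+ n * normc (c + d) + normc (a - b) ^+ n * normc (c - d)).
Proof.
have A := normc_ge0 a; have B := normc_ge0 b; have C := normc_ge0 c.
have P x y : 0 <= normc (x : R[i]) ^+ n * normc (y : R[i]) by rewrite mulr_ge0 ?exprn_ge0 ?normc_ge0.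
have [ba|ab] := leP (normc b) (2 * normc a).
  apply: (@le_trans _ _ ((2 * normc a) ^+ n * normc c)).
    by rewrite ler_wpM2r //; apply: lerXn2r; rewrite ?nnegrE // mulr_ge0.
  by rewrite exprMn -mulrA ler_wpM2l ?exprn_ge0 // -addrA lerDl addr_ge0.
have h1 : normc b <= 2 * normc (a + b).
  have := lecr_normcB b (- a); rewrite normcN opprK addrC => h.
  by move: ab h; rewrite [b + a]addrC; clear; lra.
have h2 : normc b <= 2 * normc (a - b).
  have := lecr_normcB b a; rewrite normcBC => h.
  by move: ab h; clear; lra.
have h3 : normc c <= normc (c + d) + normc (c - d).
  have := le_normcD (c + d) (c - d).
  have -> : c + d + (c - d) = 2%:R * c by ring.
  by rewrite normcM normc_nat; move: C; clear; set z := normc (_ + _); lra.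
have s1 : normc b ^+ n <= 2 ^+ n * normc (a + b) ^+ n.
  by rewrite -exprMn; apply: lerXn2r; rewrite ?nnegrE ?mulr_ge0 ?normc_ge0.
have s2 : normc b ^+ n <= 2 ^+ n * normc (a - b) ^+ n.
  by rewrite -exprMn; apply: lerXn2r; rewrite ?nnegrE ?mulr_ge0 ?normc_ge0.
apply: (@le_trans _ _ (normc b ^+ n * (normc (c + d) + normc (c - d)))).
  by rewrite ler_wpM2l // exprn_ge0.
rewrite -addrA [leRHS]mulrDr -[leLHS]add0r; apply: lerD.
  by rewrite mulr_ge0 // exprn_ge0.
rewrite !mulrDr !mulrA; apply: lerD; rewrite ler_wpM2r ?normc_ge0 //.
Qed.

Lemma Hp_comb m f g h c Kf Kg : analytic_on_disc f -> analytic_on_disc g -> analytic_on_disc h -> 0 <= c ->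
  (forall w, disc w -> abspow m h w <= c * (abspow m f w + abspow m g w)) -> Hp_bound m f Kf -> Hp_bound m g Kg ->
  Hp_bound m h (c * (Kf + Kg)).
Proof.
move=> fa ga ha c0 hfg hf hg s hs.
have mD : dmeas (fun w => abspow m f w + abspow m g w) by apply: measurable_funD; exact: dmeas_abspow.
have D0 w : 0 <= abspow m f w + abspow m g w by rewrite addr_ge0 ?abspow_ge0.
apply: le_trans (@circ_avg_mono R _ (fun w => c * (abspow m f w + abspow m g w)) s hs _ _ _ hfg) _.
- exact: dmeas_abspow.
- by apply: dmeasM mD; exact: measurable_cst.
- by move=> w; exact: abspow_ge0.
rewrite (circ_avgZ hs c0 mD D0) (circ_avgD hs (dmeas_abspow m fa) (dmeas_abspow m ga) (@abspow_ge0 R m f) (@abspow_ge0 R m g)).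
rewrite EFinM EFinD; apply: lee_wpmul2l => //; apply: leeD; [exact: hf|exact: hg].
Qed.

Lemma abspowD_le m f g w : abspow m (fun z => f z + g z) w <= 2 ^+ (2 * m) * (abspow m f w + abspow m g w).
Proof.
apply: le_trans (sum_pow_le (2 * m) (normc_ge0 (f (to_C w))) (normc_ge0 (g (to_C w)))).
by apply: lerXn2r; rewrite ?nnegrE ?addr_ge0 ?normc_ge0 // le_normcD.
Qed.

Lemma abspowN m g w : abspow m (fun z => - g z) w = abspow m g w.
Proof. by rewrite /abspow normcN. Qed.

Lemma abspowB_le m f g w : abspow m (fun z => f z - g z) w <= 2 ^+ (2 * m) * (abspow m f w + abspow m g w).
Proof. by have := abspowD_le m f (fun z => - g z) w; rewrite abspowN. Qed.

(** Its pairing with v^m is the integral on the right of the variational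
    identity for F = v and the test function (z u)'. *)
Definition test_fun m u v z : R[i] := Dz u z * v z ^+ m.-1.

Lemma analytic_test_fun m u v : analytic_on_disc u -> analytic_on_disc v -> analytic_on_disc (test_fun m u v).
Proof.
move=> ua va; exact: (@analyticM _ (Dz u) (fun z => v z ^+ m.-1) (analytic_Dz ua) (@analyticX _ v m.-1 va)).
Qed.

(** The inequality of test_fun_point between moduli: x = |u|, y = |v|, ex = |z
    u'|, the B's are the products on the right of polar_max and the A's the
    derivatives that bound them. *)
Lemma test_fun_real n (x y ex B0 B1 B2 A0 A1 A2 H U V : R) :
  0 <= x -> 0 <= y -> 0 <= ex -> 0 <= H -> 0 <= B0 -> 0 <= B1 -> 0 <= B2 ->
  y ^+ n * ex <= 2 ^+ n * (B0 + B1 + B2) -> B0 <= A0 -> B1 <= A1 -> B2 <= A2 ->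
  H <= x * y ^+ n + y ^+ n * ex -> U = x ^+ n.+1 -> V = y ^+ n.+1 ->
  H ^+ 2 <= 2 * (U ^+ 2 + V ^+ 2) + 6 * 4 ^+ n.+1 * (A0 ^+ 2 + A1 ^+ 2 + A2 ^+ 2).
Proof.
move=> x0 y0 ex0 H0 B00 B10 B20 P h0 h1 h2 HH -> ->.
have P1 : y ^+ n * ex <= 2 ^+ n.+1 * (A0 + A1 + A2).
  apply: le_trans P _; apply: ler_pM; rewrite ?exprn_ge0 ?addr_ge0 //.
    by rewrite ler_weXn2l // ler1n.
  by apply: lerD => //; apply: lerD.
have P2 : (y ^+ n * ex) ^+ 2 <= 3 * 4 ^+ n.+1 * (A0 ^+ 2 + A1 ^+ 2 + A2 ^+ 2).
  apply: (@le_trans _ _ ((2 ^+ n.+1 * (A0 + A1 + A2)) ^+ 2)).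
    apply: lerXn2r => //; rewrite nnegrE ?mulr_ge0 ?exprn_ge0 // !addr_ge0 //; exact: le_trans h0 || exact: le_trans h1 || exact: le_trans h2.
  rewrite exprMn -exprM mulnC exprM (_ : 2 ^+ 2 = 4); last by rewrite expr2 -natrM.
  rewrite [leRHS]mulrAC [leRHS]mulrC ler_wpM2l ?exprn_ge0 //.
  have := sqr_ge0 (A0 - A1); have := sqr_ge0 (A0 - A2); have := sqr_ge0 (A1 - A2).
  by clear; rewrite !expr2; lra.
have P3 : (x * y ^+ n) ^+ 2 <= (x ^+ n.+1) ^+ 2 + (y ^+ n.+1) ^+ 2.
  have [xy|/ltW yx] := leP x y.
    apply: (@le_trans _ _ ((y ^+ n.+1) ^+ 2)); last by rewrite lerDr sqr_ge0.
    apply: lerXn2r; rewrite ?nnegrE ?mulr_ge0 ?exprn_ge0 //.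
    by rewrite exprS ler_wpM2r // exprn_ge0.
  apply: (@le_trans _ _ ((x ^+ n.+1) ^+ 2)); last by rewrite lerDl sqr_ge0.
  apply: lerXn2r; rewrite ?nnegrE ?mulr_ge0 ?exprn_ge0 //.
  by rewrite exprS ler_wpM2l //; apply: lerXn2r; rewrite ?nnegrE.
apply: (@le_trans _ _ ((x * y ^+ n + y ^+ n * ex) ^+ 2)).
  by apply: lerXn2r; rewrite ?nnegrE // addr_ge0 // mulr_ge0 ?exprn_ge0.
apply: le_trans (sqr_sum_le _ _) _.
move: P2 P3; clear; set X := (_ * _) ^+ 2; set Y := (_ * _) ^+ 2; set Q := 4 ^+ n.+1.
set B := A0 ^+ 2 + _ + _; set U := (x ^+ _) ^+ 2; set V := (y ^+ _) ^+ 2 => P2 P3.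
have : 6 * Q * B = 2 * (3 * Q * B) by ring.
by move: (3 * Q * B) (6 * Q * B) P2 P3 => z z' *; lra.
Qed.

Lemma eulerB f g z : analytic_on_disc f -> analytic_on_disc g -> normc z < 1 ->
  euler (fun z => f z - g z) z = euler f z - euler g z.
Proof.
move=> fa ga z1.
rewrite (_ : (fun z => f z - g z) = (fun z => f z + (-1) * g z)); last by apply/funext => y; rewrite mulN1r.
by rewrite (@eulerD _ f (fun z => (-1) * g z) z fa (@analyticZ _ (-1) g ga) z1) (@eulerZ _ (-1) g z ga z1) mulN1r.
Qed.

Lemma euler_power_ge n g z : analytic_on_disc g -> normc z < 1 ->
  normc (g z) ^+ n * normc (euler g z) <= normc (euler (fun z => g z ^+ n.+1) z).
Proof.
move=> ga z1; rewrite (eulerX n ga z1) !normcM normcX normc_nat -mulrA.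
by rewrite ler_peMl ?mulr_ge0 ?exprn_ge0 ?normc_ge0 // ler1n.
Qed.

(** v^(m-1) z u' is not of the form z h' with h in H^2, but polar_max bounds
    it by the functions z h' for h = u^m, (u + v)^m and (u - v)^m. *)
Lemma test_fun_point m u v z : (0 < m)%N -> analytic_on_disc u -> analytic_on_disc v -> normc z < 1 ->
  normc (test_fun m u v z) ^+ 2 <= 2 * (normc (u z ^+ m) ^+ 2 + normc (v z ^+ m) ^+ 2)
   + 6 * 4 ^+ m * (normc (euler (fun z => u z ^+ m) z) ^+ 2 + normc (euler (fun z => (u z + v z) ^+ m) z) ^+ 2
      + normc (euler (fun z => (u z - v z) ^+ m) z) ^+ 2).
Proof.
case: m => // n _ ua va z1.
have uva := analyticD ua va; have uvb := analyticB ua va.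
have P := polar_max n (u z) (v z) (euler u z) (euler v z).
have h0 := @euler_power_ge n u z ua z1.
have h1 := @euler_power_ge n _ z uva z1; rewrite (eulerD ua va z1) in h1.
have h2 := @euler_power_ge n _ z uvb z1; rewrite (eulerB ua va z1) in h2.
have P4 : normc (test_fun n.+1 u v z) <= normc (u z) * normc (v z) ^+ n + normc (v z) ^+ n * normc (euler u z).
  apply: (@le_trans _ _ ((normc (u z) + normc (euler u z)) * normc (v z) ^+ n)); last by rewrite mulrDl [X in _ + X <= _]mulrC.
  rewrite /test_fun /Dz normcM normcX ler_wpM2r ?exprn_ge0 ?normc_ge0 //.
  exact: le_normcD.
have N (a b : R[i]) : 0 <= normc a ^+ n * normc b by rewrite mulr_ge0 ?exprn_ge0 ?normc_ge0.
exact: (test_fun_real (normc_ge0 (u z)) (normc_ge0 (v z)) (normc_ge0 (euler u z)) (normc_ge0 _) (N _ _) (N _ _) (N _ _)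
  P h0 h1 h2 P4 (normcX _ _) (normcX _ _)).
Qed.

Lemma test_fun_arith (x y z k l t : R) : x <= k -> y <= t * (k + l) -> z <= t * (k + l) -> 0 <= l ->
  x + y + z <= (1 + 2 * t) * (k + l).
Proof. by rewrite mulrDl mul1r -mulrA; move: (t * (k + l)) => a *; lra. Qed.

(** By test_fun_point it is enough to estimate H^2 functions and, with the
    Littlewood-Paley inequality, their derivatives. *)
Theorem test_fun_bound m u v Ku Kv : (0 < m)%N -> analytic_on_disc u -> analytic_on_disc v ->
  0 <= Ku -> 0 <= Kv -> Hp_bound m u Ku -> Hp_bound m v Kv ->
  forall N, \sum_(j < N) normc (acoef (test_fun m u v) j) ^+ 2 / (j.+1%:R * j.+2%:R) <=
   (2 + 6 * 4 ^+ m * (1 + 2 * 2 ^+ (2 * m))) * (Ku + Kv).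
Proof.
move=> m0 ua va Ku0 Kv0 hu hv N; have ca := @analytic_test_fun m u v ua va.
have uva := analyticD ua va; have uvb := analyticB ua va.
have hD : Hp_bound m (fun z => u z + v z) (2 ^+ (2 * m) * (Ku + Kv)).
  by apply: (Hp_comb ua va uva) => // w _; exact: abspowD_le.
have hB : Hp_bound m (fun z => u z - v z) (2 ^+ (2 * m) * (Ku + Kv)).
  by apply: (Hp_comb ua va uvb) => // w _; exact: abspowB_le.
have Xa (f : R[i] -> R[i]) : analytic_on_disc f -> analytic_on_disc (fun z => f z ^+ m) by move=> fa; exact: (@analyticX _ f m fa).
have [i1 b1] := defect_hardy (Xa _ ua) (fun N => Hp_coef N ua hu).
have [i2 b2] := defect_hardy (Xa _ va) (fun N => Hp_coef N va hv).
have [i3 b3] := defect_euler (Xa _ ua) (fun N => Hp_coef N ua hu).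
have [i4 b4] := defect_euler (Xa _ uva) (fun N => Hp_coef N uva hD).
have [i5 b5] := defect_euler (Xa _ uvb) (fun N => Hp_coef N uvb hB).
set X1 := defect _ in i1 b1; set X2 := defect _ in i2 b2; set X3 := defect _ in i3 b3.
set X4 := defect _ in i4 b4; set X5 := defect _ in i5 b5.
pose c := 6 * 4 ^+ m : R.
have j1 := dintegrableZ 2 (dintegrableD i1 i2).
have j2 := dintegrableD (dintegrableD i3 i4) i5.
have j3 := dintegrableZ c j2.
have j4 := dintegrableD j1 j3.
have Eq (y a b d x1 x2 x3 : R) : y * (2 * (a + b) + d * (x1 + x2 + x3)) =
  2 * (y * a + y * b) + d * (y * x1 + y * x2 + y * x3) by ring.
have pt w : disc w -> defect (test_fun m u v) w <= 2 * (X1 w + X2 w) + c * (X3 w + X4 w + X5 w).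
  move=> Dw; have := @test_fun_point m u v (to_C w) m0 ua va Dw.
  have w0 : 0 <= 1 - sqmod w by move/in_disc: Dw; rewrite subr_ge0 => /ltW.
  move=> /(ler_wpM2l w0); rewrite /X1 /X2 /X3 /X4 /X5 /defect -/c => h; apply: le_trans h _.
  by rewrite Eq; exact: lexx.
have ic : dintegrable (defect (test_fun m u v)).
  apply: (dintegrable_le (dmeas_defect ca) _ j4) => w Dw.
  by rewrite ger0_norm ?defect_ge0 // pt.
apply: le_trans (defect_ge N ca ic) _.
apply: le_trans (dint_le ic j4 pt) _.
rewrite (dintD j1 j3) (dintZ _ (dintegrableD i1 i2)) (dintZ _ j2) (dintD i1 i2) (dintD (dintegrableD i3 i4) i5) (dintD i3 i4).
have c0 : 0 <= c by rewrite mulr_ge0 ?exprn_ge0.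
rewrite -/c [leRHS]mulrDl; apply: lerD; first by rewrite ler_wpM2l // lerD.
rewrite -[leRHS]mulrA ler_wpM2l //.
exact: test_fun_arith b3 b4 b5 Kv0.
Qed.

End Trilinear.

(** * Finite sections of the pairing *)

Section PairTail.
Variable R : realType.
Notation disc := (@planar_disc R).
Implicit Types (f g h k u v X G F : R[i] -> R[i]) (m N : nat) (e K s r W T eta : R).

Lemma pair_term (a b : R[i]) j eta r : 0 < eta -> 0 <= r <= 1 ->
  `|Re (a * b^*) * (r / j.+1%:R)| <= 2 * eta * (normc a ^+ 2 / (j.+1%:R * j.+2%:R)) + normc b ^+ 2 / eta.
Proof.
move=> e0 /andP[r0 r1].
have j1 : 0 < j.+1%:R :> R by rewrite ltr0n.
have j2 : 0 < j.+2%:R :> R by rewrite ltr0n.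
have A0 := normc_ge0 a; have B0 := normc_ge0 b.
apply: (@le_trans _ _ (normc a / j.+1%:R * normc b)).
  rewrite normrM [normc a / _ * _]mulrAC; apply: ler_pM => //.
    by apply: le_trans (normr_Re_le _) _; rewrite normcM normc_conj.
  by rewrite ger0_norm ?divr_ge0 ?(ltW j1) // ler_pdivrMr // mulVf ?gt_eqF.
apply: (@le_trans _ _ (eta * (normc a / j.+1%:R) ^+ 2 + normc b ^+ 2 / eta)).
  set x := normc a / _; set y := normc b.
  have x0 : 0 <= x by rewrite divr_ge0 // ltW.
  have H : 0 <= (eta * x - y) ^+ 2 by rewrite sqr_ge0.
  rewrite -(ler_pM2r e0) [leRHS]mulrDl divfK ?gt_eqF //.
  have : 0 <= eta * (x * y) by rewrite !mulr_ge0 // ltW.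
  by move: H; rewrite /y; clear; rewrite !expr2; nra.
rewrite lerD2r (mulrC 2) -[leRHS]mulrA ler_wpM2l ?(ltW e0) //.
rewrite expr_div_n [leRHS]mulrCA ler_wpM2l ?sqr_ge0 // [(_ * j.+2%:R)^-1]invfM [leRHS]mulrCA.
rewrite expr2 invfM ler_wpM2l ?invr_ge0 ?(ltW j1) //.
rewrite ler_pdivlMr // mulrC ler_pdivrMr // -natrM ler_nat; lia.
Qed.

Lemma sum_split (a : nat -> R) N0 N : (N0 <= N)%N ->
  \sum_(j < N) a j = \sum_(j < N0) a j + \sum_(N0 <= j < N) a j.
Proof. by move=> NN; rewrite -(big_mkord predT a) (@big_cat_nat _ _ _ N0 0 N) //= big_mkord. Qed.

Lemma sum_tail_le (a b : nat -> R) N0 N : (N0 <= N)%N ->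
  (forall j, `|a j| <= b j) -> `|\sum_(j < N) a j - \sum_(j < N0) a j| <= \sum_(N0 <= j < N) b j.
Proof.
move=> NN ab; rewrite (sum_split a NN) [X in `|X|]addrC addKr.
by apply: le_trans (ler_norm_sum _ _ _) _; apply: ler_sum.
Qed.

(** Cauchy-Schwarz for the terms beyond N0. As (j + 1)^(-2) is at most twice
    the weight in W, they are controlled by W and by the tail T of G in H^2. *)
Lemma pair_tail h G W T eta N0 : analytic_on_disc h -> analytic_on_disc G -> dintegrable (re_pair h G) ->
  (forall N, \sum_(j < N) normc (acoef h j) ^+ 2 / (j.+1%:R * j.+2%:R) <= W) ->
  (forall N, \sum_(N0 <= j < N) normc (acoef G j) ^+ 2 <= T) -> 0 < eta ->
  `|dint (re_pair h G) - \sum_(j < N0) Re (acoef h j * (acoef G j)^*) / j.+1%:R| <= 2 * eta * W + T / eta.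
Proof.
move=> ha Ga ir hW hT e0.
set B := 2 * eta * W + T / eta.
pose c j := Re (acoef h j * (acoef G j)^*).
have tail r N : 0 <= r <= 1 -> (N0 <= N)%N ->
    `|\sum_(j < N) c j * (r ^+ j.+1 / j.+1%:R) - \sum_(j < N0) c j * (r ^+ j.+1 / j.+1%:R)| <= B.
  move=> hr NN.
  apply: le_trans (@sum_tail_le (fun j => c j * (r ^+ j.+1 / j.+1%:R))
    (fun j => 2 * eta * (normc (acoef h j) ^+ 2 / (j.+1%:R * j.+2%:R)) + normc (acoef G j) ^+ 2 / eta) N0 N NN _) _.
    by move=> j; apply: pair_term => //; case/andP: hr => r0 r1; rewrite exprn_ge0 //= exprn_ile1.
  rewrite big_split /= -mulr_sumr -mulr_suml; apply: lerD.
    rewrite ler_wpM2l ?mulr_ge0 ?(ltW e0) //; apply: le_trans (hW N).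
    rewrite (sum_split (fun j => normc (acoef h j) ^+ 2 / (j.+1%:R * j.+2%:R)) NN) lerDr.
    by apply: sumr_ge0 => j _; rewrite divr_ge0 ?sqr_ge0 ?mulr_ge0.
  by rewrite ler_wpM2r ?invr_ge0 ?(ltW e0).
have step n : `|\int[sigma R]_(w in subdisc (rho_ R n)) re_pair h G w - \sum_(j < N0) c j * (rho_ R n ^+ j.+1 / j.+1%:R)| <= B.
  have hn := rho_01 R n; have P := pair_trunc ha Ga hn.
  have hn' : 0 <= rho_ R n <= 1 by case/andP: hn => -> /ltW ->.
  have Q : (fun N => `|\sum_(j < N) c j * (rho_ R n ^+ j.+1 / j.+1%:R) - \sum_(j < N0) c j * (rho_ R n ^+ j.+1 / j.+1%:R)|) @ \oo -->
     `|\int[sigma R]_(w in subdisc (rho_ R n)) re_pair h G w - \sum_(j < N0) c j * (rho_ R n ^+ j.+1 / j.+1%:R)|.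
    by apply: cvg_norm; apply: cvgB; [exact: P|exact: cvg_cst].
  apply: limit_le Q _.
  by near=> N; apply: tail => //; near: N; exists N0.
have S1 : (fun n => \sum_(j < N0) c j * (rho_ R n ^+ j.+1 / j.+1%:R)) @ \oo --> \sum_(j < N0) c j / j.+1%:R.
  apply: (@cvg_ord_sum R N0 (fun n j => c j * (rho_ R n ^+ j.+1 / j.+1%:R)) (fun j => c j / j.+1%:R)) => j.
  apply: cvgM; first exact: cvg_cst.
  by rewrite -[X in _ --> X]mul1r; apply: cvgM; [exact: cvg_rhoX|exact: cvg_cst].
have Q : (fun n => `|\int[sigma R]_(w in subdisc (rho_ R n)) re_pair h G w - \sum_(j < N0) c j * (rho_ R n ^+ j.+1 / j.+1%:R)|) @ \oo -->
   `|dint (re_pair h G) - \sum_(j < N0) c j / j.+1%:R|.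
  by apply: cvg_norm; apply: cvgB; [exact: dint_trunc|exact: S1].
apply: limit_le Q _.
by apply: nearW => n; exact: step.
Unshelve. all: by end_near.
Qed.

(** The squared H^2 norm, when the partial sums are bounded. *)
Definition sq_mass X : R := lim ((fun N => \sum_(j < N) normc (acoef X j) ^+ 2) @ \oo).

Lemma sq_mass_nd X : nondecreasing_seq (fun N => \sum_(j < N) normc (acoef X j) ^+ 2).
Proof.
move=> a b ab; rewrite (sum_split (fun j => normc (acoef X j) ^+ 2) ab) lerDl.
by apply: sumr_ge0 => j _; exact: sqr_ge0.
Qed.

Lemma sq_mass_cvg X K : (forall N, \sum_(j < N) normc (acoef X j) ^+ 2 <= K) ->
  (fun N => \sum_(j < N) normc (acoef X j) ^+ 2) @ \oo --> sq_mass X.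
Proof.
move=> hK; apply: nondecreasing_is_cvgn; first exact: sq_mass_nd.
by exists K => _ [N _ <-].
Qed.

Lemma sq_mass_ge X K N : (forall N, \sum_(j < N) normc (acoef X j) ^+ 2 <= K) ->
  \sum_(j < N) normc (acoef X j) ^+ 2 <= sq_mass X.
Proof.
by move=> hK; apply: nondecreasing_cvgn_le; [exact: sq_mass_nd|apply/cvg_ex; eexists; exact: sq_mass_cvg hK].
Qed.

Lemma sq_mass_le X K : (forall N, \sum_(j < N) normc (acoef X j) ^+ 2 <= K) -> sq_mass X <= K.
Proof.
by move=> hK; apply: limit_le (sq_mass_cvg hK) _; exact: nearW.
Qed.

Lemma sq_mass_tail X K N0 N : (forall N, \sum_(j < N) normc (acoef X j) ^+ 2 <= K) ->
  \sum_(N0 <= j < N) normc (acoef X j) ^+ 2 <= sq_mass X - \sum_(j < N0) normc (acoef X j) ^+ 2.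
Proof.
move=> hK; rewrite lerBrDr.
have [NN|NN] := leqP N0 N; last first.
  by rewrite big_geq ?(ltnW NN) // add0r; exact: sq_mass_ge hK.
apply: le_trans (sq_mass_ge N hK).
by rewrite (sum_split (fun j => normc (acoef X j) ^+ 2) NN) addrC.
Qed.

End PairTail.

Section TestCoefficients.
Variable R : realType.
Notation disc := (@planar_disc R).
Implicit Types (f g h k u v X G F : R[i] -> R[i]) (m N : nat) (e K s r W T eta : R).

(** A section of the pairing of test_fun m u v with v^m. *)
Definition test_pair m N u v : R :=
  \sum_(j < N) Re (acoef (test_fun m u v) j * (acoef (fun z => v z ^+ m) j)^*) / j.+1%:R.

Definition test_kernel m v i j : R[i] :=
  i.+1%:R * (acoef (fun z => v z ^+ m.-1) (j - i)%N * (acoef (fun z => v z ^+ m) j)^*).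

Lemma test_pair_expand m N u v : analytic_on_disc u -> analytic_on_disc v ->
  test_pair m N u v = \sum_(j < N) (\sum_(i < j.+1) Re (acoef u i * test_kernel m v i j)) / j.+1%:R.
Proof.
move=> ua va; apply: eq_bigr => j _; congr (_ / _).
have E : acoef (test_fun m u v) j = \sum_(i < j.+1) acoef (Dz u) i * acoef (fun z => v z ^+ m.-1) (j - i)%N.
  exact: (acoefM j (analytic_Dz ua) (@analyticX _ v m.-1 va)).
rewrite E mulr_suml raddf_sum; apply: eq_bigr => i _; apply: (congr1 (@complex.Re R)).
apply: (etrans (congr1 (fun x => x * _ * _) (acoef_Dz i ua))).
rewrite /test_kernel; move: (acoef u i) (acoef _ (j - i)%N) (acoef _ j)^* => x y z.
by rewrite -mulrA [_ * x]mulrC -mulrA.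
Qed.

Definition ccvg (x : nat -> R[i]) (l : R[i]) := (fun n => normc (x n - l)) @ \oo --> (0 : R).

Lemma ccvg_ReM x l c : ccvg x l -> (fun n => Re (x n * c)) @ \oo --> Re (l * c).
Proof.
move=> xl; apply/cvgrPdist_le => e e0.
have [d d0 hd] : exists2 d, 0 < d & d * normc c <= e.
  exists (e / (normc c + 1)); first by rewrite divr_gt0 // ltr_wpDl // normc_ge0.
  rewrite mulrAC ler_pdivrMr ?ltr_wpDl ?normc_ge0 // ler_wpM2l ?(ltW e0) // lerDl ler01 //.
move/cvgrPdist_le: xl => /(_ d d0); apply: filterS => n; rewrite sub0r normrN ger0_norm ?normc_ge0 // => h.
have := normr_Re_le (l * c - x n * c); rewrite raddfB => h2; apply: le_trans h2 _.
rewrite -mulrBl normcM normcBC; apply: le_trans hd; rewrite ler_wpM2r ?normc_ge0 //.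
Qed.

Lemma test_pair_cvg m N (u_ : nat -> R[i] -> R[i]) u v : (forall n, analytic_on_disc (u_ n)) -> analytic_on_disc u ->
  analytic_on_disc v -> (forall j, ccvg (fun n => acoef (u_ n) j) (acoef u j)) ->
  (fun n => test_pair m N (u_ n) v) @ \oo --> test_pair m N u v.
Proof.
move=> ua_ ua va uc; rewrite (test_pair_expand m N ua va).
have H n : test_pair m N (u_ n) v = \sum_(j < N) (\sum_(i < j.+1) Re (acoef (u_ n) i * test_kernel m v i j)) / j.+1%:R := test_pair_expand m N (ua_ n) va.
rewrite (funext H).
apply: (@cvg_ord_sum R N (fun n j => (\sum_(i < j.+1) Re (acoef (u_ n) i * test_kernel m v i j)) / j.+1%:R)
  (fun j => (\sum_(i < j.+1) Re (acoef u i * test_kernel m v i j)) / j.+1%:R)) => j.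
apply: cvgM; last exact: cvg_cst.
apply: (@cvg_ord_sum R j.+1 (fun n i => Re (acoef (u_ n) i * test_kernel m v i j)) (fun i => Re (acoef u i * test_kernel m v i j))) => i.
exact: ccvg_ReM.
Qed.

Lemma ccvg_dilate u j : analytic_on_disc u -> ccvg (fun n => acoef (dilate (rho_ R n) u) j) (acoef u j).
Proof.
move=> ua; rewrite /ccvg.
rewrite (_ : (fun n => _) = (fun n => `|rho_ R n ^+ j - 1| * normc (acoef u j))); last first.
  apply/funext => n; have hn := rho_01 R n.
  have hn' : 0 <= rho_ R n <= 1 by case/andP: hn => -> /ltW ->.
  apply: (etrans (congr1 (fun x => normc (x - _)) (acoef_dilate j hn' ua))).
  move: (acoef u j) => a; rewrite -[X in _ - X]mul1r -mulrBl normcM; congr (_ * _).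
  by rewrite -normcR rmorphB.
rewrite -[X in _ --> X](mul0r (normc (acoef u j))); apply: cvgM; last exact: cvg_cst.
rewrite -[X in _ --> X](normr0 R) -(subrr (1 : R)).
by apply: cvg_norm; apply: cvgB; [exact: cvg_rhoX|exact: cvg_cst].
Qed.

(** m (z F)' F^(m-1) = m F^m + z (F^m)', so that on the diagonal the pairing
    mixes the H^2 and the A^2 norm of F^m. *)
Lemma test_pair_diag m N F : (0 < m)%N -> analytic_on_disc F ->
  test_pair m N F F = m%:R^-1 * (\sum_(j < N) normc (acoef (fun z => F z ^+ m) j) ^+ 2)
   + (1 - m%:R^-1) * (\sum_(j < N) normc (acoef (fun z => F z ^+ m) j) ^+ 2 / j.+1%:R).
Proof.
move=> m0 Fa; rewrite !mulr_sumr -big_split; apply: eq_bigr => j _ /=.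
have Ga := @analyticX _ F m Fa.
have ca := @analytic_test_fun _ m F F Fa Fa.
have mn : m%:R != 0 :> R by rewrite pnatr_eq0 -lt0n.
have E : m%:R * acoef (test_fun m F F) j = (m + j)%:R * acoef (fun z => F z ^+ m) j.
  have e1 : acoef (fun z => m%:R * test_fun m F F z) j = acoef (fun z => m%:R * F z ^+ m + euler (fun z => F z ^+ m) z) j.
    apply: eq_acoef => z z1; rewrite /test_fun /Dz.
    case: (m) m0 => // n _; rewrite (eulerX n Fa z1) /= exprS; ring.
  apply: (etrans (esym (acoefZ m%:R j ca))); apply: (etrans e1).
  apply: (etrans (acoefD j (@analyticZ _ m%:R _ Ga) (analytic_euler Ga))).
  apply: (etrans (congr2 (fun x y => x + y) (acoefZ m%:R j Ga) (acoef_euler j Ga))).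
  by rewrite -mulrDl -natrD.
move: E; move: (acoef (test_fun m F F) j) (acoef (fun z => F z ^+ m) j) => x y E.
have R1 : Re (x * y^*) = (m + j)%:R / m%:R * normc y ^+ 2.
  apply: (mulfI mn); rewrite -Re_natM mulrA E -mulrA Re_natM mul_conjc /=.
  by rewrite [RHS]mulrA; congr (_ * _); rewrite mulrC divfK.
rewrite R1 natrD -[j.+1%:R]natr1.
have jn : (j%:R + 1 : R) != 0 by rewrite natr1 pnatr_eq0.
by field; rewrite mn jn.
Qed.

End TestCoefficients.

(** * Comparison of two extremal functions *)

Section KeyInequality.
Variable R : realType.
Notation disc := (@planar_disc R).
Implicit Types (f g h k u v X G F : R[i] -> R[i]) (m N : nat) (e K s r W T eta lam : R).

Lemma cvg_affine (u : nat -> R) (l a b : R) : u @ \oo --> l -> (fun n => a * (u n + b)) @ \oo --> a * (l + b).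
Proof. by move=> ul; apply: cvgM; [exact: cvg_cst|apply: cvgD => //; exact: cvg_cst]. Qed.

Lemma cvg_tail_const (u : nat -> R) (l d b : R) : u @ \oo --> l -> (fun n => b + (l - u n) / d) @ \oo --> b + (l - l) / d.
Proof.
move=> ul; apply: cvgD; first exact: cvg_cst.
by apply: cvgM; [apply: cvgB => //; exact: cvg_cst|exact: cvg_cst].
Qed.

Definition test_const m K : R := (2 + 6 * 4 ^+ m * (1 + 2 * 2 ^+ (2 * m))) * (K + K).

Lemma test_const_ge0 m K : 0 <= K -> 0 <= test_const m K.
Proof. by move=> K0; rewrite mulr_ge0 ?addr_ge0 ?mulr_ge0 ?addr_ge0 ?mulr_ge0 ?exprn_ge0. Qed.

Definition Hp_sum m F N : R := \sum_(j < N) normc (acoef (fun z => F z ^+ m) j) ^+ 2.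
Definition Hp_mass m F : R := sq_mass (fun z => F z ^+ m).

Lemma Hp_mass_le m F K : analytic_on_disc F -> Hp_bound m F K -> Hp_mass m F <= K.
Proof. by move=> Fa hF; apply: sq_mass_le => N; exact: Hp_coef. Qed.

Lemma Hp_sum_le m F K N : analytic_on_disc F -> Hp_bound m F K -> Hp_sum m F N <= Hp_mass m F.
Proof. by move=> Fa hF; apply: sq_mass_ge => M; exact: (Hp_coef M Fa hF). Qed.

Lemma Hp_sum_cvg m F K : analytic_on_disc F -> Hp_bound m F K -> Hp_sum m F @ \oo --> Hp_mass m F.
Proof. by move=> Fa hF; apply: sq_mass_cvg => M; exact: (Hp_coef M Fa hF). Qed.

Lemma test_tail m u v K s N eta : (0 < m)%N -> analytic_on_disc u -> analytic_on_disc v -> 0 <= K ->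
  Hp_bound m u K -> Hp_bound m v K -> 0 <= s < 1 -> 0 < eta ->
  `|dint (re_pair (fun z => dilate s (Dz u) z * v z ^+ m.-1) (fun z => v z ^+ m)) - test_pair m N (dilate s u) v|
   <= 2 * eta * test_const m K + (Hp_mass m v - Hp_sum m v N) / eta.
Proof.
move=> m0 ua va K0 hu hv hs e0.
have hs1 : 0 <= s <= 1 by case/andP: hs => -> /ltW ->.
have da := analytic_dilate hs1 ua.
have Da := analytic_dilate hs1 (analytic_Dz ua).
have [iv _] := Hp_integrable va K0 hv.
have [K' K'0 dK] := @Hp_dilate_ex R m (Dz u) s (analytic_Dz ua) hs.
have [id_ _] := Hp_integrable Da K'0 dK.
have it := dintegrable_test m0 va Da iv id_.
have E w : disc w -> re_pair (fun z => dilate s (Dz u) z * v z ^+ m.-1) (fun z => v z ^+ m) w =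
    re_pair (test_fun m (dilate s u) v) (fun z => v z ^+ m) w.
  move=> Dw; rewrite /re_pair /test_fun; congr (Re (_ * _ * _)).
  by rewrite /Dz (euler_dilate hs1 ua Dw).
rewrite (eq_dint E).
have ca := @analytic_test_fun R m (dilate s u) v da va.
have Ga := @analyticX _ v m va.
have hW := test_fun_bound m0 da va K0 K0 (Hp_dilate ua hs1 hu) hv.
have hT M := @sq_mass_tail R (fun z => v z ^+ m) K N M (fun M' => Hp_coef M' va hv).
exact: (pair_tail ca Ga (eq_dintegrable E it) hW hT e0).
Qed.

(** Both variational identities are applied to the same test function, the
    dilated derivative of z F1, which lies in A^p. The left-hand sides differ
    by a pairing with k1 - k, estimated by pair_Dz_le. *)
Lemma compare_norms_dilate m k1 k F1 F lam1 lam K Kmu s N N' eta eta' e : (0 < m)%N ->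
  analytic_on_disc k1 -> analytic_on_disc k ->
  dintegrable (abspowR (conj_exp R m) k1) -> dintegrable (abspowR (conj_exp R m) k) ->
  optimal m k1 F1 lam1 -> optimal m k F lam -> 0 < lam1 -> 0 < lam -> 0 <= K -> 0 <= Kmu -> Hp_bound m F1 K -> Hp_bound m F K ->
  Hq_bound (conj_exp R m) (fun z => k1 z - k z) Kmu -> 0 < s < 1 -> 0 < eta -> 0 < eta' -> 0 < e ->
  lam1 * (test_pair m N (dilate s F1) F1 - (2 * eta * test_const m K + (Hp_mass m F1 - Hp_sum m F1 N) / eta)) <=
  lam * (test_pair m N' (dilate s F1) F + (2 * eta' * test_const m K + (Hp_mass m F - Hp_sum m F N') / eta'))
   + (e * K + young_const m e * Kmu).
Proof.
move=> m0 k1a ka ik1 ik ex1 ex l10 l0 K0 Km0 hF1 hF hmu hs e1 e2 e0.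
have [F1a _ _ _ _] := ex1; have [Fa _ _ _ _] := ex.
have hs' : 0 <= s < 1 by case/andP: hs => /ltW -> ->.
have hs1 : 0 <= s <= 1 by case/andP: hs' => -> /ltW ->.
pose g := dilate s (Dz F1).
have ga : analytic_on_disc g := analytic_dilate hs1 (analytic_Dz F1a).
have [K' K'0 dK] := @Hp_dilate_ex R m (Dz F1) s (analytic_Dz F1a) hs'.
have [ig _] := Hp_integrable ga K'0 dK.
have I1 := optimal_identity m0 k1a ik1 ex1 ga ig.
have I2 := optimal_identity m0 ka ik ex ga ig.
have ir1 := dintegrable_re_pair m0 ga k1a ig ik1.
have ir2 := dintegrable_re_pair m0 ga ka ig ik.
have S : dint (re_pair g k1) = dint (re_pair g k) + dint (re_pair g (fun z => k1 z - k z)).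
  have -> : dint (re_pair g (fun z => k1 z - k z)) = dint (re_pair g k1) - dint (re_pair g k).
    by rewrite -(dintB ir1 ir2); apply: eq_dint => w _; exact: re_pairBr.
  by rewrite addrC subrK.
have C := pair_Dz_le m0 F1a (analyticB k1a ka) K0 Km0 hF1 hmu e0 hs.
have T1 := test_tail N m0 F1a F1a K0 hF1 hF1 hs' e1.
have T2 := test_tail N' m0 F1a Fa K0 hF1 hF hs' e2.
move: T1; rewrite ler_norml => /andP[T1 _]; move: T2; rewrite ler_norml => /andP[_ T2].
apply: (@le_trans _ _ (dint (re_pair g k1))).
  by rewrite I1 ler_wpM2l ?(ltW l10) //; move: T1; rewrite lerBrDr addrC.
rewrite S; apply: lerD; last exact: C.
by rewrite I2 ler_wpM2l ?(ltW l0) //; move: T2; rewrite lerBlDl.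
Qed.

(** Let s tend to 1; the dilated F1 only occurs through finitely many
    coefficients. *)
Lemma compare_norms_limit m k1 k F1 F lam1 lam K Kmu N N' eta eta' e : (0 < m)%N ->
  analytic_on_disc k1 -> analytic_on_disc k ->
  dintegrable (abspowR (conj_exp R m) k1) -> dintegrable (abspowR (conj_exp R m) k) ->
  optimal m k1 F1 lam1 -> optimal m k F lam -> 0 < lam1 -> 0 < lam -> 0 <= K -> 0 <= Kmu -> Hp_bound m F1 K -> Hp_bound m F K ->
  Hq_bound (conj_exp R m) (fun z => k1 z - k z) Kmu -> 0 < eta -> 0 < eta' -> 0 < e ->
  lam1 * (test_pair m N F1 F1 - (2 * eta * test_const m K + (Hp_mass m F1 - Hp_sum m F1 N) / eta)) <=
  lam * (test_pair m N' F1 F + (2 * eta' * test_const m K + (Hp_mass m F - Hp_sum m F N') / eta'))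
   + (e * K + young_const m e * Kmu).
Proof.
move=> m0 k1a ka ik1 ik ex1 ex l10 l0 K0 Km0 hF1 hF hmu e1 e2 e0.
have [F1a _ _ _ _] := ex1; have [Fa _ _ _ _] := ex.
set B1 := 2 * eta * _ + _; set B2 := 2 * eta' * _ + _; set B3 := e * K + _.
have da n : analytic_on_disc (dilate (rho_ R n) F1).
  by apply: analytic_dilate => //; have /andP[-> /ltW ->] := rho_01 R n.
have c1 := @test_pair_cvg R m N _ F1 F1 da F1a F1a (fun j => ccvg_dilate j F1a).
have c2 := @test_pair_cvg R m N' _ F1 F da F1a Fa (fun j => ccvg_dilate j F1a).
have c : (fun n => lam1 * (test_pair m N (dilate (rho_ R n) F1) F1 - B1) - lam * (test_pair m N' (dilate (rho_ R n) F1) F + B2)) @ \oo -->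
   lam1 * (test_pair m N F1 F1 - B1) - lam * (test_pair m N' F1 F + B2).
  apply: cvgB; [exact: (@cvg_affine _ _ lam1 (- B1) c1)|exact: (@cvg_affine _ _ lam B2 c2)].
rewrite -lerBlDl; apply: limit_le c _.
exists 1%N => // n /= n0; rewrite lerBlDl.
have hs : 0 < rho_ R n < 1 by rewrite rho_gt0 //; case/andP: (rho_01 R n).
exact: (compare_norms_dilate N N' m0 k1a ka ik1 ik ex1 ex l10 l0 K0 Km0 hF1 hF hmu hs e1 e2 e0).
Qed.

(** The limit of the diagonal sections: a combination of the p-th powers of
    the H^p and the A^p norm of F, where the latter is 1. *)
Definition mixed m F : R := m%:R^-1 * Hp_mass m F + (1 - m%:R^-1).

Lemma series_abspow m F : analytic_on_disc F -> dintegrable (abspow m F) ->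
  (fun N => \sum_(j < N) normc (acoef (fun z => F z ^+ m) j) ^+ 2 / j.+1%:R) @ \oo --> dint (abspow m F).
Proof.
move=> Fa iF; apply: (@series_cvg R (fun j => normc (acoef (fun z => F z ^+ m) j) ^+ 2 / j.+1%:R)).
  by move=> j; rewrite divr_ge0 ?sqr_ge0.
by rewrite -(disc_abspow m Fa) dintE.
Qed.

Lemma sum_abspow_le m F N : analytic_on_disc F -> dintegrable (abspow m F) ->
  \sum_(j < N) normc (acoef (fun z => F z ^+ m) j) ^+ 2 / j.+1%:R <= dint (abspow m F).
Proof.
move=> Fa iF; rewrite -lee_fin -(dintE iF) (disc_abspow m Fa).
apply: (@series_ge R (fun j => normc (acoef (fun z => F z ^+ m) j) ^+ 2 / j.+1%:R)) => j.
by rewrite divr_ge0 ?sqr_ge0.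
Qed.

Lemma test_pair_mixed m F K : (0 < m)%N -> analytic_on_disc F -> dintegrable (abspow m F) -> dint (abspow m F) = 1 -> Hp_bound m F K ->
  (fun N => test_pair m N F F) @ \oo --> mixed m F.
Proof.
move=> m0 Fa iF F1 hF; rewrite (funext (fun N => test_pair_diag N m0 Fa)).
apply: cvgD; first by apply: cvgM; [exact: cvg_cst|exact: (Hp_sum_cvg Fa hF)].
have H := @cvg_affine _ _ (1 - m%:R^-1) 0 (series_abspow Fa iF).
rewrite F1 addr0 mulr1 in H.
by under eq_fun do rewrite -[X in _ * X]addr0.
Qed.

Lemma test_pair_mixed_le m N F K : (0 < m)%N -> analytic_on_disc F -> dintegrable (abspow m F) -> dint (abspow m F) = 1 -> Hp_bound m F K ->
  test_pair m N F F <= mixed m F.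
Proof.
move=> m0 Fa iF F1 hF; rewrite (test_pair_diag N m0 Fa); apply: lerD.
  by rewrite ler_wpM2l ?invr_ge0 //; exact: (Hp_sum_le N Fa hF).
have c0 : 0 <= 1 - m%:R^-1 :> R by rewrite subr_ge0 invf_le1 ?ltr0n // ler1n.
apply: (@le_trans _ _ ((1 - m%:R^-1) * dint (abspow m F))); last by rewrite F1 mulr1.
by rewrite ler_wpM2l //; exact: sum_abspow_le.
Qed.

(** Let the length of the section on the left tend to infinity, then its eta
    to 0. On the right F1 only occurs through finitely many coefficients. *)
Theorem compare_norms m k1 k F1 F lam1 lam K Kmu N eta e : (0 < m)%N ->
  analytic_on_disc k1 -> analytic_on_disc k ->
  dintegrable (abspowR (conj_exp R m) k1) -> dintegrable (abspowR (conj_exp R m) k) ->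
  optimal m k1 F1 lam1 -> optimal m k F lam -> 0 < lam1 -> 0 < lam -> 0 <= K -> 0 <= Kmu -> Hp_bound m F1 K -> Hp_bound m F K ->
  Hq_bound (conj_exp R m) (fun z => k1 z - k z) Kmu -> 0 < eta -> 0 < e ->
  lam1 * mixed m F1 <=
  lam * (test_pair m N F1 F + (2 * eta * test_const m K + (Hp_mass m F - Hp_sum m F N) / eta))
   + (e * K + young_const m e * Kmu).
Proof.
move=> m0 k1a ka ik1 ik ex1 ex l10 l0 K0 Km0 hF1 hF hmu e1 e0.
have [F1a iF1 F11 _ _] := ex1.
set RHS := _ + _ in |- *.
have step d : 0 < d -> lam1 * (mixed m F1 - 2 * d * test_const m K) <= RHS.
  move=> d0.
  have c : (fun M => lam1 * (test_pair m M F1 F1 - (2 * d * test_const m K + (Hp_mass m F1 - Hp_sum m F1 M) / d))) @ \oo -->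
     lam1 * (mixed m F1 - (2 * d * test_const m K + (Hp_mass m F1 - Hp_mass m F1) / d)).
    apply: cvgM; first exact: cvg_cst.
    apply: cvgB; first exact: (test_pair_mixed m0 F1a iF1 F11 hF1).
    exact: (@cvg_tail_const _ _ d (2 * d * test_const m K) (Hp_sum_cvg F1a hF1)).
  have -> : mixed m F1 - 2 * d * test_const m K = mixed m F1 - (2 * d * test_const m K + (Hp_mass m F1 - Hp_mass m F1) / d).
    by rewrite subrr mul0r addr0.
  apply: limit_le c _.
  by apply: nearW => M; exact: (compare_norms_limit M N m0 k1a ka ik1 ik ex1 ex l10 l0 K0 Km0 hF1 hF hmu d0 e1 e0).
apply/ler_addgt0Pl => t t0.
have W0 := test_const_ge0 m K0.
pose c := 2 * lam1 * test_const m K + 1.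
have P0 : 0 <= 2 * lam1 * test_const m K by apply: mulr_ge0 W0; apply: mulr_ge0 => //; exact: ltW.
have c0 : 0 < c by rewrite /c ltr_wpDl.
have := step (t / c) (divr_gt0 t0 c0); rewrite mulrBr lerBlDr => h; apply: le_trans h _.
rewrite addrC lerD2r.
have -> : lam1 * (2 * (t / c) * test_const m K) = (2 * lam1 * test_const m K) / c * t by ring.
rewrite ler_piMl ?(ltW t0) // ler_pdivrMr // mul1r /c lerDl ler01 //.
Qed.

End KeyInequality.

(** * Clarkson's inequality and complex limits *)

Section Convexity.
Variable R : realType.
Implicit Types (a b : R[i]) (x y : R) (m n : nat).

Lemma superadditive_pow n x y : 0 <= x -> 0 <= y -> x ^+ n.+1 + y ^+ n.+1 <= (x + y) ^+ n.+1.
Proof.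
move=> x0 y0; elim: n => [|n IH]; first by rewrite !expr1.
rewrite [leRHS]exprS !(exprS _ n.+1).
apply: (@le_trans _ _ ((x + y) * (x ^+ n.+1 + y ^+ n.+1))); last by rewrite ler_wpM2l // addr_ge0.
have h1 : 0 <= x * y ^+ n.+1 by rewrite mulr_ge0 ?exprn_ge0.
have h2 : 0 <= y * x ^+ n.+1 by rewrite mulr_ge0 ?exprn_ge0.
by move: h1 h2; rewrite mulrDl !mulrDr; lra.
Qed.

Lemma convex_pow n x y : 0 <= x -> 0 <= y -> ((x + y) / 2) ^+ n <= (x ^+ n + y ^+ n) / 2.
Proof.
move=> x0 y0; elim: n => [|n IH]; first by rewrite !expr0; lra.
rewrite !exprS.
have h : 0 <= (x - y) * (x ^+ n - y ^+ n).
  have [xy|/ltW yx] := leP x y.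
    by rewrite mulr_le0 // subr_le0 //; apply: lerXn2r; rewrite ?nnegrE.
  by rewrite mulr_ge0 // subr_ge0 //; apply: lerXn2r; rewrite ?nnegrE.
have c0 : 0 <= (x + y) / 2 by rewrite divr_ge0 // addr_ge0.
apply: le_trans (ler_wpM2l c0 IH) _; move: h; move: (x ^+ n) (y ^+ n) => X Y.
by rewrite mulrBl !mulrBr; lra.
Qed.

Lemma parallelogram a b :
  normc (2^-1%:C * (a + b)) ^+ 2 + normc (2^-1%:C * (a - b)) ^+ 2 = (normc a ^+ 2 + normc b ^+ 2) / 2.
Proof.
rewrite !normc_sqr !Re_scale !Im_scale; case: a => a1 a2; case: b => b1 b2 /=; lra.
Qed.

(** The parallelogram identity, between the superadditivity and the convexity
    of x^m. *)
Lemma clarkson m a b : (0 < m)%N ->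
  normc (2^-1%:C * (a + b)) ^+ (2 * m) + normc (2^-1%:C * (a - b)) ^+ (2 * m) <=
  2^-1 * (normc a ^+ (2 * m) + normc b ^+ (2 * m)).
Proof.
case: m => // n _; rewrite !exprM.
apply: le_trans (superadditive_pow n (sqr_ge0 _) (sqr_ge0 _)) _.
rewrite parallelogram [leRHS]mulrC; apply: convex_pow; exact: sqr_ge0.
Qed.

Lemma sqr_le_pow m (e x : R) : (0 < m)%N -> 0 < e -> 0 <= x -> x ^+ 2 <= e + (e^-1) ^+ m.-1 * x ^+ (2 * m).
Proof.
move=> m0 e0 x0; have [h|h] := leP (x ^+ 2) e.
  by rewrite -[leLHS]addr0 lerD // mulr_ge0 ?exprn_ge0 // invr_ge0 ltW.
apply: (@le_trans _ _ ((e^-1) ^+ m.-1 * x ^+ (2 * m))); last by rewrite lerDr ltW.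
case: m m0 => // n _ /=; rewrite exprM (exprSr (x ^+ 2) n) mulrA -exprMn ler_peMl ?sqr_ge0 //.
apply: exprn_ege1; rewrite mulrC ler_pdivlMr // mul1r ltW //.
Qed.

End Convexity.

Section ComplexLimits.
Variable R : realType.
Implicit Types (x y : nat -> R[i]) (l k : R[i]).

Lemma ccvg_cst l : ccvg (fun=> l) l.
Proof.
rewrite /ccvg (_ : (fun n => _) = (fun=> 0)); first exact: cvg_cst.
by apply/funext => n; rewrite subrr normc0.
Qed.

Lemma ccvg_le x l (b : nat -> R) : (forall n, normc (x n - l) <= b n) -> b @ \oo --> (0 : R) -> ccvg x l.
Proof.
move=> xb b0; rewrite /ccvg; apply: (@squeeze_cvgr _ _ _ _ (fun=> 0) b) => //; last exact: cvg_cst.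
by apply: nearW => n; rewrite normc_ge0 xb.
Qed.

Lemma ccvgD x y l k : ccvg x l -> ccvg y k -> ccvg (fun n => x n + y n) (l + k).
Proof.
move=> xl yk; apply: (@ccvg_le _ _ (fun n => normc (x n - l) + normc (y n - k))).
  move=> n; have -> : x n + y n - (l + k) = (x n - l) + (y n - k) by rewrite opprD addrACA.
  exact: le_normcD.
by rewrite -[X in _ --> X](addr0 0); apply: cvgD.
Qed.

Lemma ccvgM x y l k : ccvg x l -> ccvg y k -> ccvg (fun n => x n * y n) (l * k).
Proof.
move=> xl yk; apply: (@ccvg_le _ _ (fun n => normc (x n - l) * normc (y n - k) + normc l * normc (y n - k) + normc (x n - l) * normc k)).
  move=> n; have -> : x n * y n - l * k = (x n - l) * (y n - k) + l * (y n - k) + (x n - l) * k by ring.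
  by apply: le_trans (le_normcD _ _) _; rewrite [normc (_ * k)]normcM lerD2r; apply: le_trans (le_normcD _ _) _; rewrite !normcM.
have -> : (0 : R) = 0 * 0 + normc l * 0 + 0 * normc k by rewrite !mul0r mulr0 !addr0.
apply: cvgD; [apply: cvgD|].
- exact: cvgM.
- by apply: cvgM => //; exact: cvg_cst.
- by apply: cvgM => //; exact: cvg_cst.
Qed.

Lemma ccvg_sum N (x : nat -> nat -> R[i]) (l : nat -> R[i]) : (forall j, ccvg (fun n => x n j) (l j)) ->
  ccvg (fun n => \sum_(j < N) x n j) (\sum_(j < N) l j).
Proof.
move=> xl; elim: N => [|N IH].
  rewrite big_ord0; have -> : (fun n => \sum_(j < 0) x n j) = (fun=> 0) by apply/funext => n; rewrite big_ord0.
  exact: ccvg_cst.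
rewrite big_ord_recr; have -> : (fun n => \sum_(j < N.+1) x n j) = (fun n => \sum_(j < N) x n j + x n N).
  by apply/funext => n; rewrite big_ord_recr.
exact: ccvgD.
Qed.

Lemma ccvg_normc x l : ccvg x l -> (fun n => normc (x n)) @ \oo --> normc l.
Proof.
move=> xl; apply/cvgrPdist_le => e e0; move/cvgrPdist_le: xl => /(_ e e0).
apply: filterS => n; rewrite sub0r normrN ger0_norm ?normc_ge0 //; apply: le_trans.
rewrite ler_norml; apply/andP; split; last by rewrite normcBC lecr_normcB.
by rewrite lerNl opprB lecr_normcB.
Qed.

Lemma ccvg_power (u_ : nat -> R[i] -> R[i]) u : (forall n, analytic_on_disc (u_ n)) -> analytic_on_disc u ->
  (forall j, ccvg (fun n => acoef (u_ n) j) (acoef u j)) ->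
  forall m j, ccvg (fun n => acoef (fun z => u_ n z ^+ m) j) (acoef (fun z => u z ^+ m) j).
Proof.
move=> ua_ ua uc; elim=> [|m IH] j.
  have -> : (fun n => acoef (fun z => u_ n z ^+ 0) j) = (fun=> acoef (fun z => u z ^+ 0) j) by [].
  exact: ccvg_cst.
have E (f : R[i] -> R[i]) : analytic_on_disc f -> acoef (fun z => f z ^+ m.+1) j =
    \sum_(i < j.+1) acoef f i * acoef (fun z => f z ^+ m) (j - i)%N.
  move=> fa; rewrite -(acoefM j fa (@analyticX _ f m fa)).
  by apply: eq_acoef => z _; rewrite exprS.
rewrite (E u ua) (funext (fun n => E (u_ n) (ua_ n))).
apply: (@ccvg_sum j.+1 (fun n i => acoef (u_ n) i * acoef (fun z => u_ n z ^+ m) (j - i)%N)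
  (fun i => acoef u i * acoef (fun z => u z ^+ m) (j - i)%N)) => i.
by apply: ccvgM; [exact: uc|exact: IH].
Qed.

End ComplexLimits.

(** * Midpoints of two functions *)

Section Comparison.
Variable R : realType.
Notation disc := (@planar_disc R).
Implicit Types (f g h k u v F : R[i] -> R[i]) (m n N : nat) (e K s q lam : R).

Lemma Hq_sub q k1 k K1 K : 0 < q -> analytic_on_disc k1 -> analytic_on_disc k ->
  Hq_bound q (fun z => k1 z - k z) K1 -> Hq_bound q k K -> Hq_bound q k1 (2 `^ q * (K1 + K)).
Proof.
move=> q0 k1a ka h1 h s hs; have hs' : 0 <= s < 1 by case/andP: hs => /ltW -> ->.
have da := analyticB k1a ka.
have md := dmeas_abspowR q da; have mk := dmeas_abspowR q ka; have m1 := dmeas_abspowR q k1a.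
have mD : dmeas (fun w => abspowR q (fun z => k1 z - k z) w + abspowR q k w) by exact: measurable_funD.
have D0 w : 0 <= abspowR q (fun z => k1 z - k z) w + abspowR q k w by rewrite addr_ge0 ?abspowR_ge0.
have pt w : disc w -> abspowR q k1 w <= 2 `^ q * (abspowR q (fun z => k1 z - k z) w + abspowR q k w).
  move=> _; apply: le_trans (powRD_le (ltW q0) (normc_ge0 _) (normc_ge0 _)).
  apply: ge0_ler_powR; rewrite ?nnegrE ?addr_ge0 ?normc_ge0 ?(ltW q0) //.
  by rewrite -{1}(subrK (k (to_C w)) (k1 (to_C w))); exact: le_normcD.
have m2 : dmeas (fun w => 2 `^ q * (abspowR q (fun z => k1 z - k z) w + abspowR q k w)).
  by apply: dmeasM mD; exact: measurable_cst.
apply: le_trans (circ_avg_mono hs' m1 m2 (@abspowR_ge0 R q k1) pt) _.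
rewrite (circ_avgZ hs' (powR_ge0 _ _) mD D0) (circ_avgD hs' md mk (@abspowR_ge0 R q _) (@abspowR_ge0 R q k)).
rewrite EFinM EFinD; apply: lee_wpmul2l; first by rewrite lee_fin powR_ge0.
by apply: leeD; [exact: h1|exact: h].
Qed.

Lemma young_const_antitone m e e' : 0 < e -> e <= e' -> young_const m e' <= young_const m e.
Proof.
move=> e0 ee; have e'0 := lt_le_trans e0 ee; apply: ge0_ler_powR; rewrite ?nnegrE ?invr_ge0 ?(ltW e0) ?(ltW e'0) //.
by rewrite lef_pV2 ?posrE.
Qed.

Lemma coef_le_dint f j : analytic_on_disc f -> dintegrable (abspow 1 f) ->
  normc (acoef f j) ^+ 2 / j.+1%:R <= dint (abspow 1 f).
Proof.
move=> fa i1; apply: le_trans (sum_abspow_le j.+1 fa i1); rewrite big_ord_recr /= lerDr.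
by apply: sumr_ge0 => i _; rewrite divr_ge0 ?sqr_ge0.
Qed.

(** Smallness in A^(2m) gives smallness in A^2, where Parseval applies. *)
Lemma coef_le_abspow m f j e : (0 < m)%N -> 0 < e -> analytic_on_disc f -> dintegrable (abspow m f) ->
  normc (acoef f j) ^+ 2 / j.+1%:R <= e + (e^-1) ^+ m.-1 * dint (abspow m f).
Proof.
move=> m0 e0 fa im.
have ib : dintegrable (fun w => e + (e^-1) ^+ m.-1 * abspow m f w).
  by apply: dintegrableD; [exact: dintegrable_cst|exact: dintegrableZ].
have pt w : disc w -> abspow 1 f w <= e + (e^-1) ^+ m.-1 * abspow m f w.
  by move=> _; exact: (@sqr_le_pow R m e (normc (f (to_C w))) m0 e0 (normc_ge0 _)).
have i1 : dintegrable (abspow 1 f).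
  apply: (dintegrable_le (dmeas_abspow 1 fa) _ ib) => w Dw.
  by rewrite ger0_norm ?abspow_ge0 // pt.
apply: le_trans (coef_le_dint j fa i1) _; apply: le_trans (dint_le i1 ib pt) _.
by rewrite (dintD (dintegrable_cst e) (dintegrableZ _ im)) (dintZ _ im) dint_cst.
Qed.

Definition half_sum F G z : R[i] := (2^-1)%:C * (F z + G z).
Definition half_diff F G z : R[i] := (2^-1)%:C * (F z - G z).

Lemma analytic_half_sum F G : analytic_on_disc F -> analytic_on_disc G -> analytic_on_disc (half_sum F G).
Proof. by move=> Fa Ga; exact: (@analyticZ _ (2^-1)%:C (fun z => F z + G z) (analyticD Fa Ga)). Qed.

Lemma analytic_half_diff F G : analytic_on_disc F -> analytic_on_disc G -> analytic_on_disc (half_diff F G).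
Proof. by move=> Fa Ga; exact: (@analyticZ _ (2^-1)%:C (fun z => F z - G z) (analyticB Fa Ga)). Qed.

Lemma clarkson_abspow m F G w : (0 < m)%N ->
  abspow m (half_diff F G) w + abspow m (half_sum F G) w <= 2^-1 * (abspow m F w + abspow m G w).
Proof. by move=> m0; rewrite addrC; exact: clarkson. Qed.

Lemma clarkson_dint m F G : (0 < m)%N -> analytic_on_disc F -> analytic_on_disc G ->
  dintegrable (abspow m F) -> dintegrable (abspow m G) ->
  [/\ dintegrable (abspow m (half_diff F G)), dintegrable (abspow m (half_sum F G)) &
   dint (abspow m (half_diff F G)) + dint (abspow m (half_sum F G)) <= 2^-1 * (dint (abspow m F) + dint (abspow m G))].
Proof.
move=> m0 Fa Ga iF iG; have ib := dintegrableZ 2^-1 (dintegrableD iF iG).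
have da := analytic_half_diff Fa Ga; have sa := analytic_half_sum Fa Ga.
have i1 : dintegrable (abspow m (half_diff F G)).
  apply: (dintegrable_le (dmeas_abspow m da) _ ib) => w _; rewrite ger0_norm ?abspow_ge0 //.
  by apply: le_trans (clarkson_abspow F G w m0); rewrite lerDl abspow_ge0.
have i2 : dintegrable (abspow m (half_sum F G)).
  apply: (dintegrable_le (dmeas_abspow m sa) _ ib) => w _; rewrite ger0_norm ?abspow_ge0 //.
  by apply: le_trans (clarkson_abspow F G w m0); rewrite lerDr abspow_ge0.
split=> //; rewrite -(dintD i1 i2) -(dintD iF iG) -(dintZ _ (dintegrableD iF iG)).
by apply: dint_le => //; [exact: dintegrableD|move=> w _; exact: clarkson_abspow].
Qed.

(** Clarkson's inequality on circles, then Parseval. The two lengths differ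
    because the sum for half_sum will be fixed while that for half_diff grows. *)
Lemma clarkson_Hp m F G K L N N' : (0 < m)%N -> analytic_on_disc F -> analytic_on_disc G ->
  Hp_bound m F K -> Hp_bound m G L -> (N <= N')%N ->
  Hp_sum m (half_diff F G) N' + Hp_sum m (half_sum F G) N <= 2^-1 * (K + L).
Proof.
move=> m0 Fa Ga hF hG NN.
have da := analytic_half_diff Fa Ga; have sa := analytic_half_sum Fa Ga.
pose a j := normc (acoef (fun z => half_diff F G z ^+ m) j) ^+ 2 + normc (acoef (fun z => half_sum F G z ^+ m) j) ^+ 2.
have H : \sum_(j < N') a j <= 2^-1 * (K + L).
  apply: poly_at_one => s hs; rewrite -lee_fin.
  have mF := dmeas_abspow m Fa; have mG := dmeas_abspow m Ga; have md := dmeas_abspow m da; have ms := dmeas_abspow m sa.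
  have mL : dmeas (fun w => abspow m (half_diff F G) w + abspow m (half_sum F G) w) by exact: measurable_funD.
  have mS : dmeas (fun w => abspow m F w + abspow m G w) by exact: measurable_funD.
  have mR : dmeas (fun w => 2^-1 * (abspow m F w + abspow m G w)) by apply: dmeasM mS; exact: measurable_cst.
  have L0 w : 0 <= abspow m (half_diff F G) w + abspow m (half_sum F G) w by rewrite addr_ge0 ?abspow_ge0.
  have S0 w : 0 <= abspow m F w + abspow m G w by rewrite addr_ge0 ?abspow_ge0.
  have h0 : 0 <= 2^-1 :> R by rewrite invr_ge0.
  apply: (@le_trans _ _ (circ_avg (fun w => (abspow m (half_diff F G) w + abspow m (half_sum F G) w)%:E) s)).
    rewrite (circ_avgD hs md ms (@abspow_ge0 R m _) (@abspow_ge0 R m _)).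
    rewrite (eq_bigr (fun j : 'I_N' => normc (acoef (fun z => half_diff F G z ^+ m) j) ^+ 2 * s ^+ j
      + normc (acoef (fun z => half_sum F G z ^+ m) j) ^+ 2 * s ^+ j)); last by move=> j _; rewrite mulrDl.
    rewrite big_split /= EFinD; apply: leeD; exact: circ_abspow_ge.
  apply: le_trans (circ_avg_mono hs mL mR L0 (fun w _ => clarkson_abspow F G w m0)) _.
  rewrite (circ_avgZ hs h0 mS S0) (circ_avgD hs mF mG (@abspow_ge0 R m F) (@abspow_ge0 R m G)).
  rewrite EFinM EFinD; apply: lee_wpmul2l; first by rewrite lee_fin.
  by apply: leeD; [exact: hF|exact: hG].
apply: le_trans H; rewrite big_split /=; apply: lerD; first exact: lexx.
exact: (@sq_mass_nd R (fun z => half_sum F G z ^+ m) N N' NN).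
Qed.

End Comparison.

(** * Convergence of the extremal functions *)

Section Stability.
Variable R : realType.
Notation disc := (@planar_disc R).
Implicit Types (f g h k F : R[i] -> R[i]) (m N : nat) (e K lam d : R).

Lemma optimal_le m k F lam F1 : (0 < m)%N -> optimal m k F lam -> analytic_on_disc F1 -> dintegrable (abspow m F1) ->
  dint (abspow m F1) = 1 -> dint (re_pair F1 k) <= lam.
Proof.
move=> m0 [_ _ _ _ Fh] F1a iF1 F11; have := Fh F1 F1a iF1.
by rewrite F11 subrK mulrC ler_pM2r // p_gt0.
Qed.

Definition young_bound m k e : R := e + young_const m e * dint (abspowR (conj_exp R m) k).

Lemma re_pair_split m g k1 k e : (0 < m)%N -> analytic_on_disc k1 -> analytic_on_disc k ->
  dintegrable (abspowR (conj_exp R m) k1) -> dintegrable (abspowR (conj_exp R m) k) ->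
  dintegrable (abspowR (conj_exp R m) (fun z => k1 z - k z)) ->
  analytic_on_disc g -> dintegrable (abspow m g) -> dint (abspow m g) = 1 -> 0 < e ->
  `|dint (re_pair g k1) - dint (re_pair g k)| <= young_bound m (fun z => k1 z - k z) e.
Proof.
move=> m0 k1a ka i1 ik id_ ga ig g1 e0.
have ir1 := dintegrable_re_pair m0 ga k1a ig i1.
have ir2 := dintegrable_re_pair m0 ga ka ig ik.
rewrite -(dintB ir1 ir2).
have -> : dint (fun w => re_pair g k1 w - re_pair g k w) = dint (re_pair g (fun z => k1 z - k z)).
  by apply: eq_dint => w _; rewrite re_pairBr.
by have := dint_re_pair_le m0 e0 ga (analyticB k1a ka) ig id_; rewrite g1 mulr1.
Qed.

Lemma dist_of_bounds (x y x1 y1 b : R) : `|x1 - x| <= b -> `|y1 - y| <= b -> x <= y -> y1 <= x1 ->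
  `|x1 - y| <= b /\ y - x <= 2 * b.
Proof.
rewrite !ler_norml => /andP[h1 h2] /andP[h3 h4] xy yx.
by split; [apply/andP; split|]; lra.
Qed.

(** Each of the two extremal functions competes in the problem of the other
    one. *)
Lemma optimal_close m k1 k F1 F lam1 lam e : (0 < m)%N -> analytic_on_disc k1 -> analytic_on_disc k ->
  dintegrable (abspowR (conj_exp R m) k1) -> dintegrable (abspowR (conj_exp R m) k) ->
  dintegrable (abspowR (conj_exp R m) (fun z => k1 z - k z)) ->
  optimal m k1 F1 lam1 -> optimal m k F lam -> 0 < e ->
  `|lam1 - lam| <= young_bound m (fun z => k1 z - k z) e /\
  lam - dint (re_pair F1 k) <= 2 * young_bound m (fun z => k1 z - k z) e.
Proof.
move=> m0 k1a ka i1 ik id_ ex1 ex e0.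
have [F1a iF1 F11 l1E _] := ex1; have [Fa iF FF1 lE _] := ex.
have h1 := re_pair_split m0 k1a ka i1 ik id_ F1a iF1 F11 e0.
have h2 := re_pair_split m0 k1a ka i1 ik id_ Fa iF FF1 e0.
move: h1 h2; rewrite -l1E -lE => h1 h2.
exact: (dist_of_bounds h1 h2 (optimal_le m0 ex F1a iF1 F11) (optimal_le m0 ex1 Fa iF FF1)).
Qed.

Lemma half_diff_arith (lam p D B c b : R) : D + B <= 1 -> 0 < lam -> 0 < p ->
  p * (2^-1 * (c + lam)) <= lam * (p - 1 + B) -> lam - c <= 2 * b -> lam * D <= p * b.
Proof.
move=> DB l0 p0 h1 h2.
have h3 : lam * (D + B) <= lam by rewrite ger_pMr.
have h4 : p * (lam - c) <= p * (2 * b) by rewrite ler_pM2l.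
move: h1 h3 h4; rewrite !mulrDr !mulrA; nra.
Qed.

Lemma re_pair_half_sum F1 F k w :
  re_pair (half_sum F1 F) k w = 2^-1 * (re_pair F1 k w + re_pair F k w).
Proof. by rewrite -re_pairDl -re_pairZl. Qed.

(** The midpoint of the two extremal functions competes for k. Clarkson's
    inequality makes its norm fall below 1 by an amount that half_diff
    controls, while the functional is nearly lam. *)
Lemma half_diff_small m k1 k F1 F lam1 lam e : (0 < m)%N -> analytic_on_disc k1 -> analytic_on_disc k ->
  dintegrable (abspowR (conj_exp R m) k1) -> dintegrable (abspowR (conj_exp R m) k) ->
  dintegrable (abspowR (conj_exp R m) (fun z => k1 z - k z)) ->
  optimal m k1 F1 lam1 -> optimal m k F lam -> 0 < e -> 0 < lam ->
  lam * dint (abspow m (half_diff F1 F)) <= (2 * m)%:R * young_bound m (fun z => k1 z - k z) e.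
Proof.
move=> m0 k1a ka i1 ik id_ ex1 ex e0 l0.
have [_ h2] := optimal_close m0 k1a ka i1 ik id_ ex1 ex e0.
have [F1a iF1 F11 l1E _] := ex1; have [Fa iF FF1 lE Fh] := ex.
have [_ is_ cl] := clarkson_dint m0 F1a Fa iF1 iF.
have ir1 := dintegrable_re_pair m0 F1a ka iF1 ik.
have ir2 := dintegrable_re_pair m0 Fa ka iF ik.
have := Fh _ (analytic_half_sum F1a Fa) is_.
rewrite (eq_dint (fun w _ => re_pair_half_sum F1 F k w)) (dintZ _ (dintegrableD ir1 ir2)) (dintD ir1 ir2) -lE.
move=> h; apply: half_diff_arith l0 (p_gt0 R m0) h h2.
by apply: le_trans cl _; rewrite F11 FF1; lra.
Qed.

(** Choose e' first, then d, because the constant in front of x depends on e'. *)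
Lemma small_split (A e : R) m : 0 <= A -> 0 < e -> exists e' d,
  [/\ 0 < e', 0 < d & forall x, x <= d -> e' * A + young_const m e' * x <= e].
Proof.
move=> A0 e0; pose e' := e / 2 / (A + 1).
have A1 : 0 < A + 1 by rewrite ltr_wpDl.
have y1 : 0 < young_const m e' + 1 by rewrite ltr_wpDl // young_const_ge0.
exists e', (e / 2 / (young_const m e' + 1)); split; try by rewrite !divr_gt0.
move=> x xd; have -> : e = e / 2 + e / 2 by rewrite -splitr.
have e2 : 0 <= e / 2 by rewrite divr_ge0 ?(ltW e0).
apply: lerD.
  by rewrite /e' mulrAC ler_pdivrMr // ler_wpM2l // lerDl ler01.
apply: le_trans (ler_wpM2l (young_const_ge0 m e') xd) _.
by rewrite mulrCA mulrA ler_pdivrMr // ler_wpM2l // lerDl ler01.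
Qed.

End Stability.

Section Convergence.
Variables (R : realType) (m : nat) (k_ F_ : nat -> R[i] -> R[i]) (k F : R[i] -> R[i]).
Variables (lam_ : nat -> R) (lam Kk : R).
Hypotheses (m0 : (0 < m)%N) (k_a : forall n, analytic_on_disc (k_ n)) (ka : analytic_on_disc k).
Hypothesis kcvg : forall d, 0 < d -> \forall n \near \oo, Hq_bound (conj_exp R m) (fun z => k_ n z - k z) d.
Hypotheses (Kk0 : 0 <= Kk) (hk : Hq_bound (conj_exp R m) k Kk).
Hypotheses (ik_ : forall n, dintegrable (abspowR (conj_exp R m) (k_ n))).
Hypotheses (ex_ : forall n, optimal m (k_ n) (F_ n) (lam_ n)) (ex : optimal m k F lam).
Hypotheses (l_0 : forall n, 0 < lam_ n) (l0 : 0 < lam).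

Let ik : dintegrable (abspowR (conj_exp R m) k) := (Hq_integrable ka Kk0 hk).1.
Let F_a n : analytic_on_disc (F_ n). Proof. by case: (ex_ n). Qed.
Let Fa : analytic_on_disc F. Proof. by case: ex. Qed.

Lemma young_bound_small e : 0 < e -> exists2 e', 0 < e' &
  \forall n \near \oo, dintegrable (abspowR (conj_exp R m) (fun z => k_ n z - k z)) /\
    young_bound m (fun z => k_ n z - k z) e' <= e.
Proof.
move=> e0; have [e' [d [e'0 d0 H]]] := @small_split R 1 e m ler01 e0; exists e' => //.
apply: filterS (kcvg d0) => n hn.
have [i1 i2] := Hq_integrable (analyticB (@k_a n) ka) (ltW d0) hn.
by split=> //; rewrite /young_bound -[X in X + _]mulr1; exact: H.
Qed.

Lemma lam_cvg : lam_ @ \oo --> lam.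
Proof.
apply/cvgrPdist_le => e e0; have [e' e'0 H] := young_bound_small e0.
apply: filterS H => n [id_ hn]; rewrite distrC; apply: le_trans hn.
exact: (optimal_close m0 (@k_a n) ka (ik_ n) ik id_ (ex_ n) ex e'0).1.
Qed.

Lemma bergman_cvg e : 0 < e -> \forall n \near \oo, dint (abspow m (half_diff (F_ n) F)) <= e.
Proof.
move=> e0; have p0 := p_gt0 R m0.
have [e' e'0 H] := young_bound_small (divr_gt0 (mulr_gt0 l0 e0) p0).
apply: filterS H => n [id_ hn].
have := half_diff_small m0 (@k_a n) ka (ik_ n) ik id_ (ex_ n) ex e'0 l0.
move=> h; rewrite -(ler_pM2l l0); apply: le_trans h _.
by rewrite mulrC -ler_pdivlMr.
Qed.

Lemma acoef_half_diff n j : acoef (half_diff (F_ n) F) j = (2^-1)%:C * (acoef (F_ n) j - acoef F j).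
Proof.
apply: etrans; first exact: (@acoefZ _ (2^-1)%:C (fun z => F_ n z - F z) j (analyticB (@F_a n) Fa)).
exact: (congr1 (fun x => (2^-1)%:C * x) (acoefB j (@F_a n) Fa)).
Qed.

Lemma sqr_from_half (x e J : R) : 0 <= x -> 0 < e -> 0 < J ->
  (2^-1 * x) ^+ 2 / J <= 2 * (e ^+ 2 / (8 * J)) -> x <= e.
Proof.
move=> x0 e0 J0; rewrite ler_pdivrMr //.
have -> : 2 * (e ^+ 2 / (8 * J)) * J = e ^+ 2 / 4 by field; rewrite lt0r_neq0.
by move=> h; rewrite -ler_sqr ?nnegrE ?(ltW e0) //; move: h; rewrite !expr2; lra.
Qed.

Lemma coef_cvg j : ccvg (fun n => acoef (F_ n) j) (acoef F j).
Proof.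
rewrite /ccvg; apply/cvgrPdist_le => e e0.
have J0 : 0 < j.+1%:R :> R by rewrite ltr0n.
pose t := e ^+ 2 / (8 * j.+1%:R).
have t0 : 0 < t by rewrite divr_gt0 ?exprn_gt0 // mulr_gt0.
have T0 : 0 < (t^-1) ^+ m.-1 by rewrite exprn_gt0 // invr_gt0.
apply: filterS (bergman_cvg (divr_gt0 t0 T0)) => n hn.
rewrite sub0r normrN ger0_norm ?normc_ge0 //; apply: (sqr_from_half (normc_ge0 _) e0 J0).
have [_ iF1 _ _ _] := ex_ n; have [_ iF _ _ _] := ex.
have [id_ _ _] := clarkson_dint m0 (@F_a n) Fa iF1 iF.
have := coef_le_abspow j m0 t0 (analytic_half_diff (@F_a n) Fa) id_.
rewrite acoef_half_diff normcM normcR ger0_norm ?invr_ge0 // => h; apply: le_trans h _.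
rewrite -/t [2 * t]mulr_natl mulr2n lerD2l mulrC -ler_pdivlMr //.
Qed.

(** The bound in ryabykh is uniform for kernels bounded in H^q and functionals
    with norms bounded away from 0. *)
Lemma Hp_uniform : exists K, [/\ 0 <= K, Hp_bound m F K & \forall n \near \oo, Hp_bound m (F_ n) K].
Proof.
have p0 := p_gt0 R m0; have q0 := conj_exp_gt0 R m; pose p : R := (2 * m)%:R.
(* a lower bound for all the late lam_n *)
pose c := lam / 2; have c0 : 0 < c by rewrite divr_gt0.
pose L : R := 2 `^ (conj_exp R m) * (1 + Kk).
have L0 : 0 <= L by rewrite mulr_ge0 ?powR_ge0 ?addr_ge0.
have Lk : Kk <= L.
  have h1 : 1 <= 2 `^ (conj_exp R m) :> R by rewrite -[leLHS](powRr0 (2 : R)) ler_powR ?(ltW q0) // ler1n.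
  by apply: (@le_trans _ _ (1 + Kk)); [rewrite lerDr|rewrite ler_peMl // addr_ge0].
have P2 : 0 < 2 * p by rewrite mulr_gt0.
pose K := 2 * p * young_const m (c / (2 * p)) * L / c.
have K0 : 0 <= K.
  by apply: divr_ge0 (ltW c0); rewrite mulr_ge0 // mulr_ge0 ?young_const_ge0 // ltW.
have main k1 F1 l1 : analytic_on_disc k1 -> Hq_bound (conj_exp R m) k1 L -> optimal m k1 F1 l1 -> c <= l1 -> Hp_bound m F1 K.
  move=> k1a h1 e1 cl; have l10 := lt_le_trans c0 cl.
  move=> s hs; apply: le_trans (ryabykh m0 k1a L0 h1 e1 l10 hs) _; rewrite lee_fin.
  apply: ler_pM; rewrite ?invr_ge0 ?(ltW l10) ?lef_pV2 ?posrE //.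
    by rewrite mulr_ge0 // mulr_ge0 ?young_const_ge0 // ltW.
  rewrite ler_wpM2r // ler_wpM2l ?(ltW P2) //; apply: young_const_antitone; first exact: divr_gt0.
  by rewrite ler_pM2r // invr_gt0.
exists K; split=> //.
  apply: (main k F lam) => //; last by rewrite /c ler_pdivrMr // ler_peMr ?(ltW l0) // ler1n.
  by move=> s hs; apply: le_trans (hk hs) _; rewrite lee_fin.
have hl : \forall n \near \oo, c <= lam_ n.
  move/cvgrPdist_le: lam_cvg => /(_ c c0); apply: filterS => n.
  by rewrite ler_norml => /andP[_]; rewrite lerBlDr -lerBlDl; apply: le_trans; rewrite /c; lra.
near=> n; apply: (main (k_ n) (F_ n) (lam_ n)).
- exact: k_a.
- apply: (@Hq_sub R (conj_exp R m) (k_ n) k 1 Kk q0 (@k_a n) ka _ hk).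
  by near: n; exact: kcvg.
- exact: ex_.
- by near: n.
Unshelve. all: by end_near. Qed.

(** Since M is bounded, replacing lam1 by lam costs at most t lam. *)
Lemma mixed_bound (lam1 M M0 B t r : R) : 0 <= M -> M <= B -> `|lam1 - lam| <= t * lam / (B + 1) -> 0 < t ->
  lam1 * M <= lam * (M0 + t + (t + t)) + t * lam -> M <= M0 + 5 * t.
Proof.
move=> M0' MB hl t0 h; have B1 : 0 < B + 1 by rewrite ltr_wpDl // (le_trans M0').
rewrite -(ler_pM2l l0).
have h1 : (lam - lam1) * M <= t * lam.
  apply: (@le_trans _ _ (t * lam / (B + 1) * M)).
    by apply: ler_wpM2r => //; move: hl; rewrite distrC; apply: le_trans; exact: ler_norm.
  have tl : 0 <= t * lam by rewrite mulr_ge0 // ltW.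
  by rewrite mulrAC ler_pdivrMr // ler_wpM2l // (le_trans MB) // lerDl.
have -> : lam * M = lam1 * M + (lam - lam1) * M by ring.
apply: le_trans (lerD h h1) _; rewrite le_eqVlt; apply/orP; left; apply/eqP; ring.
Qed.

(** In compare_norms for k_n and k, the finite sum converges with the Taylor
    coefficients and the errors are small, so that lam_n mixed(F_n) is at most
    about lam mixed(F). *)
Lemma limsup_norm d : 0 < d -> \forall n \near \oo, Hp_mass m (F_ n) <= Hp_mass m F + d.
Proof.
move=> d0; have [K [K0 hF hF_]] := Hp_uniform.
have mR : 0 < m%:R :> R by rewrite ltr0n.
pose t := d / (5 * m%:R); have t0 : 0 < t by rewrite divr_gt0 // mulr_gt0.
pose B := m%:R^-1 * K + 1.
have B0 : 0 <= B by rewrite addr_ge0 // mulr_ge0 // invr_ge0 ltW.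
have B1 : 0 < B + 1 by rewrite ltr_wpDl.
have W0 := test_const_ge0 m K0; have W1 : 0 < 2 * test_const m K + 1 by rewrite ltr_wpDl // mulr_ge0.
(* eta makes the trilinear term small, then N the tail of F^m, then e' and dd
   the contribution of k_n - k *)
pose eta := t / (2 * test_const m K + 1); have eta0 : 0 < eta by rewrite divr_gt0.
have hW : 2 * eta * test_const m K <= t.
  by rewrite mulrAC /eta mulrA ler_pdivrMr // mulrC ler_wpM2l ?(ltW t0) // lerDl.
have [N hN] : exists N, (Hp_mass m F - Hp_sum m F N) / eta <= t.
  move/cvgrPdist_le: (Hp_sum_cvg Fa hF) => /(_ _ (mulr_gt0 t0 eta0))[N _ /(_ N (leqnn N)) hN].
  by exists N; rewrite ler_pdivrMr //; apply: le_trans (ler_norm _) hN.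
have [e' [dd [e'0 dd0 H]]] := @small_split R K (t * lam) m K0 (mulr_gt0 t0 l0).
have tc := @test_pair_cvg R m N F_ F F (@F_a) Fa Fa coef_cvg.
have h1 : \forall n \near \oo, test_pair m N (F_ n) F <= mixed m F + t.
  have [_ iF F1 _ _] := ex.
  move/cvgrPdist_le: tc => /(_ t t0); apply: filterS => n.
  rewrite distrC => h; rewrite -lerBlDl; apply: le_trans (le_trans (ler_norm _) h).
  by rewrite lerD2l lerN2; exact: (test_pair_mixed_le N m0 Fa iF F1 hF).
have h2 : \forall n \near \oo, `|lam_ n - lam| <= t * lam / (B + 1).
  have tl : 0 < t * lam / (B + 1) by rewrite divr_gt0 // mulr_gt0.
  by move/cvgrPdist_le: lam_cvg => /(_ _ tl); apply: filterS => n; rewrite distrC.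
near=> n.
have hn : Hp_bound m (F_ n) K by near: n.
have hk_n : Hq_bound (conj_exp R m) (fun z => k_ n z - k z) dd by near: n; exact: kcvg.
have h1n : test_pair m N (F_ n) F <= mixed m F + t by near: n.
have h2n : `|lam_ n - lam| <= t * lam / (B + 1) by near: n.
have ky := compare_norms N m0 (@k_a n) ka (ik_ n) ik (ex_ n) ex (l_0 n) l0 K0 (ltW dd0) hn hF hk_n eta0 e'0.
have im0 : 0 <= 1 - m%:R^-1 :> R by rewrite subr_ge0 invf_le1 // ler1n.
have n0 : 0 <= Hp_mass m (F_ n).
  by apply: le_trans (Hp_sum_le 0 (@F_a n) hn); rewrite /Hp_sum big_ord0.
have M0 : 0 <= mixed m (F_ n) by rewrite addr_ge0 // mulr_ge0 // invr_ge0 ltW.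
have MB : mixed m (F_ n) <= B.
  have im : 0 <= m%:R^-1 :> R by rewrite invr_ge0 ltW.
  apply: lerD; first exact: (ler_wpM2l im (Hp_mass_le (@F_a n) hn)).
  by rewrite lerBlDr lerDl invr_ge0 ltW.
have := @mixed_bound (lam_ n) (mixed m (F_ n)) (mixed m F) B t 0 M0 MB h2n t0.
have -> : lam_ n * mixed m (F_ n) <= lam * (mixed m F + t + (t + t)) + t * lam.
  apply: le_trans ky _; apply: lerD; last exact: H.
  by apply: (ler_wpM2l (ltW l0)); exact: (lerD h1n (lerD hW hN)).
move=> /(_ isT); rewrite /mixed addrAC lerD2r.
have -> : m%:R^-1 * Hp_mass m F + 5 * t = m%:R^-1 * (Hp_mass m F + d).
  by rewrite /t; field; rewrite lt0r_neq0.
by rewrite ler_pM2l // invr_gt0.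
Unshelve. all: by end_near. Qed.

Lemma half_double (a : R[i]) : a = (2^-1)%:C * (a + a).
Proof. by case: a => x y; apply/eqP; rewrite eq_complex /=; apply/andP; split; apply/eqP; lra. Qed.

Lemma half_sum_powsq_cvg N : (fun n => Hp_sum m (half_sum (F_ n) F) N) @ \oo --> Hp_sum m F N.
Proof.
apply: (@cvg_ord_sum R N (fun n j => normc (acoef (fun z => half_sum (F_ n) F z ^+ m) j) ^+ 2)
  (fun j => normc (acoef (fun z => F z ^+ m) j) ^+ 2)) => j.
have c i : ccvg (fun n => acoef (half_sum (F_ n) F) i) (acoef F i).
  rewrite [X in ccvg _ X]half_double.
  have -> : (fun n => acoef (half_sum (F_ n) F) i) = (fun n => (2^-1)%:C * (acoef (F_ n) i + acoef F i)).
    apply/funext => n.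
    apply: etrans; first exact: (@acoefZ _ (2^-1)%:C (fun z => F_ n z + F z) i (analyticD (@F_a n) Fa)).
    exact: (congr1 (fun x => (2^-1)%:C * x) (acoefD i (@F_a n) Fa)).
  apply: ccvgM; first exact: ccvg_cst.
  by apply: ccvgD; [exact: coef_cvg|exact: ccvg_cst].
have H := ccvg_normc (ccvg_power (fun n => analytic_half_sum (@F_a n) Fa) Fa c m j).
by apply: cvgM; exact: H.
Qed.

Lemma clarkson_arith (x y S T S1 S0 d : R) : x + y <= 2^-1 * (S1 + S) -> S1 <= S + d -> `|T - y| <= d -> `|S - T| <= d ->
  x <= 3 * d.
Proof. by rewrite !ler_norml => h1 h2 /andP[h3 h4] /andP[h5 h6]; lra. Qed.

(** Coefficients converge and norms do not jump up in the limit; as half_sum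
    has almost the full norm, Clarkson's inequality leaves no room for
    half_diff. *)
Lemma extremal_Hp_cvg d : 0 < d -> \forall n \near \oo, Hp_bound m (fun z => F_ n z - F z) d.
Proof.
move=> d0; have [K [K0 hF hF_]] := Hp_uniform.
pose t := d / 2 ^+ (2 * m) / 3; have P0 : 0 < 2 ^+ (2 * m) :> R by rewrite exprn_gt0.
have t0 : 0 < t by rewrite !divr_gt0.
have [N hN] : exists N, `|Hp_mass m F - Hp_sum m F N| <= t.
  by move/cvgrPdist_le: (Hp_sum_cvg Fa hF) => /(_ _ t0)[N _ /(_ N (leqnn N)) hN]; exists N.
have h1 := limsup_norm t0.
have h2 : \forall n \near \oo, `|Hp_sum m F N - Hp_sum m (half_sum (F_ n) F) N| <= t.
  by move/cvgrPdist_le: (@half_sum_powsq_cvg N) => /(_ _ t0).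
near=> n.
have hn : Hp_bound m (F_ n) K by near: n.
have h1n : Hp_mass m (F_ n) <= Hp_mass m F + t by near: n.
have h2n : `|Hp_sum m F N - Hp_sum m (half_sum (F_ n) F) N| <= t by near: n.
have hda := analytic_half_diff (@F_a n) Fa.
have hs1 : Hp_bound m (F_ n) (Hp_mass m (F_ n)) by apply: (coef_Hp (@F_a n)) => M; exact: (Hp_sum_le M (@F_a n) hn).
have hs2 : Hp_bound m F (Hp_mass m F) by apply: (coef_Hp Fa) => M; exact: (Hp_sum_le M Fa hF).
have hd : Hp_bound m (half_diff (F_ n) F) (3 * t).
  apply: (coef_Hp hda) => M.
  apply: (@le_trans _ _ (Hp_sum m (half_diff (F_ n) F) (maxn N M))); first exact: (sq_mass_nd _ (leq_maxr N M)).
  exact: (clarkson_arith 0 (clarkson_Hp m0 (@F_a n) Fa hs1 hs2 (leq_maxl N M)) h1n h2n hN).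
move=> s hs.
have E : (fun w => (abspow m (fun z => F_ n z - F z) w)%:E) = (fun w => (2 ^+ (2 * m) * abspow m (half_diff (F_ n) F) w)%:E).
  apply/funext => w; congr EFin; rewrite -abspowZ //; congr (normc _ ^+ _).
  by rewrite /half_diff mulrA -rmorphM mulfV ?pnatr_eq0 // mul1r.
rewrite E (circ_avgZ hs (ltW P0) (dmeas_abspow m hda) (@abspow_ge0 R m _)).
apply: (@le_trans _ _ ((2 ^+ (2 * m))%:E * (3 * t)%:E)%E).
  by apply: lee_wpmul2l; [rewrite lee_fin ltW|exact: hd].
rewrite -EFinM lee_fin /t [3 * _]mulrC divfK ?pnatr_eq0 // mulrC divfK // lt0r_neq0 //.
Unshelve. all: by end_near. Qed.

End Convergence.

Section Conversion.
Variable R : realType.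
Implicit Types (f g : R[i] -> R[i]) (m : nat) (t e K : R).

Lemma powRK t e : 0 < t -> 0 <= e -> (e `^ t) `^ t^-1 = e.
Proof. by move=> t0 e0; rewrite -powRrM mulfV ?lt0r_neq0 // powRr1. Qed.

Lemma powRVK t e : 0 < t -> 0 <= e -> (e `^ t^-1) `^ t = e.
Proof. by move=> t0 e0; rewrite -powRrM mulVf ?lt0r_neq0 // powRr1. Qed.

Lemma Hp_Hq m f K : Hp_bound m f K -> Hq_bound (2 * m)%:R f K.
Proof.
move=> h s /andP[s0 s1]; rewrite (_ : (fun w => _) = (fun w => (abspow m f w)%:E)); last first.
  by apply/funext => w; rewrite abspowR_abspow.
by apply: h; rewrite ltW.
Qed.

Lemma Hp_hardy m f K : (0 < m)%N -> analytic_on_disc f -> 0 <= K -> Hp_bound m f K -> hardy (2 * m)%:R f.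
Proof.
move=> m0 fa K0 h; split=> //; apply: le_lt_trans (ltry _).
exact: (Hq_hardy_norm (p_gt0 R m0) K0 (Hp_Hq h)).
Qed.

Lemma hardy_norm_Hq_cvg t (u : nat -> R[i] -> R[i]) : 0 < t ->
  hardy_norm t (u n) @[n --> \oo] --> 0%E -> forall d, 0 < d -> \forall n \near \oo, Hq_bound t (u n) d.
Proof.
move=> t0 /fine_cvgP[fin_ cv] d d0.
have e0 : 0 < d `^ t^-1 by rewrite powR_gt0.
move/cvgrPdist_le: cv => /(_ _ e0) cv.
near=> n; rewrite -(powRVK t0 (ltW d0)); apply: hardy_norm_le_bound (powR_ge0 _ _) _ => //.
have fn : hardy_norm t (u n) \is a fin_num by near: n.
rewrite -(fineK fn) lee_fin.
have : `|0 - fine (hardy_norm t (u n))| <= d `^ t^-1 by near: n.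
by rewrite sub0r normrN; apply: le_trans; exact: ler_norm.
Unshelve. all: by end_near. Qed.

Lemma Hp_hardy_norm_cvg m (u : nat -> R[i] -> R[i]) : (0 < m)%N ->
  (forall d, 0 < d -> \forall n \near \oo, Hp_bound m (u n) d) -> hardy_norm (2 * m)%:R (u n) @[n --> \oo] --> 0%E.
Proof.
move=> m0 H; have p0 := p_gt0 R m0; set p : R := (2 * m)%:R in p0 *.
have Hn e : 0 < e -> \forall n \near \oo, (hardy_norm p (u n) <= e%:E)%E.
  move=> e0; apply: filterS (H _ (powR_gt0 p e0)) => n hn.
  rewrite -(powRK p0 (ltW e0)).
  exact: (Hq_hardy_norm p0 (powR_ge0 _ _) (Hp_Hq hn)).
have fin_ e n : (hardy_norm p (u n) <= e%:E)%E -> hardy_norm p (u n) \is a fin_num.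
  by move=> hn; rewrite ge0_fin_numE ?hardy_norm_ge0 // (le_lt_trans hn) ?ltry.
apply/fine_cvgP; split; first by apply: filterS (Hn 1 ltr01) => n; exact: fin_.
apply/cvgrPdist_le => e e0; apply: filterS (Hn e e0) => n hn /=.
rewrite sub0r normrN ger0_norm ?fine_ge0 ?hardy_norm_ge0 //.
by rewrite -lee_fin fineK ?(fin_ e).
Qed.

Lemma conj_expE m : (0 < m)%N -> conj_exp R m = (2 * m)%:R / ((2 * m)%:R - 1).
Proof.
move=> m0; rewrite /conj_exp; have pp := @p_gt1 R m m0.
have -> : (2 * m).-1%:R = (2 * m)%:R - 1 :> R.
  have : (0 < 2 * m)%N by rewrite muln_gt0.
  by case: (2 * m)%N => // n _; rewrite -natr1 addrK.
have d0 := lt0r_neq0 pp; apply: (mulIf d0).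
by rewrite mulrDl mul1r mulVf // divfK // subrK.
Qed.

End Conversion.

Theorem theorem2p3 (R : realType) (p : nat) (q : R)
    (hp0 : (0 < p)%N) (hp : ~~ odd p) (hq : q = p%:R / (p%:R - 1))
    (k_ F_ : nat -> R[i] -> R[i]) (k F : R[i] -> R[i])
    (hk_n : forall n, not_identically_zero (k_ n))
    (hk : not_identically_zero k)
    (hkcvg : hardy_cvg q k_ k)
    (hF_n : forall n, extremal p%:R (k_ n) (F_ n))
    (hF : extremal p%:R k F) :
  hardy_cvg p%:R F_ F.
Proof.
have [m m0 pE] : exists2 m, (0 < m)%N & p = (2 * m)%N.
  exists p./2; last by rewrite mul2n even_halfK.
  by case: p hp0 hp {hq hF_n hF} => [|[|n]].
subst p; rewrite -conj_expE // in hq; subst q.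
have q0 := conj_exp_gt0 R m; have p0 := p_gt0 R m0.
have [hk_ hk' hcv] := hkcvg.
have ka_ n : analytic_on_disc (k_ n) by case: (hk_ n).
have ka : analytic_on_disc k by case: hk'.
have [Kk Kk0 hKk] := hardy_Hq q0 hk'.
have ik_ n : dintegrable (abspowR (conj_exp R m) (k_ n)).
  by have [K K0 hK] := hardy_Hq q0 (hk_ n); case: (Hq_integrable (@ka_ n) K0 hK).
have [ik _] := Hq_integrable ka Kk0 hKk.
have ex_ n := extremal_optimal m0 (@ka_ n) (ik_ n) (hF_n n).
have ex := extremal_optimal m0 ka ik hF.
have l_0 n := optimal_norm_gt0 m0 (@ka_ n) (ik_ n) (hk_n n) (ex_ n).
have l0 := optimal_norm_gt0 m0 ka ik hk ex.
have kcv := hardy_norm_Hq_cvg q0 hcv.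
have hardyF k1 F1 : hardy (conj_exp R m) k1 -> not_identically_zero k1 -> extremal (2 * m)%:R k1 F1 ->
    hardy (2 * m)%:R F1.
  move=> h1 nz1 e1; have [k1a _] := h1; have [K1 K10 hK1] := hardy_Hq q0 h1.
  have [i1 _] := Hq_integrable k1a K10 hK1; have ex1 := extremal_optimal m0 k1a i1 e1.
  have l10 := optimal_norm_gt0 m0 k1a i1 nz1 ex1.
  have [F1a _ _ _ _] := ex1.
  apply: (Hp_hardy m0 F1a _ (ryabykh m0 k1a K10 hK1 ex1 l10)).
  by apply: divr_ge0 (ltW l10); rewrite mulr_ge0 // mulr_ge0 ?young_const_ge0 // mulr_ge0 // ltW.
split.
- by move=> n; exact (hardyF (k_ n) (F_ n) (hk_ n) (hk_n n) (hF_n n)).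
- exact (hardyF k F hk' hk hF).
apply: (Hp_hardy_norm_cvg m0) => d d0.
exact: (@extremal_Hp_cvg R m k_ F_ k F _ _ Kk m0 ka_ ka kcv Kk0 hKk ik_ ex_ ex l_0 l0).
Qed.
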